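(* Let $X\subset\mathbb{P}^3_{\mathbb{K}}$ be a smooth quartic and let $\ell\subset X$ be a line of the second kind with ramification type $R=1^4$. Then: (a) The quartic $X$ is given by an equation $$\lambda\cdot S_4+L_1\cdot L_2\cdot L_3\cdot L_4=0,\qquad \lambda\in\mathbb{K}^\times,\qquad(\ast)$$ where the planes $L_1,\dots,L_4$ are pairwise distinct and meet along the line $\ell$; each plane $L_j$ intersects $X$ along four lines; and the ruled quartic $S_4$ is a component of the surface $S_8$ defined by $(X,\ell)$. Moreover, the line $\ell$ is a directrix of $S_4$, the quartic $S_4$ is smooth along $\ell$, and the singular locus $\operatorname{sing}(S_4)$ consists either of a line of triple points or of a twisted cubic of double points. (b) The Segre decomposition for the pair $(X,\ell)$ is unique and coincides with $(\ast)$: whenever $X$ is given by $S+\hat L_1\cdots\hat L_4=0$, where the quartic $S$ is a union of a family of lines each of which meets $\ell$ and the planes $\hat L_1,\dots,\hat L_4$ meet along $\ell$, then $S=S_4$ (as surfaces) and $\{\hat L_1,\dots,\hat L_4\}=\{L_1,\dots,L_4\}$. (c) The fibration $\pi$ has singular fibers $4\,I_3\oplus4\,I_1\oplus4\,II$ if and only if $\operatorname{sing}(S_4)$ is a twisted cubic. (d) The fibration $\pi$ has singular fibers $4\,IV\oplus4\,II$ if and only if $\operatorname{sing}(S_4)$ is a line of triple points.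
   Context: $\mathbb{K}$ is an algebraically closed field of characteristic different from $2$ and $3$. The same symbol is used for a homogeneous polynomial and its zero set. Let $X\subset\mathbb{P}^3_{\mathbb{K}}$ be a smooth quartic containing a line $\ell$. The linear system $|\mathcal{O}_X(1)-\ell|$ gives an elliptic fibration $\pi:X\to\mathbb{P}^1$ whose fibers are the plane cubics residual to $\ell$ in $X\cap H$, for planes $H\supset\ell$. For $P\in\ell$, $F_P$ denotes the fiber of $\pi$ containing $P$, so $X\cap T_PX=\ell+F_P$. The line $\ell$ is of the second kind iff it is contained in the (Zariski) closure of the set of inflection points of the smooth fibers of $\pi$. The restriction $\pi|_\ell:\ell\to\mathbb{P}^1$ has degree $3$ and its ramification divisor $\mathcal{R}$ has degree $4$; ramification type $R=1^4$ means that $\mathcal{R}$ is a sum of four distinct points. ''The fibration has singular fibers $\sum n_iT_i$'' means this is the complete list of its singular fibers with Kodaira types. The surface $S_8$ defined by $(X,\ell)$ is the union of all lines in $$\mathfrak{S}_\ell=\{\tilde\ell\subset\mathbb{P}^3\text{ a line}:\ \exists P\in\ell\text{ with }\tilde\ell\subset T_PX\text{ and }i(\tilde\ell,F_P;P)\ge2\},$$ where $i(\tilde\ell,F_P;P)$ is the intersection multiplicity at $P$ of $\tilde\ell$ and the cubic $F_P$ inside the plane $T_PX$ (taken to be $\infty$ if $P\in\tilde\ell\subset F_P$); it is a hypersurface in $\mathbb{P}^3$. A ruled surface is a reduced, irreducible surface in $\mathbb{P}^3$ that is a union of a family of lines and is not a cone over a planar curve. The set of lines on a ruled quartic, as a subset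 of $\mathrm{Gr}(2,4)$, consists of an irreducible curve $C$ and at most two points; a line contained in the surface is a directrix iff it meets all lines from $C$. *)

(* Defs.v *)
From mathcomp Require Import all_boot all_order all_algebra.
From mathcomp.multinomials Require Export mpoly.

Set Implicit Arguments.
Unset Strict Implicit.
Unset Printing Implicit Defensive.

Import GRing.Theory.
Local Open Scope ring_scope.

(* A point of P^(n-1) is a nonzero row vector up to scaling; linear subspaces
   are row spaces of matrices, compared with the relations of the scope %MS.
   A subset of P^(n-1) is a predicate on row vectors, which is only ever
   consulted at nonzero vectors.  Hypersurfaces are forms up to scaling. *)

Definition ev (K : closedFieldType) (n : nat) (G : {mpoly K[n]})
  (x : 'rV[K]_n) : K := G.@[x 0].

Definition zeros (K : closedFieldType) (n : nat) (G : {mpoly K[n]})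
  (x : 'rV[K]_n) : Prop := ev G x = 0.

Definition proportional (K : closedFieldType) (n : nat)
  (p q : {mpoly K[n]}) : Prop := exists2 c : K, c != 0 & p = c *: q.

Definition singular_at (K : closedFieldType) (n : nat) (G : {mpoly K[n]})
  (x : 'rV[K]_n) : Prop :=
  ev G x = 0 /\ forall i : 'I_n, ev G^`M(i) x = 0.

Definition smooth_form (K : closedFieldType) (n : nat)
  (G : {mpoly K[n]}) : Prop := forall x : 'rV[K]_n, x != 0 -> ~ singular_at G x.

Definition smooth_quartic (K : closedFieldType) (F : {mpoly K[4]}) : Prop :=
  F \is 4.-homog /\ smooth_form F.

Definition irreducible_mpoly (K : closedFieldType) (n : nat)
  (p : {mpoly K[n]}) : Prop :=
  (1 < msize p)%N /\
  forall a b : {mpoly K[n]}, p = a * b -> (msize a <= 1)%N \/ (msize b <= 1)%N.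

Definition linear_form (K : closedFieldType) (n : nat)
  (l : {mpoly K[n]}) : Prop := l != 0 /\ l \is 1.-homog.

(** * Zariski topology of P^(n-1) *)

Definition psub (K : closedFieldType) (n : nat)
  (Z W : 'rV[K]_n -> Prop) : Prop := forall x : 'rV[K]_n, x != 0 -> Z x -> W x.

Definition zclosure (K : closedFieldType) (n : nat) (Z : 'rV[K]_n -> Prop)
  (x : 'rV[K]_n) : Prop :=
  forall (d : nat) (G : {mpoly K[n]}),
    G \is d.-homog -> psub Z (zeros G) -> ev G x = 0.

Definition zclosed (K : closedFieldType) (n : nat)
  (Z : 'rV[K]_n -> Prop) : Prop := psub (zclosure Z) Z.

Definition zirreducible (K : closedFieldType) (n : nat)
  (Z : 'rV[K]_n -> Prop) : Prop :=
  (exists2 x : 'rV[K]_n, x != 0 & Z x) /\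
  forall A B : 'rV[K]_n -> Prop, zclosed A -> zclosed B ->
    psub Z (fun x => A x \/ B x) -> psub Z A \/ psub Z B.

Definition irreducible_component (K : closedFieldType) (n : nat)
  (Y Z : 'rV[K]_n -> Prop) : Prop :=
  [/\ zclosed Z, zirreducible Z, psub Z Y &
   forall W, zclosed W -> zirreducible W -> psub Z W -> psub W Y -> psub W Z].

Definition is_point (K : closedFieldType) (n : nat)
  (Z : 'rV[K]_n -> Prop) : Prop :=
  exists2 p : 'rV[K]_n, p != 0 &
    forall x : 'rV[K]_n, x != 0 -> (Z x <-> (x == p)%MS).

(* Irreducible closed subset of Krull dimension 1. *)
Definition irreducible_curve (K : closedFieldType) (n : nat)
  (Z : 'rV[K]_n -> Prop) : Prop :=
  [/\ zclosed Z, zirreducible Z, ~ is_point Z &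
   forall W, zclosed W -> zirreducible W -> psub W Z ->
     psub Z W \/ is_point W].

(** * Lines, multiplicities *)

Definition is_line (K : closedFieldType) (n : nat) (m : 'M[K]_(2, n)) : Prop :=
  \rank m = 2%N.

Definition is_plane (K : closedFieldType) (H : 'M[K]_(3, 4)) : Prop :=
  \rank H = 3%N.

Definition line_in (K : closedFieldType) (n : nat) (m : 'M[K]_(2, n))
  (G : {mpoly K[n]}) : Prop := forall x, (x <= m)%MS -> ev G x = 0.

Definition lines_meet (K : closedFieldType) (n : nat)
  (m m' : 'M[K]_(2, n)) : Prop :=
  exists x : 'rV[K]_n, [/\ x != 0, (x <= m)%MS & (x <= m')%MS].

(* G (p + 'X v), a univariate polynomial. *)
Definition along (K : closedFieldType) (n : nat) (G : {mpoly K[n]})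
  (p v : 'rV[K]_n) : {poly K} :=
  mmap (@polyC K) (fun i => (p 0 i)%:P + v 0 i *: 'X) G.

(* i(m, G; p) >= k, for k > 0, p a point and m a line: the order of vanishing
   at p of the restriction of G to m.  It is infinite if m lies on G, as 'X^k
   divides 0.  The directions v proportional to p only express G(p) = 0. *)
Definition imult_ge (K : closedFieldType) (n : nat) (m : 'M[K]_(2, n))
  (G : {mpoly K[n]}) (p : 'rV[K]_n) (k : nat) : Prop :=
  (p <= m)%MS /\ forall v, (v <= m)%MS -> 'X^k %| along G p v.

(* The hypersurface G has multiplicity >= k at the point p. *)
Definition mult_ge (K : closedFieldType) (n : nat) (G : {mpoly K[n]})
  (p : 'rV[K]_n) (k : nat) : Prop := forall v, 'X^k %| along G p v.

Definition mult_eq (K : closedFieldType) (n : nat) (G : {mpoly K[n]})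
  (p : 'rV[K]_n) (k : nat) : Prop := mult_ge G p k /\ ~ mult_ge G p k.+1.

(** * Plane cubics *)

Definition inflection_point (K : closedFieldType) (G : {mpoly K[3]})
  (p : 'rV[K]_3) : Prop :=
  p != 0 /\ exists2 m : 'M[K]_(2, 3), is_line m & imult_ge m G p 3.

(* At a double point p, the lines m with i(m, G; p) >= 3 are the tangents of
   the branches: two for a node and one for a cusp. *)
Definition node_at (K : closedFieldType) (G : {mpoly K[3]})
  (p : 'rV[K]_3) : Prop :=
  [/\ p != 0, mult_eq G p 2 &
   exists m1 m2 : 'M[K]_(2, 3),
     [/\ is_line m1, is_line m2, ~~ (m1 == m2)%MS &
      forall m : 'M[K]_(2, 3), is_line m ->
        (imult_ge m G p 3 <-> (m == m1)%MS \/ (m == m2)%MS)]].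

Definition cusp_at (K : closedFieldType) (G : {mpoly K[3]})
  (p : 'rV[K]_3) : Prop :=
  [/\ p != 0, mult_eq G p 2 &
   exists2 m1 : 'M[K]_(2, 3), is_line m1 &
     forall m : 'M[K]_(2, 3), is_line m ->
       (imult_ge m G p 3 <-> (m == m1)%MS)].

(* The Kodaira types of the singular reduced plane cubics.  Other types do not
   occur for the pencil of cubics residual to a line on a smooth quartic. *)
Inductive kodaira := I_1 | I_2 | I_3 | II | III | IV.

Definition three_lines (K : closedFieldType) (G : {mpoly K[3]})
  (l : 'I_3 -> {mpoly K[3]}) : Prop :=
  [/\ forall i, linear_form (l i),
      forall i j, i != j -> ~ proportional (l i) (l j) & G = \prod_i l i].

Definition conic_and_line (K : closedFieldType) (G q l : {mpoly K[3]}) : Prop :=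
  [/\ q \is 2.-homog, irreducible_mpoly q, linear_form l & G = q * l].

Definition kodaira_type (K : closedFieldType) (G : {mpoly K[3]})
  (T : kodaira) : Prop :=
  match T with
  | I_1 => irreducible_mpoly G /\ exists p, node_at G p
  | II => irreducible_mpoly G /\ exists p, cusp_at G p
  | I_2 => exists q l, conic_and_line G q l /\
      exists p1 p2 : 'rV[K]_3, [/\ p1 != 0, p2 != 0, ~~ (p1 == p2)%MS &
        forall x : 'rV[K]_3, x != 0 -> (zeros q x /\ zeros l x <->
                             (x == p1)%MS \/ (x == p2)%MS)]
  | III => exists q l, conic_and_line G q l /\
      is_point (fun x => zeros q x /\ zeros l x)
  | I_3 => exists2 l, three_lines G l &
      ~ exists2 x : 'rV[K]_3, x != 0 & forall i, zeros (l i) x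
  | IV => exists2 l, three_lines G l &
      exists2 x : 'rV[K]_3, x != 0 & forall i, zeros (l i) x
  end.

(** * The pencil of cubics residual to a line on a quartic *)

(* The restriction of F to the plane H, in the coordinates t |-> t *m H. *)
Definition restrict (K : closedFieldType) (F : {mpoly K[4]})
  (H : 'M[K]_(3, 4)) : {mpoly K[3]} :=
  F \mPo [tuple \sum_(i < 3) H i j *: 'X_i | j < 4].

Definition residual_cubic (K : closedFieldType) (F : {mpoly K[4]})
  (ell : 'M[K]_(2, 4)) (H : 'M[K]_(3, 4)) (G : {mpoly K[3]}) : Prop :=
  exists h : {mpoly K[3]},
    [/\ linear_form h, forall t : 'rV[K]_3, (t *m H <= ell)%MS -> zeros h t
      & restrict F H = h * G].

Definition pencil_plane (K : closedFieldType) (ell : 'M[K]_(2, 4))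
  (H : 'M[K]_(3, 4)) : Prop := is_plane H /\ (ell <= H)%MS.

(* "The singular fibers are exactly the ones listed in s" *)
Definition has_singular_fibers (K : closedFieldType) (F : {mpoly K[4]})
  (ell : 'M[K]_(2, 4)) (s : seq kodaira) : Prop :=
  exists H : 'I_(size s) -> 'M[K]_(3, 4),
    [/\ forall i, pencil_plane ell (H i),
        forall i j, i != j -> ~~ (H i == H j)%MS,
        forall i, exists2 G, residual_cubic F ell (H i) G &
                             kodaira_type G (tnth (in_tuple s) i)
      & forall H' G, pencil_plane ell H' -> residual_cubic F ell H' G ->
          ~ smooth_form G -> exists i, (H' == H i)%MS].

Definition second_kind (K : closedFieldType) (F : {mpoly K[4]})
  (ell : 'M[K]_(2, 4)) : Prop :=
  psub (fun x => (x <= ell)%MS)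
    (zclosure (fun x => exists (H : 'M[K]_(3, 4)) (G : {mpoly K[3]}) t,
       [/\ pencil_plane ell H, residual_cubic F ell H G, smooth_form G,
           inflection_point G t & x = t *m H])).

Definition gradient (K : closedFieldType) (F : {mpoly K[4]})
  (P : 'rV[K]_4) : 'rV[K]_4 := \row_i ev F^`M(i) P.

Definition tangent_plane (K : closedFieldType) (F : {mpoly K[4]})
  (P : 'rV[K]_4) (H : 'M[K]_(3, 4)) : Prop :=
  is_plane H /\ H *m (gradient F P)^T = 0.

(* e_P >= k, where e_P is the ramification index at P of pi restricted to ell,
   that is, of the map sending P to T_P X, a point of the dual space with
   coordinates the gradient of F at P: the maximal ideal of its image is
   generated by the minors below. *)
Definition ramification_ge (K : closedFieldType) (F : {mpoly K[4]})
  (ell : 'M[K]_(2, 4)) (P : 'rV[K]_4) (k : nat) : Prop :=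
  forall v, (v <= ell)%MS -> forall i j : 'I_4,
    'X^k %| gradient F P 0 i *: along F^`M(j) P v
            - gradient F P 0 j *: along F^`M(i) P v.

(* The ramification divisor is the sum of the (e_P - 1) P, ramification being
   tame: the degree is 3 and the characteristic is neither 2 nor 3. *)
Definition ramification_1111 (K : closedFieldType) (F : {mpoly K[4]})
  (ell : 'M[K]_(2, 4)) : Prop :=
  exists R : 'I_4 -> 'rV[K]_4,
    [/\ forall i, R i != 0 /\ (R i <= ell)%MS,
        forall i j, i != j -> ~~ (R i == R j)%MS
      & forall P : 'rV[K]_4, P != 0 -> (P <= ell)%MS ->
          (ramification_ge F ell P 2 <-> exists i, (P == R i)%MS) /\
          ~ ramification_ge F ell P 3].

(** * The surface S_8 *)

Definition tangent_line_family (K : closedFieldType) (F : {mpoly K[4]})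
  (ell m : 'M[K]_(2, 4)) : Prop :=
  is_line m /\
  exists (P : 'rV[K]_4) (H : 'M[K]_(3, 4)) (G : {mpoly K[3]})
         (p : 'rV[K]_3) (m' : 'M[K]_(2, 3)),
    [/\ P != 0 /\ (P <= ell)%MS, tangent_plane F P H, residual_cubic F ell H G,
        p *m H = P /\ m' *m H = m & imult_ge m' G p 2].

Definition S8 (K : closedFieldType) (F : {mpoly K[4]}) (ell : 'M[K]_(2, 4))
  (x : 'rV[K]_4) : Prop :=
  exists2 m : 'M[K]_(2, 4), tangent_line_family F ell m & (x <= m)%MS.

(** * Ruled surfaces *)

Definition cone_over_planar_curve (K : closedFieldType)
  (S : {mpoly K[4]}) : Prop :=
  exists (V : 'rV[K]_4) (H : 'M[K]_(3, 4)) (d : nat) (g : {mpoly K[3]}),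
    [/\ is_plane H, ~~ (V <= H)%MS, g != 0 /\ g \is d.-homog &
     forall x : 'rV[K]_4, x != 0 ->
       (zeros S x <-> exists t : 'rV[K]_3,
          [/\ t != 0, zeros g t & (x <= col_mx V (t *m H))%MS])].

Definition ruled_quartic (K : closedFieldType) (S : {mpoly K[4]}) : Prop :=
  [/\ S \is 4.-homog, irreducible_mpoly S,
      forall x : 'rV[K]_4, x != 0 -> zeros S x ->
        exists m : 'M[K]_(2, 4), [/\ is_line m, line_in m S & (x <= m)%MS]
    & ~ cone_over_planar_curve S].

(* The 16 entries of the antisymmetric matrix of the Pluecker coordinates
   p_ij = m_0i m_1j - m_0j m_1i; a linear embedding of P^5 in P^15. *)
Definition plucker (K : closedFieldType) (m : 'M[K]_(2, 4)) : 'rV[K]_(4 * 4) :=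
  mxvec (\matrix_(i, j) (m 0 i * m 1 j - m 0 j * m 1 i)).

(* C is the irreducible curve of lines on S. *)
Definition ruling (K : closedFieldType) (S : {mpoly K[4]})
  (C : 'M[K]_(2, 4) -> Prop) : Prop :=
  irreducible_curve (fun y => exists2 m, is_line m /\ C m & y = plucker m) /\
  exists2 s : seq 'M[K]_(2, 4), (size s <= 2)%N &
    forall m, is_line m ->
      (line_in m S <-> C m \/ has (fun m' => (m == m')%MS) s).

Definition directrix (K : closedFieldType) (S : {mpoly K[4]})
  (m : 'M[K]_(2, 4)) : Prop :=
  [/\ is_line m, line_in m S &
   exists2 C, ruling S C & forall m', is_line m' -> C m' -> lines_meet m m'].

Definition veronese (K : closedFieldType) (u : 'rV[K]_2) : 'rV[K]_4 :=
  \row_(i < 4) (u 0 0 ^+ (3 - i) * u 0 1 ^+ i).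

Definition twisted_cubic (K : closedFieldType) (Z : 'rV[K]_4 -> Prop) : Prop :=
  exists2 A : 'M[K]_4, A \in unitmx &
    forall x : 'rV[K]_4, x != 0 ->
      (Z x <-> exists2 u : 'rV[K]_2, u != 0 &
         (x == veronese u *m A)%MS).

Definition sing_line_of_triple_points (K : closedFieldType)
  (S : {mpoly K[4]}) : Prop :=
  (exists2 m : 'M[K]_(2, 4), is_line m &
     forall x : 'rV[K]_4, x != 0 -> (singular_at S x <-> (x <= m)%MS)) /\
  forall x : 'rV[K]_4, x != 0 -> singular_at S x -> mult_eq S x 3.

Definition sing_twisted_cubic_of_double_points (K : closedFieldType)
  (S : {mpoly K[4]}) : Prop :=
  twisted_cubic (singular_at S) /\
  forall x : 'rV[K]_4, x != 0 -> singular_at S x -> mult_eq S x 2.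

(** * Segre decompositions *)

Definition plane_through (K : closedFieldType) (ell : 'M[K]_(2, 4))
  (L : {mpoly K[4]}) : Prop := linear_form L /\ line_in ell L.

Definition meets_in_four_lines (K : closedFieldType)
  (F L : {mpoly K[4]}) : Prop :=
  exists M : 'I_4 -> 'M[K]_(2, 4),
    [/\ forall i, is_line (M i), forall i j, i != j -> ~~ (M i == M j)%MS &
     forall x : 'rV[K]_4, x != 0 ->
       (zeros F x /\ zeros L x <-> exists i, (x <= M i)%MS)].

Definition segre_decomposition (K : closedFieldType) (F : {mpoly K[4]})
  (ell : 'M[K]_(2, 4)) (S : {mpoly K[4]}) (L : 'I_4 -> {mpoly K[4]}) : Prop :=
  [/\ S != 0 /\ S \is 4.-homog,
      forall x : 'rV[K]_4, x != 0 -> zeros S x ->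
        exists m : 'M[K]_(2, 4),
          [/\ is_line m, line_in m S, (x <= m)%MS & lines_meet m ell],
      forall j, plane_through ell (L j)
    & proportional F (S + \prod_j L j)].

(* Main.v *)
Require Import Defs.
From mathcomp Require Import all_boot all_order all_algebra.
From mathcomp.multinomials Require Import mpoly.
From mathcomp Require Import ring zify.
From Stdlib Require Import Classical.

(** Why the theorem is true.

    Choose coordinates in which the line ell is x2 = x3 = 0.  The equation of the quartic
    is x2 A + x3 B + (terms of degree two or more in x2, x3), with binary cubics A, B in
    x0, x1 that describe the projection of ell.  Ramification type 1^4 allows coordinates with
      A = x0 ^ 2 (x0 + b x1),  B = x1 ^ 2 (x1 + b x0),  b ^ 2 not in {0, 1, 9}
    (ramified_coordinates, smooth_directrix_coprime, ramification_distinct).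

    The planes through ell are x2 = s w, x3 = t w, and the residual cubic in such a plane is
    C + w Q + w ^ 2 R + f w ^ 3 with C = s A + t B.  Its flexes are cut out by its Hessian.
    Substituting for (s, t) the plane through the point x of the quartic, which is an
    expression in x, gives a form of degree 18 that vanishes at all flexes, hence on ell if
    ell is of the second kind (second_kind_flex_form).  On ell this condition involves
    only C, Q and R.  After a translation along ell it forces Q to be k times the Hessian h
    of the binary cubic C, and R = 0 (line_quartic_normal).  If D is the discriminant of C,
    the equation is thus
      (C + k h + k ^ 3 D) + c(x2, x3)
    with a binary quartic c, which is a product of four planes through ell.

    The first summand is the ruled quartic S4.  The reason is the identity
    cubic_hess_disc_split: if C is a product of three linear forms, then adding its Hessian
    and its discriminant gives again a product of three linear forms.  So every plane
    through ell meets S4 in ell and three lines (fibre_lines).  The lines are the generators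
    Tl u, u in ell, and their geometry is explicit: S4 is irreducible because its points are
    polynomially parametrised (irreducible_path), the generators form a closed irreducible
    curve (generators_curve) and ell is a directrix (scroll_directrix).  The double locus is
    the line x0 = x1 = 0, with triple points, if k = 0 (scroll_triple_line), and a twisted
    cubic otherwise (scroll_twisted_cubic).  The tangent lines making up S_8 are the
    generators, apart from those in the four planes D = 0 (tangent_surface_sub).

    The singular fibres are the planes where c, D or, for k nonzero, k ^ 3 D + c vanishes.  By
    smoothness these binary quartics have simple roots and no common root with D.  Over c = 0
    the fibre consists of three lines, concurrent exactly if k = 0; over D = 0 it is cuspidal;
    over k ^ 3 D + c = 0 it is nodal.  So there are twelve singular fibres if k is nonzero and
    eight if k = 0 (fibres_twisted, fibres_triple), and this number tells the two cases apart
    (singular_fibers_leq).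

    Uniqueness of the decomposition is no_ruled_deformation: a nonzero form in x2, x3 added to
    a multiple of S4 destroys its lines. *)

Set Implicit Arguments.
Unset Strict Implicit.
Unset Printing Implicit Defensive.

Import GRing.Theory.
Local Open Scope ring_scope.


(** * Forms and their values *)

Section Evaluation.
Variable K : closedFieldType.
Implicit Types n m d : nat.

Lemma poly_ext0 (p : {poly K}) : (forall t, p.[t] = 0) -> p = 0.
Proof.
move=> p0; apply/eqP; apply: contraT => /closed_nonrootP[x].
by rewrite /root p0 eqxx.
Qed.

Lemma poly_ext (p q : {poly K}) : (forall t, p.[t] = q.[t]) -> p = q.
Proof.
by move=> pq; apply/subr0_eq/poly_ext0 => t; rewrite hornerD hornerN pq subrr.
Qed.

Definition peval n (g : 'I_n -> {poly K}) (G : {mpoly K[n]}) : {poly K} :=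
  mmap (@polyC K) g G.

Lemma pevalD n (g : 'I_n -> {poly K}) : {morph peval g : p q / p + q}.
Proof. by move=> p q; rewrite /peval mmapD. Qed.
Lemma pevalM n (g : 'I_n -> {poly K}) : {morph peval g : p q / p * q}.
Proof. by move=> p q; rewrite /peval; apply: (mmap_is_multiplicative _ _).1. Qed.
Lemma pevalXU n (g : 'I_n -> {poly K}) i : peval g 'X_i = g i.
Proof. by rewrite /peval mmapX mmap1U. Qed.
Lemma pevalC n (g : 'I_n -> {poly K}) c : peval g c%:MP = c%:P.
Proof. by rewrite /peval mmapC. Qed.

Lemma horner_peval n (g : 'I_n -> {poly K}) (G : {mpoly K[n]}) t :
  (peval g G).[t] = ev G (\row_i (g i).[t]).
Proof.
rewrite /peval /ev /meval /mmap horner_sum; apply: eq_bigr => m _.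
rewrite hornerM hornerC; congr (_ * _); rewrite /mmap1 horner_prod.
by apply: eq_bigr => i _; rewrite horner_exp mxE.
Qed.

Lemma alongE n (G : {mpoly K[n]}) p v :
  along G p v = peval (fun i => (p 0 i)%:P + v 0 i *: 'X) G.
Proof. by []. Qed.

Lemma horner_along n (G : {mpoly K[n]}) p v t :
  (along G p v).[t] = ev G (p + t *: v).
Proof.
rewrite alongE horner_peval; congr ev; apply/rowP => i.
by rewrite !mxE hornerD hornerC hornerZ hornerX mulrC.
Qed.

Lemma evD n (x : 'rV[K]_n) : {morph (fun G => ev G x) : p q / p + q}.
Proof. by move=> p q; rewrite /ev mevalD. Qed.
Lemma evB n (x : 'rV[K]_n) : {morph (fun G => ev G x) : p q / p - q}.
Proof. by move=> p q; rewrite /ev mevalB. Qed.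
Lemma evN n (x : 'rV[K]_n) : {morph (fun G => ev G x) : p / - p}.
Proof. by move=> p; rewrite /ev mevalN. Qed.
Lemma evM n (x : 'rV[K]_n) : {morph (fun G => ev G x) : p q / p * q}.
Proof. by move=> p q; rewrite /ev mevalM. Qed.
Lemma evZ n (x : 'rV[K]_n) c p : ev (c *: p) x = c * ev p x.
Proof. by rewrite /ev mevalZ. Qed.
Lemma evXU n (x : 'rV[K]_n) i : ev 'X_i x = x 0 i.
Proof. by rewrite /ev mevalXU. Qed.
Lemma evC n (x : 'rV[K]_n) c : ev c%:MP x = c.
Proof. by rewrite /ev mevalC. Qed.
Lemma evX n (x : 'rV[K]_n) p k : ev (p ^+ k) x = ev p x ^+ k.
Proof. exact: rmorphXn. Qed.
Lemma ev_prod n (x : 'rV[K]_n) (I : finType) (F : I -> {mpoly K[n]}) :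
  ev (\prod_i F i) x = \prod_i ev (F i) x.
Proof. by rewrite /ev rmorph_prod. Qed.

Lemma ev_homog n (G : {mpoly K[n]}) d (c : K) x :
  G \is d.-homog -> ev G (c *: x) = c ^+ d * ev G x.
Proof.
move=> /dhomogP hG; rewrite /ev /meval /mmap mulr_sumr.
apply: eq_big_seq => m /hG /= <-; rewrite mulrCA; congr (_ * _).
rewrite /mmap1 mdegE -prodrXr -big_split /=.
by apply: eq_bigr => i _; rewrite mxE exprMn.
Qed.

Lemma ev0_homog n (G : {mpoly K[n]}) d : G \is d.+1.-homog -> ev G 0 = 0.
Proof.
by move=> hG; rewrite -(scale0r (0 : 'rV_n)) (ev_homog _ _ hG) exprS !mul0r.
Qed.

(** Reading a polynomial as univariate in its last variable, a nonzero
    polynomial takes a nonzero value because K is infinite. *)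
Lemma mpoly_ext0 n (p : {mpoly K[n]}) : (forall x, ev p x = 0) -> p = 0.
Proof.
elim: n p => [|n IH] p p0.
  by rewrite (nvar0_mpolyC p); have := p0 0; rewrite {1}(nvar0_mpolyC p) evC => ->.
have mevalU (x : 'rV[K]_n) (t : K) :
    (map_poly (meval (x 0)) (muni p)).[t] =
    ev p (\row_i if unlift ord_max i is Some j then x 0 j else t).
  rewrite muniE /ev {2}/meval /mmap rmorph_sum horner_sum; apply: eq_bigr => m _.
  rewrite -mul_polyC rmorphM /= map_polyC /= map_polyXn hornerM hornerC hornerXn mevalZ -mulrA; congr (_ * _).
  rewrite /mmap1 big_ord_recr /= mxE unlift_none mevalX; congr (_ * _).
  apply: eq_bigr => i _; rewrite mnmE mxE.
  have -> : widen_ord (leqnSn n) i = lift ord_max i.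
    by apply: val_inj; rewrite /= /bump leqNgt ltn_ord.
  by rewrite liftK.
have {p0 IH mevalU} u0 : muni p = 0.
  apply/polyP => k; rewrite coef0; apply: IH => x.
  have : map_poly (meval (x 0)) (muni p) = 0.
    by apply: poly_ext0 => t; rewrite mevalU p0.
  by move/polyP/(_ k); rewrite coef_map coef0.
apply/mpolyP => m0; rewrite mcoeff0.
have := congr1 (fun q : {poly {mpoly K[n]}} =>
  (q`_(m0 ord_max))@_[multinom m0 (widen_ord (leqnSn n) i) | i < n]) u0.
rewrite coef0 mcoeff0 => <-; rewrite muniE coef_sum [RHS]raddf_sum /=.
rewrite {1}(mpolyE p) raddf_sum /=; apply: eq_bigr => m _.
rewrite mcoeffZ mcoeffX coefZ coefXn mulr_natr mcoeffMn mcoeffZ mcoeffX -mulrnAr.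
congr (_ * _); rewrite eq_sym -mulrnA mulnb; congr (_ %:R); congr nat_of_bool.
apply/eqP/andP => [<-|[/eqP h1 /eqP h2]] //.
apply/mnmP => i; case: (unliftP ord_max i) => [j ->|-> //].
have -> : lift ord_max j = widen_ord (leqnSn n) j.
  by apply: val_inj; rewrite /= /bump leqNgt ltn_ord.
by have /mnmP/(_ j) := h1; rewrite !mnmE.
Qed.

Lemma mpoly_ext n (p q : {mpoly K[n]}) : (forall x, ev p x = ev q x) -> p = q.
Proof.
by move=> pq; apply/subr0_eq/mpoly_ext0 => x; rewrite evB pq subrr.
Qed.

(** Taylor expansion to first order, by induction on the construction of G. *)
Lemma along_coef1 n (G : {mpoly K[n]}) p v :
  (along G p v)`_1 = \sum_i v 0 i * ev G^`M(i) p.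
Proof.
pose g := fun i => (p 0 i)%:P + v 0 i *: 'X : {poly K}.
pose D (G : {mpoly K[n]}) := \sum_i v 0 i * ev G^`M(i) p.
have c0 H : (peval g H)`_0 = ev H p.
  by rewrite -horner_coef0 -alongE horner_along scale0r addr0.
pose P (G : {mpoly K[n]}) := (peval g G)`_1 = D G.
have PM H1 H2 : P H1 -> P H2 -> P (H1 * H2).
  rewrite /P pevalM coefM !big_ord_recr big_ord0 /= add0r !c0 => -> ->.
  rewrite /D mulr_sumr mulr_suml -big_split /=; apply: eq_bigr => i _.
  rewrite mderivM evD !evM; ring.
have PC c : P c%:MP.
  rewrite /P pevalC coefC /= /D big1 // => i _; rewrite mderivC.
  by rewrite -mpolyC0 evC mulr0.
have P1 : P 1 by rewrite -mpolyC1; apply: PC.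
have PX i : P 'X_i.
  rewrite /P pevalXU /g coefD coefC add0r coefZ coefX mulr1 /D.
  rewrite (bigD1 i) //= big1 => [|j ji].
    rewrite mderivX mnm1E eqxx scale1r addr0.
    have -> : (U_(i) - U_(i))%MM = 0%MM by apply/mnmP => k; rewrite !mnmE subnn.
    by rewrite mpolyX0 -mpolyC1 evC mulr1.
  by rewrite mderivX mnm1E eq_sym (negbTE ji) scale0r -mpolyC0 evC mulr0.
rewrite alongE -/g -/(D G) -/(P G).
elim/mpolyind: G => [|c m q _ _ IH]; first by rewrite -mpolyC0; apply: PC.
rewrite /P pevalD coefD IH.
have : P (c *: 'X_[m]).
  rewrite -mul_mpolyC; apply: (PM) => //; rewrite mpolyXE_id.
  apply: (big_ind P) => // i _.
  by elim: (m i) => [|k IHk]; rewrite ?expr0 // exprS; apply: (PM).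
rewrite /P => ->; rewrite /D -big_split /=; apply: eq_bigr => i _.
by rewrite mderivD evD mulrDr.
Qed.

Lemma singular_along n (G : {mpoly K[n]}) x :
  singular_at G x <-> forall v, 'X^2 %| along G x v.
Proof.
have c0 v : (along G x v)`_0 = ev G x.
  by rewrite -horner_coef0 horner_along scale0r addr0.
split=> [[G0 dG] v|h].
  apply/dvdpP; exists (\poly_(i < size (along G x v)) (along G x v)`_i.+2).
  apply/polyP => i; rewrite coefMXn coef_poly.
  case: i => [|[|i]] //=; rewrite ?c0 // ?along_coef1.
    by rewrite big1 // => i _; rewrite dG mulr0.
  rewrite subn2 /=; case: ltnP => // le_i; rewrite nth_default //.
  by rewrite (leq_trans le_i) // !leqW.
have h1 v i : (i < 2)%N -> (along G x v)`_i = 0.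
  by move=> i2; have /dvdpP[q ->] := h v; rewrite coefMXn i2.
split=> [|i]; first by rewrite -(c0 0) h1.
have := h1 (delta_mx 0 i) 1%N isT; rewrite along_coef1 (bigD1 i) //= big1.
  by rewrite mxE !eqxx mul1r addr0.
by move=> j ji; rewrite mxE eqxx (negbTE ji) mul0r.
Qed.

End Evaluation.

(** * Linear substitutions *)

Section Substitution.
Variable K : closedFieldType.
Implicit Types n m d : nat.

Definition lsub m n (M : 'M[K]_(m, n)) (F : {mpoly K[n]}) : {mpoly K[m]} :=
  F \mPo [tuple \sum_(i < m) M i j *: 'X_i | j < n].

Lemma ev_lsub m n (M : 'M[K]_(m, n)) F x : ev (lsub M F) x = ev F (x *m M).
Proof.
rewrite /ev comp_mpoly_meval; apply: meval_eq => j.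
rewrite tnth_map tnth_ord_tuple raddf_sum mxE; apply: eq_bigr => i _ /=.
by rewrite mevalZ mevalXU mulrC.
Qed.

Lemma ev_restrict (F : {mpoly K[4]}) H t : ev (restrict F H) t = ev F (t *m H).
Proof. exact: ev_lsub. Qed.

Lemma along_lsub m n (M : 'M[K]_(m, n)) F p v :
  along (lsub M F) p v = along F (p *m M) (v *m M).
Proof.
by apply: poly_ext => t; rewrite !horner_along ev_lsub mulmxDl -scalemxAl.
Qed.

Lemma lsub_comp m n k (M : 'M[K]_(m, n)) (N : 'M[K]_(n, k)) F :
  lsub M (lsub N F) = lsub (M *m N) F.
Proof. by apply: mpoly_ext => x; rewrite !ev_lsub mulmxA. Qed.

Lemma lsub1 n (F : {mpoly K[n]}) : lsub 1%:M F = F.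
Proof. by apply: mpoly_ext => x; rewrite ev_lsub mulmx1. Qed.

Lemma lsubM m n (M : 'M[K]_(m, n)) : {morph lsub M : p q / p * q}.
Proof. by move=> p q; rewrite /lsub rmorphM. Qed.
Lemma lsubD m n (M : 'M[K]_(m, n)) : {morph lsub M : p q / p + q}.
Proof. by move=> p q; rewrite /lsub rmorphD. Qed.
Lemma lsubZ m n (M : 'M[K]_(m, n)) c p : lsub M (c *: p) = c *: lsub M p.
Proof. by rewrite /lsub comp_mpolyZ. Qed.
Lemma lsubC m n (M : 'M[K]_(m, n)) c : lsub M c%:MP = c%:MP.
Proof. by rewrite /lsub comp_mpolyC. Qed.
Lemma lsub0 m n (M : 'M[K]_(m, n)) : lsub M 0 = 0.
Proof. by rewrite /lsub rmorph0. Qed.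
Lemma lsub_prod m n (M : 'M[K]_(m, n)) (I : finType) (G : I -> {mpoly K[n]}) :
  lsub M (\prod_i G i) = \prod_i lsub M (G i).
Proof. by rewrite /lsub rmorph_prod. Qed.

Lemma lsub_homog m n (M : 'M[K]_(m, n)) F d :
  F \is d.-homog -> lsub M F \is d.-homog.
Proof.
move=> /dhomogP hF; rewrite /lsub comp_mpolyEX big_seq; apply: rpred_sum => x /hF /= <-.
apply: dhomogZ; rewrite comp_mpolyX mdegE.
elim/big_rec2: _ => [|i y1 y2 _ h]; first exact: dhomog1.
apply: dhomogM => //; rewrite -[X in X.-homog]mul1n; apply: dhomogMn.
rewrite tnth_map tnth_ord_tuple; apply: rpred_sum => j _.
by apply: dhomogZ; rewrite dhomogX /= mdeg1.
Qed.

Lemma mderiv_lsub m n (M : 'M[K]_(m, n)) F j :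
  (lsub M F)^`M(j) = \sum_k M j k *: lsub M F^`M(k).
Proof.
apply: mpoly_ext => x.
have := along_coef1 (lsub M F) x (delta_mx 0 j).
rewrite (bigD1 j) //= big1 => [|i ij]; last by rewrite mxE eqxx (negbTE ij) mul0r.
rewrite mxE !eqxx mul1r addr0 => <-; rewrite along_lsub along_coef1.
rewrite [RHS](_ : _ = \sum_k ev (M j k *: lsub M F^`M(k)) x).
  by apply: eq_bigr => k _; rewrite -rowE mxE evZ ev_lsub.
by rewrite /ev raddf_sum.
Qed.

Lemma singular_lsub n (M : 'M[K]_n) (F : {mpoly K[n]}) x : M \in unitmx ->
  singular_at (lsub M F) x <-> singular_at F (x *m M).
Proof.
move=> uM; rewrite !singular_along; split=> h v; last by rewrite along_lsub.
by rewrite -(mulmxKV uM v) -along_lsub.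
Qed.

Lemma mult_ge_lsub n (M : 'M[K]_n) (F : {mpoly K[n]}) x k : M \in unitmx ->
  mult_ge (lsub M F) x k <-> mult_ge F (x *m M) k.
Proof.
move=> uM; split=> h v; last by rewrite along_lsub.
by rewrite -(mulmxKV uM v) -along_lsub.
Qed.

Lemma mult_eq_lsub n (M : 'M[K]_n) (F : {mpoly K[n]}) x k : M \in unitmx ->
  mult_eq (lsub M F) x k <-> mult_eq F (x *m M) k.
Proof. by move=> uM; rewrite /mult_eq !mult_ge_lsub. Qed.

Lemma mul_unit_neq0 m n (M : 'M[K]_n) (x : 'M[K]_(m, n)) : M \in unitmx ->
  (x *m M != 0) = (x != 0).
Proof.
move=> uM; apply/idP/idP; apply: contra => /eqP; first by move=> ->; rewrite mul0mx.
by move=> h; rewrite -(mulmxK uM x) h mul0mx.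
Qed.

Lemma submx_mul m p n (M : 'M[K]_n) (A : 'M[K]_(m, n)) (B : 'M[K]_(p, n)) :
  M \in unitmx -> (A *m M <= B *m M)%MS = (A <= B)%MS.
Proof. by move=> uM; rewrite submxMfree // row_free_unit. Qed.

Lemma submx_mulV m p n (M : 'M[K]_n) (A : 'M[K]_(m, n)) (B : 'M[K]_(p, n)) :
  M \in unitmx -> (A <= B *m invmx M)%MS = (A *m M <= B)%MS.
Proof. by move=> uM; rewrite -(submx_mul A _ uM) mulmxKV. Qed.

Lemma eqmx_mul m p n (M : 'M[K]_n) (A : 'M[K]_(m, n)) (B : 'M[K]_(p, n)) :
  M \in unitmx -> (A *m M == B *m M)%MS = (A == B)%MS.
Proof. by move=> uM; rewrite !submx_mul. Qed.

Lemma eqmx_mulV m p n (M : 'M[K]_n) (A : 'M[K]_(m, n)) (B : 'M[K]_(p, n)) :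
  M \in unitmx -> (A == B *m invmx M)%MS = (A *m M == B)%MS.
Proof. by move=> uM; rewrite -(eqmx_mul A _ uM) mulmxKV. Qed.

Lemma rank_mul m n (M : 'M[K]_n) (A : 'M[K]_(m, n)) :
  M \in unitmx -> \rank (A *m M) = \rank A.
Proof. by move=> uM; rewrite mxrankMfree // row_free_unit. Qed.

End Substitution.

(** * Invariance under projective transformations *)

Section ZariskiTransport.
Variables (K : closedFieldType) (n : nat) (M : 'M[K]_n).
Hypothesis uM : M \in unitmx.
Implicit Types Y Z W : 'rV[K]_n -> Prop.

Lemma zclosure_transport Z Z' x :
  (forall y, y != 0 -> Z (y *m M) -> Z' y) -> zclosure Z (x *m M) -> zclosure Z' x.
Proof.
move=> hZ hx d G hG vG; rewrite -(mulmxK uM x) -ev_lsub.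
apply: (hx d); first exact: lsub_homog.
move=> y y0 Zy; rewrite /zeros ev_lsub; apply: vG.
  by rewrite mul_unit_neq0 ?unitmx_inv.
by apply: hZ; rewrite ?mulmxKV // mul_unit_neq0 ?unitmx_inv.
Qed.

Lemma zclosed_transport Z Z' :
  (forall y, y != 0 -> Z' y <-> Z (y *m M)) -> zclosed Z -> zclosed Z'.
Proof.
move=> hZ cZ x x0 cx; apply/(hZ _ x0)/cZ; first by rewrite mul_unit_neq0.
move=> d G hG vG; rewrite -ev_lsub; apply: (cx d); first exact: lsub_homog.
move=> y y0 /(hZ _ y0) Zy; rewrite /zeros ev_lsub; apply: vG => //.
by rewrite mul_unit_neq0.
Qed.

Lemma is_point_transport Z Z' :
  (forall y, y != 0 -> Z' y <-> Z (y *m M)) -> is_point Z -> is_point Z'.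
Proof.
move=> hZ [p p0 hp]; exists (p *m invmx M); first by rewrite mul_unit_neq0 ?unitmx_inv.
move=> x x0; rewrite hZ // hp ?mul_unit_neq0 //.
by rewrite -{1 2}(mulmxKV uM p) eqmx_mul.
Qed.
End ZariskiTransport.

Section IrreducibleTransport.
Variables (K : closedFieldType) (n : nat) (M : 'M[K]_n).
Hypothesis uM : M \in unitmx.
Implicit Types Y Z W : 'rV[K]_n -> Prop.

Let uV : invmx M \in unitmx. Proof. by rewrite unitmx_inv. Qed.

Let flip Z Z' : (forall y, y != 0 -> Z' y <-> Z (y *m M)) ->
  forall y, y != 0 -> Z y <-> Z' (y *m invmx M).
Proof. by move=> h y y0; rewrite h ?mul_unit_neq0 // mulmxKV. Qed.

Let comp W : forall y, y != 0 -> W (y *m invmx M) <-> W (y *m invmx M).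
Proof. by []. Qed.

Lemma psub_transport Z Z' W W' :
  (forall y, y != 0 -> Z' y <-> Z (y *m M)) ->
  (forall y, y != 0 -> W' y <-> W (y *m M)) -> psub Z W -> psub Z' W'.
Proof.
move=> hZ hW ZW y y0 /(hZ _ y0) Zy; apply/(hW _ y0)/ZW => //.
by rewrite mul_unit_neq0.
Qed.

Lemma zirreducible_transport Z Z' :
  (forall y, y != 0 -> Z' y <-> Z (y *m M)) -> zirreducible Z -> zirreducible Z'.
Proof.
move=> hZ [[x x0 Zx] irr]; split.
  exists (x *m invmx M); first by rewrite mul_unit_neq0.
  by apply/(flip hZ x0).
move=> A B cA cB hAB.
have [|||h|h] := irr (fun x => A (x *m invmx M)) (fun x => B (x *m invmx M)).
- exact: (zclosed_transport uV (comp A)).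
- exact: (zclosed_transport uV (comp B)).
- move=> y y0 /(flip hZ y0) Zy; apply: hAB => //; by rewrite mul_unit_neq0.
- left=> y y0 /(hZ _ y0) Zy; have := h (y *m M); rewrite mulmxK // mul_unit_neq0 //.
  exact.
right=> y y0 /(hZ _ y0) Zy; have := h (y *m M); rewrite mulmxK // mul_unit_neq0 //.
exact.
Qed.
End IrreducibleTransport.

Section CurveTransport.
Variables (K : closedFieldType) (n : nat) (M : 'M[K]_n).
Hypothesis uM : M \in unitmx.
Implicit Types Y Z W : 'rV[K]_n -> Prop.

Let uV : invmx M \in unitmx. Proof. by rewrite unitmx_inv. Qed.

Let flip Z Z' : (forall y, y != 0 -> Z' y <-> Z (y *m M)) ->
  forall y, y != 0 -> Z y <-> Z' (y *m invmx M).
Proof. by move=> h y y0; rewrite h ?mul_unit_neq0 // mulmxKV. Qed.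

Let back W : forall y, y != 0 -> W (y *m invmx M) <-> W (y *m invmx M).
Proof. by []. Qed.

Let forth W : forall y, y != 0 -> W y <-> W (y *m M *m invmx M).
Proof. by move=> y y0; rewrite mulmxK. Qed.

Lemma irreducible_component_transport Y Y' Z Z' :
  (forall y, y != 0 -> Y' y <-> Y (y *m M)) ->
  (forall y, y != 0 -> Z' y <-> Z (y *m M)) ->
  irreducible_component Y Z -> irreducible_component Y' Z'.
Proof.
move=> hY hZ [cZ iZ ZY maxZ]; split.
- exact: zclosed_transport hZ cZ.
- exact: zirreducible_transport hZ iZ.
- exact: psub_transport hZ hY ZY.
move=> W cW iW ZW WY.
apply: (psub_transport uM (Z := fun y => W (y *m invmx M)) (@forth W) hZ).
apply: maxZ.
- exact: (zclosed_transport uV (@back W)).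
- exact: (zirreducible_transport uV (@back W)).
- exact: (psub_transport uV (flip hZ) (@back W) ZW).
exact: (psub_transport uV (@back W) (flip hY) WY).
Qed.

Lemma irreducible_curve_transport Z Z' :
  (forall y, y != 0 -> Z' y <-> Z (y *m M)) ->
  irreducible_curve Z -> irreducible_curve Z'.
Proof.
move=> hZ [cZ iZ nZ maxZ]; split.
- exact: zclosed_transport hZ cZ.
- exact: zirreducible_transport hZ iZ.
- by move/(is_point_transport uV (flip hZ)).
move=> W cW iW WZ.
have [|||h|h] := maxZ (fun y => W (y *m invmx M)).
- exact: (zclosed_transport uV (@back W)).
- exact: (zirreducible_transport uV (@back W)).
- exact: (psub_transport uV (@back W) (flip hZ) WZ).
- by left; apply: (psub_transport uM hZ (@forth W) h).
by right; apply: (is_point_transport uM (@forth W) h).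
Qed.
End CurveTransport.

Section Transport.
Variables (K : closedFieldType) (M : 'M[K]_4) (ell ell' : 'M[K]_(2, 4)).
Hypotheses (uM : M \in unitmx) (hl : (ell' *m M :=: ell)%MS).
Implicit Types (F S L : {mpoly K[4]}).

Let uV : invmx M \in unitmx. Proof. by rewrite unitmx_inv. Qed.

Let sub_ell m (x : 'M[K]_(m, 4)) : (x <= ell')%MS = (x *m M <= ell)%MS.
Proof. by rewrite -hl submx_mul. Qed.

Let ell_sub m (H : 'M[K]_(m, 4)) : (ell' <= H)%MS = (ell <= H *m M)%MS.
Proof. by rewrite -hl submx_mul. Qed.

Let lsubK F : lsub (invmx M) (lsub M F) = F.
Proof. by rewrite lsub_comp mulVmx // lsub1. Qed.

Let lsubVK F : lsub M (lsub (invmx M) F) = F.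
Proof. by rewrite lsub_comp mulmxV // lsub1. Qed.

Let hlV : (ell *m invmx M :=: ell')%MS.
Proof.
apply/eqmxP; rewrite -{1}(mulmxK uM ell') -{2}(mulmxK uM ell') !submx_mul //.
by rewrite !hl submx_refl.
Qed.

Lemma smooth_quartic_transport F : smooth_quartic F -> smooth_quartic (lsub M F).
Proof.
move=> [hF sF]; split; first exact: lsub_homog.
by move=> x x0; rewrite singular_lsub //; apply: sF; rewrite mul_unit_neq0.
Qed.

Lemma is_line_mul n (N : 'M[K]_n) (m : 'M[K]_(2, n)) : N \in unitmx ->
  is_line (m *m N) <-> is_line m.
Proof. by move=> uN; rewrite /is_line rank_mul. Qed.

Lemma is_line_transport : is_line ell -> is_line ell'.
Proof. by rewrite /is_line -hl rank_mul. Qed.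

Lemma line_in_lsub m S : line_in m (lsub M S) <-> line_in (m *m M) S.
Proof.
split=> h x xm; last by rewrite ev_lsub h // submx_mul.
by rewrite -(mulmxKV uM x) -ev_lsub h // -(submx_mul _ _ uM) mulmxKV.
Qed.

Lemma line_in_ell_transport S : line_in ell S <-> line_in ell' (lsub M S).
Proof.
split=> h x xm; first by rewrite ev_lsub h // -sub_ell.
by rewrite -(mulmxKV uM x) -ev_lsub h // sub_ell mulmxKV.
Qed.

Lemma residual_cubic_lsub F H G :
  residual_cubic (lsub M F) ell' H G <-> residual_cubic F ell (H *m M) G.
Proof.
have e0 : restrict F (H *m M) = restrict (lsub M F) H by rewrite /restrict -!/(lsub _ _) lsub_comp.
rewrite /residual_cubic e0; split=> -[h [lh vh e]]; exists h; split=> // t ht; apply: vh;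
  by move: ht; rewrite sub_ell mulmxA.
Qed.

Lemma pencil_plane_lsub H : pencil_plane ell' H <-> pencil_plane ell (H *m M).
Proof. by rewrite /pencil_plane /is_plane rank_mul // ell_sub. Qed.

Lemma second_kind_transport F : second_kind F ell -> second_kind (lsub M F) ell'.
Proof.
move=> h x x0; rewrite sub_ell => /h hx.
apply: (zclosure_transport uM _ (hx _)); last by rewrite mul_unit_neq0.
move=> y y0 [H [G [t [pH rG sG iG e]]]]; exists (H *m invmx M), G, t; split=> //.
- by rewrite pencil_plane_lsub mulmxKV.
- by rewrite residual_cubic_lsub mulmxKV.
by rewrite mulmxA -e mulmxK.
Qed.

Lemma gradient_lsub F P : gradient (lsub M F) P = gradient F (P *m M) *m M^T.
Proof.
apply/rowP => j; rewrite !mxE mderiv_lsub /ev raddf_sum; apply: eq_bigr => k _ /=.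
by rewrite mevalZ !mxE -[_.@[_]]/(ev _ _) ev_lsub mulrC.
Qed.

Lemma along_mderiv_lsub F j P v :
  along (lsub M F)^`M(j) P v = \sum_k M j k *: along F^`M(k) (P *m M) (v *m M).
Proof.
rewrite mderiv_lsub; apply: poly_ext => t.
rewrite horner_along /ev raddf_sum horner_sum; apply: eq_bigr => k _ /=.
by rewrite mevalZ -[_.@[_]]/(ev _ _) ev_lsub mulmxDl -scalemxAl hornerZ horner_along.
Qed.

Lemma ramification_ge_lsub F P k :
  ramification_ge F ell (P *m M) k -> ramification_ge (lsub M F) ell' P k.
Proof.
move=> h v; rewrite sub_ell => hv i j.
rewrite !along_mderiv_lsub gradient_lsub !mxE !scaler_suml -sumrB.
pose g k : K := gradient F (P *m M) 0 k.
pose a k := along F^`M(k) (P *m M) (v *m M).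
rewrite (_ : \sum_i _ =
  \sum_k \sum_l (M i k * M j l) *: (g k *: a l - g l *: a k)); last first.
  under [RHS]eq_bigr => r _ do under eq_bigr => l _ do rewrite scalerBr !scalerA.
  under [RHS]eq_bigr => r _ do rewrite sumrB.
  rewrite !sumrB; congr (_ - _); last rewrite [RHS]exchange_big /=.
    apply: eq_bigr => r _; rewrite scaler_sumr; apply: eq_bigr => l _.
    rewrite scalerA [M^T _ _]mxE; congr (_ *: _); rewrite -/(g _); ring.
  apply: eq_bigr => l _; rewrite scaler_sumr; apply: eq_bigr => r _.
  rewrite scalerA [M^T _ _]mxE; congr (_ *: _); rewrite -/(g _); ring.
pose P' (p : {poly K}) := is_true ('X^k %| p).
have P0 : P' 0 by exact: dvdp0.
have PD p q : P' p -> P' q -> P' (p + q) by exact: dvdp_add.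
rewrite -/(P' _); apply: (big_ind P') => // r _; apply: (big_ind P') => // l _.
by rewrite /P' -mul_polyC dvdp_mull // h.
Qed.

End Transport.

Section ConclusionTransport.
Variables (K : closedFieldType) (M : 'M[K]_4) (ell ell' : 'M[K]_(2, 4)).
Hypotheses (uM : M \in unitmx) (hl : (ell' *m M :=: ell)%MS).
Implicit Types (F S L : {mpoly K[4]}).

Let uV : invmx M \in unitmx. Proof. by rewrite unitmx_inv. Qed.

Let sub_ell m (x : 'M[K]_(m, 4)) : (x <= ell')%MS = (x *m M <= ell)%MS.
Proof. by rewrite -hl submx_mul. Qed.

Let lsubK F : lsub (invmx M) (lsub M F) = F.
Proof. by rewrite lsub_comp mulVmx // lsub1. Qed.

Let lsubVK F : lsub M (lsub (invmx M) F) = F.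
Proof. by rewrite lsub_comp mulmxV // lsub1. Qed.

Let hlV : (ell *m invmx M :=: ell')%MS.
Proof.
apply/eqmxP; rewrite -{1}(mulmxK uM ell') -{2}(mulmxK uM ell') !submx_mul //.
by rewrite !hl submx_refl.
Qed.

Lemma ramification_transport F :
  ramification_1111 F ell -> ramification_1111 (lsub M F) ell'.
Proof.
have ramE P k : ramification_ge (lsub M F) ell' P k <-> ramification_ge F ell (P *m M) k.
  split; last exact: ramification_ge_lsub.
  rewrite -{1}(mulmxK uM P) => h.
  by rewrite -(lsubK F); apply: (ramification_ge_lsub uV hlV).
move=> [R [R0 dR hR]]; exists (fun i => R i *m invmx M); split=> [i|i j ij|P P0].
- by rewrite mul_unit_neq0 // sub_ell mulmxKV.
- by rewrite eqmx_mul // dR.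
rewrite sub_ell => hP; rewrite !ramE.
have [|h1 h2] := hR _ _ hP; first by rewrite mul_unit_neq0.
split=> //; rewrite h1; split=> -[i e]; exists i.
  by rewrite -(eqmx_mul _ _ uM) mulmxKV.
by move: e; rewrite -(eqmx_mul _ _ uM) mulmxKV.
Qed.

Lemma proportional_lsub p q : proportional (lsub M p) (lsub M q) <-> proportional p q.
Proof.
split=> -[c c0 e]; exists c => //; last by rewrite e lsubZ.
by rewrite -(lsubK p) e lsubZ lsubK.
Qed.

Lemma linear_form_lsub L : linear_form L -> linear_form (lsub M L).
Proof.
move=> [L0 hL]; split; last exact: lsub_homog.
by apply: contraNneq L0 => e; rewrite -(lsubK L) e lsub0.
Qed.

Lemma plane_through_transport L : plane_through ell L -> plane_through ell' (lsub M L).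
Proof.
move=> [lL eL]; split; first exact: linear_form_lsub.
by rewrite -(line_in_ell_transport uM hl).
Qed.

Lemma four_lines_transport F L :
  meets_in_four_lines F L -> meets_in_four_lines (lsub M F) (lsub M L).
Proof.
move=> [m [lm dm hm]]; exists (fun i => m i *m invmx M); split=> [i|i j ij|x x0].
- exact/is_line_mul.
- by rewrite eqmx_mul // dm.
rewrite /zeros !ev_lsub -!/(zeros _ _) hm ?mul_unit_neq0 //.
by split=> -[i xi]; exists i; move: xi; rewrite submx_mulV.
Qed.

Lemma irreducible_lsub S : irreducible_mpoly S -> irreducible_mpoly (lsub M S).
Proof.
have small p : (msize (lsub (invmx M) p) <= 1)%N -> (msize p <= 1)%N.
  by move=> /msize1_polyC e; rewrite -(lsubVK p) e lsubC msizeC leq_b1.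
move=> [S1 irr]; split.
  rewrite ltnNge; apply/negP => h; move: S1; rewrite ltnNge => /negP; apply.
  have /msize1_polyC e := h; by rewrite -(lsubK S) e lsubC msizeC leq_b1.
move=> a b e; have [|/small|/small] := irr (lsub (invmx M) a) (lsub (invmx M) b); auto.
by rewrite -lsubM -e lsubK.
Qed.

Lemma ruled_quartic_transport S : ruled_quartic S -> ruled_quartic (lsub M S).
Proof.
move=> [hS iS rS nS]; split.
- exact: lsub_homog.
- exact: irreducible_lsub.
- move=> x x0; rewrite /zeros ev_lsub => Sx.
  have [|m [lm mS xm]] := rS _ _ Sx; first by rewrite mul_unit_neq0.
  exists (m *m invmx M); split; first exact/is_line_mul.
    by rewrite line_in_lsub // mulmxKV.
  by rewrite submx_mulV.
move=> [V [H [d [g [pH VH g0 hg]]]]]; apply: nS.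
exists (V *m M), (H *m M), d, g; split=> //.
- by rewrite /is_plane rank_mul.
- by rewrite submx_mul.
move=> x x0; have := hg (x *m invmx M); rewrite /zeros ev_lsub mulmxKV //.
rewrite mul_unit_neq0 // => /(_ x0) ->.
split=> -[t [t0 gt xt]]; exists t; split=> //.
  by move: xt; rewrite -(submx_mul _ _ uM) mulmxKV // mul_col_mx mulmxA.
by rewrite -(submx_mul _ _ uM) mulmxKV // mul_col_mx -mulmxA.
Qed.

Lemma S8_transport F x : S8 (lsub M F) ell' x <-> S8 F ell (x *m M).
Proof.
have tl m : tangent_line_family (lsub M F) ell' m <-> tangent_line_family F ell (m *m M).
  rewrite /tangent_line_family is_line_mul //.
  have tp P H : tangent_plane (lsub M F) P H <-> tangent_plane F (P *m M) (H *m M).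
    by rewrite /tangent_plane /is_plane rank_mul // gradient_lsub trmx_mul trmxK mulmxA.
  split=> -[lm [P [H [G [p [m' [[P0 Pl] tH rG [e1 e2] i]]]]]]]; split=> //.
    exists (P *m M), (H *m M), G, p, m'; split=> //.
    - by rewrite mul_unit_neq0 // -sub_ell.
    - exact/tp.
    - by apply/(residual_cubic_lsub uM hl).
    by rewrite !mulmxA e1 e2.
  exists (P *m invmx M), (H *m invmx M), G, p, m'; split=> //.
  - by rewrite mul_unit_neq0 // sub_ell mulmxKV.
  - by apply/tp; rewrite !mulmxKV.
  - by apply/(residual_cubic_lsub uM hl); rewrite mulmxKV.
  by rewrite !mulmxA e1 e2 mulmxK.
split=> -[m tm xm].
  by exists (m *m M); [apply/tl | rewrite submx_mul].
exists (m *m invmx M); first by apply/tl; rewrite mulmxKV.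
by rewrite submx_mulV.
Qed.

Definition plucker_mx (N : 'M[K]_4) : 'M[K]_(4 * 4) :=
  lin_mx (mulmxr N \o mulmx N^T).

Lemma plucker_mul (N : 'M[K]_4) (m : 'M[K]_(2, 4)) :
  plucker (m *m N) = plucker m *m plucker_mx N.
Proof.
rewrite /plucker mul_vec_lin /=; congr mxvec.
have pE (k : 'M[K]_(2, 4)) : \matrix_(i, j) (k 0 i * k 1 j - k 0 j * k 1 i) =
    (row 0 k)^T *m row 1 k - (row 1 k)^T *m row 0 k.
  by apply/matrixP => i j; rewrite !mxE !big_ord1 !mxE [k 1 i * _]mulrC.
rewrite !pE !row_mul !trmx_mul mulmxBr mulmxBl.
by rewrite !mulmxA.
Qed.

Lemma plucker_mx_unit (N : 'M[K]_4) : N \in unitmx -> plucker_mx N \in unitmx.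
Proof.
move=> uN; suff h : plucker_mx N *m plucker_mx (invmx N) = 1%:M by case/mulmx1_unit: h.
apply/row_matrixP => i; rewrite row_mul rowE -[delta_mx _ _]vec_mxK.
rewrite rowE -[X in _ = X *m _]vec_mxK mulmx1 !mul_vec_lin /=; congr mxvec.
rewrite !mulmxA trmx_inv mulVmx ?unitmx_tr // mul1mx.
by rewrite -mulmxA mulmxV // mulmx1.
Qed.

Lemma ruling_transport S C : ruling S C -> ruling (lsub M S) (fun m => C (m *m M)).
Proof.
move=> [iC [s s2 hs]]; split.
  apply: (irreducible_curve_transport (plucker_mx_unit uM) _ iC) => y y0.
  split=> -[m [lm Cm] e].
    by exists (m *m M); [split=> //; apply/is_line_mul | rewrite plucker_mul -e].
  exists (m *m invmx M); first by split; [apply/is_line_mul | rewrite mulmxKV].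
  rewrite -[RHS](mulmxK (plucker_mx_unit uM)) -plucker_mul mulmxKV // -e mulmxK //.
  exact: plucker_mx_unit.
exists [seq m *m invmx M | m <- s]; first by rewrite size_map.
move=> m lm; rewrite line_in_lsub // hs ?is_line_mul // has_map.
rewrite (@eq_has _ (fun m' => (m *m M == m')%MS)
  (preim (fun m0 => m0 *m invmx M) (fun m' => (m == m')%MS))) //.
by move=> m' /=; rewrite -{1 2}(mulmxKV uM m') !submx_mul.
Qed.

Lemma lines_meet_mul (m m' : 'M[K]_(2, 4)) (N : 'M[K]_4) : N \in unitmx ->
  lines_meet m m' -> lines_meet (m *m N) (m' *m N).
Proof.
by move=> uN [x [x0 xm xm']]; exists (x *m N); rewrite mul_unit_neq0 // !submx_mul.
Qed.

Lemma lines_meet_eqmx (m m1 m2 : 'M[K]_(2, 4)) :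
  (m1 :=: m2)%MS -> lines_meet m m1 -> lines_meet m m2.
Proof. by move=> e [x [x0 xm xm']]; exists x; rewrite -e. Qed.

Lemma directrix_transport S : directrix S ell -> directrix (lsub M S) ell'.
Proof.
move=> [ll lS [C rC hC]]; split.
- exact: (is_line_transport uM hl).
- by rewrite -(line_in_ell_transport uM hl).
exists (fun m => C (m *m M)); first exact: ruling_transport.
move=> m lm Cm; have [|x [x0 xl xm]] := hC (m *m M) _ Cm; first exact/is_line_mul.
exists (x *m invmx M); rewrite mul_unit_neq0 // sub_ell mulmxKV // xl; split=> //.
by rewrite -(submx_mul _ _ uM) mulmxKV.
Qed.

Lemma sing_line_transport S :
  sing_line_of_triple_points S <-> sing_line_of_triple_points (lsub M S).
Proof.
split=> -[[m lm hm] tm].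
  split.
    exists (m *m invmx M); first exact/is_line_mul.
    move=> x x0; rewrite singular_lsub // hm ?mul_unit_neq0 //.
    by rewrite submx_mulV.
  move=> x x0; rewrite singular_lsub // mult_eq_lsub // => /tm; apply.
  by rewrite mul_unit_neq0.
split.
  exists (m *m M); first exact/is_line_mul.
  move=> x x0; rewrite -{1 2}(mulmxKV uM x) submx_mul // -hm ?mul_unit_neq0 //.
  by rewrite singular_lsub.
move=> x x0; have := tm (x *m invmx M); rewrite singular_lsub // mult_eq_lsub //.
by rewrite mulmxKV // mul_unit_neq0 //; apply.
Qed.

Lemma twisted_cubic_transport S :
  twisted_cubic (singular_at S) <-> twisted_cubic (singular_at (lsub M S)).
Proof.
split=> -[A uA hA].
  exists (A *m invmx M); first by rewrite unitmx_mul uA.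
  move=> x x0; rewrite singular_lsub // hA ?mul_unit_neq0 //.
  by split=> -[u u0 e]; exists u => //; move: e;
    rewrite mulmxA eqmx_mulV.
exists (A *m M); first by rewrite unitmx_mul uA.
move=> x x0; have := hA (x *m invmx M); rewrite singular_lsub // mulmxKV //.
rewrite mul_unit_neq0 // => /(_ x0) ->.
by split=> -[u u0 e]; exists u => //; move: e;
  rewrite -(eqmx_mul (x *m invmx M) _ uM) mulmxKV // -mulmxA.
Qed.

Lemma sing_twisted_transport S :
  sing_twisted_cubic_of_double_points S ->
  sing_twisted_cubic_of_double_points (lsub M S).
Proof.
move=> [tS mS]; split; first by rewrite -twisted_cubic_transport.
move=> x x0; rewrite singular_lsub // mult_eq_lsub // => /mS; apply.
by rewrite mul_unit_neq0.
Qed.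

Lemma segre_transport F S (L : 'I_4 -> {mpoly K[4]}) :
  segre_decomposition F ell S L ->
  segre_decomposition (lsub M F) ell' (lsub M S) (fun i => lsub M (L i)).
Proof.
move=> [[S0 hS] rS pL pF]; split.
- split; last exact: lsub_homog.
  by apply: contraNneq S0 => e; rewrite -(lsubK S) e lsub0.
- move=> x x0; rewrite /zeros ev_lsub => Sx.
  have [|m [lm mS xm ml]] := rS _ _ Sx; first by rewrite mul_unit_neq0.
  exists (m *m invmx M); split; first exact/is_line_mul.
  + by rewrite line_in_lsub // mulmxKV.
  + by rewrite submx_mulV.
  by apply: (lines_meet_eqmx hlV); apply: lines_meet_mul.
- by move=> j; apply: plane_through_transport.
by rewrite -lsub_prod -lsubD proportional_lsub.
Qed.

Lemma singular_fibers_transport F s :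
  has_singular_fibers F ell s -> has_singular_fibers (lsub M F) ell' s.
Proof.
move=> [H [pH dH kH cH]]; exists (fun i => H i *m invmx M); split.
- by move=> i; apply/(pencil_plane_lsub uM hl); rewrite mulmxKV.
- by move=> i j ij; rewrite eqmx_mul // dH.
- move=> i; have [G rG kG] := kH i; exists G => //.
  by apply/(residual_cubic_lsub uM hl); rewrite mulmxKV.
move=> H' G /(pencil_plane_lsub uM hl) pH' /(residual_cubic_lsub uM hl) rG nG.
have [i e] := cH _ _ pH' rG nG; exists i.
by rewrite -[X in (X == _)%MS](mulmxK uM) eqmx_mul.
Qed.
End ConclusionTransport.

(** * Coordinates, lines and planes *)

Definition o0 : 'I_4 := @Ordinal 4 0 isT.
Definition o1 : 'I_4 := @Ordinal 4 1 isT.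
Definition o2 : 'I_4 := @Ordinal 4 2 isT.
Definition o3 : 'I_4 := @Ordinal 4 3 isT.
Definition r0 : 'I_3 := @Ordinal 3 0 isT.
Definition r1 : 'I_3 := @Ordinal 3 1 isT.
Definition r2 : 'I_3 := @Ordinal 3 2 isT.

Lemma ord4P (P : 'I_4 -> Prop) : P o0 -> P o1 -> P o2 -> P o3 -> forall i, P i.
Proof.
by move=> h0 h1 h2 h3 [[|[|[|[|//]]]] hi]; rewrite (bool_irrelevance hi isT).
Qed.

Lemma ord3P (P : 'I_3 -> Prop) : P r0 -> P r1 -> P r2 -> forall i, P i.
Proof.
by move=> h0 h1 h2 [[|[|[|//]]] hi]; rewrite (bool_irrelevance hi isT).
Qed.

Lemma big_ord4 (R : Type) (idx : R) (op : Monoid.law idx) (F : 'I_4 -> R) :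
  \big[op/idx]_i F i = op (F o0) (op (F o1) (op (F o2) (F o3))).
Proof.
rewrite !big_ord_recl big_ord0 Monoid.mulm1.
by congr (op (F _) (op (F _) (op (F _) (F _)))); apply: val_inj.
Qed.

Lemma big_ord3 (R : Type) (idx : R) (op : Monoid.law idx) (F : 'I_3 -> R) :
  \big[op/idx]_i F i = op (F r0) (op (F r1) (F r2)).
Proof.
rewrite !big_ord_recl big_ord0 Monoid.mulm1.
by congr (op (F _) (op (F _) (F _))); apply: val_inj.
Qed.

Section Coordinates.
Variable K : closedFieldType.
Implicit Types a c d e : K.

Definition pt4 a c d e : 'rV[K]_4 := \row_i nth 0 [:: a; c; d; e] i.
Definition pt3 a c d : 'rV[K]_3 := \row_i nth 0 [:: a; c; d] i.
Definition pt2 a c : 'rV[K]_2 := \row_i nth 0 [:: a; c] i.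

Lemma pt4E a c d e : (pt4 a c d e 0 o0 = a) * (pt4 a c d e 0 o1 = c) *
  (pt4 a c d e 0 o2 = d) * (pt4 a c d e 0 o3 = e).
Proof. by rewrite !mxE. Qed.

Lemma pt3E a c d : (pt3 a c d 0 r0 = a) * (pt3 a c d 0 r1 = c) * (pt3 a c d 0 r2 = d).
Proof. by rewrite !mxE. Qed.

Lemma pt2E a c : (pt2 a c 0 0 = a) * (pt2 a c 0 1 = c).
Proof. by rewrite !mxE. Qed.

Lemma row4E (x : 'rV[K]_4) : x = pt4 (x 0 o0) (x 0 o1) (x 0 o2) (x 0 o3).
Proof. by apply/rowP; apply: ord4P; rewrite pt4E. Qed.

Lemma row3E (x : 'rV[K]_3) : x = pt3 (x 0 r0) (x 0 r1) (x 0 r2).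
Proof. by apply/rowP; apply: ord3P; rewrite pt3E. Qed.

Lemma row2E (x : 'rV[K]_2) : x = pt2 (x 0 0) (x 0 1).
Proof.
apply/rowP => -[[|[|//]] hi]; rewrite mxE /=; congr (x 0 _); exact: val_inj.
Qed.

Lemma pt4D a c d e a' c' d' e' :
  pt4 a c d e + pt4 a' c' d' e' = pt4 (a + a') (c + c') (d + d') (e + e').
Proof. by apply/rowP; apply: ord4P; rewrite !mxE. Qed.
Lemma pt4Z k a c d e : k *: pt4 a c d e = pt4 (k * a) (k * c) (k * d) (k * e).
Proof. by apply/rowP; apply: ord4P; rewrite !mxE. Qed.
Lemma pt3D a c d a' c' d' : pt3 a c d + pt3 a' c' d' = pt3 (a + a') (c + c') (d + d').
Proof. by apply/rowP; apply: ord3P; rewrite !mxE. Qed.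
Lemma pt3Z k a c d : k *: pt3 a c d = pt3 (k * a) (k * c) (k * d).
Proof. by apply/rowP; apply: ord3P; rewrite !mxE. Qed.

Lemma pt4_inj a c d e a' c' d' e' :
  pt4 a c d e = pt4 a' c' d' e' -> [/\ a = a', c = c', d = d' & e = e'].
Proof.
move=> h; split; [have := congr1 (fun x : 'rV_4 => x 0 o0) h
  | have := congr1 (fun x : 'rV_4 => x 0 o1) h
  | have := congr1 (fun x : 'rV_4 => x 0 o2) h
  | have := congr1 (fun x : 'rV_4 => x 0 o3) h]; by rewrite !pt4E.
Qed.

Lemma pt3_inj a c d a' c' d' :
  pt3 a c d = pt3 a' c' d' -> [/\ a = a', c = c' & d = d'].
Proof.
move=> h; split; [have := congr1 (fun x : 'rV_3 => x 0 r0) h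
  | have := congr1 (fun x : 'rV_3 => x 0 r1) h
  | have := congr1 (fun x : 'rV_3 => x 0 r2) h]; by rewrite !pt3E.
Qed.

Lemma pt4_0 : pt4 0 0 0 0 = 0. Proof. by apply/rowP; apply: ord4P; rewrite !mxE. Qed.
Lemma pt3_0 : pt3 0 0 0 = 0. Proof. by apply/rowP; apply: ord3P; rewrite !mxE. Qed.

Lemma pt4_eq0 a c d e : (pt4 a c d e == 0) = [&& a == 0, c == 0, d == 0 & e == 0].
Proof.
apply/eqP/and4P => [|[/eqP-> /eqP-> /eqP-> /eqP->]]; last exact: pt4_0.
by rewrite -pt4_0 => /pt4_inj[-> -> -> ->].
Qed.
Lemma pt3_eq0 a c d : (pt3 a c d == 0) = [&& a == 0, c == 0 & d == 0].
Proof.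
apply/eqP/and3P => [|[/eqP-> /eqP-> /eqP->]]; last exact: pt3_0.
by rewrite -pt3_0 => /pt3_inj[-> -> ->].
Qed.

Definition join2 n (p q : 'rV[K]_n) : 'M[K]_(2, n) := col_mx p q.
Definition join3 n (p q r : 'rV[K]_n) : 'M[K]_(3, n) := col_mx (col_mx p q) r.

Lemma sub_join2 n (p q x : 'rV[K]_n) :
  (x <= join2 p q)%MS <-> exists a c, x = a *: p + c *: q.
Proof.
have -> : (x <= join2 p q)%MS = (x <= p + q)%MS by rewrite addsmxE.
split.
  move/sub_addsmxP => [[u v] /= ->]; exists (u 0 0), (v 0 0).
  by rewrite {1}[u]mx11_scalar {1}[v]mx11_scalar !mul_scalar_mx.
move=> [a [c ->]]; apply/sub_addsmxP; exists (a%:M, c%:M) => /=.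
by rewrite !mul_scalar_mx.
Qed.

Lemma sub_join3 n (p q r x : 'rV[K]_n) :
  (x <= join3 p q r)%MS <-> exists a c d, x = a *: p + c *: q + d *: r.
Proof.
have -> : (x <= join3 p q r)%MS = (x <= col_mx p q + r)%MS by rewrite addsmxE.
split.
  move/sub_addsmxP => [[u v] /= ->].
  have /sub_join2 [a [c ->]] : (u *m col_mx p q <= join2 p q)%MS by exact: submxMl.
  by exists a, c, (v 0 0); rewrite {1}[v]mx11_scalar !mul_scalar_mx.
move=> [a [c [d ->]]]; apply/sub_addsmxP.
have /submxP [u e] : ((a *: p + c *: q)%R <= join2 p q)%MS by apply/sub_join2; exists a, c.
by exists (u, d%:M) => /=; rewrite mul_scalar_mx -e.
Qed.

Lemma join2_sub m n (p q : 'rV[K]_n) (B : 'M[K]_(m, n)) :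
  (join2 p q <= B)%MS = (p <= B)%MS && (q <= B)%MS.
Proof. by apply: (@col_mx_sub K 1 1 n p q m B). Qed.

Lemma join3_sub m n (p q r : 'rV[K]_n) (B : 'M[K]_(m, n)) :
  (join3 p q r <= B)%MS = [&& (p <= B)%MS, (q <= B)%MS & (r <= B)%MS].
Proof.
rewrite andbA -join2_sub; exact: (@col_mx_sub K 2 1 n (join2 p q) r m B).
Qed.

Lemma mul_join2 n k (p q : 'rV[K]_n) (M : 'M[K]_(n, k)) :
  join2 p q *m M = join2 (p *m M) (q *m M).
Proof. exact: (@mul_col_mx K 1 1 n k p q M). Qed.

Lemma mul_join3 n k (p q r : 'rV[K]_n) (M : 'M[K]_(n, k)) :
  join3 p q r *m M = join3 (p *m M) (q *m M) (r *m M).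
Proof.
rewrite /join3; etransitivity; first exact: (@mul_col_mx K 2 1 n k (join2 p q) r M).
by rewrite mul_join2.
Qed.

Lemma pt2_join2 n (p q : 'rV[K]_n) a c : pt2 a c *m join2 p q = a *: p + c *: q.
Proof.
apply/rowP => j; rewrite mxE !big_ord_recl big_ord0 addr0 [RHS]mxE [X in _ = X + _]mxE [X in _ = _ + X]mxE.
congr (_ * _ + _ * _); try by rewrite mxE.
  have -> : ord0 = lshift 1 0 :> 'I_(1 + 1) by apply: val_inj.
  exact: (col_mxEu p q).
have -> : lift ord0 ord0 = rshift 1 0 :> 'I_(1 + 1) by apply: val_inj.
exact: (col_mxEd p q).
Qed.

Lemma pt3_join3 n (p q r : 'rV[K]_n) a c d :
  pt3 a c d *m join3 p q r = a *: p + c *: q + d *: r.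
Proof.
apply/rowP => j; rewrite mxE big_ord3 /= !pt3E.
have -> : join3 p q r r0 j = p 0 j.
  have -> : r0 = lshift 1 (lshift 1 0) :> 'I_(1 + 1 + 1) by apply: val_inj.
  by rewrite (col_mxEu (col_mx p q) r) col_mxEu.
have -> : join3 p q r r1 j = q 0 j.
  have -> : r1 = lshift 1 (rshift 1 0) :> 'I_(1 + 1 + 1) by apply: val_inj.
  by rewrite (col_mxEu (col_mx p q) r) col_mxEd.
have -> : join3 p q r r2 j = r 0 j.
  have -> : r2 = rshift 2 0 :> 'I_(1 + 1 + 1) by apply: val_inj.
  by rewrite (col_mxEd (col_mx p q) r).
by rewrite !mxE addrA.
Qed.

Lemma row_mx2 n (m : 'M[K]_(2, n)) : m = join2 (row 0 m) (row 1 m).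
Proof.
rewrite /join2; apply/matrixP => i j; rewrite !mxE; case: splitP => k; rewrite ord1 mxE.
  by move=> e; congr (m _ j); apply: val_inj.
by move=> e; congr (m _ j); apply: val_inj.
Qed.

Lemma is_line_join2 n (p q : 'rV[K]_n) :
  (forall a c, a *: p + c *: q = 0 -> a = 0 /\ c = 0) <-> is_line (join2 p q).
Proof.
split=> h.
  apply/eqP; change (row_free (join2 p q)); apply: inj_row_free => v.
  rewrite [v]row2E pt2_join2 => /h[-> ->].
  by apply/rowP => -[[|[|//]] hi]; rewrite !mxE.
move=> a c e.
have /row_free_inj inj : row_free (join2 p q) by rewrite /row_free h.
have : pt2 a c *m join2 p q = 0 *m join2 p q by rewrite pt2_join2 e mul0mx.
move/inj => /rowP e0; split.
  by have := e0 0; rewrite !mxE.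
by have := e0 1; rewrite !mxE.
Qed.

Lemma line_eq_join2 n (m : 'M[K]_(2, n)) p q : is_line m -> is_line (join2 p q) ->
  (p <= m)%MS -> (q <= m)%MS -> (join2 p q == m)%MS.
Proof.
move=> lm lj pm qm; have h : (join2 p q <= m)%MS by rewrite join2_sub pm qm.
by rewrite h /= -(geq_leqif (mxrank_leqif_sup h)) lm lj.
Qed.

Lemma eq_rV n (x y : 'rV[K]_n) : x != 0 -> y != 0 ->
  (x == y)%MS <-> exists2 c, c != 0 & x = c *: y.
Proof.
move=> x0 y0; split.
  case/andP=> /sub_rVP[c e] _; exists c => //.
  by apply: contraNneq x0 => c0; rewrite e c0 scale0r.
move=> [c c0 ->]; apply/andP; split; first exact: scalemx_sub.
by apply/sub_rVP; exists c^-1; rewrite scalerA mulVf // scale1r.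
Qed.

End Coordinates.

(** * Binary cubics and their covariants *)

Section Covariants.
Variable R : comNzRingType.
Implicit Types c x y s t p q : R.

Definition cubic c0 c1 c2 c3 x y :=
  c0 * x ^+ 3 + c1 * x ^+ 2 * y + c2 * x * y ^+ 2 + c3 * y ^+ 3.

Definition hess c0 c1 c2 c3 x y :=
  (c0 * c2 *+ 3 - c1 ^+ 2) * x ^+ 2 + (c0 * c3 *+ 9 - c1 * c2) * x * y
  + (c1 * c3 *+ 3 - c2 ^+ 2) * y ^+ 2.

Definition disc c0 c1 c2 c3 :=
  c1 ^+ 2 * c2 ^+ 2 - c0 * c2 ^+ 3 *+ 4 - c1 ^+ 3 * c3 *+ 4
  - c0 ^+ 2 * c3 ^+ 2 *+ 27 + c0 * c1 * c2 * c3 *+ 18.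

Definition quartic f0 f1 f2 f3 f4 s t : R :=
  f0 * s ^+ 4 + f1 * s ^+ 3 * t + f2 * s ^+ 2 * t ^+ 2 + f3 * s * t ^+ 3 + f4 * t ^+ 4.

Definition quartic_s f0 f1 f2 f3 (f4 : R) s t : R :=
  f0 * s ^+ 3 *+ 4 + f1 * s ^+ 2 * t *+ 3 + f2 * s * t ^+ 2 *+ 2 + f3 * t ^+ 3.

Definition quartic_t (f0 : R) f1 f2 f3 f4 s t : R :=
  f1 * s ^+ 3 + f2 * s ^+ 2 * t *+ 2 + f3 * s * t ^+ 2 *+ 3 + f4 * t ^+ 3 *+ 4.

Definition cubic_factors c0 c1 c2 c3 p1 q1 p2 q2 p3 q3 :=
  [/\ c0 = p1 * p2 * p3, c1 = q1 * p2 * p3 + p1 * q2 * p3 + p1 * p2 * q3,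
      c2 = p1 * q2 * q3 + q1 * p2 * q3 + q1 * q2 * p3 & c3 = q1 * q2 * q3].

Lemma cubic_factors_rot c0 c1 c2 c3 p1 q1 p2 q2 p3 q3 :
  cubic_factors c0 c1 c2 c3 p1 q1 p2 q2 p3 q3 ->
  cubic_factors c0 c1 c2 c3 p2 q2 p3 q3 p1 q1.
Proof. by case=> -> -> -> ->; split; ring. Qed.

Lemma cubicE c0 c1 c2 c3 p1 q1 p2 q2 p3 q3 x y :
  cubic_factors c0 c1 c2 c3 p1 q1 p2 q2 p3 q3 ->
  cubic c0 c1 c2 c3 x y = (p1 * x + q1 * y) * (p2 * x + q2 * y) * (p3 * x + q3 * y).
Proof. by case=> -> -> -> ->; rewrite /cubic; ring. Qed.

Lemma discE c0 c1 c2 c3 p1 q1 p2 q2 p3 q3 :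
  cubic_factors c0 c1 c2 c3 p1 q1 p2 q2 p3 q3 ->
  disc c0 c1 c2 c3 =
  ((p1 * q2 - p2 * q1) * (p1 * q3 - p3 * q1) * (p2 * q3 - p3 * q2)) ^+ 2.
Proof. by case=> -> -> -> ->; rewrite /disc; ring. Qed.

(** Adding to a product of three linear forms its Hessian and its discriminant
    moves every factor by a multiple of w, and nothing is left over: the missing
    term would be a covariant of order 1 and degree 3, and a binary cubic has
    none. *)
Lemma cubic_hess_disc_split c0 c1 c2 c3 p1 q1 p2 q2 p3 q3 k x y w :
  cubic_factors c0 c1 c2 c3 p1 q1 p2 q2 p3 q3 ->
  cubic c0 c1 c2 c3 x y + k * w * hess c0 c1 c2 c3 x y
    + k ^+ 3 * w ^+ 3 * disc c0 c1 c2 c3 =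
  (p1 * x + q1 * y - k * ((p2 * q1 - p1 * q2) * (p3 * q1 - p1 * q3)) * w) *
  (p2 * x + q2 * y - k * ((p3 * q2 - p2 * q3) * (p1 * q2 - p2 * q1)) * w) *
  (p3 * x + q3 * y - k * ((p1 * q3 - p3 * q1) * (p2 * q3 - p3 * q2)) * w).
Proof. by case=> -> -> -> ->; rewrite /cubic /hess /disc; ring. Qed.

Lemma cubic_dx_root c0 c1 c2 c3 p1 q1 p2 q2 p3 q3 :
  cubic_factors c0 c1 c2 c3 p1 q1 p2 q2 p3 q3 ->
  c0 * q1 ^+ 2 *+ 3 - c1 * q1 * p1 *+ 2 + c2 * p1 ^+ 2 =
  p1 * ((p2 * q1 - p1 * q2) * (p3 * q1 - p1 * q3)).
Proof. by case=> -> -> -> _; ring. Qed.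

Lemma cubic_dy_root c0 c1 c2 c3 p1 q1 p2 q2 p3 q3 :
  cubic_factors c0 c1 c2 c3 p1 q1 p2 q2 p3 q3 ->
  c1 * q1 ^+ 2 - c2 * q1 * p1 *+ 2 + c3 * p1 ^+ 2 *+ 3 =
  q1 * ((p2 * q1 - p1 * q2) * (p3 * q1 - p1 * q3)).
Proof. by case=> _ -> -> ->; ring. Qed.

End Covariants.

Section CovariantMorphism.
Variables (R R' : comNzRingType) (f : {rmorphism R -> R'}).

Lemma rmorph_cubic c0 c1 c2 c3 x y :
  f (cubic c0 c1 c2 c3 x y) = cubic (f c0) (f c1) (f c2) (f c3) (f x) (f y).
Proof. rewrite /cubic; ring. Qed.

Lemma rmorph_hess c0 c1 c2 c3 x y :
  f (hess c0 c1 c2 c3 x y) = hess (f c0) (f c1) (f c2) (f c3) (f x) (f y).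
Proof. rewrite /hess; ring. Qed.

Lemma rmorph_disc c0 c1 c2 c3 :
  f (disc c0 c1 c2 c3) = disc (f c0) (f c1) (f c2) (f c3).
Proof. rewrite /disc; ring. Qed.

Lemma rmorph_quartic f0 f1 f2 f3 f4 s t :
  f (quartic f0 f1 f2 f3 f4 s t) = quartic (f f0) (f f1) (f f2) (f f3) (f f4) (f s) (f t).
Proof. rewrite /quartic; ring. Qed.
End CovariantMorphism.

Section Factorisation.
Variable K : closedFieldType.
Implicit Types c f p q s t : K.

Lemma quadratic_split c0 c1 c2 : exists p1 q1 p2 q2,
  [/\ c0 = p1 * p2, c1 = p1 * q2 + q1 * p2 & c2 = q1 * q2].
Proof.
case: (eqVneq c0 0) => [->|c00].
  by exists 0, 1, c1, c2; split; ring.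
have [x ex] := @solve_monicpoly K 2 (fun i => nth 0 [:: - c2 / c0; - c1 / c0] i) isT.
rewrite !big_ord_recl big_ord0 /= in ex.
exists 1, (- x), c0, (c1 + c0 * x); split; [by ring | by ring |].
have -> : - x * (c1 + c0 * x) = - x * c1 - c0 * x ^+ 2 by ring.
by rewrite ex; field.
Qed.

Lemma cubic_split c0 c1 c2 c3 : exists p1 q1 p2 q2 p3 q3,
  cubic_factors c0 c1 c2 c3 p1 q1 p2 q2 p3 q3.
Proof.
case: (eqVneq c0 0) => [->|c00].
  have [p1 [q1 [p2 [q2 [e1 e2 e3]]]]] := quadratic_split c1 c2 c3.
  by exists 0, 1, p1, q1, p2, q2; split; rewrite ?e1 ?e2 ?e3; ring.
have [x ex] := @solve_monicpoly K 3
  (fun i => nth 0 [:: - c3 / c0; - c2 / c0; - c1 / c0] i) isT.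
rewrite !big_ord_recl big_ord0 /= /bump /= in ex.
have [p1 [q1 [p2 [q2 [e1 e2 e3]]]]] :=
  quadratic_split c0 (c1 + c0 * x) (c2 + c1 * x + c0 * x ^+ 2).
exists 1, (- x), p1, q1, p2, q2; split.
- by rewrite e1; ring.
- by rewrite -[LHS](addrK (c0 * x)) e2 e1; ring.
- have -> : c2 = c2 + c1 * x + c0 * x ^+ 2 - x * (c1 + c0 * x) by ring.
  by rewrite e2 e3; ring.
have -> : - x * q1 * q2 = - x * (q1 * q2) by ring.
rewrite -e3.
have -> : - x * (c2 + c1 * x + c0 * x ^+ 2) = - x * c2 - c1 * x ^+ 2 - c0 * x ^+ 3 by ring.
by rewrite ex; field.
Qed.

Lemma quartic_split f0 f1 f2 f3 f4 : exists p q : 'I_4 -> K,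
  forall s t, quartic f0 f1 f2 f3 f4 s t = \prod_i (p i * s + q i * t) /\
   quartic_s f0 f1 f2 f3 f4 s t = \sum_i p i * \prod_(j | j != i) (p j * s + q j * t) /\
   quartic_t f0 f1 f2 f3 f4 s t = \sum_i q i * \prod_(j | j != i) (p j * s + q j * t).
Proof.
suff [p1 [q1 [p2 [q2 [p3 [q3 [p4 [q4 [e0 e1 e2 e3 e4]]]]]]]]] :
    exists p1 q1 p2 q2 p3 q3 p4 q4,
    [/\ f0 = p1 * (p2 * p3 * p4),
        f1 = p1 * (q2 * p3 * p4 + p2 * q3 * p4 + p2 * p3 * q4) + q1 * (p2 * p3 * p4),
        f2 = p1 * (p2 * q3 * q4 + q2 * p3 * q4 + q2 * q3 * p4)
           + q1 * (q2 * p3 * p4 + p2 * q3 * p4 + p2 * p3 * q4),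
        f3 = p1 * (q2 * q3 * q4) + q1 * (p2 * q3 * q4 + q2 * p3 * q4 + q2 * q3 * p4)
      & f4 = q1 * (q2 * q3 * q4)].
  exists (fun i => nth 0 [:: p1; p2; p3; p4] i), (fun i => nth 0 [:: q1; q2; q3; q4] i).
  move=> s t; split; last split.
  - by rewrite big_ord4 /= /quartic e0 e1 e2 e3 e4; ring.
  - rewrite big_ord4 /= !(big_mkcond (fun j => j != _)) /= !big_ord4 /=.
    by rewrite /quartic_s e0 e1 e2 e3; ring.
  rewrite big_ord4 /= !(big_mkcond (fun j => j != _)) /= !big_ord4 /=.
  by rewrite /quartic_t e1 e2 e3 e4; ring.
case: (eqVneq f0 0) => [->|f00].
  have [p1 [q1 [p2 [q2 [p3 [q3 [e1 e2 e3 e4]]]]]]] := cubic_split f1 f2 f3 f4.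
  by exists 0, 1, p1, q1, p2, q2, p3, q3; split; rewrite ?e1 ?e2 ?e3 ?e4; ring.
have [x ex] := @solve_monicpoly K 4
  (fun i => nth 0 [:: - f4 / f0; - f3 / f0; - f2 / f0; - f1 / f0] i) isT.
rewrite !big_ord_recl big_ord0 /= /bump /= in ex.
have [p1 [q1 [p2 [q2 [p3 [q3 [e1 e2 e3 e4]]]]]]] :=
  cubic_split f0 (f1 + f0 * x) (f2 + f1 * x + f0 * x ^+ 2)
    (f3 + f2 * x + f1 * x ^+ 2 + f0 * x ^+ 3).
exists 1, (- x), p1, q1, p2, q2, p3, q3; rewrite -e1 -e2 -e3 -e4; split; try ring.
have -> : - x * (f3 + f2 * x + f1 * x ^+ 2 + f0 * x ^+ 3) =
  - x * f3 - f2 * x ^+ 2 - f1 * x ^+ 3 - f0 * x ^+ 4 by ring.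
by rewrite ex; field.
Qed.

Definition quartic_sqfree f0 f1 f2 f3 f4 := forall s t, (s != 0) || (t != 0) ->
  quartic_s f0 f1 f2 f3 f4 s t = 0 -> quartic_t f0 f1 f2 f3 f4 s t = 0 -> False.

(** A double factor would make both partial derivatives vanish at its zero. *)
Lemma quartic_sqfree_split f0 f1 f2 f3 f4 : quartic_sqfree f0 f1 f2 f3 f4 ->
  exists p q : 'I_4 -> K,
  [/\ forall s t, quartic f0 f1 f2 f3 f4 s t = \prod_i (p i * s + q i * t),
      forall i, (p i != 0) || (q i != 0) &
      forall i j, i != j -> p i * q j - p j * q i != 0].
Proof.
move=> sf; have [p [q h]] := quartic_split f0 f1 f2 f3 f4.
have dbl s t i j : (s != 0) || (t != 0) -> i != j ->
    p i * s + q i * t = 0 -> p j * s + q j * t = 0 -> False.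
  move=> st ij ei ej; apply: (sf s t st); rewrite ?(h s t).2.1 ?(h s t).2.2.
    rewrite big1 // => k _; case: (eqVneq i k) => [ik|ik].
      by rewrite (bigD1 j) /= ?ej ?mul0r ?mulr0 // -ik eq_sym.
    by rewrite (bigD1 i) //= ei mul0r mulr0.
  rewrite big1 // => k _; case: (eqVneq i k) => [ik|ik].
    by rewrite (bigD1 j) /= ?ej ?mul0r ?mulr0 // -ik eq_sym.
  by rewrite (bigD1 i) //= ei mul0r mulr0.
exists p, q; split=> [s t|i|i j ij]; first by case: (h s t).
  apply: contraT; rewrite negb_or !negbK => /andP[/eqP p0 /eqP q0].
  pose j : 'I_4 := if i == o0 then o1 else o0.
  have ij : i != j by rewrite /j; case: (eqVneq i o0) => [-> |].
  case: (boolP ((q j != 0) || (- p j != 0))) => st.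
    by case: (dbl _ _ _ _ st ij); rewrite ?p0 ?q0; ring.
  rewrite negb_or !negbK oppr_eq0 in st; case/andP: st => /eqP qj /eqP pj.
  have st : ((1 : K) != 0) || ((1 : K) != 0) by rewrite oner_eq0.
  by case: (dbl _ _ _ _ st ij); rewrite ?p0 ?q0 ?pj ?qj; ring.
apply/eqP => e0.
case: (boolP ((q i != 0) || (- p i != 0))) => st.
  apply: (dbl _ _ _ _ st ij); first by ring.
  by rewrite -[RHS]oppr0 -e0; ring.
rewrite negb_or !negbK oppr_eq0 in st; case/andP: st => /eqP qi /eqP pi.
case: (boolP ((q j != 0) || (- p j != 0))) => st.
  by case: (dbl _ _ _ _ st ij); rewrite ?pi ?qi; ring.
rewrite negb_or !negbK oppr_eq0 in st; case/andP: st => /eqP qj /eqP pj.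
have st : ((1 : K) != 0) || ((1 : K) != 0) by rewrite oner_eq0.
by case: (dbl _ _ _ _ st ij); rewrite ?pi ?qi ?pj ?qj; ring.
Qed.
End Factorisation.

(** * Irreducibility through polynomial paths *)

Section Paths.
Variable K : closedFieldType.
Implicit Types n d : nat.

(** Homogeneity may be read off the values, K being infinite. *)
Lemma homog_ev n (G : {mpoly K[n]}) d :
  (forall c x, ev G (c *: x) = c ^+ d * ev G x) -> G \is d.-homog.
Proof.
move=> h; apply/dhomogP => m0 m0G; apply/eqP; apply: contraTT m0G => /= hd.
rewrite mcoeff_msupp negbK.
have hc c : c ^+ mdeg m0 * G@_m0 = c ^+ d * G@_m0.
  pose G' : {mpoly K[n]} := \sum_(m <- msupp G) (c ^+ mdeg m * G@_m) *: 'X_[m].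
  have -> : c ^+ mdeg m0 * G@_m0 = G'@_m0.
    rewrite {1}(mpolyE G) /G' !raddf_sum mulr_sumr /=; apply: eq_bigr => m _.
    rewrite !mcoeffZ mcoeffX; case: eqP => [->|_]; first by rewrite mulrA.
    by rewrite !mulr0.
  have -> : G' = c ^+ d *: G; last by rewrite mcoeffZ.
  apply: mpoly_ext => x; rewrite evZ -h /ev /G' raddf_sum /=.
  rewrite [RHS]/meval /mmap; apply: eq_bigr => m _.
  rewrite mevalZ mevalX [c ^+ _ * _]mulrC -mulrA; congr (_ * _).
  rewrite /mmap1 mdegE -prodrXr -big_split /=.
  by apply: eq_bigr => i _; rewrite mxE exprMn.
pose p : {poly K} := 'X^(mdeg m0) - 'X^d.
have p0 : p != 0.
  rewrite subr_eq0; apply: contraNneq hd => /(congr1 (fun q : {poly K} => size q)).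
  by rewrite !size_polyXn => -[->].
have [c] := closed_nonrootP p p0; rewrite /root hornerD hornerN !hornerXn => hcd.
have /eqP : (c ^+ mdeg m0 - c ^+ d) * G@_m0 = 0 by rewrite mulrBl hc subrr.
by rewrite mulf_eq0 (negbTE hcd).
Qed.

Definition path_between n (Z : 'rV[K]_n -> Prop) x y :=
  exists g : 'I_n -> {poly K},
    [/\ forall t, Z (\row_i (g i).[t]), \row_i (g i).[0] = x & \row_i (g i).[1] = y].

(** Along a polynomial path the product of the two forms is the zero polynomial, so one of the
    factors is; evaluate it at the corresponding end. *)
Lemma path_zero_divisor n (Z : 'rV[K]_n -> Prop) (G1 G2 : {mpoly K[n]}) x y :
  path_between Z x y -> (forall z, Z z -> ev (G1 * G2) z = 0) ->
  ev G1 x = 0 \/ ev G2 y = 0.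
Proof.
move=> [g [hZ <- <-]] h12.
have /eqP : peval g G1 * peval g G2 = 0.
  by rewrite -pevalM; apply: poly_ext0 => t; rewrite horner_peval h12.
rewrite mulf_eq0 => /orP[]/eqP e; [left | right]; by rewrite -horner_peval e horner0.
Qed.

(** Two closed sets not containing Z have forms G1, G2 vanishing on them but not at some points
    x1, x2 of Z; apply path_zero_divisor to G1 G2 on a path from x1 to x2.  Paths may pass
    through the zero vector, where forms of positive degree vanish. *)
Lemma zirreducible_path n (Z : 'rV[K]_n -> Prop) :
  (exists2 x, x != 0 & Z x) ->
  (forall x y, x != 0 -> y != 0 -> Z x -> Z y ->
     path_between (fun z => z = 0 \/ Z z) x y) -> zirreducible Z.
Proof.
move=> neZ pZ; split=> // A B cA cB ZAB.
have outside (W : 'rV[K]_n -> Prop) : zclosed W -> ~ psub Z W -> exists x (G : {mpoly K[n]}),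
    [/\ x != 0, Z x, ev G x != 0, ev G 0 = 0 & psub W (zeros G)].
  move=> cW nZW; apply: NNPP => nex; apply: nZW => x x0 Zx; apply: cW => // d G hG WG.
  apply/eqP; apply: contraT => Gx; case: nex.
  have [i xi] : exists i, x 0 i != 0.
    apply/existsP; apply: contraT; rewrite negb_exists => /forallP h.
    by case/eqP: x0; apply/rowP => i; rewrite mxE; apply/eqP; have := h i; rewrite negbK.
  exists x, (G * 'X_i); split=> //; rewrite ?evM ?evXU ?mulf_neq0 ?mxE ?mulr0 //.
  by move=> y y0 /(WG _ y0) Gy; rewrite /zeros evM Gy mul0r.
apply: NNPP => /not_or_and [nA nB].
have [x [G [x0 Zx Gx G0 AG]]] := outside _ cA nA.
have [y [G' [y0 Zy Gy G'0 BG]]] := outside _ cB nB.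
have [|/eqP|/eqP] := path_zero_divisor (G1 := G) (G2 := G') (pZ x y x0 y0 Zx Zy).
- move=> z [->|Zz]; first by rewrite evM G0 mul0r.
  case: (eqVneq z 0) => [->|z0]; first by rewrite evM G0 mul0r.
  by rewrite evM; case: (ZAB z z0 Zz) => [/(AG _ z0)|/(BG _ z0)] ->; rewrite ?mul0r ?mulr0.
- by rewrite (negbTE Gx).
by rewrite (negbTE Gy).
Qed.

Lemma size_along n (G : {mpoly K[n]}) p v : (size (along G p v) <= msize G)%N.
Proof.
rewrite alongE /peval /mmap; apply: (leq_trans (size_sum _ _ _)).
apply/bigmax_leqP_seq => m mG _; rewrite mul_polyC.
apply: (leq_trans (size_scale_leq _ _)); apply: leq_trans (msize_mdeg_lt mG).
rewrite /mmap1 mdegE.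
elim/big_rec2: _ => [|i q k _ IH]; first by rewrite size_poly1.
pose r : {poly K} := (p 0 i)%:P + v 0 i *: 'X; rewrite -/r.
have lin : (size r <= 2)%N.
  apply: (leq_trans (size_polyD _ _)); rewrite geq_max.
  rewrite (leq_trans (size_polyC_leq1 _)) //=.
  by apply: (leq_trans (size_scale_leq _ _)); rewrite size_polyX.
have pow := size_poly_exp_leq r (m i).
have h : (size (r ^+ m i)%R <= (m i).+1)%N.
  apply: (leq_trans pow); rewrite ltnS -{2}[m i]mul1n leq_mul //.
  by rewrite -subn1 leq_subLR.
apply: (leq_trans (size_polyMleq _ _)).
by rewrite -subn1 leq_subLR add1n -addnS -addSn (leq_trans (leq_add h IH)).
Qed.

(** If the zero set is connected by polynomial paths, one of two factors of G
    vanishes on it; on a line that meets it in as many points as the degree of G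
    this factor has full degree. *)
Lemma irreducible_path n d (G : {mpoly K[n]}) p v (rs : seq K) :
  (0 < d)%N -> (msize G <= d.+1)%N ->
  (forall x y, zeros G x -> zeros G y -> path_between (zeros G) x y) ->
  along G p v != 0 -> uniq rs -> size rs = d -> all (root (along G p v)) rs ->
  irreducible_mpoly G.
Proof.
move=> d0 sG pG nG ur sr rr.
have big a : along a p v != 0 -> (forall x, zeros G x -> ev a x = 0) -> (d < msize a)%N.
  move=> na va; apply: leq_trans (size_along a p v); rewrite -sr.
  apply: max_poly_roots => //; apply/allP => t /(allP rr).
  by rewrite !rootE !horner_along => /eqP /va ->.
split; first by apply: (leq_ltn_trans d0); apply: big.
have half a c : G = a * c -> (forall x, zeros G x -> ev a x = 0) -> (msize c <= 1)%N.
  move=> e va; have nac : along a p v * along c p v != 0.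
    by move: nG; rewrite e !alongE pevalM.
  have := nac; rewrite mulf_eq0 negb_or => /andP[na nc].
  have da := big a na va.
  have a0 : a != 0 by rewrite -msize_poly_eq0 -lt0n (leq_trans _ da).
  have c0 : c != 0.
    by apply: contraNneq nc => ->; rewrite alongE -mpolyC0 pevalC polyC0.
  have := sG; rewrite e msizeM //; move: da.
  by move: (mmeasure _ a) (mmeasure _ c) => ma mc h1 h2; lia.
move=> a c e; apply: NNPP => /not_or_and [ha hc].
have va : ~ forall x, zeros G x -> ev a x = 0 by move=> va; apply: hc; apply: (half a c).
have vc : ~ forall x, zeros G x -> ev c x = 0.
  by move=> vc; apply: ha; apply: (half c a) => //; rewrite mulrC.
have [x hx] := not_all_ex_not _ _ va; have [Gx ax] := imply_to_and _ _ hx.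
have [y hy] := not_all_ex_not _ _ vc; have [Gy cy] := imply_to_and _ _ hy.
by case: (path_zero_divisor (G1 := a) (G2 := c) (pG x y Gx Gy)) => // z; rewrite -e.
Qed.
End Paths.

(** * The normal form: the scroll and its lines *)

Section ScrollForms.
Variable R : comNzRingType.
Implicit Types b k u x s t m w : R.

Definition cA b u0 u1 := u0 ^+ 2 * (u0 + b * u1).
Definition cB b u0 u1 := u1 ^+ 2 * (u1 + b * u0).
Definition gq b u0 u1 := b * u0 ^+ 2 *+ 2 + (b ^+ 2 + 3%:R) * u0 * u1 + b * u1 ^+ 2 *+ 2.

(** The equation of the scroll.  The binary cubic of the plane (s, t) is s A + t B, with
    coefficients (s, b s, b t, t); to it are added its Hessian and its discriminant, which have
    degree two and four in (s, t), so as to get a quartic that splits in every such plane. *)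
Definition Sf b k x0 x1 s t := cubic s (b * s) (b * t) t x0 x1
  + k * hess s (b * s) (b * t) t x0 x1 + k ^+ 3 * disc s (b * s) (b * t) t.

Lemma cubic_cAB b s t x y : cubic s (b * s) (b * t) t x y = s * cA b x y + t * cB b x y.
Proof. rewrite /cubic /cA /cB; ring. Qed.

Lemma Sf_scroll b k u0 u1 m w :
  Sf b k (m * u0 + w * (k * u0 * gq b u0 u1)) (m * u1)
     (w * cB b u0 u1) (- (w * cA b u0 u1)) = 0.
Proof. rewrite /Sf /cubic /hess /disc /gq /cA /cB; ring. Qed.

Lemma cubic_dx_scroll b nu u0 u1 :
  let s := nu * cB b u0 u1 in let t := - (nu * cA b u0 u1) in
  s * u0 ^+ 2 *+ 3 + b * s * u0 * u1 *+ 2 + b * t * u1 ^+ 2 =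
  nu * u1 * (u0 * u1 * gq b u0 u1).
Proof. rewrite /gq /cA /cB /=; ring. Qed.

Lemma cubic_dy_scroll b nu u0 u1 :
  let s := nu * cB b u0 u1 in let t := - (nu * cA b u0 u1) in
  b * s * u0 ^+ 2 + b * t * u0 * u1 *+ 2 + t * u1 ^+ 2 *+ 3 =
  - (nu * u0 * (u0 * u1 * gq b u0 u1)).
Proof. rewrite /gq /cA /cB /=; ring. Qed.

(** The discriminant of the pencil pulled back to the line: the ramification
    divisor occurs twice, the last factor vanishes at the residual points. *)
Lemma disc_scroll b u0 u1 :
  let s := cB b u0 u1 in let t := - cA b u0 u1 in
  disc s (b * s) (b * t) t = (u0 * u1 * gq b u0 u1) ^+ 2 *
   (((b ^+ 2 + 1) * u0 * u1 + b * u0 ^+ 2 + b * u1 ^+ 2) ^+ 2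
    - (u1 ^+ 2 + b * u0 * u1) * (u0 ^+ 2 + b * u0 * u1) *+ 4).
Proof. rewrite /disc /gq /cA /cB /=; ring. Qed.

Lemma hess_scroll b u0 u1 :
  let s := cB b u0 u1 in let t := - cA b u0 u1 in
  hess s (b * s) (b * t) t u0 u1 = - (u0 * u1 * gq b u0 u1) ^+ 2.
Proof. rewrite /hess /gq /cA /cB /=; ring. Qed.

Lemma disc_quartic b s t : disc s (b * s) (b * t) t =
  quartic 0 (- (b ^+ 3 *+ 4)) (b ^+ 4 + b ^+ 2 *+ 18 - 27%:R) (- (b ^+ 3 *+ 4)) 0 s t.
Proof. rewrite /disc /quartic; ring. Qed.

Lemma Sf_plane b k x0 x1 s t w : Sf b k x0 x1 (s * w) (t * w) =
  w * (cubic s (b * s) (b * t) t x0 x1 + k * w * hess s (b * s) (b * t) t x0 x1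
       + k ^+ 3 * w ^+ 3 * disc s (b * s) (b * t) t).
Proof. rewrite /Sf /cubic /hess /disc; ring. Qed.

End ScrollForms.

Section ScrollMorphism.
Variables (R R' : comNzRingType) (f : {rmorphism R -> R'}).

Lemma rmorph_Sf b k x0 x1 s t :
  f (Sf b k x0 x1 s t) = Sf (f b) (f k) (f x0) (f x1) (f s) (f t).
Proof. rewrite /Sf /cubic /hess /disc; ring. Qed.

Lemma rmorph_cA b u0 u1 : f (cA b u0 u1) = cA (f b) (f u0) (f u1).
Proof. rewrite /cA; ring. Qed.
Lemma rmorph_cB b u0 u1 : f (cB b u0 u1) = cB (f b) (f u0) (f u1).
Proof. rewrite /cB; ring. Qed.
Lemma rmorph_gq b u0 u1 : f (gq b u0 u1) = gq (f b) (f u0) (f u1).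
Proof. rewrite /gq; ring. Qed.
End ScrollMorphism.

Section Scroll.
Variables (K : closedFieldType) (b k : K).
Hypotheses (n2 : (2%:R : K) != 0) (n3 : (3%:R : K) != 0).
Hypotheses (b0 : b != 0) (b1 : b ^+ 2 != 1) (b9 : b ^+ 2 != 9%:R).
Implicit Types s t u x m w : K.

Local Notation A := (cA b).
Local Notation B := (cB b).
Local Notation g := (gq b).
Local Notation S := (Sf b k).

Lemma prop2 u0 u1 a c : (u0 != 0) || (u1 != 0) -> u1 * a = u0 * c ->
  exists m, a = m * u0 /\ c = m * u1.
Proof.
case/orP => u e.
  exists (a / u0); split; first by field.
  by apply: (mulfI u); rewrite -e; field.
exists (c / u1); split; last by field.
by apply: (mulfI u); rewrite e; field.
Qed.

Lemma cAB_coprime u0 u1 : A u0 u1 = 0 -> B u0 u1 = 0 -> u0 = 0 /\ u1 = 0.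
Proof.
rewrite /cA /cB => /eqP; rewrite mulf_eq0 sqrf_eq0 => /orP[/eqP ->|/eqP e].
  rewrite mulr0 addr0 -exprSr => /eqP; rewrite expf_eq0 /= => /eqP ->; by [].
have -> : u0 = - b * u1 by rewrite -[LHS](addrK (b * u1)) e; ring.
have -> : u1 ^+ 2 * (u1 + b * (- b * u1)) = (1 - b ^+ 2) * u1 ^+ 3 by ring.
move=> /eqP; rewrite mulf_eq0 subr_eq0 eq_sym (negbTE b1) expf_eq0 /= => /eqP ->.
by rewrite mulr0.
Qed.

Lemma cAB_neq0 u0 u1 : (u0 != 0) || (u1 != 0) -> (A u0 u1 != 0) || (B u0 u1 != 0).
Proof.
apply: contraTT; rewrite !negb_or !negbK => /andP[/eqP a /eqP c].
by have [-> ->] := cAB_coprime a c; rewrite eqxx.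
Qed.

(** The fibre containing u is the one with parameters (B u, - A u). *)
Lemma root_nu u0 u1 s t : (u0 != 0) || (u1 != 0) -> s * A u0 u1 + t * B u0 u1 = 0 ->
  exists nu, s = nu * B u0 u1 /\ t = - (nu * A u0 u1).
Proof.
move=> /cAB_neq0 ab e; have [||nu [e1 e2]] := @prop2 (B u0 u1) (- A u0 u1) s t.
- by rewrite oppr_eq0 orbC.
- by apply/subr0_eq; rewrite -[RHS]oppr0 -e; ring.
by exists nu; rewrite e1 e2 mulrN.
Qed.

Definition fibre_root s t (u v z : K * K) (nu : K) :=
  [/\ s = nu * B u.1 u.2, t = - (nu * A u.1 u.2) &
   nu * (u.1 * u.2 * g u.1 u.2) =
   - ((u.2 * v.1 - u.1 * v.2) * (u.2 * z.1 - u.1 * z.2))].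

(** The three lines that make up the section of the scroll by the plane (s, t),
    each with the point u where it meets the directrix. *)
Lemma fibre_lines s t : (s != 0) || (t != 0) -> exists u v z : K * K,
  [/\ (u.1 != 0) || (u.2 != 0), (v.1 != 0) || (v.2 != 0), (z.1 != 0) || (z.2 != 0),
   cubic_factors s (b * s) (b * t) t (- u.2) u.1 (- v.2) v.1 (- z.2) z.1 &
   exists nu1 nu2 nu3, [/\ fibre_root s t u v z nu1, fibre_root s t v z u nu2,
     fibre_root s t z u v nu3 &
     forall x0 x1 w, cubic s (b * s) (b * t) t x0 x1 + k * w * hess s (b * s) (b * t) t x0 x1
       + k ^+ 3 * w ^+ 3 * disc s (b * s) (b * t) t =
      ((u.1 * x1 - u.2 * x0 + k * nu1 * (u.1 * u.2 * g u.1 u.2) * w) *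
       (v.1 * x1 - v.2 * x0 + k * nu2 * (v.1 * v.2 * g v.1 v.2) * w) *
       (z.1 * x1 - z.2 * x0 + k * nu3 * (z.1 * z.2 * g z.1 z.2) * w))]].
Proof.
move=> st; have [p1 [q1 [p2 [q2 [p3 [q3 fac]]]]]] := cubic_split s (b * s) (b * t) t.
have step p q p' q' p'' q'' : cubic_factors s (b * s) (b * t) t p q p' q' p'' q'' ->
  (q != 0) || (- p != 0) /\
  exists nu, [/\ s = nu * B q (- p), t = - (nu * A q (- p)) &
    (p' * q - p * q') * (p'' * q - p * q'') = - (nu * (q * (- p) * g q (- p)))].
  move=> f; have qp : (q != 0) || (- p != 0).
    apply: contraTT st; rewrite !negb_or !negbK oppr_eq0 => /andP[/eqP q0 /eqP p0].
    by case: f => -> _ _ ->; rewrite q0 p0 !mul0r !eqxx.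
  split=> //; have [|nu [es et]] := root_nu (s := s) (t := t) qp.
    by rewrite -cubic_cAB (cubicE _ _ f); ring.
  exists nu; split=> //.
  have dx := cubic_dx_root f; have dy := cubic_dy_root f.
  have dx' := cubic_dx_scroll b nu q (- p); have dy' := cubic_dy_scroll b nu q (- p).
  rewrite /= -!es -!et in dx' dy'.
  have ex : p * ((p' * q - p * q') * (p'' * q - p * q'') +
                  nu * (q * - p * g q (- p))) = 0.
    rewrite mulrDr -dx.
    have -> : p * (nu * (q * - p * g q (- p))) = - (nu * - p * (q * - p * g q (- p))) by ring.
    rewrite -dx'; ring.
  have ey : q * ((p' * q - p * q') * (p'' * q - p * q'') +
                  nu * (q * - p * g q (- p))) = 0.
    rewrite mulrDr -dy.
    have -> : q * (nu * (q * - p * g q (- p))) = - - (nu * q * (q * - p * g q (- p))) by ring.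
    rewrite -dy'; ring.
  apply/eqP; rewrite -addr_eq0; apply/eqP; move: qp; rewrite oppr_eq0.
  by case/orP => ne; apply: (mulfI ne); rewrite mulr0.
have fac2 := cubic_factors_rot fac; have fac3 := cubic_factors_rot fac2.
have [n1 [nu1 [es1 et1 d1]]] := step _ _ _ _ _ _ fac.
have [nn2 [nu2 [es2 et2 d2]]] := step _ _ _ _ _ _ fac2.
have [nn3 [nu3 [es3 et3 d3]]] := step _ _ _ _ _ _ fac3.
exists (q1, - p1), (q2, - p2), (q3, - p3); rewrite /= !opprK; split=> //.
have root p q p' q' p'' q'' nu : s = nu * B q (- p) -> t = - (nu * A q (- p)) ->
    (p' * q - p * q') * (p'' * q - p * q'') = - (nu * (q * (- p) * g q (- p))) ->
    fibre_root s t (q, - p) (q', - p') (q'', - p'') nu.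
  by move=> es et d; split=> //=; rewrite -[LHS]opprK -d; congr (- _); ring.
exists nu1, nu2, nu3; split; try by apply: root.
move=> x0 x1 w.
rewrite (cubic_hess_disc_split _ _ _ _ fac) d1.
rewrite [(p3 * q2 - p2 * q3) * _]d2 [(p1 * q3 - p3 * q1) * _]d3.
ring.
Qed.

Lemma scroll_of_Sf x0 x1 s t : S x0 x1 s t = 0 -> exists u0 u1 m w,
  [/\ (u0 != 0) || (u1 != 0), x0 = m * u0 + w * (k * u0 * g u0 u1), x1 = m * u1,
      s = w * B u0 u1 & t = - (w * A u0 u1)].
Proof.
move=> S0; case: (boolP ((s != 0) || (t != 0))) => [st|]; last first.
  rewrite negb_or !negbK => /andP[/eqP -> /eqP ->].
  case: (boolP ((x0 != 0) || (x1 != 0))) => [x|].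
    by exists x0, x1, 1, 0; split=> //; ring.
  rewrite negb_or !negbK => /andP[/eqP -> /eqP ->].
  by exists 1, 0, 0, 0; split; rewrite ?oner_eq0 //; ring.
have [u [v [z [u0 v0 z0 _ [nu1 [nu2 [nu3 [[es1 et1 _] [es2 et2 _] [es3 et3 _] fS]]]]]]]] :=
  fibre_lines st.
have := Sf_plane b k x0 x1 s t 1; rewrite fS !mulr1 mul1r S0 => /esym /eqP.
rewrite !mulf_eq0.
have fin (y : K * K) nu : (y.1 != 0) || (y.2 != 0) -> s = nu * B y.1 y.2 ->
  t = - (nu * A y.1 y.2) ->
  y.1 * x1 - y.2 * x0 + k * nu * (y.1 * y.2 * g y.1 y.2) == 0 ->
  exists u0 u1 m w,
  [/\ (u0 != 0) || (u1 != 0), x0 = m * u0 + w * (k * u0 * g u0 u1), x1 = m * u1,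
      s = w * B u0 u1 & t = - (w * A u0 u1)].
  move=> y0 es et /eqP e.
  have [|m [e1 e2]] := @prop2 y.1 y.2 (x0 - nu * (k * y.1 * g y.1 y.2)) x1 y0.
    by apply/subr0_eq; rewrite -[RHS]oppr0 -e; ring.
  by exists y.1, y.2, m, nu; split=> //; rewrite -e1; ring.
by case/orP => [/orP[]|]; apply: fin.
Qed.

Lemma disc11 : disc 1 (b * 1) (b * 1) 1 != 0.
Proof.
have -> : disc 1 (b * 1) (b * 1) 1 = (b - 3%:R) ^+ 3 * (b + 1) by rewrite /disc; ring.
rewrite mulf_neq0 ?expf_neq0 ?subr_eq0 ?addr_eq0 //.
  by apply: contraNneq b9 => ->; apply/eqP; ring.
by apply: contraNneq b1 => ->; apply/eqP; ring.
Qed.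

Lemma disc_sqfree :
  quartic_sqfree 0 (- (b ^+ 3 *+ 4)) (b ^+ 4 + b ^+ 2 *+ 18 - 27%:R) (- (b ^+ 3 *+ 4)) 0.
Proof.
have n4 : b ^+ 3 *+ 4 != 0.
  by rewrite -mulr_natr mulf_neq0 ?expf_neq0 // (natrM _ 2 2) mulf_neq0.
move=> s t st; rewrite /quartic_s /quartic_t.
set al := b ^+ 3 *+ 4 in n4 *; set be := b ^+ 4 + _ - _ => es et.
have e1 : t * (- (al * s ^+ 2 *+ 3) + be * s * t *+ 2 - al * t ^+ 2) = 0.
  by rewrite -es; ring.
have e2 : s * (- (al * s ^+ 2) + be * s * t *+ 2 - al * t ^+ 2 *+ 3) = 0.
  by rewrite -et; ring.
have [t0|t0] := eqVneq t 0.
  move/eqP: e2; rewrite t0 in st *; rewrite eqxx orbF in st.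
  rewrite mulf_eq0 (negbTE st) /= => /eqP e.
  have : al * s ^+ 2 = 0 by rewrite -[RHS]oppr0 -e; ring.
  by move/eqP; rewrite mulf_eq0 (negbTE n4) sqrf_eq0 (negbTE st).
have [s0|s0] := eqVneq s 0.
  move/eqP: e1; rewrite s0; rewrite mulf_eq0 (negbTE t0) /= => /eqP e.
  have : al * t ^+ 2 = 0 by rewrite -[RHS]oppr0 -e; ring.
  by move/eqP; rewrite mulf_eq0 (negbTE n4) sqrf_eq0 (negbTE t0).
have {e1}e1 : - (al * s ^+ 2 *+ 3) + be * s * t *+ 2 - al * t ^+ 2 = 0.
  by apply: (mulfI t0); rewrite e1 mulr0.
have {e2}e2 : - (al * s ^+ 2) + be * s * t *+ 2 - al * t ^+ 2 *+ 3 = 0.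
  by apply: (mulfI s0); rewrite e2 mulr0.
have e3 : (2%:R * al) * ((s - t) * (s + t)) = 0.
  by rewrite -[RHS](subrr 0) -{1}e2 -e1; ring.
have b3 : b != 3%:R by apply: contraNneq b9 => ->; apply/eqP; ring.
have bm3 : b != - 3%:R by apply: contraNneq b9 => ->; apply/eqP; ring.
have bb1 : b != 1 by apply: contraNneq b1 => ->; apply/eqP; ring.
have bm1 : b != - 1 by apply: contraNneq b1 => ->; apply/eqP; ring.
move/eqP: e3; rewrite !mulf_eq0 (negbTE n2) (negbTE n4) /= subr_eq0 addr_eq0.
case/orP => /eqP st'; move: e1; rewrite st'.
  have -> : - (al * t ^+ 2 *+ 3) + be * t * t *+ 2 - al * t ^+ 2 =
     2%:R * ((b - 3%:R) ^+ 3 * (b + 1)) * t ^+ 2 by rewrite /al /be; ring.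
  move=> e; have : 2%:R * ((b - 3%:R) ^+ 3 * (b + 1)) * t ^+ 2 != 0.
    apply: mulf_neq0; last exact: expf_neq0.
    apply: mulf_neq0 => //; apply: mulf_neq0; last by rewrite addr_eq0.
    by apply: expf_neq0; rewrite subr_eq0.
  by rewrite e eqxx.
have -> : - (al * (- t) ^+ 2 *+ 3) + be * - t * t *+ 2 - al * t ^+ 2 =
     - (2%:R * ((b + 3%:R) ^+ 3 * (b - 1)) * t ^+ 2) by rewrite /al /be; ring.
move=> e; have : - (2%:R * ((b + 3%:R) ^+ 3 * (b - 1)) * t ^+ 2) != 0.
  rewrite oppr_eq0; apply: mulf_neq0; last exact: expf_neq0.
  apply: mulf_neq0 => //; apply: mulf_neq0; last by rewrite subr_eq0.
  by apply: expf_neq0; rewrite addr_eq0.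
by rewrite e eqxx.
Qed.

End Scroll.

(** * The quartic surface in normal form *)

Lemma quartic_taylor (R : comNzRingType) (f0 f1 f2 f3 f4 s t s' t' x : R) :
  quartic f0 f1 f2 f3 f4 (s + s' * x) (t + t' * x) =
  quartic f0 f1 f2 f3 f4 s t
  + (s' * quartic_s f0 f1 f2 f3 f4 s t + t' * quartic_t f0 f1 f2 f3 f4 s t) * x
  + (f0 * (s ^+ 2 * s' ^+ 2 *+ 6 + s * s' ^+ 3 * x *+ 4 + s' ^+ 4 * x ^+ 2)
    + f1 * (s * s' ^+ 2 * t *+ 3 + s ^+ 2 * s' * t' *+ 3
       + (s' ^+ 3 * t + s * s' ^+ 2 * t' *+ 3) * x + s' ^+ 3 * t' * x ^+ 2)
    + f2 * (s ^+ 2 * t' ^+ 2 + s * s' * t * t' *+ 4 + s' ^+ 2 * t ^+ 2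
       + (s * s' * t' ^+ 2 + s' ^+ 2 * t * t') * x *+ 2 + s' ^+ 2 * t' ^+ 2 * x ^+ 2)
    + f3 * (t * t' ^+ 2 * s *+ 3 + t ^+ 2 * t' * s' *+ 3
       + (t' ^+ 3 * s + t * t' ^+ 2 * s' *+ 3) * x + t' ^+ 3 * s' * x ^+ 2)
    + f4 * (t ^+ 2 * t' ^+ 2 *+ 6 + t * t' ^+ 3 * x *+ 4 + t' ^+ 4 * x ^+ 2)) * x ^+ 2.
Proof. rewrite /quartic /quartic_s /quartic_t; ring. Qed.

Lemma quartic_euler (R : comNzRingType) (f0 f1 f2 f3 f4 s t : R) :
  s * quartic_s f0 f1 f2 f3 f4 s t + t * quartic_t f0 f1 f2 f3 f4 s t =
  quartic f0 f1 f2 f3 f4 s t *+ 4.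
Proof. rewrite /quartic /quartic_s /quartic_t; ring. Qed.

Section NormalForm.
Variables (K : closedFieldType) (b k c0 c1 c2 c3 c4 : K).
Implicit Types (s t u m w : K) (x y z p v : 'rV[K]_4).

Local Notation A := (cA b).
Local Notation B := (cB b).
Local Notation g := (gq b).
Local Notation S := (Sf b k).
Local Notation Q := (quartic c0 c1 c2 c3 c4).

Definition E01 : 'M[K]_(2, 4) := join2 (pt4 1 0 0 0) (pt4 0 1 0 0).
Definition Hst s t : 'M[K]_(3, 4) := join3 (pt4 1 0 0 0) (pt4 0 1 0 0) (pt4 0 0 s t).

Definition Smp : {mpoly K[4]} := Sf b%:MP k%:MP 'X_o0 'X_o1 'X_o2 'X_o3.
Definition Qmp : {mpoly K[4]} :=
  quartic c0%:MP c1%:MP c2%:MP c3%:MP c4%:MP 'X_o2 'X_o3.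
Definition Fmp : {mpoly K[4]} := Smp + Qmp.

Lemma sub_E01 (x : 'rV[K]_4) : (x <= E01)%MS <-> x 0 o2 = 0 /\ x 0 o3 = 0.
Proof.
rewrite sub_join2; split=> [[a [c ->]]|[e2 e3]].
  by rewrite !mxE /= !mulr0 addr0.
exists (x 0 o0), (x 0 o1); rewrite !pt4Z pt4D [LHS]row4E e2 e3.
by congr pt4; ring.
Qed.

Lemma E01_line : is_line E01.
Proof.
by apply/is_line_join2 => a c; rewrite !pt4Z pt4D -pt4_0 => /pt4_inj[]; rewrite !(mulr1, mulr0, addr0, add0r).
Qed.

Lemma ev_Smp x : ev Smp x = S (x 0 o0) (x 0 o1) (x 0 o2) (x 0 o3).
Proof. by rewrite /ev /Smp (rmorph_Sf (meval _)) /= !mevalC !mevalXU. Qed.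
Lemma ev_Qmp x : ev Qmp x = Q (x 0 o2) (x 0 o3).
Proof. by rewrite /ev /Qmp (rmorph_quartic (meval _)) /= !mevalC !mevalXU. Qed.
Lemma ev_Fmp x : ev Fmp x = S (x 0 o0) (x 0 o1) (x 0 o2) (x 0 o3) + Q (x 0 o2) (x 0 o3).
Proof. by rewrite evD ev_Smp ev_Qmp. Qed.

Lemma ev_Smp4 (x0 x1 s t : K) : ev Smp (pt4 x0 x1 s t) = S x0 x1 s t.
Proof. by rewrite ev_Smp !pt4E. Qed.
Lemma ev_Fmp4 (x0 x1 s t : K) : ev Fmp (pt4 x0 x1 s t) = S x0 x1 s t + Q s t.
Proof. by rewrite ev_Fmp !pt4E. Qed.

Lemma along_Smp p v : let y i := (p 0 i)%:P + v 0 i *: 'X : {poly K} in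
  along Smp p v = Sf b%:P k%:P (y o0) (y o1) (y o2) (y o3).
Proof.
rewrite alongE /peval /Smp (rmorph_Sf (mmap (@polyC K) _)) /=.
by rewrite -!/(peval _ _) !pevalC !pevalXU.
Qed.
Lemma along_Qmp p v : let y i := (p 0 i)%:P + v 0 i *: 'X : {poly K} in
  along Qmp p v = quartic c0%:P c1%:P c2%:P c3%:P c4%:P (y o2) (y o3).
Proof.
rewrite alongE /peval /Qmp (rmorph_quartic (mmap (@polyC K) _)) /=.
by rewrite -!/(peval _ _) !pevalC !pevalXU.
Qed.
Lemma along_Fmp p v : along Fmp p v = along Smp p v + along Qmp p v.
Proof. by rewrite !alongE pevalD. Qed.

Lemma SfZ (a x0 x1 s t : K) : S (a * x0) (a * x1) (a * s) (a * t) = a ^+ 4 * S x0 x1 s t.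
Proof. rewrite /Sf /cubic /hess /disc; ring. Qed.

Lemma Smp_homog : Smp \is 4.-homog.
Proof. by apply: homog_ev => a x; rewrite !ev_Smp !mxE SfZ. Qed.

(** The generator through the point u of the directrix; it lies in the plane with
    parameters (B u, - A u), whose cubic vanishes at u. *)
Definition Tl u0 u1 : 'M[K]_(2, 4) :=
  join2 (pt4 u0 u1 0 0) (pt4 (k * u0 * g u0 u1) 0 (B u0 u1) (- A u0 u1)).

Lemma sub_Tl u0 u1 x : (x <= Tl u0 u1)%MS <-> exists m w,
  x = pt4 (m * u0 + w * (k * u0 * g u0 u1)) (m * u1) (w * B u0 u1) (- (w * A u0 u1)).
Proof.
rewrite sub_join2; split=> -[m [w ->]]; exists m, w; rewrite !pt4Z pt4D;
  by congr pt4; ring.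
Qed.

Lemma Tl_in_S u0 u1 : line_in (Tl u0 u1) Smp.
Proof. by move=> x /sub_Tl[m [w ->]]; rewrite ev_Smp4 Sf_scroll. Qed.

Section Nondegenerate.
Hypotheses (n2 : (2%:R : K) != 0) (n3 : (3%:R : K) != 0).
Hypotheses (b0 : b != 0) (b1 : b ^+ 2 != 1) (b9 : b ^+ 2 != 9%:R).

Lemma Tl_line u0 u1 : (u0 != 0) || (u1 != 0) -> is_line (Tl u0 u1).
Proof.
move=> u; apply/is_line_join2 => a c.
rewrite !pt4Z pt4D -pt4_0 => /pt4_inj[e1 e2 e3 e4].
have c0' : c = 0.
  case/orP: (cAB_neq0 b1 u) => h; apply: (mulIf h); rewrite mul0r.
    by rewrite -[RHS]oppr0 -e4; ring.
  by rewrite -e3; ring.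
move: e1 e2; rewrite c0' !mul0r !addr0 => e1 e2; split=> //.
by case/orP: u => h; [move/eqP: e1 | move/eqP: e2]; rewrite mulf_eq0 (negbTE h) orbF => /eqP.
Qed.

Lemma zeros_Smp x : zeros Smp x <-> exists u0 u1, [/\ (u0 != 0) || (u1 != 0) & (x <= Tl u0 u1)%MS].
Proof.
split=> [|[u0 [u1 [u xT]]]]; last exact: Tl_in_S xT.
rewrite /zeros ev_Smp => /(scroll_of_Sf b1) [u0 [u1 [m [w [u e0 e1 e2 e3]]]]].
exists u0, u1; split=> //; apply/sub_Tl; exists m, w.
by rewrite [x]row4E e0 e1 e2 e3.
Qed.

(** The cubics that parametrise the double curve: the gradient of the ramification form,
    rotated, and the two forms of the pencil. *)
Definition M4 : 'M[K]_4 := \matrix_(i, j) nth 0 (nth [::]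
  [:: [:: - (k * b); 0; 0; -1]; [:: - (k * (b ^+ 2 + 3%:R)); k * b *+ 3; 0; - b];
      [:: - (k * b *+ 3); k * (b ^+ 2 + 3%:R); b; 0]; [:: 0; k * b; 1; 0]] i) j.

Lemma mul_M4 (y0 y1 y2 y3 : K) : pt4 y0 y1 y2 y3 *m M4 =
  pt4 (- (k * (b * y0 + (b ^+ 2 + 3%:R) * y1 + b * y2 *+ 3)))
      (k * (b * y1 *+ 3 + (b ^+ 2 + 3%:R) * y2 + b * y3)) (b * y2 + y3) (- (y0 + b * y1)).
Proof.
apply/rowP; apply: ord4P; rewrite !pt4E mxE big_ord4 /= !pt4E /M4 !mxE /=; ring.
Qed.

Lemma M4_unit : k != 0 -> M4 \in unitmx.
Proof.
move=> k0; rewrite -row_free_unit; apply: inj_row_free => v.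
rewrite [v]row4E mul_M4 -pt4_0; set y0 := v 0 o0; set y1 := v 0 o1; set y2 := v 0 o2; set y3 := v 0 o3.
case/pt4_inj => /eqP; rewrite oppr_eq0 mulf_eq0 (negbTE k0) /= => /eqP e0 /eqP.
rewrite mulf_eq0 (negbTE k0) /= => /eqP e1 e2 /eqP; rewrite oppr_eq0 => /eqP e3.
have y3E : y3 = - (b * y2) by rewrite -[LHS](addKr (b * y2)) e2 addr0.
have y0E : y0 = - (b * y1) by rewrite -[LHS](addrK (b * y1)) e3 add0r.
have z1 : y1 + b * y2 = 0.
  by apply: (mulfI n3); rewrite mulr0 -e0 y0E; ring.
have z2 : b * y1 + y2 = 0.
  by apply: (mulfI n3); rewrite mulr0 -e1 y3E; ring.
have y1E : y1 = - (b * y2) by rewrite -[LHS](addrK (b * y2)) z1 add0r.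
have /eqP : (1 - b ^+ 2) * y2 = 0 by rewrite -z2 y1E; ring.
rewrite mulf_eq0 subr_eq0 eq_sym (negbTE b1) /= => /eqP y20.
by rewrite y3E y0E y1E y20; congr pt4; ring.
Qed.

Lemma Sf_M4 (R : comNzRingType) (bb kk y0 y1 y2 y3 : R) :
  Sf bb kk (- (kk * (bb * y0 + (bb ^+ 2 + 3%:R) * y1 + bb * y2 *+ 3)))
      (kk * (bb * y1 *+ 3 + (bb ^+ 2 + 3%:R) * y2 + bb * y3)) (bb * y2 + y3) (- (y0 + bb * y1)) =
  let q1 := y0 * y2 - y1 ^+ 2 in let q2 := y0 * y3 - y1 * y2 in let q3 := y1 * y3 - y2 ^+ 2 in
  27%:R * kk ^+ 3 * (bb ^+ 2 - 1) *
   (q2 ^+ 2 + bb * q1 * q2 + bb * q2 * q3 + (bb ^+ 2 - 1) * q1 * q3).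
Proof. rewrite /Sf /cubic /hess /disc /=; ring. Qed.

(** In the coordinates of the twisted cubic the scroll is a conic in the three
    quadrics through that curve. *)
Lemma along_M4 (y z : 'rV[K]_4) :
  let Y i := (y 0 i)%:P + z 0 i *: 'X : {poly K} in
  let q1 := Y o0 * Y o2 - Y o1 ^+ 2 in let q2 := Y o0 * Y o3 - Y o1 * Y o2 in
  let q3 := Y o1 * Y o3 - Y o2 ^+ 2 in
  along Smp (y *m M4) (z *m M4) = (27%:R * k ^+ 3 * (b ^+ 2 - 1))%:P *
   (q2 ^+ 2 + b%:P * q1 * q2 + b%:P * q2 * q3 + (b ^+ 2 - 1)%:P * q1 * q3).
Proof.
move=> Y q1 q2 q3; rewrite along_Smp /=.
rewrite (_ : (27%:R * _ * _)%:P = 27%:R * k%:P ^+ 3 * (b%:P ^+ 2 - 1)); last by ring.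
rewrite (_ : (b ^+ 2 - 1)%:P = b%:P ^+ 2 - 1); last by ring.
refine (etrans _ (Sf_M4 b%:P k%:P (Y o0) (Y o1) (Y o2) (Y o3))).
rewrite /Y {1 2 3 4}[y]row4E {1 2 3 4}[z]row4E !mul_M4 !pt4E -!mul_polyC.
congr Sf; ring.
Qed.

Definition twc u0 u1 : 'rV[K]_4 := pt4 (u0 ^+ 3) (u0 ^+ 2 * u1) (u0 * u1 ^+ 2) (u1 ^+ 3).

Lemma twc_singular u0 u1 : k != 0 -> singular_at Smp (twc u0 u1 *m M4).
Proof.
move=> k0; apply/singular_along => v; rewrite -(mulmxKV (M4_unit k0) v).
set z := v *m invmx M4; rewrite along_M4 !pt4E; apply: dvdp_mull.
set Y0 := _ + z 0 o0 *: _; set Y1 := _ + z 0 o1 *: _.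
set Y2 := _ + z 0 o2 *: _; set Y3 := _ + z 0 o3 *: _.
have [r1 ->] : exists r, Y0 * Y2 - Y1 ^+ 2 = r * 'X.
  exists ((z 0 o0 * (u0 * u1 ^+ 2) + u0 ^+ 3 * z 0 o2 - u0 ^+ 2 * u1 * z 0 o1 *+ 2)%:P
    + (z 0 o0 * z 0 o2 - z 0 o1 ^+ 2) *: 'X).
  by rewrite /Y0 /Y1 /Y2 -!mul_polyC; ring.
have [q2 ->] : exists r, Y0 * Y3 - Y1 * Y2 = r * 'X.
  exists ((z 0 o0 * u1 ^+ 3 + u0 ^+ 3 * z 0 o3 - u0 ^+ 2 * u1 * z 0 o2
     - z 0 o1 * (u0 * u1 ^+ 2))%:P + (z 0 o0 * z 0 o3 - z 0 o1 * z 0 o2) *: 'X).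
  by rewrite /Y0 /Y1 /Y2 /Y3 -!mul_polyC; ring.
have [r3 ->] : exists r, Y1 * Y3 - Y2 ^+ 2 = r * 'X.
  exists ((z 0 o1 * u1 ^+ 3 + u0 ^+ 2 * u1 * z 0 o3 - u0 * u1 ^+ 2 * z 0 o2 *+ 2)%:P
    + (z 0 o1 * z 0 o3 - z 0 o2 ^+ 2) *: 'X).
  by rewrite /Y1 /Y2 /Y3 -!mul_polyC; ring.
apply/dvdpP; exists (q2 ^+ 2 + b%:P * r1 * q2 + b%:P * q2 * r3 + (b ^+ 2 - 1)%:P * r1 * r3).
ring.
Qed.

Lemma axis_singular s t : k = 0 -> singular_at Smp (pt4 0 0 s t).
Proof.
move=> k0; apply/singular_along => v; rewrite along_Smp !pt4E k0 -!mul_polyC.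
apply/dvdpP; rewrite /Sf cubic_cAB /cA /cB.
exists ((s%:P + (v 0 o2)%:P * 'X) * ((v 0 o0)%:P ^+ 2 * ((v 0 o0)%:P + b%:P * (v 0 o1)%:P) * 'X)
  + (t%:P + (v 0 o3)%:P * 'X) * ((v 0 o1)%:P ^+ 2 * ((v 0 o1)%:P + b%:P * (v 0 o0)%:P) * 'X)).
rewrite /hess /disc polyC0; ring.
Qed.

(** Every plane through ell contains a singular point of the scroll off ell, on the triple line
    or on the twisted cubic. *)
Lemma double_point s t : (s != 0) || (t != 0) -> exists x nu,
  [/\ x != 0, nu != 0, s = nu * x 0 o2, t = nu * x 0 o3 & singular_at Smp x].
Proof.
move=> st; have [k0|k0] := eqVneq k 0.
  exists (pt4 0 0 s t), 1; rewrite !pt4E !mul1r oner_eq0; split=> //.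
    by rewrite pt4_eq0 eqxx /= negb_and.
  exact: axis_singular.
have [u [_ [_ [u0 _ _ _ [nu [_ [_ [[es et _] _ _ _]]]]]]]] := fibre_lines k b1 st.
have nu0 : nu != 0.
  by apply: contraTneq st => nu0; rewrite es et nu0 !mul0r oppr0 eqxx.
have e2 : (twc u.1 u.2 *m M4) 0 o2 = B u.1 u.2.
  by rewrite mul_M4 pt4E /cB; ring.
have e3 : (twc u.1 u.2 *m M4) 0 o3 = - A u.1 u.2.
  by rewrite mul_M4 pt4E /cA; ring.
exists (twc u.1 u.2 *m M4), nu; rewrite e2 e3 mulrN; split=> //; last exact: twc_singular.
apply: contraTneq (cAB_neq0 b1 u0) => x0.
by move: e2 e3; rewrite x0 !mxE => <- /eqP; rewrite eq_sym oppr_eq0 => /eqP ->; rewrite eqxx.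
Qed.

Lemma dvdp_quartic (f0 f1 f2 f3 f4 s t s' t' : K) :
  quartic_s f0 f1 f2 f3 f4 s t = 0 -> quartic_t f0 f1 f2 f3 f4 s t = 0 ->
  'X^2 %| quartic f0%:P f1%:P f2%:P f3%:P f4%:P (s%:P + s' *: 'X) (t%:P + t' *: 'X).
Proof.
move=> es et; rewrite -!mul_polyC quartic_taylor.
have -> : quartic_s f0%:P f1%:P f2%:P f3%:P f4%:P s%:P t%:P = 0.
  rewrite -[RHS]polyC0 -es /quartic_s; ring.
have -> : quartic_t f0%:P f1%:P f2%:P f3%:P f4%:P s%:P t%:P = 0.
  rewrite -[RHS]polyC0 -et /quartic_t; ring.
have -> : quartic f0%:P f1%:P f2%:P f3%:P f4%:P s%:P t%:P = 0.
  have n4 : (4%:R : K) != 0 by rewrite (natrM _ 2 2) mulf_neq0.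
  rewrite -(rmorph_quartic (@polyC K)) /=; apply/eqP; rewrite polyC_eq0; apply/eqP.
  apply: (mulfI n4); rewrite mulr0 mulr_natl -quartic_euler es et; ring.
by rewrite !mulr0 addr0 mul0r !add0r dvdp_mull.
Qed.

(** A fibre with a double line: at a common zero of the discriminant the point u
    ramifies, and u is not a triple point because b ^ 2 is not 9. *)
Lemma ramified_fibre s t : (s != 0) || (t != 0) -> disc s (b * s) (b * t) t = 0 ->
  exists u0 u1 nu e0 e1 e2,
  [/\ (u0 != 0) || (u1 != 0), nu != 0, s = nu * B u0 u1 /\ t = - (nu * A u0 u1),
     u0 * u1 * g u0 u1 = 0 & e0 * u0 + e1 * u1 != 0 /\
     forall x0 x1 w : K, cubic s (b * s) (b * t) t x0 x1
       + k * w * hess s (b * s) (b * t) t x0 x1 + k ^+ 3 * w ^+ 3 * disc s (b * s) (b * t) t =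
       (u0 * x1 - u1 * x0) ^+ 2 * (e0 * x0 + e1 * x1 + e2 * w)].
Proof.
move=> st d0; have [u [v [z [u0 v0 z0 fac [nu1 [nu2 [nu3 [R1 R2 R3 fS]]]]]]]] :=
  fibre_lines k b1 st.
have nu_neq0 (y y' y'' : K * K) nu : fibre_root b s t y y' y'' nu -> nu != 0.
  by case=> es et _; apply: contraTneq st => e; rewrite es et e !mul0r oppr0 eqxx.
have fin (y y' y'' : K * K) nu nu' nu'' : (y.1 != 0) || (y.2 != 0) -> (y'.1 != 0) || (y'.2 != 0) ->
    cubic_factors s (b * s) (b * t) t (- y.2) y.1 (- y'.2) y'.1 (- y''.2) y''.1 ->
    fibre_root b s t y y' y'' nu -> fibre_root b s t y' y'' y nu' ->
    y.1 * y'.2 - y'.1 * y.2 = 0 ->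
    (forall x0 x1 w : K, cubic s (b * s) (b * t) t x0 x1
       + k * w * hess s (b * s) (b * t) t x0 x1 + k ^+ 3 * w ^+ 3 * disc s (b * s) (b * t) t =
      ((y.1 * x1 - y.2 * x0 + k * nu * (y.1 * y.2 * g y.1 y.2) * w) *
       (y'.1 * x1 - y'.2 * x0 + k * nu' * (y'.1 * y'.2 * g y'.1 y'.2) * w) *
       (y''.1 * x1 - y''.2 * x0 + k * nu'' * (y''.1 * y''.2 * g y''.1 y''.2) * w))) ->
    exists u0 u1 nu e0 e1 e2,
    [/\ (u0 != 0) || (u1 != 0), nu != 0, s = nu * B u0 u1 /\ t = - (nu * A u0 u1),
     u0 * u1 * g u0 u1 = 0 & e0 * u0 + e1 * u1 != 0 /\
     forall x0 x1 w : K, cubic s (b * s) (b * t) t x0 x1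
       + k * w * hess s (b * s) (b * t) t x0 x1 + k ^+ 3 * w ^+ 3 * disc s (b * s) (b * t) t =
       (u0 * x1 - u1 * x0) ^+ 2 * (e0 * x0 + e1 * x1 + e2 * w)].
  move=> y0 y'0 f Ry Ry' dy fy.
  have [es et j] := Ry; have [es' et' j'] := Ry'.
  have nu0 := nu_neq0 _ _ _ _ Ry; have nu'0 := nu_neq0 _ _ _ _ Ry'.
  have J0 : y.1 * y.2 * g y.1 y.2 = 0.
    apply: (mulfI nu0); rewrite mulr0 j.
    have -> : y.2 * y'.1 - y.1 * y'.2 = 0 by rewrite -[RHS]oppr0 -dy; ring.
    by rewrite mul0r oppr0.
  have J'0 : y'.1 * y'.2 * g y'.1 y'.2 = 0.
    apply: (mulfI nu'0); rewrite mulr0 j'.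
    have -> : y'.2 * y.1 - y'.1 * y.2 = 0 by rewrite -[RHS]dy; ring.
    by rewrite mulr0 oppr0.
  have [|lam [l1 l2]] := @prop2 K y.1 y.2 y'.1 y'.2 y0.
    by apply/subr0_eq; rewrite -[RHS]oppr0 -dy; ring.
  have lam0 : lam != 0 by apply: contraTneq y'0 => e; rewrite l1 l2 e !mul0r eqxx.
  exists y.1, y.2, nu, (- lam * y''.2), (lam * y''.1), (lam * k * nu'' * (y''.1 * y''.2 * g y''.1 y''.2)).
  split=> //; split; last by move=> x0 x1 w; rewrite fy J0 J'0 l1 l2; ring.
  (* Otherwise u is a triple root, so that 9 c0 c3 = c1 c2. *)
  apply/eqP => e.
  have d3 : y.1 * y''.2 - y''.1 * y.2 = 0.
    by apply: (mulfI lam0); rewrite mulr0 -[RHS]oppr0 -e; ring.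
  have [|mu [m1 m2]] := @prop2 K y.1 y.2 y''.1 y''.2 y0.
    by apply/subr0_eq; rewrite -[RHS]oppr0 -d3; ring.
  case: f => E0 E1 E2 E3; have : 9%:R * (s * t) = b * s * (b * t).
    by rewrite E1 E2 E0 E3 l1 l2 m1 m2; ring.
  have -> : b * s * (b * t) = b ^+ 2 * (s * t) by ring.
  move/eqP; rewrite -subr_eq0 -mulrBl mulf_eq0 subr_eq0 eq_sym (negbTE b9) /= mulf_eq0.
  have bz c : b * c = 0 -> c = 0 by move/eqP; rewrite mulf_eq0 (negbTE b0) => /eqP.
  case/orP => /eqP zz.
    have /eqP : lam * mu * y.2 ^+ 3 = 0 by rewrite -[RHS]oppr0 -zz E0 l2 m2; ring.
    rewrite mulf_eq0 expf_eq0 /= => /orP[/eqP lm|/eqP y20].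
      have t0 : t = lam * mu * y.1 ^+ 3 by rewrite E3 l1 m1; ring.
      by move: st; rewrite zz t0 lm mul0r eqxx.
    have t0 : t = 0 by apply: bz; rewrite E2 l2 m2 y20; ring.
    by move: st; rewrite zz t0 eqxx.
  have /eqP : lam * mu * y.1 ^+ 3 = 0 by rewrite -zz E3 l1 m1; ring.
  rewrite mulf_eq0 expf_eq0 /= => /orP[/eqP lm|/eqP y10].
    have s0 : s = - (lam * mu * y.2 ^+ 3) by rewrite E0 l2 m2; ring.
    by move: st; rewrite zz s0 lm mul0r oppr0 eqxx.
  have s0 : s = 0 by apply: bz; rewrite E1 l1 m1 y10; ring.
  by move: st; rewrite zz s0 eqxx.
have fac2 := cubic_factors_rot fac; have fac3 := cubic_factors_rot fac2.
have /eqP := etrans (esym (discE fac)) d0; rewrite sqrf_eq0 mulf_eq0 mulf_eq0.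
case/orP => [/orP[]|] /eqP e.
- by apply: (fin u v z nu1 nu2 nu3) => //; rewrite -e; ring.
- apply: (fin z u v nu3 nu1 nu2) => //; first by rewrite -[RHS]oppr0 -e; ring.
  by move=> x0 x1 w; rewrite fS; ring.
apply: (fin v z u nu2 nu3 nu1) => //; first by rewrite -e; ring.
by move=> x0 x1 w; rewrite fS; ring.
Qed.

Section Smooth.
Hypothesis smF : smooth_form Fmp.

(** At a double root of c the form Q vanishes to order two on a whole plane, and this plane
    contains a singular point of the scroll. *)
Lemma smooth_c_sqfree : quartic_sqfree c0 c1 c2 c3 c4.
Proof.
move=> s t st es et; have [x [nu [x0 nu0 e2 e3 sx]]] := double_point st.
apply: (smF x0); apply/singular_along => v; rewrite along_Fmp dvdp_add //.
  by move/singular_along: sx; apply.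
rewrite along_Qmp; apply: dvdp_quartic.
  have : nu ^+ 3 * quartic_s c0 c1 c2 c3 c4 (x 0 o2) (x 0 o3) = 0.
    by rewrite -es e2 e3 /quartic_s; ring.
  by move/eqP; rewrite mulf_eq0 expf_eq0 (negbTE nu0) => /eqP.
have : nu ^+ 3 * quartic_t c0 c1 c2 c3 c4 (x 0 o2) (x 0 o3) = 0.
  by rewrite -et e2 e3 /quartic_t; ring.
by move/eqP; rewrite mulf_eq0 expf_eq0 (negbTE nu0) => /eqP.
Qed.

(** The part of the form without x0 and x1, as a binary quartic. *)
Definition phi1 := c1 - k ^+ 3 * (b ^+ 3 *+ 4).
Definition phi2 := c2 + k ^+ 3 * (b ^+ 4 + b ^+ 2 *+ 18 - 27%:R).
Definition phi3 := c3 - k ^+ 3 * (b ^+ 3 *+ 4).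

Lemma phiE s t : quartic c0 phi1 phi2 phi3 c4 s t =
  k ^+ 3 * disc s (b * s) (b * t) t + Q s t.
Proof. rewrite disc_quartic /quartic /phi1 /phi2 /phi3; ring. Qed.

(** At a double root the point (0 : 0 : s : t) is singular, all other terms of the equation
    being of degree at least two in (x0, x1). *)
Lemma smooth_phi_sqfree : quartic_sqfree c0 phi1 phi2 phi3 c4.
Proof.
move=> s t st es et; apply: (smF (x := pt4 0 0 s t)).
  by rewrite pt4_eq0 !eqxx /= negb_and.
apply/singular_along => v; rewrite along_Fmp along_Smp along_Qmp /= !pt4E.
have := @dvdp_quartic _ _ _ _ _ _ _ (v 0 o2) (v 0 o3) es et.
set X0 := _ + v 0 o0 *: _; set X1 := _ + v 0 o1 *: _.
set X2 := _ + v 0 o2 *: _; set X3 := _ + v 0 o3 *: _ => h.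
rewrite (_ : _ + _ = cubic X2 (b%:P * X2) (b%:P * X3) X3 X0 X1 +
   k%:P * hess X2 (b%:P * X2) (b%:P * X3) X3 X0 X1 +
   quartic c0%:P phi1%:P phi2%:P phi3%:P c4%:P X2 X3); last first.
  rewrite /Sf disc_quartic /quartic /phi1 /phi2 /phi3; ring.
rewrite dvdp_add // dvdp_add //.
  apply/dvdpP; exists (((v 0 o0)%:P ^+ 3 * X2 + b%:P * X2 * (v 0 o0)%:P ^+ 2 * (v 0 o1)%:P
    + b%:P * X3 * (v 0 o0)%:P * (v 0 o1)%:P ^+ 2 + X3 * (v 0 o1)%:P ^+ 3) * 'X).
  by rewrite /cubic /X0 /X1 -!mul_polyC; ring.
apply: dvdp_mull; apply/dvdpP.
exists (hess X2 (b%:P * X2) (b%:P * X3) X3 (v 0 o0)%:P (v 0 o1)%:P).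
by rewrite /hess /X0 /X1 -!mul_polyC; ring.
Qed.

(** Over a common zero of the discriminant and of c the plane section contains a
    double line; the derivative of the form transversal to the plane is a cubic
    along this line, and the surface is singular at a zero of it. *)
Lemma smooth_disc_c s t : (s != 0) || (t != 0) -> disc s (b * s) (b * t) t = 0 ->
  Q s t = 0 -> False.
Proof.
move=> st d0 q0.
have [u0 [u1 [nu [e0 [e1 [e2 [u nu0 [es et] J0 [_ fS]]]]]]]] := ramified_fibre st d0.
have [s' [t' d']] : exists s' t', s * t' - t * s' != 0.
  by case/orP: st => h; [exists 0, 1 | exists (-1), 0];
    rewrite ?mulr1 ?mulr0 ?subr0 // sub0r mulrN1 opprK.
pose a := s' * A u0 u1 + t' * B u0 u1.
have a0 : a != 0.
  apply: contraNneq d' => e; rewrite es et.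
  have -> : nu * B u0 u1 * t' - - (nu * A u0 u1) * s' = nu * a by rewrite /a; ring.
  by rewrite e mulr0.
pose h1 := hess (s + s') (b * (s + s')) (b * (t + t')) (t + t') u0 u1
  - hess s (b * s) (b * t) t u0 u1 - hess s' (b * s') (b * t') t' u0 u1.
pose qp := s' * quartic_s c0 phi1 phi2 phi3 c4 s t + t' * quartic_t c0 phi1 phi2 phi3 c4 s t.
have [m em] := @solve_monicpoly K 3 (fun i => nth 0 [:: - qp / a; 0; - k * h1 / a] i) isT.
rewrite !big_ord_recl big_ord0 /= /bump /= in em.
pose x := pt4 (m * u0) (m * u1) s t.
have x0 : x != 0 by rewrite pt4_eq0 !negb_and; case/orP: st => ->; rewrite !orbT.
apply: (smF x0).
pose d v := \sum_i v 0 i * ev Fmp^`M(i) x.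
have dD v v' c : d (v + c *: v') = d v + c * d v'.
  rewrite /d mulr_sumr -big_split; apply: eq_bigr => i _ /=; rewrite !mxE; ring.
have Fx : ev Fmp x = 0.
  have := Sf_plane b k (m * u0) (m * u1) s t 1; rewrite fS !mulr1 ev_Fmp4 q0 addr0 => ->; ring.
have dplane (y0 y1 w : K) : d (pt4 y0 y1 (s * w) (t * w)) = 0.
  rewrite /d -along_coef1.
  have -> : along Fmp x (pt4 y0 y1 (s * w) (t * w)) =
    'X^2 * ((1 + w *: 'X) * ((u0 * y1 - u1 * y0)%:P ^+ 2 *
      (e0%:P * ((m * u0)%:P + y0 *: 'X) + e1%:P * ((m * u1)%:P + y1 *: 'X) + e2%:P * (1 + w *: 'X)))).
    apply: poly_ext => z; rewrite horner_along pt4Z pt4D ev_Fmp4.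
    have -> : s + z * (s * w) = s * (1 + z * w) by ring.
    have -> : t + z * (t * w) = t * (1 + z * w) by ring.
    rewrite Sf_plane fS; have -> : Q (s * (1 + z * w)) (t * (1 + z * w)) = (1 + z * w) ^+ 4 * Q s t.
      rewrite /quartic; ring.
    by rewrite q0 !(hornerM, hornerD, hornerZ, horner_exp, hornerC, hornerX, hornerXn); ring.
  by rewrite coefXnM.
have dtrans : d (pt4 0 0 s' t') = 0.
  rewrite /d -along_coef1.
  have -> : along Fmp x (pt4 0 0 s' t') = (ev Fmp x)%:P + (m ^+ 3 * a + m ^+ 2 * k * h1 + qp)%:P * 'X
     + (k * m ^+ 2 * hess s' (b * s') (b * t') t' u0 u1)%:P * 'X^2 +
     (quartic c0%:P phi1%:P phi2%:P phi3%:P c4%:P (s%:P + s'%:P * 'X) (t%:P + t'%:P * 'X)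
      - (quartic c0 phi1 phi2 phi3 c4 s t)%:P - qp%:P * 'X).
    apply: poly_ext => z; rewrite horner_along pt4Z pt4D !ev_Fmp4.
    have [qq eqq] : exists q, q = quartic c0%:P phi1%:P phi2%:P phi3%:P c4%:P
       (s%:P + s'%:P * 'X) (t%:P + t'%:P * 'X) by eexists.
    rewrite -eqq !(hornerD, hornerN, hornerM, hornerC, hornerX, hornerXn).
    have -> : qq.[z] = quartic c0 phi1 phi2 phi3 c4 (s + s' * z) (t + t' * z).
      by rewrite eqq -horner_evalE rmorph_quartic /= !horner_evalE
        !(hornerD, hornerM, hornerC, hornerX).
    have qE (x0' x1' s1 t1 : K) : S x0' x1' s1 t1 + Q s1 t1 = cubic s1 (b * s1) (b * t1) t1 x0' x1' +
       k * hess s1 (b * s1) (b * t1) t1 x0' x1' + quartic c0 phi1 phi2 phi3 c4 s1 t1.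
      by rewrite phiE /Sf; ring.
    rewrite !qE [z * s']mulrC [z * t']mulrC.
    rewrite /a /h1 !cubic_cAB /cA /cB /hess; ring.
  have [r er] : exists r, quartic c0%:P phi1%:P phi2%:P phi3%:P c4%:P (s%:P + s'%:P * 'X)
      (t%:P + t'%:P * 'X) = (quartic c0 phi1 phi2 phi3 c4 s t)%:P + qp%:P * 'X + r * 'X^2.
    rewrite quartic_taylor; set r := (X in _ + X * 'X^2); exists r.
    rewrite /qp /quartic /quartic_s /quartic_t; ring.
  rewrite er Fx; set q := (quartic _ _ _ _ _ _ _)%:P.
  set h := (k * m ^+ 2 * _)%:P; set P1 := m ^+ 3 * a + _ + _.
  rewrite (_ : _ + _ + _ + _ = P1%:P * 'X + (h + r) * 'X^2); last by rewrite polyC0; ring.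
  rewrite coefD coefCM coefX mulr1 coefMXn /= addr0 /P1 em.
  by field.
have dall v : d v = 0.
  have -> : v = pt4 (v 0 o0) (v 0 o1) (s * ((v 0 o2 * t' - v 0 o3 * s') / (s * t' - t * s')))
     (t * ((v 0 o2 * t' - v 0 o3 * s') / (s * t' - t * s')))
     + ((s * v 0 o3 - t * v 0 o2) / (s * t' - t * s')) *: pt4 0 0 s' t'.
    by rewrite pt4Z pt4D {1}[v]row4E; congr pt4; rewrite ?mulr0 ?addr0 //; field.
  by rewrite dD dplane dtrans mulr0 addr0.
split=> // i; have := dall (delta_mx 0 i); rewrite /d (bigD1 i) //= big1 ?addr0.
  by rewrite mxE !eqxx mul1r.
by move=> j ji; rewrite mxE eqxx (negbTE ji) mul0r.
Qed.
End Smooth.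
End Nondegenerate.
End NormalForm.

(** * Planes through the line and their residual cubics *)

Section LinearForms.
Variables (K : closedFieldType) (n : nat).

Lemma linear_ev (L : {mpoly K[n]}) x : L \is 1.-homog ->
  ev L x = \sum_i x 0 i * ev L^`M(i) 0.
Proof.
move=> hL; rewrite -along_coef1.
have -> : along L 0 x = (ev L x)%:P * 'X.
  apply: poly_ext => t; rewrite horner_along add0r (ev_homog _ _ hL) expr1.
  by rewrite hornerM hornerC hornerX mulrC.
by rewrite coefMX coefC.
Qed.

Lemma smooth_form_lsub (N : 'M[K]_n) c (G : {mpoly K[n]}) : N \in unitmx -> c != 0 ->
  smooth_form G -> smooth_form (c *: lsub N G).
Proof.
move=> uN c0 sG x x0 [e0 e1]; apply: (sG (x *m N)); first by rewrite mul_unit_neq0.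
apply/(singular_lsub _ _ uN); split=> [|i].
  by move/eqP: e0; rewrite evZ mulf_eq0 (negbTE c0) => /eqP.
by move/eqP: (e1 i); rewrite mderivZ evZ mulf_eq0 (negbTE c0) => /eqP.
Qed.
End LinearForms.

Section Residual.
Variables (K : closedFieldType) (b k c0 c1 c2 c3 c4 : K).
Implicit Types s t : K.

Local Notation Q := (quartic c0 c1 c2 c3 c4).
Local Notation F := (Fmp b k c0 c1 c2 c3 c4).

Definition Gst s t : {mpoly K[3]} :=
  cubic s%:MP (b * s)%:MP (b * t)%:MP t%:MP 'X_r0 'X_r1
  + k%:MP * 'X_r2 * hess s%:MP (b * s)%:MP (b * t)%:MP t%:MP 'X_r0 'X_r1
  + (k ^+ 3 * disc s (b * s) (b * t) t + Q s t)%:MP * 'X_r2 ^+ 3.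

Lemma ev_Gst s t (x y w : K) : ev (Gst s t) (pt3 x y w) =
  cubic s (b * s) (b * t) t x y + k * w * hess s (b * s) (b * t) t x y
  + k ^+ 3 * w ^+ 3 * disc s (b * s) (b * t) t + Q s t * w ^+ 3.
Proof.
have aux (C H W : {mpoly K[3]}) d e p : ev (C + d%:MP * W * H + e%:MP * W ^+ 3) p =
    ev C p + d * ev W p * ev H p + e * ev W p ^+ 3.
  by rewrite !(evD, evM, evC).
rewrite aux evXU /ev (rmorph_cubic (meval _)) (rmorph_hess (meval _)) /= !mevalC !mevalXU !pt3E.
by ring.
Qed.

Lemma along_Gst s t (x y w x' y' w' : K) : along (Gst s t) (pt3 x y w) (pt3 x' y' w') =
  cubic s%:P (b * s)%:P (b * t)%:P t%:P (x%:P + x' *: 'X) (y%:P + y' *: 'X)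
  + k%:P * (w%:P + w' *: 'X) *
    hess s%:P (b * s)%:P (b * t)%:P t%:P (x%:P + x' *: 'X) (y%:P + y' *: 'X)
  + (k ^+ 3 * disc s (b * s) (b * t) t + Q s t)%:P * (w%:P + w' *: 'X) ^+ 3.
Proof.
have aux (C H W : {mpoly K[3]}) d e i : peval i (C + d%:MP * W * H + e%:MP * W ^+ 3) =
    peval i C + d%:P * peval i W * peval i H + e%:P * peval i W ^+ 3.
  by rewrite !(pevalD, pevalM, pevalC).
rewrite alongE aux pevalXU /peval (rmorph_cubic (mmap (@polyC K) _)).
by rewrite (rmorph_hess (mmap (@polyC K) _)) /= !mmapC !mmapX !mmap1U !pt3E.
Qed.

Lemma mul_Hst s t (x y w : K) : pt3 x y w *m Hst s t = pt4 x y (s * w) (t * w).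
Proof. by rewrite pt3_join3 !pt4Z !pt4D; congr pt4; ring. Qed.

Lemma restrict_Hst s t : restrict F (Hst s t) = 'X_r2 * Gst s t.
Proof.
apply: mpoly_ext => x; rewrite [x]row3E ev_restrict mul_Hst evM evXU pt3E ev_Gst.
rewrite ev_Fmp4 Sf_plane /quartic; ring.
Qed.

Lemma linear_X n (i : 'I_n) : linear_form ('X_i : {mpoly K[n]}).
Proof.
split; last by rewrite dhomogX /= mdeg1.
apply/eqP => /(congr1 (fun G => ev G (delta_mx 0 i))).
by rewrite evXU mxE !eqxx -mpolyC0 evC => /eqP; rewrite oner_eq0.
Qed.

Lemma residual_Hst s t : (s != 0) || (t != 0) -> residual_cubic F (E01 K) (Hst s t) (Gst s t).
Proof.
move=> st; exists 'X_r2; split; [exact: linear_X | | exact: restrict_Hst].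
move=> x; rewrite [x]row3E mul_Hst => /sub_E01; rewrite !pt4E /zeros evXU pt3E => -[e1 e2].
by case/orP: st => h; apply: (mulfI h); rewrite ?e1 ?e2 mulr0.
Qed.

Lemma Hst_plane s t : (s != 0) || (t != 0) -> pencil_plane (E01 K) (Hst s t).
Proof.
move=> st; split.
  apply/eqP; change (row_free (Hst s t)); apply: inj_row_free => v.
  rewrite [v]row3E mul_Hst -pt4_0 => /pt4_inj[-> -> e2 e3].
  have -> : v 0 r2 = 0; last exact: pt3_0.
  by case/orP: st => h; apply: (mulfI h); rewrite ?e2 ?e3 mulr0.
rewrite join2_sub; apply/andP; split; apply/sub_join3.
  by exists 1, 0, 0; rewrite !pt4Z !pt4D; congr pt4; ring.
by exists 0, 1, 0; rewrite !pt4Z !pt4D; congr pt4; ring.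
Qed.

Lemma sub_Hst s t (x : 'rV[K]_4) : (s != 0) || (t != 0) ->
  (x <= Hst s t)%MS <-> t * x 0 o2 = s * x 0 o3.
Proof.
move=> st; split.
  by move=> /sub_join3[a [c [d ->]]]; rewrite !mxE /=; ring.
move=> e; have [w [e2 e3]] := prop2 st e.
apply/sub_join3; exists (x 0 o0), (x 0 o1), w.
by rewrite {1}[x]row4E !pt4Z !pt4D e2 e3; congr pt4; ring.
Qed.

Lemma pencil_planeP (H : 'M[K]_(3, 4)) : pencil_plane (E01 K) H ->
  exists s t (N : 'M[K]_3), [/\ (s != 0) || (t != 0), N \in unitmx, H = N *m Hst s t &
    (H == Hst s t)%MS].
Proof.
move=> [rH eH].
have [i hi] : exists i, ~~ (row i H <= E01 K)%MS.
  apply/existsP; apply: contraT; rewrite negb_exists => /forallP h.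
  have : (H <= E01 K)%MS by apply/row_subP => i; have := h i; rewrite negbK.
  by move/mxrankS; rewrite rH (E01_line K).
pose s := H i o2; pose t := H i o3.
have st : (s != 0) || (t != 0).
  apply: contraNT hi; rewrite negb_or !negbK => /andP[/eqP s0 /eqP t0].
  by apply/sub_E01; rewrite !mxE.
have [rHst _] := Hst_plane st.
have sH : (Hst s t <= H)%MS.
  rewrite join3_sub; move: (eH); rewrite join2_sub => /andP[h0 h1]; rewrite h0 h1 /=.
  have -> : pt4 0 0 s t = row i H - H i o0 *: pt4 1 0 0 0 - H i o1 *: pt4 0 1 0 0.
    by rewrite [row i H]row4E !mxE -!scaleNr !pt4Z !pt4D; congr pt4; rewrite /s /t; ring.
  by rewrite !addmx_sub ?row_sub // eqmx_opp scalemx_sub.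
have eqH : (Hst s t == H)%MS by rewrite sH /= -(geq_leqif (mxrank_leqif_sup sH)) rH rHst.
have /andP[_ /submxP[N eN]] := eqH.
exists s, t, N; split=> //; last by rewrite andbC.
rewrite -row_free_unit /row_free eqn_leq rank_leq_row /= -[X in (X <= _)%N]rH eN.
exact: mxrankM_maxl.
Qed.

(** The residual cubic is determined up to a change of coordinates in the plane,
    because the equation of the line in the plane is determined up to a scalar. *)
Lemma residual_unique (F' : {mpoly K[4]}) (G' : K -> K -> {mpoly K[3]}) (H : 'M[K]_(3, 4)) G :
  (forall s t, restrict F' (Hst s t) = 'X_r2 * G' s t) ->
  pencil_plane (E01 K) H -> residual_cubic F' (E01 K) H G ->
  exists s t N c, [/\ (s != 0) || (t != 0), N \in unitmx, c != 0, H = N *m Hst s t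
    & G = c *: lsub N (G' s t)].
Proof.
move=> rF pH [h [[h0 lh] vh eF]].
have [s [t [N [st uN eH eqH]]]] := pencil_planeP pH.
pose h' := lsub (invmx N) h.
have hE x : ev h' x = x 0 r2 * ev h'^`M(r2) 0.
  have lh' : h' \is 1.-homog by exact: lsub_homog.
  have v0 (y0 y1 : K) : ev h' (pt3 y0 y1 0) = 0.
    rewrite ev_lsub; apply: vh; rewrite eH mulmxA mulmxKV // mul_Hst.
    by apply/sub_E01; rewrite !pt4E !mulr0.
  have lin (y : 'rV_3) : ev h' y = y 0 r0 * ev h'^`M(r0) 0 + y 0 r1 * ev h'^`M(r1) 0
      + y 0 r2 * ev h'^`M(r2) 0 by rewrite linear_ev // big_ord3 /= addrA.
  have := v0 1 0; rewrite lin !pt3E !mul0r mul1r !addr0 => d0.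
  have := v0 0 1; rewrite lin !pt3E !mul0r mul1r add0r addr0 => d1.
  by rewrite lin d0 d1 !mulr0 !add0r.
have eh : h = ev h'^`M(r2) 0 *: lsub N 'X_r2.
  apply: mpoly_ext => x; rewrite evZ ev_lsub evXU mulrC -hE ev_lsub mulmxK //.
set c := ev _ 0 in eh.
have cn0 : c != 0 by apply: contraNneq h0 => c0'; rewrite eh c0' scale0r.
exists s, t, N, c^-1; split=> //; first by rewrite invr_eq0.
have X0 : lsub N 'X_r2 != 0 by apply: contraNneq h0 => e; rewrite eh e scaler0.
have : lsub N 'X_r2 * lsub N (G' s t) = h * G.
  by rewrite -lsubM -rF -eF eH /restrict -!/(lsub _ _) lsub_comp.
rewrite eh -scalerAl scalerAr => /(mulfI X0) ->.
by rewrite scalerA mulVf // scale1r.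
Qed.

Lemma residualP (H : 'M[K]_(3, 4)) G :
  pencil_plane (E01 K) H -> residual_cubic F (E01 K) H G ->
  exists s t N c, [/\ (s != 0) || (t != 0), N \in unitmx, c != 0, H = N *m Hst s t
    & G = c *: lsub N (Gst s t)].
Proof. by apply: residual_unique => s t; apply: restrict_Hst. Qed.

End Residual.

(** * The fibres of the pencil *)

Lemma hess_root (R : comNzRingType) (c0 c1 c2 c3 p1 q1 p2 q2 p3 q3 : R) :
  cubic_factors c0 c1 c2 c3 p1 q1 p2 q2 p3 q3 ->
  hess c0 c1 c2 c3 q1 (- p1) = - ((p2 * q1 - p1 * q2) * (p3 * q1 - p1 * q3)) ^+ 2.
Proof. by case=> -> -> -> ->; rewrite /hess; ring. Qed.

Lemma hess_disc (R : comNzRingType) (c0 c1 c2 c3 p1 q1 p2 q2 : R) :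
  c0 * c2 *+ 3 - c1 ^+ 2 = p1 * p2 -> c0 * c3 *+ 9 - c1 * c2 = p1 * q2 + q1 * p2 ->
  c1 * c3 *+ 3 - c2 ^+ 2 = q1 * q2 ->
  (p1 * q2 - p2 * q1) ^+ 2 = - (disc c0 c1 c2 c3 *+ 3).
Proof.
move=> e0 e1 e2.
have -> : (p1 * q2 - p2 * q1) ^+ 2 = (p1 * q2 + q1 * p2) ^+ 2 - (p1 * p2) * (q1 * q2) *+ 4 by ring.
by rewrite -e0 -e1 -e2 /disc; ring.
Qed.

Section PathParam.
Variable K : closedFieldType.

Lemma path_param n m (Z : 'rV[K]_n -> Prop) (T : 'I_n -> {mpoly K[m]}) :
  (forall p, Z (\row_i ev (T i) p)) ->
  forall p q, path_between Z (\row_i ev (T i) p) (\row_i ev (T i) q).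
Proof.
move=> hZ p q; exists (fun i => along (T i) p (q - p)); split=> [t||].
- rewrite (_ : \row_i _ = \row_i ev (T i) (p + t *: (q - p))) //.
  by apply/rowP => i; rewrite !mxE horner_along.
- by apply/rowP => i; rewrite !mxE horner_along scale0r addr0.
by apply/rowP => i; rewrite !mxE horner_along scale1r addrC subrK.
Qed.

Lemma solve2 (u0 u1 v0 v1 a c : K) : u0 * v1 - u1 * v0 != 0 ->
  exists x y, u0 * y - u1 * x = a /\ v0 * y - v1 * x = c.
Proof.
move=> d; exists ((a * v0 - c * u0) / (u0 * v1 - u1 * v0)),
  ((a * v1 - c * u1) / (u0 * v1 - u1 * v0)).
by split; field.
Qed.

Lemma bracket0 (u0 u1 v0 v1 x y : K) : u0 * v1 - u1 * v0 != 0 ->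
  u0 * y - u1 * x = 0 -> v0 * y - v1 * x = 0 -> x = 0 /\ y = 0.
Proof.
move=> d e1 e2; split; apply: (mulfI d); rewrite mulr0.
  have -> : (u0 * v1 - u1 * v0) * x = (u0 * y - u1 * x) * v0 - (v0 * y - v1 * x) * u0 by ring.
  by rewrite e1 e2 !mul0r subrr.
have -> : (u0 * v1 - u1 * v0) * y = (u0 * y - u1 * x) * v1 - (v0 * y - v1 * x) * u1 by ring.
by rewrite e1 e2 !mul0r subrr.
Qed.

Lemma line_through n (m : 'M[K]_(2, n)) p : is_line m -> p != 0 -> (p <= m)%MS ->
  exists r, [/\ (r <= m)%MS, is_line (join2 p r) & (join2 p r == m)%MS].
Proof.
move=> lm p0 pm.
have [i hi] : exists i, ~~ (row i m <= p)%MS.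
  apply/existsP; apply: contraT; rewrite negb_exists => /forallP h.
  have /mxrankS : (m <= p)%MS by apply/row_subP => i; have := h i; rewrite negbK.
  by rewrite lm => /leq_trans/(_ (rank_leq_row p)).
have lj : is_line (join2 p (row i m)).
  apply/is_line_join2 => a c e.
  have c0 : c = 0.
    apply: contraNeq hi => c0; apply/sub_rVP; exists (- a / c).
    have -> : row i m = c^-1 *: (a *: p + c *: row i m - a *: p).
      by rewrite addrAC subrr add0r scalerA mulVf // scale1r.
    by rewrite e sub0r scalerN scalerA -scaleNr; congr (_ *: _); field.
  move: e; rewrite c0 scale0r addr0 => /eqP; rewrite scaler_eq0 (negbTE p0) orbF => /eqP.
  by [].
exists (row i m); rewrite row_sub; split=> //.
by apply: line_eq_join2 => //; apply: row_sub.
Qed.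

Lemma dvdp_X3 (a : K) (q : {poly K}) : 'X^3 %| 'X^2 * (a%:P + 'X * q) <-> a = 0.
Proof.
split=> [|->]; last by rewrite add0r mulrA -exprSr dvdp_mulr.
rewrite exprSr dvdp_mul2l ?expf_neq0 ?polyX_eq0 //.
have -> : 'X = 'X - 0%:P :> {poly K} by rewrite subr0.
rewrite dvdp_XsubCl rootE hornerD hornerM hornerD hornerN hornerX !hornerC subrr mul0r addr0.
by move/eqP.
Qed.

End PathParam.

Section Fibres.
Variables (K : closedFieldType) (b k c0 c1 c2 c3 c4 : K).
Hypotheses (n2 : (2%:R : K) != 0) (n3 : (3%:R : K) != 0).
Hypotheses (b0 : b != 0) (b1 : b ^+ 2 != 1) (b9 : b ^+ 2 != 9%:R).
Variables (s t : K).
Hypothesis st : (s != 0) || (t != 0).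

Local Notation Q := (quartic c0 c1 c2 c3 c4 s t).
Local Notation G := (Gst b k c0 c1 c2 c3 c4 s t).
Local Notation D := (disc s (b * s) (b * t) t).
Local Notation C := (cubic s (b * s) (b * t) t).
Local Notation H := (hess s (b * s) (b * t) t).

(** The three lines of the fibre of the scroll; a1, a2, a3 are the coefficients of
    the linear relation between the three forms in x and y. *)
Lemma fibre_product : exists u0 u1 v0 v1 z0 z1,
  let a1 := v0 * z1 - v1 * z0 in let a2 := z0 * u1 - z1 * u0 in
  let a3 := u0 * v1 - u1 * v0 in
  [/\ D = (a1 * a2 * a3) ^+ 2,
     cubic_factors s (b * s) (b * t) t (- u1) u0 (- v1) v0 (- z1) z0 &
     forall x y w, C x y + k * w * H x y + k ^+ 3 * w ^+ 3 * D =
       (u0 * y - u1 * x + k * (a2 * a3) * w) * (v0 * y - v1 * x + k * (a3 * a1) * w) *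
       (z0 * y - z1 * x + k * (a1 * a2) * w)].
Proof.
have [u [v [z [_ _ _ fac [nu1 [nu2 [nu3 [[_ _ R1] [_ _ R2] [_ _ R3] fS]]]]]]]] :=
  fibre_lines k b1 st.
exists u.1, u.2, v.1, v.2, z.1, z.2; split=> //; first by rewrite (discE fac); ring.
move=> x y w; rewrite fS -!(mulrA k) R1 R2 R3; ring.
Qed.

Definition lin3 e0 e1 e2 : {mpoly K[3]} := e0%:MP * 'X_r0 + e1%:MP * 'X_r1 + e2%:MP * 'X_r2.

Lemma ev_lin3 e0 e1 e2 (x y w : K) :
  ev (lin3 e0 e1 e2) (pt3 x y w) = e0 * x + e1 * y + e2 * w.
Proof. by rewrite !evD !evM !evC !evXU !pt3E. Qed.

Lemma lin3_form e0 e1 e2 : (e0 != 0) || (e1 != 0) -> linear_form (lin3 e0 e1 e2).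
Proof.
move=> e; split; last first.
  by apply: homog_ev => c x; rewrite [x]row3E pt3Z !ev_lin3; ring.
apply: contraTneq e => l0; have := ev_lin3 e0 e1 e2 1 0 0; have := ev_lin3 e0 e1 e2 0 1 0.
by rewrite l0 -mpolyC0 !evC !mulr0 !mulr1 !addr0 add0r => <- <-; rewrite eqxx.
Qed.

(** The lines T1, T2, T3 satisfy a1 T1 + a2 T2 + a3 T3 = 3 k a1 a2 a3 w.  So w = 0 at a common
    point of them unless k = 0, but on w = 0 they meet in distinct points. *)
Lemma fibre_three_lines : D != 0 -> Q = 0 -> exists2 l : 'I_3 -> {mpoly K[3]},
  three_lines G l & (exists2 x : 'rV[K]_3, x != 0 & forall i, zeros (l i) x) <-> k = 0.
Proof.
move=> D0 Q0; have [u0 [u1 [v0 [v1 [z0 [z1 [eD fac fS]]]]]]] := fibre_product.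
set a1 := _ - v1 * z0 in eD fS; set a2 := _ - z1 * u0 in eD fS; set a3 := _ - u1 * v0 in eD fS.
have : a1 * a2 * a3 != 0 by apply: contraNneq D0 => e; rewrite eD e expr0n.
rewrite !mulf_eq0 !negb_or -andbA => /and3P[n1 n2' n3'].
pose l (i : 'I_3) := nth 0 [:: lin3 (- u1) u0 (k * (a2 * a3)); lin3 (- v1) v0 (k * (a3 * a1));
  lin3 (- z1) z0 (k * (a1 * a2))] i.
have bra p q r p' q' r' : p * q' - q * p' != 0 -> ~ proportional (lin3 (- q) p r) (lin3 (- q') p' r').
  move=> hd [c _ e]; case/eqP: hd.
  have := ev_lin3 (- q) p r 1 0 0; have := ev_lin3 (- q) p r 0 1 0.
  rewrite e !evZ !ev_lin3 !mulr0 !mulr1 !addr0 !add0r => <- /eqP.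
  rewrite mulrN eqr_opp => /eqP <-; ring.
have neg p q : p - q != 0 -> q - p != 0 by rewrite -opprB oppr_eq0.
have neq0 p q p' q' : p * q' - q * p' != 0 -> (- q != 0) || (p != 0).
  apply: contraTT; rewrite !negb_or !negbK oppr_eq0 => /andP[/eqP-> /eqP->].
  by rewrite !mul0r subrr.
exists l; first split.
- apply: ord3P; apply: lin3_form; [exact: neq0 n3' | exact: neq0 n1 | exact: neq0 n2'].
- apply: ord3P; apply: ord3P => //= _; apply: bra => //.
  + by apply: contraNneq n2' => e; apply/eqP; rewrite /a2 -[RHS]oppr0 -e; ring.
  + by apply: contraNneq n3' => e; apply/eqP; rewrite /a3 -[RHS]oppr0 -e; ring.
  + by apply: contraNneq n1 => e; apply/eqP; rewrite /a1 -[RHS]oppr0 -e; ring.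
- apply: mpoly_ext => x; rewrite [x]row3E ev_prod big_ord3 /= !ev_lin3 ev_Gst fS Q0; ring.
split=> [[x x0 lx]|k0]; last first.
  exists (pt3 0 0 1); first by rewrite pt3_eq0 !eqxx oner_eq0.
  by apply: ord3P; rewrite /zeros ev_lin3 k0; ring.
have h0 := lx r0; have h1 := lx r1; have h2 := lx r2.
rewrite /zeros [x]row3E !ev_lin3 in h0 h1 h2.
apply/eqP; apply: contraNT x0 => k0.
have w0 : x 0 r2 = 0.
  have : 3%:R * k * (a1 * a2 * a3) * x 0 r2 = 0.
    have -> : 3%:R * k * (a1 * a2 * a3) * x 0 r2 =
      a1 * (- u1 * x 0 r0 + u0 * x 0 r1 + k * (a2 * a3) * x 0 r2)
      + a2 * (- v1 * x 0 r0 + v0 * x 0 r1 + k * (a3 * a1) * x 0 r2)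
      + a3 * (- z1 * x 0 r0 + z0 * x 0 r1 + k * (a1 * a2) * x 0 r2).
      by rewrite /a1 /a2 /a3; ring.
    by rewrite h0 h1 h2; ring.
  move/eqP; rewrite !mulf_eq0 (negbTE n3) (negbTE k0) (negbTE n1) (negbTE n2') (negbTE n3') /=.
  by move/eqP.
have [x00 x10] : x 0 r0 = 0 /\ x 0 r1 = 0.
  by apply: (bracket0 n3'); [rewrite -h0 | rewrite -h1]; rewrite w0; ring.
by rewrite [x]row3E x00 x10 w0 pt3_0.
Qed.

Lemma fibre_I3 : D != 0 -> k != 0 -> Q = 0 -> kodaira_type G I_3.
Proof.
move=> D0 k0 /(fibre_three_lines D0)[l tl hl]; exists l => // /hl e.
by rewrite e eqxx in k0.
Qed.

Lemma fibre_IV : D != 0 -> k = 0 -> Q = 0 -> kodaira_type G IV.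
Proof. by move=> D0 k0 /(fibre_three_lines D0)[l tl hl]; exists l => //; apply/hl. Qed.

(** Write G = T1 T2 T3 + Q w ^ 3.  If k is not zero, the three forms are coordinates and
    a1 T1 + a2 T2 + a3 T3 = 3 k a1 a2 a3 w, so at a singular point the products T2 T3, T3 T1,
    T1 T2 are proportional to a1, a2, a3; this leaves one point, where the derivative of G
    vanishes only if k ^ 3 D + Q = 0.  If k = 0, the fibre is the cyclic cubic C + Q w ^ 3. *)
Lemma fibre_smooth : D != 0 -> Q != 0 -> (k = 0) \/ (k ^+ 3 * D + Q != 0) -> smooth_form G.
Proof.
move=> D0 Q0 hk x x0 /singular_along sx.
have [u0 [u1 [v0 [v1 [z0 [z1 [eD fac fS]]]]]]] := fibre_product.
set a1 := _ - v1 * z0 in eD fS; set a2 := _ - z1 * u0 in eD fS; set a3 := _ - u1 * v0 in eD fS.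
have : a1 * a2 * a3 != 0 by apply: contraNneq D0 => e; rewrite eD e expr0n.
rewrite !mulf_eq0 !negb_or -andbA => /and3P[n1 n2' n3'].
pose T1 (x y w : K) := u0 * y - u1 * x + k * (a2 * a3) * w.
pose T2 (x y w : K) := v0 * y - v1 * x + k * (a3 * a1) * w.
pose T3 (x y w : K) := z0 * y - z1 * x + k * (a1 * a2) * w.
move: x0 sx; rewrite [x]row3E; set X := x 0 r0; set Y := x 0 r1; set W := x 0 r2 => x0 sx.
have T_rel x' y' w' : a1 * T1 x' y' w' + a2 * T2 x' y' w' + a3 * T3 x' y' w' =
    3%:R * k * (a1 * a2 * a3) * w' by rewrite /T1 /T2 /T3 /a1 /a2 /a3; ring.
have dG x' y' w' : T1 x' y' w' * T2 X Y W * T3 X Y W + T1 X Y W * T2 x' y' w' * T3 X Y W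
    + T1 X Y W * T2 X Y W * T3 x' y' w' + 3%:R * Q * W ^+ 2 * w' = 0.
  have := sx (pt3 x' y' w').
  have -> : along G (pt3 X Y W) (pt3 x' y' w') =
    ((T1 X Y W)%:P + T1 x' y' w' *: 'X) * ((T2 X Y W)%:P + T2 x' y' w' *: 'X)
      * ((T3 X Y W)%:P + T3 x' y' w' *: 'X) + Q%:P * (W%:P + w' *: 'X) ^+ 3.
    apply: poly_ext => r; rewrite horner_along pt3Z pt3D ev_Gst fS.
    rewrite !(hornerD, hornerM, hornerZ, hornerC, hornerX, horner_exp).
    by rewrite /T1 /T2 /T3; ring.
  case/dvdpP => q e; have := congr1 (fun p : {poly K} => p`_1) e.
  rewrite coefMXn /= => <-.
  have -> : forall A1 A2 A3 A4 B1 B2 B3 B4 q0 : K,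
    (A1%:P + B1 *: 'X) * (A2%:P + B2 *: 'X) * (A3%:P + B3 *: 'X) + q0%:P * (A4%:P + B4 *: 'X) ^+ 3
    = (A1 * A2 * A3 + q0 * A4 ^+ 3)%:P + (B1 * A2 * A3 + A1 * B2 * A3 + A1 * A2 * B3
        + 3%:R * q0 * A4 ^+ 2 * B4)%:P * 'X
      + ((B1 * B2 * A3 + B1 * A2 * B3 + A1 * B2 * B3 + 3%:R * q0 * A4 * B4 ^+ 2)%:P
         + (B1 * B2 * B3 + q0 * B4 ^+ 3)%:P * 'X) * 'X^2.
    by move=> *; rewrite -!mul_polyC; ring.
  by rewrite coefD coefMXn /= addr0 coefD coefC /= add0r coefCM coefX mulr1.
have done0 : T1 X Y W = 0 -> T2 X Y W = 0 -> W = 0 -> False.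
  rewrite /T1 /T2 => e1 e2 W0; rewrite W0 !mulr0 !addr0 in e1 e2.
  have [X0 Y0] := bracket0 n3' e1 e2.
  by move: x0; rewrite X0 Y0 W0 pt3_0 eqxx.
case: (eqVneq k 0) hk => [k0 _|k0 [/eqP|phi0]]; last first.
- pose rho := Q * W ^+ 2 / (k * (a1 * a2 * a3)).
  have d0 : 3%:R * k * (a1 * a2 * a3) != 0 by rewrite !mulf_neq0.
  have dual y1 y2 y3 : exists x' y' w', [/\ T1 x' y' w' = y1, T2 x' y' w' = y2,
     T3 x' y' w' = y3 & w' = (a1 * y1 + a2 * y2 + a3 * y3) / (3%:R * k * (a1 * a2 * a3))].
    pose w' := (a1 * y1 + a2 * y2 + a3 * y3) / (3%:R * k * (a1 * a2 * a3)).
    have [x' [y' [ex ey]]] := @solve2 K u0 u1 v0 v1 (y1 - k * (a2 * a3) * w')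
      (y2 - k * (a3 * a1) * w') n3'.
    have e1 : T1 x' y' w' = y1 by rewrite /T1 ex subrK.
    have e2 : T2 x' y' w' = y2 by rewrite /T2 ey subrK.
    exists x', y', w'; split=> //; apply: (mulfI n3').
    have := T_rel x' y' w'; rewrite e1 e2.
    have -> : 3%:R * k * (a1 * a2 * a3) * w' = a1 * y1 + a2 * y2 + a3 * y3.
      by rewrite /w' mulrC divfK.
    by move/addrI.
  have r1 : T2 X Y W * T3 X Y W = - (a1 * rho).
    have [x' [y' [w' [e1 e2 e3 ew]]]] := dual 1 0 0; have := dG x' y' w'.
    rewrite e1 e2 e3 ew !mulr0 !mul0r !addr0 mul1r mulr1 => /eqP; rewrite addr_eq0 => /eqP ->.
    by rewrite /rho; field; rewrite ?n3 ?k0 ?n1 ?n2' ?n3'.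
  have r2 : T1 X Y W * T3 X Y W = - (a2 * rho).
    have [x' [y' [w' [e1 e2 e3 ew]]]] := dual 0 1 0; have := dG x' y' w'.
    rewrite e1 e2 e3 ew !mulr0 !mul0r !addr0 !add0r !mulr1 => /eqP; rewrite addr_eq0 => /eqP ->.
    by rewrite /rho; field; rewrite ?n3 ?k0 ?n1 ?n2' ?n3'.
  have r3 : T1 X Y W * T2 X Y W = - (a3 * rho).
    have [x' [y' [w' [e1 e2 e3 ew]]]] := dual 0 0 1; have := dG x' y' w'.
    rewrite e1 e2 e3 ew !mulr0 !mul0r !add0r !mulr1 => /eqP; rewrite addr_eq0 => /eqP ->.
    by rewrite /rho; field; rewrite ?n3 ?k0 ?n1 ?n2' ?n3'.
  have rel := T_rel X Y W.
  have [W0|W0] := eqVneq W 0.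
    have rho0 : rho = 0 by rewrite /rho W0 expr0n /= mulr0 mul0r.
    have rel0 : a1 * T1 X Y W + a2 * T2 X Y W + a3 * T3 X Y W = 0 by rewrite rel W0 mulr0.
    move: r1 r2 r3 rel0; rewrite rho0 !mulr0 oppr0.
    move=> /eqP; rewrite mulf_eq0 => /orP[]/eqP e2.
      move=> /eqP; rewrite mulf_eq0 => /orP[]/eqP e1 _; first by move=> _; apply: done0.
      rewrite e2 e1 !mulr0 !addr0 => /eqP; rewrite mulf_eq0 (negbTE n1) /= => /eqP e.
      exact: done0.
    move=> _ /eqP; rewrite mulf_eq0 => /orP[]/eqP e1; rewrite e2 e1 !mulr0 ?addr0 ?add0r => /eqP;
      rewrite mulf_eq0 ?(negbTE n1) ?(negbTE n2') /= => /eqP e; exact: done0.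
  have rho0 : rho != 0 by rewrite /rho !mulf_neq0 ?invr_eq0 ?expf_neq0 // !mulf_neq0.
  have T30 : T3 X Y W != 0.
    by apply: contraNneq rho0 => e; move/eqP: r1; rewrite e mulr0 eq_sym oppr_eq0 mulf_eq0 (negbTE n1).
  have T10 : T1 X Y W != 0.
    by apply: contraNneq rho0 => e; move/eqP: r3; rewrite e mul0r eq_sym oppr_eq0 mulf_eq0 (negbTE n3').
  have e12 : a1 * T1 X Y W = a2 * T2 X Y W.
    apply: (mulIf T30); rewrite -!mulrA r1 r2; ring.
  have e23 : a2 * T2 X Y W = a3 * T3 X Y W.
    apply: (mulIf T10); rewrite -!mulrA [T2 _ _ _ * _]mulrC [T3 _ _ _ * _]mulrC r3 r2; ring.
  have eT : a1 * T1 X Y W = k * (a1 * a2 * a3) * W.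
    by apply: (mulfI n3); rewrite !mulrA in rel *; rewrite -rel -e23 -e12; ring.
  have : (a1 * T1 X Y W) * (a2 * T2 X Y W) = - (Q * W ^+ 2 / k).
    have -> : (a1 * T1 X Y W) * (a2 * T2 X Y W) = a1 * a2 * (T1 X Y W * T2 X Y W) by ring.
    by rewrite r3 /rho; field; rewrite k0 n1 n2' n3'.
  rewrite -e12 eT => e; case/eqP: phi0.
  have WW : k^-1 * W ^+ 2 != 0 by rewrite mulf_neq0 ?invr_eq0 ?expf_neq0.
  apply: (mulIf WW); rewrite mul0r eD mulrDl.
  have -> : k ^+ 3 * (a1 * a2 * a3) ^+ 2 * (k^-1 * W ^+ 2) =
     k * (a1 * a2 * a3) * W * (k * (a1 * a2 * a3) * W) by field.
  by rewrite e; field.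
- by rewrite (negbTE k0).
have W0 : W = 0.
  have := dG 0 0 1; rewrite /T1 /T2 /T3 k0 => /eqP.
  rewrite (_ : _ + _ = 3%:R * Q * W ^+ 2); last by ring.
  by rewrite !mulf_eq0 (negbTE n3) (negbTE Q0) /= orbb => /eqP.
have G0 : T1 X Y W * T2 X Y W * T3 X Y W = 0.
  have /singular_along[G00 _] := sx.
  by rewrite -[RHS]G00 ev_Gst fS /T1 /T2 /T3 W0; ring.
have [x1 [y1 [e1 e2]]] := @solve2 K u0 u1 v0 v1 1 0 n3'.
have [x2 [y2 [e1' e2']]] := @solve2 K u0 u1 v0 v1 0 1 n3'.
have t1 : T1 x1 y1 0 = 1 by rewrite /T1 e1 mulr0 addr0.
have t2 : T2 x1 y1 0 = 0 by rewrite /T2 e2 mulr0 addr0.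
have t1' : T1 x2 y2 0 = 0 by rewrite /T1 e1' mulr0 addr0.
have t2' : T2 x2 y2 0 = 1 by rewrite /T2 e2' mulr0 addr0.
have d1 : T2 X Y W * T3 X Y W + T1 X Y W * T2 X Y W * T3 x1 y1 0 = 0.
  by rewrite -[RHS](dG x1 y1 0) t1 t2; ring.
have d2 : T1 X Y W * T3 X Y W + T1 X Y W * T2 X Y W * T3 x2 y2 0 = 0.
  by rewrite -[RHS](dG x2 y2 0) t1' t2'; ring.
have rel : a1 * T1 X Y W + a2 * T2 X Y W + a3 * T3 X Y W = 0 by rewrite T_rel W0 mulr0.
move/eqP: G0; rewrite !mulf_eq0 => /orP[/orP[]|] /eqP e.
- move: d1; rewrite e !mul0r addr0 => /eqP; rewrite mulf_eq0 => /orP[]/eqP e'; first exact: done0.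
  move: rel; rewrite e e' !mulr0 add0r addr0 => /eqP; rewrite mulf_eq0 (negbTE n2') => /eqP e''.
  exact: done0.
- move: d2; rewrite e mulr0 !mul0r addr0 => /eqP; rewrite mulf_eq0 => /orP[]/eqP e'; first exact: done0.
  move: rel; rewrite e e' !mulr0 !addr0 => /eqP; rewrite mulf_eq0 (negbTE n1) => /eqP e''.
  exact: done0.
move: d1; rewrite e mulr0 add0r => /eqP; rewrite mulf_eq0 => /orP[].
  rewrite mulf_eq0 => /orP[]/eqP e'; move: rel; rewrite e e' !mulr0 ?addr0 ?add0r => /eqP;
    rewrite mulf_eq0 ?(negbTE n1) ?(negbTE n2') => /eqP e''; exact: done0.
move=> /eqP tz; exfalso.
(* The third form cannot be constant in this direction: a1 T1 + a3 T3 = 0. *)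
have := T_rel x1 y1 0; rewrite t1 t2 tz !mulr0 !addr0 mulr1.
by move/eqP; rewrite (negbTE n1).
Qed.

End Fibres.

Section SpecialFibres.
Variables (K : closedFieldType) (b k c0 c1 c2 c3 c4 : K).
Hypotheses (n2 : (2%:R : K) != 0) (n3 : (3%:R : K) != 0).
Hypotheses (b0 : b != 0) (b1 : b ^+ 2 != 1) (b9 : b ^+ 2 != 9%:R).
Variables (s t : K).
Hypothesis st : (s != 0) || (t != 0).

Local Notation Q := (quartic c0 c1 c2 c3 c4 s t).
Local Notation G := (Gst b k c0 c1 c2 c3 c4 s t).
Local Notation D := (disc s (b * s) (b * t) t).
Local Notation C := (cubic s (b * s) (b * t) t).
Local Notation H := (hess s (b * s) (b * t) t).

Lemma Gst_homog : G \is 3.-homog.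
Proof.
apply: homog_ev => c x; rewrite [x]row3E pt3Z !ev_Gst /cubic /hess; ring.
Qed.

Lemma msize_homog n d (p : {mpoly K[n]}) : p \is d.-homog -> (msize p <= d.+1)%N.
Proof.
move=> /dhomogP hp; rewrite msizeE; apply/bigmax_leqP_seq => m /hp /= -> _.
exact: leqnn.
Qed.

Lemma cubic_hess_coprime (x y : K) : D != 0 -> C x y = 0 -> H x y = 0 -> x = 0 /\ y = 0.
Proof.
move=> D0; have [u0 [u1 [v0 [v1 [z0 [z1 [eD fac _]]]]]]] := fibre_product k b1 st.
rewrite (cubicE _ _ fac) => /eqP C0 h0.
have : (v0 * z1 - v1 * z0) * (z0 * u1 - z1 * u0) * (u0 * v1 - u1 * v0) != 0.
  by apply: contraNneq D0 => e; rewrite eD e expr0n.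
rewrite !mulf_eq0 !negb_or -andbA => /and3P[n1 n2' n3'].
have fin p1 q1 p2 q2 p3 q3 : cubic_factors s (b * s) (b * t) t p1 q1 p2 q2 p3 q3 ->
    (p2 * q1 - p1 * q2) * (p3 * q1 - p1 * q3) != 0 -> p1 * x + q1 * y = 0 -> x = 0 /\ y = 0.
  move=> f h e.
  have n : (q1 != 0) || (- p1 != 0).
    apply: contraTT h; rewrite oppr_eq0 negb_or !negbK => /andP[/eqP -> /eqP ->].
    by rewrite !mulr0 !mul0r !subrr mul0r eqxx.
  have [|m [ex ey]] := @prop2 K q1 (- p1) x y n.
    by apply/subr0_eq; rewrite -[RHS]oppr0 -e; ring.
  have : m ^+ 2 * H q1 (- p1) = 0 by rewrite -h0 ex ey /hess; ring.
  rewrite (hess_root f) mulrN => /eqP; rewrite oppr_eq0 mulf_eq0 !expf_eq0 /= (negbTE h) orbF.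
  by move=> /eqP m0; rewrite ex ey m0 !mul0r.
have neg p q : p - q != 0 -> q - p != 0 by rewrite -opprB oppr_eq0.
move: C0; rewrite !mulf_eq0 => /orP[/orP[]|] /eqP e.
- apply: (fin _ _ _ _ _ _ fac) => //; apply: mulf_neq0.
    by rewrite (_ : _ - _ = - (u0 * v1 - u1 * v0)) ?oppr_eq0 //; ring.
  by rewrite (_ : _ - _ = z0 * u1 - z1 * u0) //; ring.
- apply: (fin _ _ _ _ _ _ (cubic_factors_rot fac)) => //; apply: mulf_neq0.
    by rewrite (_ : _ - _ = - (v0 * z1 - v1 * z0)) ?oppr_eq0 //; ring.
  by rewrite (_ : _ - _ = u0 * v1 - u1 * v0) //; ring.
apply: (fin _ _ _ _ _ _ (cubic_factors_rot (cubic_factors_rot fac))) => //; apply: mulf_neq0.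
  by rewrite (_ : _ - _ = - (z0 * u1 - z1 * u0)) ?oppr_eq0 //; ring.
by rewrite (_ : _ - _ = v0 * z1 - v1 * z0) //; ring.
Qed.

(** The three points of the fibre on ell, which are distinct because the binary cubic has
    nonzero discriminant; v is a direction off them. *)
Lemma cubic_three_points : D != 0 -> exists (p v : K * K) (rs : seq K),
  [/\ uniq rs, size rs = 3%N, forall r, r \in rs -> C (p.1 + r * v.1) (p.2 + r * v.2) = 0
    & C v.1 v.2 != 0].
Proof.
move=> D0; have [u0 [u1 [v0 [v1 [z0 [z1 [eD fac _]]]]]]] := fibre_product k b1 st.
have : (v0 * z1 - v1 * z0) * (z0 * u1 - z1 * u0) * (u0 * v1 - u1 * v0) != 0.
  by apply: contraNneq D0 => e; rewrite eD e expr0n.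
rewrite !mulf_eq0 !negb_or -andbA => /and3P[n1 n2' n3'].
have [f0 _ _ f3] := fac.
have uniq3 (x y z : K) : x != y -> y != z -> z != x -> uniq [:: x; y; z].
  by move=> h1 h2 h3; rewrite /= !inE negb_or h1 h2 eq_sym h3.
case/orP: st => [s0|t0].
  have : (u1 != 0) && (v1 != 0) && (z1 != 0).
    by move: s0; rewrite f0 !mulf_eq0 !negb_or !oppr_eq0.
  case/andP => /andP[nu nv] nz.
  exists (0, 1), (1, 0), [:: u0 / u1; v0 / v1; z0 / z1]; split=> //=.
  - have ne (a1 a2 d1 d2 : K) : a2 != 0 -> d2 != 0 -> a1 * d2 - a2 * d1 != 0 -> a1 / a2 != d1 / d2.
      move=> h1 h2; apply: contraNneq => e.
      have -> : a1 * d2 - a2 * d1 = a2 * d2 * (a1 / a2 - d1 / d2) by field; rewrite h1 h2.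
      by rewrite e subrr mulr0.
    by apply: uniq3; apply: ne.
  - move=> r; rewrite !inE (cubicE _ _ fac) => /or3P[] /eqP ->; field; by [].
  by rewrite /cubic; move: s0; apply: contraNneq => e; rewrite -e; apply/eqP; ring.
have : (u0 != 0) && (v0 != 0) && (z0 != 0).
  by move: t0; rewrite f3 !mulf_eq0 !negb_or.
case/andP => /andP[nu nv] nz.
exists (1, 0), (0, 1), [:: u1 / u0; v1 / v0; z1 / z0]; split=> //=.
- have ne (a1 a2 d1 d2 : K) : a1 != 0 -> d1 != 0 -> a1 * d2 - a2 * d1 != 0 -> a2 / a1 != d2 / d1.
    move=> h1 h2; apply: contraNneq => e.
    have -> : a1 * d2 - a2 * d1 = - (a1 * d1 * (a2 / a1 - d2 / d1)) by field; rewrite h1 h2.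
    by rewrite e subrr mulr0 oppr0.
  by apply: uniq3; apply: ne.
- move=> r; rewrite !inE (cubicE _ _ fac) => /or3P[] /eqP ->; field; by [].
by rewrite /cubic; move: t0; apply: contraNneq => e; rewrite -e; apply/eqP; ring.
Qed.

(** The plane cubic C + k w H is linear in w, so it is rational; its only singular
    point is (0, 0, 1), where the Hessian form H is the tangent cone. *)
Lemma fibre_I1 : D != 0 -> k != 0 -> k ^+ 3 * D + Q = 0 -> kodaira_type G I_1.
Proof.
move=> D0 k0 phi0.
have evG (x y w : K) : ev G (pt3 x y w) = C x y + k * w * H x y.
  rewrite ev_Gst; have -> : Q = - (k ^+ 3 * D) by rewrite -[LHS](addKr (k ^+ 3 * D)) phi0 addr0.
  ring.
have [p1 [q1 [p2 [q2 [h0 h1 h2]]]]] := quadratic_split (s * (b * t) *+ 3 - (b * s) ^+ 2)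
  (s * t *+ 9 - b * s * (b * t)) (b * s * t *+ 3 - (b * t) ^+ 2).
have HE x y : H x y = (p1 * x + q1 * y) * (p2 * x + q2 * y).
  by rewrite /hess h0 h1 h2; ring.
have d12 : p1 * q2 - p2 * q1 != 0.
  have := hess_disc h0 h1 h2; move/eqP; apply: contraTneq => ->.
  by rewrite expr0n eq_sym oppr_eq0 -mulr_natr mulf_neq0.
split.
  have [p [v [rs [urs srs rrs Cv]]]] := cubic_three_points D0.
  have alE r : (along G (pt3 p.1 p.2 0) (pt3 v.1 v.2 0)).[r] = C (p.1 + r * v.1) (p.2 + r * v.2).
    by rewrite horner_along pt3Z pt3D evG; ring.
  apply: (@irreducible_path _ _ 3 G (pt3 p.1 p.2 0) (pt3 v.1 v.2 0) rs) => //.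
  - exact: msize_homog Gst_homog.
  - pose T (i : 'I_3) : {mpoly K[3]} := nth 0
      [:: 'X_r2 * k%:MP * hess s%:MP (b * s)%:MP (b * t)%:MP t%:MP 'X_r0 'X_r1 * 'X_r0;
          'X_r2 * k%:MP * hess s%:MP (b * s)%:MP (b * t)%:MP t%:MP 'X_r0 'X_r1 * 'X_r1;
          - 'X_r2 * cubic s%:MP (b * s)%:MP (b * t)%:MP t%:MP 'X_r0 'X_r1] i.
    have TE x y w : \row_i ev (T i) (pt3 x y w) =
        pt3 (w * k * H x y * x) (w * k * H x y * y) (- w * C x y).
      have aux (A1 A2 A3 A4 : {mpoly K[3]}) z : ev (A1 * A2 * A3 * A4) z = ev A1 z * ev A2 z * ev A3 z * ev A4 z.
        by rewrite !evM.
      have aux2 (A1 A2 : {mpoly K[3]}) z : ev (- A1 * A2) z = - ev A1 z * ev A2 z.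
        by rewrite evM /ev mevalN.
      apply/rowP; apply: ord3P; rewrite [LHS]mxE pt3E /= ?aux ?aux2 !evXU ?evC /ev
        ?(rmorph_hess (meval _)) ?(rmorph_cubic (meval _)) /= ?mevalC ?mevalXU !pt3E //.
    have TZ z : zeros G (\row_i ev (T i) z).
      by rewrite [z]row3E TE /zeros evG /cubic /hess; ring.
    have TS x : zeros G x -> exists z, x = \row_i ev (T i) z.
      rewrite [x]row3E /zeros evG; set X := x 0 r0; set Y := x 0 r1; set W := x 0 r2 => e.
      have [H0|H0] := eqVneq (H X Y) 0.
        move: e; rewrite H0 mulr0 addr0 => CXY.
        have [X0 Y0] := cubic_hess_coprime D0 CXY H0.
        have Hq : H q1 (- p1) = 0 by rewrite HE; ring.
        have Cq : C q1 (- p1) != 0.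
          apply: contraNneq d12 => Cq; have [-> /eqP] := cubic_hess_coprime D0 Cq Hq.
          by rewrite oppr_eq0 => /eqP ->; rewrite mul0r mulr0 subrr.
        exists (pt3 q1 (- p1) (- W / C q1 (- p1))); rewrite TE Hq X0 Y0.
        by congr pt3; field.
      exists (pt3 X Y (k * H X Y)^-1); rewrite TE; congr pt3; try by field; rewrite ?k0 ?H0.
      have -> : C X Y = - (k * W * H X Y) by rewrite -[LHS](addrK (k * W * H X Y)) e add0r.
      by field; rewrite k0 H0.
    by move=> x y /TS[z ->] /TS[z' ->]; apply: path_param.
  - apply: contraNneq Cv => e.
    have : forall r, C (p.1 + r * v.1) (p.2 + r * v.2) = 0 by move=> r; rewrite -alE e horner0.
    move=> all0; apply/eqP.
    have : (C v.1 v.2)%:P * 'X^3 + ((3%:R * s * p.1 * v.1 ^+ 2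
        + b * s * (p.2 * v.1 ^+ 2 + 2%:R * p.1 * v.1 * v.2) + b * t * (p.1 * v.2 ^+ 2
        + 2%:R * p.2 * v.2 * v.1) + 3%:R * t * p.2 * v.2 ^+ 2)%:P * 'X^2 +
        (3%:R * s * p.1 ^+ 2 * v.1 + b * s * (p.1 ^+ 2 * v.2 + 2%:R * p.1 * p.2 * v.1)
         + b * t * (p.2 ^+ 2 * v.1 + 2%:R * p.1 * p.2 * v.2) + 3%:R * t * p.2 ^+ 2 * v.2)%:P * 'X
         + (C p.1 p.2)%:P) = 0.
      apply: poly_ext0 => r; rewrite -[RHS](all0 r).
      by rewrite !(hornerD, hornerM, hornerC, hornerXn, hornerX) /cubic; ring.
    move/(congr1 (fun q : {poly K} => q`_3)).
    by rewrite !(coefD, coefCM, coefXn, coefX, coefC, coef0) /= mulr1 !mulr0 !addr0.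
  by apply/allP => r /rrs h; rewrite rootE alE h.
exists (pt3 0 0 1).
have p0 : pt3 0 0 1 != 0 :> 'rV[K]_3 by rewrite pt3_eq0 oner_eq0 !andbF.
have alE (x y w : K) : along G (pt3 0 0 1) (pt3 x y w) =
    'X^2 * ((k * H x y)%:P + 'X * (C x y + k * w * H x y)%:P).
  apply: poly_ext => r; rewrite horner_along pt3Z pt3D evG.
  by rewrite !(hornerD, hornerM, hornerC, hornerXn, hornerX) /cubic /hess; ring.
have al3 x y w : 'X^3 %| along G (pt3 0 0 1) (pt3 x y w) <-> H x y = 0.
  rewrite alE dvdp_X3; split=> [/eqP|->]; last by rewrite mulr0.
  by rewrite mulf_eq0 (negbTE k0) => /eqP.
have pm q p : is_line (join2 (pt3 0 0 1) (pt3 q (- p) 0)) <-> (q != 0) || (p != 0).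
  split=> [/is_line_join2 h|h].
    apply: contraT; rewrite negb_or !negbK => /andP[/eqP q0 /eqP p0'].
    have [|_ /eqP] := h 0 1; last by rewrite oner_eq0.
    by rewrite !pt3Z pt3D q0 p0' -pt3_0; congr pt3; ring.
  apply/is_line_join2 => a c; rewrite !pt3Z pt3D -pt3_0 => /pt3_inj[e1 e2 e3].
  have c0' : c = 0.
    by case/orP: h => h; apply: (mulIf h); [rewrite mul0r -e1 | rewrite mul0r -[RHS]oppr0 -e2]; ring.
  by split=> //; rewrite -e3; ring.
have n1' : (q1 != 0) || (p1 != 0).
  by apply: contraTT d12; rewrite negb_or !negbK => /andP[/eqP-> /eqP->]; rewrite mul0r mulr0 subrr.
have n2' : (q2 != 0) || (p2 != 0).
  by apply: contraTT d12; rewrite negb_or !negbK => /andP[/eqP-> /eqP->]; rewrite mul0r mulr0 subrr.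
split=> //.
  split=> [v|h]; first by rewrite [v]row3E alE dvdp_mulr.
  have dn : q1 * - p2 - - p1 * q2 != 0 by rewrite (_ : _ - _ = p1 * q2 - p2 * q1) //; ring.
  have [x [y [e1 e2]]] := solve2 1 1 dn.
  have := h (pt3 x y 0); rewrite al3 HE.
  have -> : (p1 * x + q1 * y) * (p2 * x + q2 * y) = (q1 * y - - p1 * x) * (q2 * y - - p2 * x) by ring.
  by rewrite e1 e2 mul1r => /eqP; rewrite oner_eq0.
exists (join2 (pt3 0 0 1) (pt3 q1 (- p1) 0)), (join2 (pt3 0 0 1) (pt3 q2 (- p2) 0)); split.
- exact/pm.
- exact/pm.
- apply/negP => /andP[h _]; move: h; rewrite join2_sub => /andP[_ /sub_join2[a [c]]].
  rewrite !pt3Z pt3D => /pt3_inj[e1 e2 _]; case/eqP: d12.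
  have -> : p1 = c * p2 by apply: oppr_inj; rewrite e2; ring.
  by rewrite e1; ring.
move=> m lm; split.
  move=> [pm' im]; have [r [rm lj ej]] := line_through lm p0 pm'.
  have := im r rm; rewrite [r]row3E al3 HE => /eqP.
  have rr : (r 0 r0 != 0) || (r 0 r1 != 0).
    apply: contraT; rewrite negb_or !negbK => /andP[/eqP x0 /eqP y0].
    have /is_line_join2 h := lj; have [|_ /eqP] := h (- r 0 r2) 1; last by rewrite oner_eq0.
    by rewrite {2}[r]row3E x0 y0 !pt3Z pt3D -pt3_0; congr pt3; ring.
  have fin p q : (q != 0) || (p != 0) -> p * r 0 r0 + q * r 0 r1 = 0 ->
      (m == join2 (pt3 0 0 1) (pt3 q (- p) 0))%MS.
    move=> qp e; rewrite andbC; apply: line_eq_join2 => //; first exact/pm.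
    rewrite -(eqmxP ej); apply/sub_join2.
    have [|a [ea ec]] := @prop2 K (r 0 r0) (r 0 r1) q (- p) rr.
      by apply/subr0_eq; rewrite -[RHS]e; ring.
    exists (- (a * r 0 r2)), a; rewrite {2}[r]row3E !pt3Z pt3D ea ec; congr pt3; ring.
  by rewrite mulf_eq0 => /orP[]/eqP e; [left | right]; apply: fin.
have back p q : H q (- p) = 0 -> (m == join2 (pt3 0 0 1) (pt3 q (- p) 0))%MS -> imult_ge m G (pt3 0 0 1) 3.
  move=> Hq /eqmxP em; split.
    by rewrite em; apply/sub_join2; exists 1, 0; rewrite !pt3Z pt3D; congr pt3; ring.
  move=> v; rewrite em => /sub_join2[a [c ->]]; rewrite !pt3Z pt3D al3.
  have -> : H (a * 0 + c * q) (a * 0 + c * - p) = c ^+ 2 * H q (- p) by rewrite /hess; ring.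
  by rewrite Hq mulr0.
by case; apply: back; rewrite HE; ring.
Qed.

End SpecialFibres.

Section CuspidalFibre.
Variables (K : closedFieldType) (b k c0 c1 c2 c3 c4 : K).
Hypotheses (n2 : (2%:R : K) != 0) (n3 : (3%:R : K) != 0).
Hypotheses (b0 : b != 0) (b1 : b ^+ 2 != 1) (b9 : b ^+ 2 != 9%:R).
Variables (s t : K).
Hypothesis st : (s != 0) || (t != 0).

Local Notation Q := (quartic c0 c1 c2 c3 c4 s t).
Local Notation G := (Gst b k c0 c1 c2 c3 c4 s t).
Local Notation D := (disc s (b * s) (b * t) t).

Lemma cube_root (z : K) : exists a, a ^+ 3 = z.
Proof.
have [a ea] := @solve_monicpoly K 3 (fun i => nth 0 [:: z; 0; 0] i) isT.
by exists a; move: ea; rewrite !big_ord_recl big_ord0 /= /bump /= => ->; ring.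
Qed.

(** A fibre with a double tangent line is the cuspidal cubic L1 ^ 2 L3 + Q w ^ 3
    in independent linear forms L1, L3, w, parametrised by L1 = a ^ 3,
    L3 = - Q c ^ 3, w = a ^ 2 c. *)
Lemma fibre_II : D = 0 -> Q != 0 -> kodaira_type G II.
Proof.
move=> D0 Q0; have [u0 [u1 [_ [e0 [e1 [e2 [u _ _ _ [E0 fS]]]]]]]] := ramified_fibre k b0 b1 b9 st D0.
have [E eE] : exists E, E = e0 * u0 + e1 * u1 by eexists.
have [I eI] : exists I, I * E = 1 by exists E^-1; rewrite mulVf // eE.
rewrite -eE in E0.
have evG (x y w : K) : ev G (pt3 x y w) =
    (u0 * y - u1 * x) ^+ 2 * (e0 * x + e1 * y + e2 * w) + Q * w ^+ 3 by rewrite ev_Gst fS.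
split.
  pose X1 (l1 l3 : K) := (u0 * l3 - e1 * l1) * I.
  pose Y1 (l1 l3 : K) := (u1 * l3 + e0 * l1) * I.
  have X1Y1 l1 l3 : u0 * Y1 l1 l3 - u1 * X1 l1 l3 = l1 /\ e0 * X1 l1 l3 + e1 * Y1 l1 l3 = l3.
    have -> : u0 * Y1 l1 l3 - u1 * X1 l1 l3 = I * (e0 * u0 + e1 * u1) * l1 by rewrite /X1 /Y1; ring.
    have -> : e0 * X1 l1 l3 + e1 * Y1 l1 l3 = I * (e0 * u0 + e1 * u1) * l3 by rewrite /X1 /Y1; ring.
    by rewrite -eE eI !mul1r.
  have X1K (x y : K) : X1 (u0 * y - u1 * x) (e0 * x + e1 * y) = x /\
      Y1 (u0 * y - u1 * x) (e0 * x + e1 * y) = y.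
    have -> : X1 (u0 * y - u1 * x) (e0 * x + e1 * y) = I * (e0 * u0 + e1 * u1) * x by rewrite /X1; ring.
    have -> : Y1 (u0 * y - u1 * x) (e0 * x + e1 * y) = I * (e0 * u0 + e1 * u1) * y by rewrite /Y1; ring.
    by rewrite -eE eI !mul1r.
  pose L3 : {mpoly K[3]} := (- Q)%:MP * 'X_r1 ^+ 3 + (- e2)%:MP * ('X_r0 ^+ 2 * 'X_r1).
  pose T (i : 'I_3) : {mpoly K[3]} := nth 0
    [:: (u0%:MP * L3 + (- e1)%:MP * 'X_r0 ^+ 3) * I%:MP;
        (u1%:MP * L3 + e0%:MP * 'X_r0 ^+ 3) * I%:MP; 'X_r0 ^+ 2 * 'X_r1] i.
  have evL3 a c d : ev L3 (pt3 a c d) = - Q * c ^+ 3 - e2 * (a ^+ 2 * c).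
    by rewrite !(evD, evM, evC, evXU) !pt3E; ring.
  have TE a c d : \row_i ev (T i) (pt3 a c d) =
      pt3 (X1 (a ^+ 3) (- Q * c ^+ 3 - e2 * (a ^+ 2 * c)))
          (Y1 (a ^+ 3) (- Q * c ^+ 3 - e2 * (a ^+ 2 * c))) (a ^+ 2 * c).
    have aux e f (A : {mpoly K[3]}) z : ev ((e%:MP * L3 + f%:MP * A) * I%:MP) z =
      (e * ev L3 z + f * ev A z) * I by rewrite !(evD, evM, evC).
    apply/rowP; apply: ord3P; rewrite [LHS]mxE pt3E /= ?aux ?evL3 ?evX ?evM ?evXU ?pt3E; rewrite /X1 /Y1; ring.
  have TZ z : zeros G (\row_i ev (T i) z).
    rewrite [z]row3E TE /zeros evG.
    have [-> ->] := X1Y1 ((z 0 r0) ^+ 3) (- Q * (z 0 r1) ^+ 3 - e2 * ((z 0 r0) ^+ 2 * z 0 r1)).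
    ring.
  have TS x : zeros G x -> exists z, x = \row_i ev (T i) z.
    rewrite [x]row3E /zeros evG; set X := x 0 r0; set Y := x 0 r1; set W := x 0 r2 => e.
    suff [a [c [ea ec ew]]] : exists a c, [/\ u0 * Y - u1 * X = a ^+ 3,
        e0 * X + e1 * Y + e2 * W = - Q * c ^+ 3 & W = a ^+ 2 * c].
      exists (pt3 a c 0); rewrite TE -ew -ec -ea addrK.
      by have [-> ->] := X1K X Y.
    have [a ea] := cube_root (u0 * Y - u1 * X).
    rewrite -ea in e *; have [a0|a0] := eqVneq a 0.
      have [c ec] := cube_root (- (e0 * X + e1 * Y + e2 * W) / Q).
      exists a, c; split=> //; first by rewrite ec; field.
      move: e; rewrite a0 !expr0n /= !mul0r add0r => /eqP.
      by rewrite mulf_eq0 (negbTE Q0) expf_eq0 => /eqP.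
    exists a, (W / a ^+ 2); split=> //; last by field.
    apply: (mulfI (expf_neq0 2 (expf_neq0 3 a0))).
    by rewrite -[LHS](addrK (Q * W ^+ 3)) e add0r; field.
  pose p := pt3 (- e1 * I) (e0 * I) 0; pose v := pt3 (u0 * (- Q - e2) * I) (u1 * (- Q - e2) * I) 1.
  have alE r : (along G p v).[r] = Q * (r ^+ 3 - r).
    rewrite horner_along pt3Z pt3D evG.
    have -> : u0 * (e0 * I + r * (u1 * (- Q - e2) * I)) - u1 * (- e1 * I + r * (u0 * (- Q - e2) * I))
       = I * (e0 * u0 + e1 * u1) by ring.
    have -> : e0 * (- e1 * I + r * (u0 * (- Q - e2) * I)) + e1 * (e0 * I + r * (u1 * (- Q - e2) * I))
        + e2 * (0 + r * 1) = r * (I * (e0 * u0 + e1 * u1)) * (- Q - e2) + e2 * r by ring.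
    by rewrite -eE eI; ring.
  apply: (@irreducible_path _ _ 3 G p v [:: 0; 1; -1]) => //.
  - exact: msize_homog (Gst_homog _ _ _ _ _ _ _ _ _).
  - by move=> x y /TS[z ->] /TS[z' ->]; apply: path_param.
  - apply/eqP => e; have := alE 2%:R; rewrite e horner0 => /esym/eqP.
    have -> : Q * (2%:R ^+ 3 - 2%:R) = Q * (2%:R * 3%:R) by ring.
    by rewrite !mulf_eq0 (negbTE Q0) (negbTE n2) (negbTE n3).
  - rewrite /= !inE !negb_or eq_sym oner_eq0 eq_sym oppr_eq0 oner_eq0 /= andbT.
    by rewrite -addr_eq0.
  apply/allP => r; rewrite !inE rootE alE => /or3P[] /eqP ->; apply/eqP; ring.
exists (pt3 u0 u1 0).
have p0 : pt3 u0 u1 0 != 0 :> 'rV[K]_3 by rewrite pt3_eq0 !negb_and eqxx orbF.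
have alE (x y w : K) : along G (pt3 u0 u1 0) (pt3 x y w) = 'X^2 *
    (((u0 * y - u1 * x) ^+ 2 * E)%:P +
      'X * ((u0 * y - u1 * x) ^+ 2 * (e0 * x + e1 * y + e2 * w) + Q * w ^+ 3)%:P).
  apply: poly_ext => r; rewrite horner_along pt3Z pt3D evG.
  by rewrite !(hornerD, hornerM, hornerC, hornerXn, hornerX) eE; ring.
have al3 x y w : 'X^3 %| along G (pt3 u0 u1 0) (pt3 x y w) <-> u0 * y - u1 * x = 0.
  rewrite alE dvdp_X3; split=> [/eqP|->]; last by rewrite expr0n mul0r.
  by rewrite mulf_eq0 (negbTE E0) orbF expf_eq0 => /eqP.
have lm1 : is_line (join2 (pt3 u0 u1 0) (pt3 0 0 1)).
  apply/is_line_join2 => a c; rewrite !pt3Z pt3D -pt3_0 => /pt3_inj[f1 f2 f3].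
  split; last by rewrite -f3; ring.
  by case/orP: u => h; apply: (mulIf h); rewrite mul0r; [rewrite -f1 | rewrite -f2]; ring.
split=> //.
  split=> [v|h]; first by rewrite [v]row3E alE dvdp_mulr.
  have := h (pt3 (- e1) e0 0); rewrite al3.
  have -> : u0 * e0 - u1 * - e1 = E by rewrite eE; ring.
  by apply/eqP.
exists (join2 (pt3 u0 u1 0) (pt3 0 0 1)) => // m lm; split.
  move=> [pm im]; have [r [rm lj ej]] := line_through lm p0 pm.
  have := im r rm; rewrite [r]row3E al3 => e.
  have [|a [ea ec]] := @prop2 K u0 u1 (r 0 r0) (r 0 r1) u.
    by apply/subr0_eq; rewrite -[RHS]oppr0 -e; ring.
  have r20 : r 0 r2 != 0.
    apply/eqP => r20; have /is_line_join2 h := lj; have [|_ /eqP] := h (- a) 1; last by rewrite oner_eq0.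
    by rewrite [r]row3E ea ec r20 !pt3Z pt3D -pt3_0; congr pt3; ring.
  rewrite andbC; apply: line_eq_join2 => //; rewrite -(eqmxP ej); apply/sub_join2.
  exists (- a / r 0 r2), (r 0 r2)^-1; rewrite {3}[r]row3E !pt3Z pt3D ea ec.
  by congr pt3; field.
move=> /eqmxP em; split.
  by rewrite em; apply/sub_join2; exists 1, 0; rewrite !pt3Z pt3D; congr pt3; ring.
by move=> v; rewrite em => /sub_join2[a [c ->]]; rewrite !pt3Z pt3D al3; ring.
Qed.
End CuspidalFibre.

(** * The list of the singular fibres *)

Section KodairaSingular.
Variable K : closedFieldType.

Lemma kodaira_not_smooth (G : {mpoly K[3]}) T : kodaira_type G T -> ~ smooth_form G.
Proof.
have dbl p : p != 0 -> mult_eq G p 2 -> ~ smooth_form G.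
  by move=> p0 [m2 _] sG; apply: (sG p p0); apply/singular_along.
have prod2 (q l r : {mpoly K[3]}) p : G = q * l * r -> p != 0 -> ev q p = 0 -> ev l p = 0 ->
    ~ smooth_form G.
  move=> -> p0 q0 l0 sG; apply: (sG p p0); split=> [|i]; first by rewrite !evM q0 !mul0r.
  by rewrite !mderivM !evD !evM evD !evM q0 l0; ring.
have meet (l1 l2 : {mpoly K[3]}) : linear_form l1 -> linear_form l2 ->
    exists2 p, p != 0 & ev l1 p = 0 /\ ev l2 p = 0.
  move=> [_ h1] [_ h2].
  pose M : 'M[K]_(3, 2) := \matrix_(i, j) (if j == 0 then ev l1^`M(i) 0 else ev l2^`M(i) 0).
  have : kermx M != 0.
    by rewrite kermx_eq0 /row_free neq_ltn (leq_ltn_trans (rank_leq_col M)).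
  case/rowV0Pn => p /sub_kermxP pM p0; exists p => //.
  rewrite !linear_ev //; split.
    by have /rowP/(_ 0) := pM; rewrite !mxE => {2}<-; apply: eq_bigr => i _; rewrite !mxE.
  by have /rowP/(_ 1) := pM; rewrite !mxE => {2}<-; apply: eq_bigr => i _; rewrite !mxE.
case: T => /=.
- by case=> _ [p [p0 m2 _]]; exact: (dbl p).
- move=> [q [l [[_ _ _ eG] [p1 [p2 [p0 _ _ h]]]]]].
  have /(h p1 p0).2 [q0 l0] : (p1 == p1)%MS \/ (p1 == p2)%MS by left; rewrite submx_refl.
  by apply: (prod2 q l 1 p1) => //; rewrite mulr1.
- move=> [l [lf _ eG] _]; have [p p0 [e1 e2]] := meet _ _ (lf r0) (lf r1).
  by apply: (prod2 (l r0) (l r1) (l r2) p) => //; rewrite eG big_ord3 /= mulrA.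
- by case=> _ [p [p0 m2 _]]; exact: (dbl p).
- move=> [q [l [[_ _ _ eG] [p1 p0 h]]]].
  have /(h p1 p0).2 [q0 l0] : (p1 == p1)%MS by rewrite submx_refl.
  by apply: (prod2 q l 1 p1) => //; rewrite mulr1.
move=> [l [lf _ eG] _]; have [p p0 [e1 e2]] := meet _ _ (lf r0) (lf r1).
by apply: (prod2 (l r0) (l r1) (l r2) p) => //; rewrite eG big_ord3 /= mulrA.
Qed.

(** Each plane of the first list carries a singular fibre, so it is one of the planes of
    the second list, and distinct planes give distinct entries. *)
Lemma singular_fibers_leq (F : {mpoly K[4]}) ell l l' :
  has_singular_fibers F ell l -> has_singular_fibers F ell l' -> (size l <= size l')%N.
Proof.
move=> [H [pH dH kH _]] [H' [_ _ _ cH']].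
have h i : exists j, (H i == H' j)%MS.
  by have [G rG /kodaira_not_smooth sG] := kH i; apply: cH' rG sG.
pose f i := xchoose (h i).
have fP i : (H i == H' (f i))%MS by exact: xchooseP (h i).
have /leq_card : injective f; last by rewrite !card_ord.
move=> i j e; apply/eqP; apply: contraT => /dH /negP[].
by apply/eqmxP; apply: eqmx_trans (eqmxP (fP i)) _; rewrite e; apply: eqmx_sym; apply/eqmxP.
Qed.
End KodairaSingular.

Section FibreLists.
Variables (K : closedFieldType) (b k c0 c1 c2 c3 c4 : K).
Hypotheses (n2 : (2%:R : K) != 0) (n3 : (3%:R : K) != 0).
Hypotheses (b0 : b != 0) (b1 : b ^+ 2 != 1) (b9 : b ^+ 2 != 9%:R).

Local Notation Q := (quartic c0 c1 c2 c3 c4).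
Local Notation F := (Fmp b k c0 c1 c2 c3 c4).
Local Notation G := (Gst b k c0 c1 c2 c3 c4).
Hypothesis smF : smooth_form F.

Lemma Hst_eq (s t s' t' : K) : (s != 0) || (t != 0) -> (s' != 0) || (t' != 0) ->
  (Hst s t == Hst s' t')%MS = (s * t' - t * s' == 0).
Proof.
move=> st st'; apply/idP/eqP => [/andP[h _]|e].
  have : (pt4 0 0 s t <= Hst s' t')%MS.
    by apply: submx_trans h; apply/sub_join3; exists 0, 0, 1; rewrite !pt4Z !pt4D; congr pt4; ring.
  by move/(sub_Hst _ st'); rewrite !pt4E => e; rewrite mulrC e; ring.
have [rH _] := Hst_plane st; have [rH' _] := Hst_plane st'.
have sub : (Hst s t <= Hst s' t')%MS.
  rewrite join3_sub; apply/and3P; split; apply/(sub_Hst _ st'); rewrite !pt4E; try ring.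
  by apply/subr0_eq; rewrite -[RHS]e; ring.
by rewrite sub -(geq_leqif (mxrank_leqif_sup sub)) rH rH'.
Qed.

Lemma prod_root (p q : 'I_4 -> K) s t : \prod_i (p i * s + q i * t) = 0 ->
  exists i, p i * s + q i * t = 0.
Proof.
by move/eqP; rewrite prodf_seq_eq0 => /hasP[i _ /= /eqP e]; exists i.
Qed.

Lemma fibre_list_aux (T : seq kodaira) (P : seq (K * K)) : size T = size P ->
  (forall z, z \in P -> (z.1 != 0) || (z.2 != 0)) ->
  pairwise (fun z z' : K * K => z.1 * z'.2 - z.2 * z'.1 != 0) P ->
  (forall i, (i < size T)%N -> kodaira_type (G (nth (0, 0) P i).1 (nth (0, 0) P i).2) (nth I_1 T i)) ->
  (forall s t, (s != 0) || (t != 0) -> ~ smooth_form (G s t) ->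
     exists2 z, z \in P & s * z.2 - t * z.1 = 0) ->
  has_singular_fibers F (E01 K) T.
Proof.
move=> sTP P0 dP kP cP.
pose z (i : 'I_(size T)) := nth (0, 0) P i.
have zP i : z i \in P by rewrite mem_nth // -sTP.
exists (fun i => Hst (z i).1 (z i).2); split.
- by move=> i; apply: Hst_plane; apply: P0.
- have lt (i j : 'I_(size T)) : (i < j)%N -> ~~ (Hst (z i).1 (z i).2 == Hst (z j).1 (z j).2)%MS.
    move=> ij; rewrite Hst_eq ?P0 //.
    by have /pairwiseP := dP => /(_ (0, 0)) h; apply: h => //; rewrite inE -sTP.
  move=> i j; rewrite neq_ltn => /orP[/lt // | /lt].
  by apply: contra; rewrite andbC.
- move=> i; exists (G (z i).1 (z i).2); first by apply: residual_Hst; apply: P0.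
  by rewrite (tnth_nth I_1); apply: kP.
move=> H' G' pH' rG' nG'.
have [s [t [N [c [st uN cn0 eHN eG]]]]] := residualP pH' rG'.
have eH : (H' == Hst s t)%MS by rewrite eHN; apply/eqmxP/eqmxMfull; rewrite row_full_unit.
have nG : ~ smooth_form (G s t) by move=> sG; apply: nG'; rewrite eG; apply: smooth_form_lsub.
have [z' z'P ez] := cP s t st nG.
have /(nthP (0, 0))[i iP ei] := z'P; rewrite -sTP in iP.
exists (Ordinal iP); rewrite /z /= ei.
apply/eqmxP; apply: eqmx_trans (eqmxP eH) _; apply/eqmxP.
by rewrite Hst_eq ?P0 // ez.
Qed.

Lemma quartic_points f0 f1 f2 f3 f4 : quartic_sqfree f0 f1 f2 f3 f4 ->
  exists P : seq (K * K), [/\ size P = 4%N,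
    forall z, z \in P -> (z.1 != 0) || (z.2 != 0),
    pairwise (fun z z' : K * K => z.1 * z'.2 - z.2 * z'.1 != 0) P,
    forall z, z \in P -> quartic f0 f1 f2 f3 f4 z.1 z.2 = 0 &
    forall s t, quartic f0 f1 f2 f3 f4 s t = 0 -> exists2 z, z \in P & s * z.2 - t * z.1 = 0].
Proof.
move=> /quartic_sqfree_split[p [q [eq pq0 dpq]]].
exists [seq (q i, - p i) | i <- enum 'I_4]; split.
- by rewrite size_map size_enum_ord.
- by move=> z /mapP[i _ ->] /=; rewrite oppr_eq0 orbC.
- rewrite pairwise_map; apply/(@sub_pairwise _ (fun i j => i != j)); last first.
    by rewrite -uniq_pairwise enum_uniq.
  move=> i j ij /=; have := dpq i j ij; congr (_ != _); ring.
- move=> z /mapP[i _ ->] /=; rewrite eq (bigD1 i) //=.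
  by rewrite (_ : _ + _ = 0) ?mul0r //; ring.
move=> s t; rewrite eq => /prod_root[i e]; exists (q i, - p i); first by apply/mapP; exists i; rewrite ?mem_enum.
by rewrite /= -[RHS]oppr0 -e; ring.
Qed.

Lemma pairwise_points (P P' : seq (K * K)) (f f' : K -> K -> K) :
  (forall c s t, f (c * s) (c * t) = c ^+ 4 * f s t) ->
  (forall z, z \in P -> (z.1 != 0) || (z.2 != 0)) ->
  (forall z, z \in P' -> (z.1 != 0) || (z.2 != 0)) ->
  (forall z, z \in P -> f z.1 z.2 = 0) -> (forall z, z \in P' -> f' z.1 z.2 = 0) ->
  (forall s t, (s != 0) || (t != 0) -> f s t = 0 -> f' s t = 0 -> False) ->
  allrel (fun z z' : K * K => z.1 * z'.2 - z.2 * z'.1 != 0) P P'.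
Proof.
move=> fh P0 P'0 fP fP' ff; apply/allrelP => z z' zP z'P; apply/eqP => e.
have [|c [e1 e2]] := @prop2 K z.1 z.2 z'.1 z'.2 (P0 _ zP).
  by apply/subr0_eq; rewrite -[RHS]oppr0 -e; ring.
apply: (ff z'.1 z'.2); [exact: P'0 | by rewrite e1 e2 fh fP ?mulr0 | exact: fP'].
Qed.

Lemma fibres_twisted : k != 0 ->
  has_singular_fibers F (E01 K) (nseq 4 I_3 ++ nseq 4 I_1 ++ nseq 4 II).
Proof.
move=> k0.
have [P [sP P0 dP zP cP]] := quartic_points (smooth_c_sqfree n2 n3 b1 smF).
have [P' [sP' P'0 dP' zP' cP']] := quartic_points (smooth_phi_sqfree n2 smF).
have [P'' [sP'' P''0 dP'' zP'' cP'']] := quartic_points (disc_sqfree n2 b0 b1 b9).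
have hq f0 f1 f2 f3 f4 (c s t : K) :
    quartic f0 f1 f2 f3 f4 (c * s) (c * t) = c ^+ 4 * quartic f0 f1 f2 f3 f4 s t.
  by rewrite /quartic; ring.
have cd s t : (s != 0) || (t != 0) -> disc s (b * s) (b * t) t = 0 -> Q s t = 0 -> False.
  exact: (smooth_disc_c b0 b1 b9 smF).
have pd s t : (s != 0) || (t != 0) -> disc s (b * s) (b * t) t = 0 ->
    quartic c0 (phi1 b k c1) (phi2 b k c2) (phi3 b k c3) c4 s t = 0 -> False.
  by move=> st d0; rewrite phiE d0 mulr0 add0r; apply: cd.
have cp s t : (s != 0) || (t != 0) -> Q s t = 0 ->
    quartic c0 (phi1 b k c1) (phi2 b k c2) (phi3 b k c3) c4 s t = 0 -> False.
  move=> st q0; rewrite phiE q0 addr0 => /eqP; rewrite mulf_eq0 expf_eq0 (negbTE k0) /= => /eqP d0.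
  exact: cd st d0 q0.
have nthP4 (R : seq (K * K)) i : size R = 4%N -> (i < 4)%N -> nth (0, 0) R i \in R.
  by move=> sR i4; rewrite mem_nth // sR.
apply: (@fibre_list_aux _ (P ++ P' ++ P'')).
- by rewrite !size_cat !size_nseq sP sP' sP''.
- by move=> z; rewrite !mem_cat => /or3P[/P0 | /P'0 | /P''0].
- rewrite !pairwise_cat dP dP' dP'' !allrel_catr !andbT.
  rewrite -andbA; apply/and3P; split.
  + by apply: (pairwise_points (f := quartic _ _ _ _ _) (hq _ _ _ _ _) P0 P'0 zP zP').
  + apply: (pairwise_points (f := quartic _ _ _ _ _) (hq _ _ _ _ _) P0 P''0 zP zP'') => s t st e1 e2.
    by apply: (cd s t) => //; rewrite disc_quartic.
  apply: (pairwise_points (f := quartic _ _ _ _ _) (hq _ _ _ _ _) P'0 P''0 zP' zP'') => s t st e1 e2.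
  by apply: (pd s t) => //; rewrite disc_quartic.
- move=> i; rewrite !size_cat !size_nseq => i12; rewrite !nth_cat !size_nseq sP sP'.
  have [i4|i4] := ltnP i 4.
    rewrite nth_nseq i4; have zz := nthP4 P i sP i4; apply: fibre_I3 => //; try exact: zP; try exact: P0.
    by apply/eqP => d0; apply: (cd _ _ (P0 _ zz) d0); apply: zP.
  have [i8|i8] := ltnP (i - 4) 4.
    rewrite nth_nseq i8; have zz := nthP4 P' (i - 4)%N sP' i8; apply: fibre_I1 => //; try exact: P'0.
      by apply/eqP => d0; apply: (pd _ _ (P'0 _ zz) d0); apply: zP'.
    by rewrite -phiE; apply: zP'.
  have i84 : (i - 4 - 4 < 4)%N by rewrite !ltn_subLR // ?leq_subRL // (leq_trans _ i8).
  rewrite nth_nseq i84; have zz := nthP4 P'' (i - 4 - 4)%N sP'' i84.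
  have d0 := zP'' _ zz; rewrite -disc_quartic in d0.
  apply: fibre_II => //; first exact: P''0.
  by apply/eqP => q0; apply: (cd _ _ (P''0 _ zz) d0).
move=> s t st nG.
have [d0|d0] := eqVneq (disc s (b * s) (b * t) t) 0.
  have [z zz ez] := cP'' s t (etrans (esym (disc_quartic b s t)) d0).
  by exists z; rewrite // !mem_cat zz !orbT.
have [q0|q0] := eqVneq (Q s t) 0.
  by have [z zz ez] := cP s t q0; exists z; rewrite // !mem_cat zz.
have [p0|p0] := eqVneq (quartic c0 (phi1 b k c1) (phi2 b k c2) (phi3 b k c3) c4 s t) 0.
  by have [z zz ez] := cP' s t p0; exists z; rewrite // !mem_cat zz !orbT.
by case: nG; apply: fibre_smooth => //; right; rewrite -phiE.
Qed.

Lemma fibres_triple : k = 0 ->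
  has_singular_fibers F (E01 K) (nseq 4 IV ++ nseq 4 II).
Proof.
move=> k0.
have [P [sP P0 dP zP cP]] := quartic_points (smooth_c_sqfree n2 n3 b1 smF).
have [P'' [sP'' P''0 dP'' zP'' cP'']] := quartic_points (disc_sqfree n2 b0 b1 b9).
have hq f0 f1 f2 f3 f4 (c s t : K) :
    quartic f0 f1 f2 f3 f4 (c * s) (c * t) = c ^+ 4 * quartic f0 f1 f2 f3 f4 s t.
  by rewrite /quartic; ring.
have cd s t : (s != 0) || (t != 0) -> disc s (b * s) (b * t) t = 0 -> Q s t = 0 -> False.
  exact: (smooth_disc_c b0 b1 b9 smF).
have nthP4 (R : seq (K * K)) i : size R = 4%N -> (i < 4)%N -> nth (0, 0) R i \in R.
  by move=> sR i4; rewrite mem_nth // sR.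
apply: (@fibre_list_aux _ (P ++ P'')).
- by rewrite !size_cat !size_nseq sP sP''.
- by move=> z; rewrite !mem_cat => /orP[/P0 | /P''0].
- rewrite !pairwise_cat dP dP'' !andbT.
  apply: (pairwise_points (f := quartic _ _ _ _ _) (hq _ _ _ _ _) P0 P''0 zP zP'') => s t st e1 e2.
  by apply: (cd s t) => //; rewrite disc_quartic.
- move=> i; rewrite !size_cat !size_nseq => i8; rewrite !nth_cat !size_nseq sP.
  have [i4|i4] := ltnP i 4.
    rewrite nth_nseq i4; have zz := nthP4 P i sP i4; apply: fibre_IV => //; try exact: zP; try exact: P0.
    by apply/eqP => d0; apply: (cd _ _ (P0 _ zz) d0); apply: zP.
  have i84 : (i - 4 < 4)%N by rewrite ltn_subLR.
  rewrite nth_nseq i84; have zz := nthP4 P'' (i - 4)%N sP'' i84.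
  have d0 := zP'' _ zz; rewrite -disc_quartic in d0.
  apply: fibre_II => //; first exact: P''0.
  by apply/eqP => q0; apply: (cd _ _ (P''0 _ zz) d0).
move=> s t st nG.
have [d0|d0] := eqVneq (disc s (b * s) (b * t) t) 0.
  have [z zz ez] := cP'' s t (etrans (esym (disc_quartic b s t)) d0).
  by exists z; rewrite // !mem_cat zz !orbT.
have [q0|q0] := eqVneq (Q s t) 0.
  by have [z zz ez] := cP s t q0; exists z; rewrite // !mem_cat zz.
by case: nG; apply: fibre_smooth => //; left.
Qed.
End FibreLists.

(** * The scroll is an irreducible ruled quartic *)

Section Ruled.
Variables (K : closedFieldType) (b k : K).
Hypotheses (n2 : (2%:R : K) != 0) (n3 : (3%:R : K) != 0).
Hypotheses (b0 : b != 0) (b1 : b ^+ 2 != 1) (b9 : b ^+ 2 != 9%:R).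

Local Notation A := (cA b).
Local Notation B := (cB b).
Local Notation g := (gq b).
Local Notation S := (Smp b k).

Definition scroll_param (i : 'I_4) : {mpoly K[4]} :=
  let u0 := 'X_o0 in let u1 := 'X_o1 in let m := 'X_o2 in let w := 'X_o3 in
  nth 0 [:: m * u0 + w * (k%:MP * u0 * gq b%:MP u0 u1); m * u1;
            w * cB b%:MP u0 u1; - (w * cA b%:MP u0 u1)] i.

Lemma scroll_paramE (u0 u1 m w : K) : \row_i ev (scroll_param i) (pt4 u0 u1 m w) =
  pt4 (m * u0 + w * (k * u0 * g u0 u1)) (m * u1) (w * B u0 u1) (- (w * A u0 u1)).
Proof.
have e1 (x1 x2 x3 x4 x5 x6 : {mpoly K[4]}) z : ev (x1 * x2 + x3 * (x4 * x5 * x6)) z =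
  ev x1 z * ev x2 z + ev x3 z * (ev x4 z * ev x5 z * ev x6 z) by rewrite evD !evM.
have e2 (x1 x2 : {mpoly K[4]}) z : ev (- (x1 * x2)) z = - (ev x1 z * ev x2 z) by rewrite evN evM.
apply/rowP; apply: ord4P; rewrite [LHS]mxE pt4E /= ?e1 ?e2.
- by rewrite evC !evXU /ev (rmorph_gq (meval _)) /= mevalC !mevalXU !pt4E.
- by rewrite evM !evXU !pt4E.
- by rewrite evM !evXU /ev (rmorph_cB (meval _)) /= mevalC !mevalXU !pt4E.
by rewrite !evXU /ev (rmorph_cA (meval _)) /= mevalC !mevalXU !pt4E.
Qed.

Lemma scroll_path (x y : 'rV[K]_4) : zeros S x -> zeros S y -> path_between (zeros S) x y.
Proof.
have hZ z : zeros S (\row_i ev (scroll_param i) z).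
  by rewrite [z]row4E scroll_paramE /zeros ev_Smp4 Sf_scroll.
have hS z : zeros S z -> exists z', z = \row_i ev (scroll_param i) z'.
  rewrite /zeros ev_Smp => /(scroll_of_Sf b1)[u0 [u1 [m [w [_ e0 e1 e2 e3]]]]].
  by exists (pt4 u0 u1 m w); rewrite scroll_paramE -e0 -e1 -e2 -e3 -row4E.
by move=> /hS[x' ->] /hS[y' ->]; apply: path_param.
Qed.

(** A line of the plane s = t that meets the four lines ell, T1, T2, T3 of the
    scroll in this plane at prescribed parameters. *)
Lemma scroll_irreducible : irreducible_mpoly S.
Proof.
have st : ((1 : K) != 0) || ((1 : K) != 0) by rewrite oner_eq0.
have [u0 [u1 [v0 [v1 [z0 [z1 [eD fac fS]]]]]]] := fibre_product k b1 st.
set a1 := _ - v1 * z0 in eD fS; set a2 := _ - z1 * u0 in eD fS; set a3 := _ - u1 * v0 in eD fS.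
have : a1 * a2 * a3 != 0.
  by apply: contraNneq (disc11 b1 b9) => e; rewrite eD e expr0n.
rewrite !mulf_eq0 !negb_or -andbA => /and3P[n1 n2' n3'].
have [d ed] : exists d, d = a1 * a2 * a3 by eexists.
have d0 : d != 0 by rewrite ed !mulf_neq0.
have [mu [mu0 hmu]] : exists mu : K, mu != 0 /\
   (if k == 0 then k * mu = 0 else 3%:R * k * d * mu = 1).
  have [->|k0] := eqVneq k 0; first by exists 1; rewrite mul0r oner_eq0.
  exists (3%:R * k * d)^-1; rewrite divff ?invr_eq0 ?mulf_neq0 //.
have [x0 [y0 [ex0 ey0]]] := solve2 (- k * (a2 * a3) * mu) (- a2^-1 - k * (a3 * a1) * mu) n3'.
have [x1 [y1 [ex1 ey1]]] := solve2 (a1^-1 - k * (a2 * a3) * mu) (a2^-1 - k * (a3 * a1) * mu) n3'.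
have ez r : a3 * (z0 * (y0 + r * y1) - z1 * (x0 + r * x1) + k * (a1 * a2) * (mu * (1 + r))) =
    3%:R * k * d * mu * (1 + r) + 1 - r - r.
  have -> : a3 * (z0 * (y0 + r * y1) - z1 * (x0 + r * x1) + k * (a1 * a2) * (mu * (1 + r))) =
    k * (a1 * a2 * a3) * mu * (1 + r)
    - a1 * ((u0 * y0 - u1 * x0) + r * (u0 * y1 - u1 * x1))
    - a2 * ((v0 * y0 - v1 * x0) + r * (v0 * y1 - v1 * x1)).
    by rewrite /a1 /a2 /a3; ring.
  by rewrite ex0 ey0 ex1 ey1 ed; field; rewrite n1 n2'.
pose p := pt4 x0 y0 mu mu; pose v := pt4 x1 y1 mu mu.
have alE r : a1 * a2 * a3 * (along S p v).[r] = mu * (1 + r) * (r * ((r - 1) *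
    (3%:R * k * d * mu * (1 + r) + 1 - r - r))).
  rewrite horner_along pt4Z pt4D ev_Smp4.
  have -> : mu + r * mu = 1 * (mu * (1 + r)) by ring.
  rewrite Sf_plane fS -ez.
  have -> : u0 * (y0 + r * y1) - u1 * (x0 + r * x1) + k * (a2 * a3) * (mu * (1 + r)) = r / a1.
    have -> : u0 * (y0 + r * y1) - u1 * (x0 + r * x1) =
       (u0 * y0 - u1 * x0) + r * (u0 * y1 - u1 * x1) by ring.
    by rewrite ex0 ex1; ring.
  have -> : v0 * (y0 + r * y1) - v1 * (x0 + r * x1) + k * (a3 * a1) * (mu * (1 + r)) = (r - 1) / a2.
    have -> : v0 * (y0 + r * y1) - v1 * (x0 + r * x1) =
       (v0 * y0 - v1 * x0) + r * (v0 * y1 - v1 * x1) by ring.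
    by rewrite ey0 ey1; ring.
  by field; rewrite n1 n2'.
have n6 : (2%:R * 3%:R : K) != 0 by rewrite mulf_neq0.
have nal r : (along S p v).[r] != 0 -> along S p v != 0.
  by apply: contraNneq => ->; rewrite horner0.
have root_al r : mu * (1 + r) * (r * ((r - 1) * (3%:R * k * d * mu * (1 + r) + 1 - r - r))) = 0 ->
    root (along S p v) r.
  rewrite -alE => /eqP; rewrite -ed mulf_eq0 (negbTE d0) => /eqP e; exact/rootP.
have nroot_al r : mu * (1 + r) * (r * ((r - 1) * (3%:R * k * d * mu * (1 + r) + 1 - r - r))) != 0 ->
    along S p v != 0.
  rewrite -alE => h; apply: (nal r); apply: contraNneq h => ->; by rewrite mulr0.
have d1 : (0 : K) != 1 by rewrite eq_sym oner_eq0.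
have d2 : (0 : K) != -1 by rewrite eq_sym oppr_eq0 oner_eq0.
have d3 : (1 : K) != -1 by rewrite -addr_eq0.
have [k0|k0] := eqVneq k 0.
  have half : (2%:R : K) * 2%:R^-1 = 1 by rewrite divff.
  apply: (@irreducible_path _ _ 4 S p v [:: 0; 1; -1; 2%:R^-1]) => //.
  - exact: msize_homog (Smp_homog _ _).
  - exact: scroll_path.
  - apply: (nroot_al 2%:R); rewrite k0.
    have -> : mu * (1 + 2%:R) * (2%:R * ((2%:R - 1) * (3%:R * 0 * d * mu * (1 + 2%:R) + 1 - 2%:R - 2%:R)))
      = - (mu * (2%:R * 3%:R) * 3%:R) by ring.
    by rewrite oppr_eq0 !mulf_neq0.
  - have h0 : (0 : K) != 2%:R^-1 by rewrite eq_sym invr_eq0.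
    have h1 : (1 : K) != 2%:R^-1.
      apply: contra_eq_neq half => <-; rewrite mulr1 -subr_eq0.
      by rewrite (_ : 2%:R - 1 = 1 :> K) ?oner_eq0 //; ring.
    have h2 : (-1 : K) != 2%:R^-1.
      apply: contra_eq_neq half => <-; rewrite mulrN1 eq_sym -subr_eq0.
      by rewrite (_ : 1 - - 2%:R = 3%:R :> K) //; ring.
    by rewrite /= !inE !negb_or d1 d2 d3 h0 h1 h2.
  apply/allP => r; rewrite !inE => /or4P[] /eqP ->; apply: root_al; rewrite k0; try ring.
  have -> : 3%:R * 0 * d * mu * (1 + 2%:R^-1) + 1 - 2%:R^-1 - 2%:R^-1 = 1 - 2%:R * 2%:R^-1 :> K by ring.
  by rewrite half subrr !mulr0.
rewrite (negbTE k0) in hmu.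
apply: (@irreducible_path _ _ 4 S p v [:: 0; 1; -1; 2%:R]) => //.
- exact: msize_homog (Smp_homog _ _).
- exact: scroll_path.
- apply: (nroot_al 3%:R); rewrite hmu.
  have -> : mu * (1 + 3%:R) * (3%:R * ((3%:R - 1) * (1 * (1 + 3%:R) + 1 - 3%:R - 3%:R)))
      = - (mu * (2%:R * 2%:R) * (2%:R * 3%:R)) by ring.
  by rewrite oppr_eq0 !mulf_neq0.
- have h0 : (0 : K) != 2%:R by rewrite eq_sym.
  have h1 : (1 : K) != 2%:R.
    by rewrite eq_sym -subr_eq0 (_ : 2%:R - 1 = 1 :> K) ?oner_eq0 //; ring.
  have h2 : (-1 : K) != 2%:R.
    by rewrite eq_sym -subr_eq0 (_ : 2%:R - -1 = 3%:R :> K) //; ring.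
  by rewrite /= !inE !negb_or d1 d2 d3 h0 h1 h2.
apply/allP => r; rewrite !inE => /or4P[] /eqP ->; apply: root_al; rewrite hmu; ring.
Qed.

(** In the direction of a point v of the directrix the quartic only has degree three, and
    its leading coefficient is the cubic of the plane at v. *)
Lemma along_directrix (x0 x1 s t v0 v1 : K) : exists P1 P2 : K,
  along S (pt4 x0 x1 s t) (pt4 v0 v1 0 0) = (s * A v0 v1 + t * B v0 v1)%:P * 'X^3
    + P2%:P * 'X^2 + P1%:P * 'X + (Sf b k x0 x1 s t)%:P.
Proof.
exists (s * (3%:R * x0 ^+ 2 * v0 + b * (x0 ^+ 2 * v1 + 2%:R * x0 * x1 * v0))
   + t * (b * (x1 ^+ 2 * v0 + 2%:R * x0 * x1 * v1) + 3%:R * x1 ^+ 2 * v1)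
   + k * (hess s (b * s) (b * t) t (x0 + v0) (x1 + v1) - hess s (b * s) (b * t) t x0 x1
          - hess s (b * s) (b * t) t v0 v1)).
exists (s * (3%:R * x0 * v0 ^+ 2 + b * (x1 * v0 ^+ 2 + 2%:R * x0 * v0 * v1))
   + t * (b * (x0 * v1 ^+ 2 + 2%:R * x1 * v0 * v1) + 3%:R * x1 * v1 ^+ 2)
   + k * hess s (b * s) (b * t) t v0 v1).
apply: poly_ext => r; rewrite horner_along pt4Z pt4D ev_Smp4.
rewrite !(hornerD, hornerM, hornerC, hornerXn, hornerX) /Sf /cubic /hess /disc /cA /cB; ring.
Qed.

(** A cubic polynomial with nonzero leading coefficient does not vanish identically. *)
Lemma no_directrix_translation (x0 x1 s t v0 v1 : K) : s * A v0 v1 + t * B v0 v1 != 0 ->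
  (forall r, r != 0 -> ev S (pt4 (x0 + r * v0) (x1 + r * v1) s t) = 0) -> False.
Proof.
move=> h all0; have [P1 [P2 e]] := along_directrix x0 x1 s t v0 v1.
have /eqP : 'X * along S (pt4 x0 x1 s t) (pt4 v0 v1 0 0) = 0.
  apply: poly_ext0 => r; rewrite hornerM hornerX horner_along pt4Z pt4D.
  have [->|r0] := eqVneq r 0; first by rewrite mul0r.
  by rewrite !mulr0 !addr0 all0 ?mulr0.
rewrite mulf_eq0 polyX_eq0 /= e => /eqP /(congr1 (fun q : {poly K} => q`_3)).
rewrite !(coefD, coefCM, coefXn, coefX, coefC, coef0) /= mulr1 !mulr0 !addr0.
by apply/eqP.
Qed.

(** Translating by the vertex preserves a cone.  If the vertex is off the directrix, the whole
    plane of the vertex and the directrix would lie on the scroll; if it is on the directrix,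
    move a point of the scroll towards it.  Both contradict no_directrix_translation. *)
Lemma scroll_not_cone : ~ cone_over_planar_curve S.
Proof.
move=> [V [H [d [gg [pH VH _ hS]]]]].
have V0 : V != 0 by apply: contraNneq VH => ->; apply: sub0mx.
have tr x r : x != 0 -> zeros S x -> ev S (x + r *: V) = 0.
  move=> x0 /(hS x x0)[t [t0 gt xt]].
  have [->|y0] := eqVneq (x + r *: V) 0; first exact: ev0_homog (Smp_homog b k).
  apply/(hS _ y0); exists t; split=> //.
  by rewrite addmx_sub // scalemx_sub // -addsmxE addsmxSl.
move: V0 tr; rewrite [V]row4E; set v0 := V 0 o0; set v1 := V 0 o1; set v2 := V 0 o2; set v3 := V 0 o3.
move=> V0 tr; have [st|] := boolP ((v2 != 0) || (v3 != 0)).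
  have [e0 [e1 [ene Ce]]] : exists e0 e1, ((e0 != 0) || (e1 != 0)) /\ v2 * A e0 e1 + v3 * B e0 e1 != 0.
    case/orP: (st) => h; [exists 1, 0 | exists 0, 1]; rewrite oner_eq0 ?orbT; split=> //.
      by rewrite (_ : _ + _ = v2) // /cA /cB; ring.
    by rewrite (_ : _ + _ = v3) // /cA /cB; ring.
  apply: (no_directrix_translation (x0 := v0) (x1 := v1) Ce) => r r0.
  have := tr (pt4 (r * e0) (r * e1) 0 0) 1; rewrite scale1r pt4D !add0r.
  rewrite [r * e0 + _]addrC [r * e1 + _]addrC; apply.
    by rewrite pt4_eq0 !mulf_eq0 (negbTE r0) /= !eqxx !andbT negb_and.
  by rewrite /zeros ev_Smp4 /Sf /cubic /hess /disc; ring.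
rewrite negb_or !negbK => /andP[/eqP v20 /eqP v30].
have v01 : (v0 != 0) || (v1 != 0).
  by move: V0; rewrite v20 v30 pt4_eq0 !eqxx !andbT negb_and.
have [s [t [st Ce]]] : exists s t, ((s != 0) || (t != 0)) /\ s * A v0 v1 + t * B v0 v1 != 0.
  by case/orP: (cAB_neq0 b1 v01) => h; [exists 1, 0 | exists 0, 1];
    rewrite oner_eq0 ?orbT mul1r mul0r ?addr0 ?add0r.
have [r hr] : exists r, root (along S (pt4 0 0 s t) (pt4 v0 v1 0 0)) r.
  apply/closed_rootP; have [P1 [P2 ->]] := along_directrix 0 0 s t v0 v1.
  set p := _ + _; have : p`_3 != 0.
    by rewrite !(coefD, coefCM, coefXn, coefX, coefC, coef0) /= mulr1 !mulr0 !addr0.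
  by apply: contraNneq => sp; rewrite nth_default // sp.
have Sx : zeros S (pt4 (r * v0) (r * v1) s t).
  move: hr; rewrite rootE horner_along pt4Z pt4D !mulr0 !addr0 !add0r => /eqP e.
  by rewrite /zeros.
apply: (no_directrix_translation (x0 := r * v0) (x1 := r * v1) Ce) => r' _.
have := tr _ r' _ Sx; rewrite v20 v30 pt4Z pt4D !mulr0 !addr0; apply.
by rewrite pt4_eq0 !negb_and; case/orP: st => ->; rewrite !orbT.
Qed.

Lemma scroll_ruled : ruled_quartic S.
Proof.
split; [exact: Smp_homog | exact: scroll_irreducible | | exact: scroll_not_cone].
move=> x _ /(zeros_Smp k b1)[u0 [u1 [u xT]]]; exists (Tl b k u0 u1); split=> //.
  exact: Tl_line.
exact: Tl_in_S.
Qed.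

Lemma directrix_in_S : line_in (E01 K) S.
Proof.
move=> x /sub_E01[e2 e3]; rewrite ev_Smp e2 e3 /Sf /cubic /hess /disc; ring.
Qed.

(** The tangent plane at the point u of the directrix is x2 A(u) + x3 B(u) = 0, and the two
    cubics have no common zero. *)
Lemma S_smooth_directrix x : x != 0 -> (x <= E01 K)%MS -> ~ singular_at S x.
Proof.
move=> x0 /sub_E01[e2 e3] /singular_along sx.
have x01 : (x 0 o0 != 0) || (x 0 o1 != 0).
  by move: x0; rewrite {1}[x]row4E e2 e3 pt4_eq0 !eqxx !andbT negb_and.
have d s t : s * A (x 0 o0) (x 0 o1) + t * B (x 0 o0) (x 0 o1) = 0.
  have := sx (pt4 0 0 s t).
  have -> : along S x (pt4 0 0 s t) = (s * A (x 0 o0) (x 0 o1) + t * B (x 0 o0) (x 0 o1))%:P * 'X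
     + (k * hess s (b * s) (b * t) t (x 0 o0) (x 0 o1))%:P * 'X^2
     + (k ^+ 3 * disc s (b * s) (b * t) t)%:P * 'X^4.
    apply: poly_ext => r; rewrite horner_along {1}[x]row4E e2 e3 pt4Z pt4D ev_Smp4.
    rewrite !(hornerD, hornerM, hornerC, hornerXn, hornerX) /Sf /cubic /hess /disc /cA /cB; ring.
  case/dvdpP => q /(congr1 (fun q : {poly K} => q`_1)).
  by rewrite coefMXn !(coefD, coefCM, coefXn, coefX) /= mulr1 !mulr0 !addr0.
case/orP: (cAB_neq0 b1 x01) => /eqP; apply.
  by have := d 1 0; rewrite mul1r mul0r addr0.
by have := d 0 1; rewrite mul1r mul0r add0r.
Qed.

(** The section consists of the directrix and of three generators, which are distinct
    because they meet the directrix in distinct points. *)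
Lemma plane_section s t : (s != 0) || (t != 0) -> disc s (b * s) (b * t) t != 0 ->
  exists M : 'I_4 -> 'M[K]_(2, 4), [/\ forall i, is_line (M i),
    forall i j, i != j -> ~~ (M i == M j)%MS &
    forall x, zeros S x /\ (x <= Hst s t)%MS <-> exists i, (x <= M i)%MS].
Proof.
move=> st D0.
have [u [v [z [u0 v0 z0 fac [nu1 [nu2 [nu3 [[s1 t1 _] [s2 t2 _] [s3 t3 _] fS]]]]]]]] :=
  fibre_lines k b1 st.
have : (u.1 * v.2 - v.1 * u.2) * (u.1 * z.2 - z.1 * u.2) * (v.1 * z.2 - z.1 * v.2) != 0.
  apply: contraNneq D0 => e; rewrite (discE fac).
  rewrite (_ : _ * _ * _ = (u.1 * v.2 - v.1 * u.2) * (u.1 * z.2 - z.1 * u.2)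
    * (v.1 * z.2 - z.1 * v.2)); last by ring.
  by rewrite e expr0n.
rewrite !mulf_eq0 !negb_or -andbA => /and3P[d12 d13 d23].
pose T (y : K * K) := Tl b k y.1 y.2.
have T_ell (y : K * K) (c0 c1 : K) : (y.1 != 0) || (y.2 != 0) -> (pt4 c0 c1 0 0 <= T y)%MS ->
    c0 * y.2 - y.1 * c1 = 0.
  move=> y0 /sub_Tl[m [w /pt4_inj[e0 e1 e2 e3]]].
  have w0 : w = 0.
    case/orP: (cAB_neq0 b1 y0) => h; apply: (mulIf h); rewrite mul0r //.
    by apply: oppr_inj; rewrite -e3 oppr0.
  by rewrite e0 e1 w0; ring.
have on_T (y : K * K) : (pt4 y.1 y.2 0 0 <= T y)%MS.
  by apply/sub_Tl; exists 1, 0; congr pt4; ring.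
have ell_T (y : K * K) : (y.1 != 0) || (y.2 != 0) -> ~~ (E01 K <= T y)%MS.
  move=> y0; apply/negP => h; have ex c0 c1 : (pt4 c0 c1 0 0 <= T y)%MS.
    by apply: submx_trans h; apply/sub_E01; rewrite !pt4E.
  have := T_ell y _ _ y0 (ex 1 0); have := T_ell y _ _ y0 (ex 0 1).
  rewrite !mul1r !mul0r !mulr1 !mulr0 subr0 sub0r => /eqP; rewrite oppr_eq0 => /eqP y1 y2.
  by move: y0; rewrite y1 y2 eqxx.
have T_T (y y' : K * K) : (y.1 != 0) || (y.2 != 0) -> (y'.1 != 0) || (y'.2 != 0) ->
    y.1 * y'.2 - y'.1 * y.2 != 0 -> ~~ (T y == T y')%MS.
  move=> y0 y'0 d; apply/negP => /andP[h _]; case/eqP: d.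
  by apply: T_ell => //; apply: submx_trans (on_T y) h.
exists (fun i => nth (E01 K) [:: E01 K; T u; T v; T z] i); split.
- by apply: ord4P; rewrite /=; [apply: E01_line | apply: Tl_line | apply: Tl_line | apply: Tl_line].
- have sym (m m' : 'M[K]_(2, 4)) : ~~ (m == m')%MS -> ~~ (m' == m)%MS by rewrite andbC.
  have nE y : (y.1 != 0) || (y.2 != 0) -> ~~ (E01 K == T y)%MS.
    by move=> y0; rewrite negb_and ell_T.
  by apply: ord4P; apply: ord4P => //= _; first [exact: nE | exact/sym/nE | exact: T_T
    | exact/sym/T_T].
have TP (y : K * K) nu : (y.1 != 0) || (y.2 != 0) -> s = nu * B y.1 y.2 -> t = - (nu * A y.1 y.2) ->
    forall x0 x1 w, (pt4 x0 x1 (s * w) (t * w) <= T y)%MS <->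
     y.1 * x1 - y.2 * x0 + k * nu * (y.1 * y.2 * g y.1 y.2) * w = 0.
  move=> y0 es et x0 x1 w; split.
    move=> /sub_Tl[m [w' /pt4_inj[e0 e1 e2 e3]]].
    have ew : w' = nu * w.
      case/orP: (cAB_neq0 b1 y0) => h; apply: (mulIf h); last by rewrite -e2 es; ring.
      by apply: oppr_inj; rewrite -e3 et; ring.
    by rewrite e0 e1 ew; ring.
  move=> e; have [|m [e1 e2]] := @prop2 K y.1 y.2 (x0 - nu * w * (k * y.1 * g y.1 y.2)) x1 y0.
    by apply/subr0_eq; rewrite -[RHS]oppr0 -e; ring.
  apply/sub_Tl; exists m, (nu * w); rewrite -e1 e2 es et; congr pt4; ring.
have T_plane (y : K * K) nu : s = nu * B y.1 y.2 -> t = - (nu * A y.1 y.2) -> (T y <= Hst s t)%MS.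
  by move=> es et; rewrite join2_sub; apply/andP; split; apply/(sub_Hst _ st); rewrite !pt4E es et; ring.
move=> x; split.
  move=> [Sx /(sub_Hst _ st) e]; have [w [e2 e3]] := prop2 st e.
  move: Sx; rewrite /zeros [x]row4E e2 e3 [w * s]mulrC [w * t]mulrC ev_Smp4 Sf_plane fS.
  move=> /eqP; rewrite !mulf_eq0 => /orP[|/orP[/orP[]|]] /eqP h.
  - by exists o0; apply/sub_E01; rewrite !pt4E h !mulr0.
  - by exists o1; apply/(TP u nu1 u0 s1 t1).
  - by exists o2; apply/(TP v nu2 v0 s2 t2).
  by exists o3; apply/(TP z nu3 z0 s3 t3).
have T_S (y : K * K) : (x <= T y)%MS -> zeros S x by apply: Tl_in_S.
case; apply: ord4P => /= h.
- by split; [apply: directrix_in_S | apply/(sub_Hst _ st); have [-> ->] := (sub_E01 x).1 h; ring].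
- by split; [apply: T_S h | apply: submx_trans h _; apply: T_plane s1 t1].
- by split; [apply: T_S h | apply: submx_trans h _; apply: T_plane s2 t2].
by split; [apply: T_S h | apply: submx_trans h _; apply: T_plane s3 t3].
Qed.

End Ruled.

(** * The singular locus of the scroll *)

Section TwistedCubicsAndLines.
Variable K : closedFieldType.

Lemma veroneseE (u : 'rV[K]_2) : veronese u = twc (u 0 0) (u 0 1).
Proof. by apply/rowP; apply: ord4P; rewrite pt4E mxE /= ?expr0 ?expr1 ?mulr1 ?mul1r. Qed.

Lemma along_scale n (G : {mpoly K[n]}) d c p v : G \is d.-homog ->
  along G (c *: p) (c *: v) = (c ^+ d)%:P * along G p v.
Proof.
move=> hG; apply: poly_ext => r; rewrite hornerM hornerC !horner_along.
by rewrite scalerA mulrC -scalerA -scalerDr (ev_homog _ _ hG).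
Qed.

Lemma mult_ge_scale n (G : {mpoly K[n]}) d c p j : G \is d.-homog -> c != 0 ->
  mult_ge G (c *: p) j <-> mult_ge G p j.
Proof.
move=> hG c0; split=> h v.
  by have := h (c *: v); rewrite (along_scale _ _ _ hG) mul_polyC dvdpZr ?expf_neq0.
rewrite -[v](scalerKV c0) (along_scale _ _ _ hG).
exact: dvdp_mull.
Qed.

(** No three points of a twisted cubic are collinear. *)
Lemma twisted_cubic_not_line (Z : 'rV[K]_4 -> Prop) (m : 'M[K]_(2, 4)) :
  is_line m -> (forall x, x != 0 -> Z x <-> (x <= m)%MS) -> ~ twisted_cubic Z.
Proof.
move=> lm hZ [N uN hN].
have sub a c : (a != 0) || (c != 0) -> (twc a c *m N <= m)%MS.
  move=> ac; have t0 : twc a c *m N != 0.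
    rewrite mul_unit_neq0 // pt4_eq0 !negb_and !expf_eq0 /=.
    by case/orP: ac => ->; rewrite ?orbT.
  apply/(hZ _ t0)/(hN _ t0); exists (pt2 a c).
    by apply: contraTneq ac => /rowP e; have := e 0; have := e 1; rewrite !mxE /= => -> ->; rewrite eqxx.
  by rewrite veroneseE !pt2E submx_refl.
have h : (join3 (twc 1 0) (twc 1 1) (twc 0 1) *m N <= m)%MS.
  by rewrite mul_join3 join3_sub; apply/and3P; split; apply: sub; rewrite ?oner_eq0 ?orbT.
have := mxrankS h; rewrite rank_mul // lm.
have /eqP -> : row_free (join3 (twc (1 : K) 0) (twc 1 1) (twc 0 1)); last by [].
apply: inj_row_free => v; rewrite [v]row3E pt3_join3 !pt4Z !pt4D -pt4_0.
case/pt4_inj => e0 e1 e2 e3; rewrite -pt3_0.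
have v1 : v 0 r1 = 0 by rewrite -e1; ring.
congr pt3 => //; first by rewrite -e0 v1; ring.
by rewrite -e3 v1; ring.
Qed.
End TwistedCubicsAndLines.

Section SingularLocus.
Variables (K : closedFieldType) (b k : K).
Hypotheses (n2 : (2%:R : K) != 0) (n3 : (3%:R : K) != 0).
Hypotheses (b0 : b != 0) (b1 : b ^+ 2 != 1) (b9 : b ^+ 2 != 9%:R).

Local Notation A := (cA b).
Local Notation B := (cB b).
Local Notation S := (Smp b k).

Definition axis : 'M[K]_(2, 4) := join2 (pt4 0 0 1 0) (pt4 0 0 0 1).

Lemma sub_axis (x : 'rV[K]_4) : (x <= axis)%MS <-> x 0 o0 = 0 /\ x 0 o1 = 0.
Proof.
rewrite sub_join2; split=> [[a [c ->]]|[e2 e3]].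
  by rewrite !mxE /= !mulr0 addr0.
exists (x 0 o2), (x 0 o3); rewrite !pt4Z pt4D [LHS]row4E e2 e3.
by congr pt4; ring.
Qed.

Lemma axis_line : is_line axis.
Proof.
apply/is_line_join2 => a c; rewrite !pt4Z pt4D -pt4_0 => /pt4_inj[].
by rewrite !(mulr1, mulr0, addr0, add0r).
Qed.

Lemma scroll_triple_line : k = 0 -> sing_line_of_triple_points S.
Proof.
move=> k0.
have alE (x0 x1 s t s' t' : K) : along S (pt4 x0 x1 s t) (pt4 0 0 s' t') =
    (s' * A x0 x1 + t' * B x0 x1)%:P * 'X + (s * A x0 x1 + t * B x0 x1)%:P.
  apply: poly_ext => r; rewrite horner_along pt4Z pt4D ev_Smp4 k0.
  rewrite !(hornerD, hornerM, hornerC, hornerX) /Sf /cubic /hess /disc /cA /cB; ring.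
have sing x : singular_at S x <-> (x <= axis)%MS.
  split.
    move=> /singular_along sx; have d s t : s * A (x 0 o0) (x 0 o1) + t * B (x 0 o0) (x 0 o1) = 0.
      have := sx (pt4 0 0 s t); rewrite {1}[x]row4E alE => /dvdpP[q].
      move/(congr1 (fun q : {poly K} => q`_1)).
      by rewrite coefMXn !(coefD, coefCM, coefX, coefC) /= mulr1 addr0.
    apply/sub_axis; apply: (cAB_coprime b1).
      by have := d 1 0; rewrite mul1r mul0r addr0.
    by have := d 0 1; rewrite mul1r mul0r add0r.
  by move=> /sub_axis[e0 e1]; rewrite [x]row4E e0 e1; apply: axis_singular.
split; first by exists axis; [exact: axis_line | move=> x _; exact: sing].
move=> x x0 /sing /sub_axis[e0 e1].
have alx (v0 v1 v2 v3 : K) : along S x (pt4 v0 v1 v2 v3) =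
    'X^3 * ((x 0 o2 * A v0 v1 + x 0 o3 * B v0 v1)%:P + 'X * (v2 * A v0 v1 + v3 * B v0 v1)%:P).
  apply: poly_ext => r; rewrite horner_along {1}[x]row4E e0 e1 pt4Z pt4D ev_Smp4 k0.
  rewrite !(hornerD, hornerM, hornerC, hornerXn, hornerX) /Sf /cubic /hess /disc /cA /cB; ring.
split=> [v|h]; first by rewrite [v]row4E alx dvdp_mulr.
have st : (x 0 o2 != 0) || (x 0 o3 != 0).
  by move: x0; rewrite {1}[x]row4E e0 e1 pt4_eq0 !eqxx /= negb_and.
have d v0 v1 : x 0 o2 * A v0 v1 + x 0 o3 * B v0 v1 = 0.
  have := h (pt4 v0 v1 0 0); rewrite alx; case/dvdpP => q.
  move/(congr1 (fun q : {poly K} => q`_3)).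
  by rewrite coefMXn coefXnM /= subnn coefD coefC coefXM /= addr0.
have := d 1 0; have := d 0 1; rewrite /cA /cB.
rewrite !(expr0n, expr1n, mul0r, mulr0, mul1r, mulr1, addr0, add0r) /= => e3 e2.
by move: st; rewrite e2 e3 eqxx.
Qed.

(** The two by three matrix with columns (y0, y1), (y1, y2), (y2, y3) has rank one
    exactly on the twisted cubic. *)
Lemma twisted_minors (y : 'rV[K]_4) : y != 0 ->
  y 0 o0 * y 0 o2 = y 0 o1 ^+ 2 -> y 0 o0 * y 0 o3 = y 0 o1 * y 0 o2 ->
  y 0 o1 * y 0 o3 = y 0 o2 ^+ 2 ->
  exists u0 u1 c, [/\ (u0 != 0) || (u1 != 0), c != 0 & y = c *: twc u0 u1].
Proof.
move=> y0; set a := y 0 o0; set c := y 0 o1; set d := y 0 o2; set e := y 0 o3 => h1 h2 h3.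
have [a0|a0] := eqVneq a 0.
  have c0 : c = 0 by move/eqP: h1; rewrite a0 mul0r eq_sym expf_eq0 => /eqP.
  have d0 : d = 0 by move/eqP: h3; rewrite c0 mul0r eq_sym expf_eq0 => /eqP.
  exists 0, 1, e; split; first by rewrite oner_eq0 orbT.
    by apply: contraNneq y0 => e0; rewrite [y]row4E -/a -/c -/d -/e a0 c0 d0 e0 pt4_0.
  by rewrite /twc pt4Z [LHS]row4E -/a -/c -/d -/e a0 c0 d0; congr pt4; ring.
exists a, c, (a ^+ 2)^-1; split; [by rewrite a0 | by rewrite invr_eq0 expf_neq0 |].
rewrite /twc pt4Z [LHS]row4E -/a -/c -/d -/e; congr pt4; try by field.
  apply: (mulfI (expf_neq0 2 a0)); rewrite [RHS]mulVKf ?expf_neq0 // -h1; ring.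
apply: (mulfI (expf_neq0 2 a0)); rewrite [RHS]mulVKf ?expf_neq0 //.
have -> : a ^+ 2 * e = a * (a * e) by ring.
have -> : c ^+ 3 = c * c ^+ 2 by ring.
by rewrite h2 -h1; ring.
Qed.

(** The three quadrics through the twisted cubic have independent differentials off
    the curve. *)
Lemma minors_submersion (P1 P2 P3 : K) (y : 'rV[K]_4) : y != 0 ->
  P1 * y 0 o2 + P2 * y 0 o3 = 0 -> - (2%:R * P1 * y 0 o1) - P2 * y 0 o2 + P3 * y 0 o3 = 0 ->
  P1 * y 0 o0 - P2 * y 0 o1 - 2%:R * P3 * y 0 o2 = 0 -> P2 * y 0 o0 + P3 * y 0 o1 = 0 ->
  [/\ P1 = 0, P2 = 0 & P3 = 0] \/ [/\ y 0 o0 * y 0 o2 = y 0 o1 ^+ 2,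
    y 0 o0 * y 0 o3 = y 0 o1 * y 0 o2 & y 0 o1 * y 0 o3 = y 0 o2 ^+ 2].
Proof.
move=> yn0; set y0 := y 0 o0; set y1 := y 0 o1; set y2 := y 0 o2; set y3 := y 0 o3.
move=> e0 e1 e2 e3.
have yz : y0 = 0 -> y1 = 0 -> y2 = 0 -> y3 = 0 -> False.
  by move=> z0 z1 z2 z3; move: yn0; rewrite [y]row4E -/y0 -/y1 -/y2 -/y3 z0 z1 z2 z3 pt4_0 eqxx.
have zero (a c : K) : a != 0 -> a * c = 0 -> c = 0.
  by move=> a0 /eqP; rewrite mulf_eq0 (negbTE a0) => /eqP.
have [P20|P20] := eqVneq P2 0.
  rewrite P20 !mul0r ?addr0 ?add0r ?subr0 in e0 e1 e2 e3.
  have [P10|P10] := eqVneq P1 0; have [P30|P30] := eqVneq P3 0; first by left.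
  - have z1 := zero _ _ P30 e3.
    rewrite P10 z1 !(mulr0, mul0r, oppr0, add0r, sub0r) in e1 e2.
    have z3 := zero _ _ P30 e1.
    have z2 : y2 = 0.
      by apply: (zero (- (2%:R * P3))); rewrite ?oppr_eq0 ?mulf_neq0 // mulNr e2.
    by right; rewrite z1 z2 z3; split; ring.
  - have z2 := zero _ _ P10 e0.
    rewrite P30 z2 !(mulr0, mul0r, oppr0, addr0, subr0) in e1 e2.
    have z0 := zero _ _ P10 e2.
    have z1 : y1 = 0.
      by apply: (zero (- (2%:R * P1))); rewrite ?oppr_eq0 ?mulf_neq0 // mulNr e1.
    by right; rewrite z1 z2 z0; split; ring.
  have z1 := zero _ _ P30 e3; have z2 := zero _ _ P10 e0.
  rewrite z1 z2 !(mulr0, oppr0, add0r, subr0) in e1 e2.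
  by case: yz => //; [exact: zero P10 e2 | exact: zero P30 e1].
have y3E : y3 = - (P1 * y2) / P2.
  by apply: (mulfI P20); rewrite -[LHS](addKr (P1 * y2)) e0 addr0; field.
have y0E : y0 = - (P3 * y1) / P2.
  by apply: (mulfI P20); rewrite -[LHS](addrK (P3 * y1)) e3 add0r; field.
have f1 : 2%:R * (P1 * P2) * y1 + (P2 ^+ 2 + P1 * P3) * y2 = 0.
  by rewrite -[RHS](mulr0 (- P2)) -e1 y3E; field.
have f2 : (P2 ^+ 2 + P1 * P3) * y1 + 2%:R * (P2 * P3) * y2 = 0.
  by rewrite -[RHS](mulr0 (- P2)) -e2 y0E; field.
have [pp|pp] := eqVneq (P1 * P3) (P2 ^+ 2); last first.
  have dd : (P2 ^+ 2 - P1 * P3) ^+ 2 != 0 by rewrite expf_neq0 // subr_eq0 eq_sym.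
  have z1 : y1 = 0.
    apply: (zero _ _ dd).
    have -> : (P2 ^+ 2 - P1 * P3) ^+ 2 * y1 = (P2 ^+ 2 + P1 * P3) * ((P2 ^+ 2 + P1 * P3) * y1
      + 2%:R * (P2 * P3) * y2) - 2%:R * (P2 * P3) * (2%:R * (P1 * P2) * y1 + (P2 ^+ 2 + P1 * P3) * y2) by ring.
    by rewrite f1 f2 !mulr0 subr0.
  have z2 : y2 = 0.
    apply: (zero _ _ dd).
    have -> : (P2 ^+ 2 - P1 * P3) ^+ 2 * y2 = (P2 ^+ 2 + P1 * P3) * (2%:R * (P1 * P2) * y1
       + (P2 ^+ 2 + P1 * P3) * y2) - 2%:R * (P1 * P2) * ((P2 ^+ 2 + P1 * P3) * y1
      + 2%:R * (P2 * P3) * y2) by ring.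
    by rewrite f1 f2 !mulr0 subr0.
  by case: yz => //; rewrite ?y0E ?y3E ?z1 ?z2 !mulr0 oppr0 mul0r.
have f3 : P1 * y1 + P2 * y2 = 0.
  apply: (zero (2%:R * P2)); first by rewrite mulf_neq0.
  by rewrite -[RHS]f1 pp; ring.
have y2E : y2 = - (P1 * y1) / P2.
  by apply: (mulfI P20); rewrite -[LHS](addKr (P1 * y1)) f3 addr0; field.
right; rewrite y3E y0E y2E; split.
- have -> : - (P3 * y1) / P2 * (- (P1 * y1) / P2) = P1 * P3 * y1 ^+ 2 / P2 ^+ 2 by field.
  by rewrite pp; field.
- have -> : - (P3 * y1) / P2 * (- (P1 * (- (P1 * y1) / P2)) / P2) =
    - (P1 * P3 * P1 * y1 ^+ 2 / P2 ^+ 3) by field.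
  by rewrite pp; field.
by field.
Qed.

(** In the coordinates of M4 the equation is a nondegenerate quadratic form in the three minors.
    By minors_submersion its differential vanishes only on the twisted cubic or where the
    gradient of that quadratic form does, that is where the minors are zero. *)
Lemma scroll_twisted_cubic : k != 0 -> sing_twisted_cubic_of_double_points S.
Proof.
move=> k0; have uM := M4_unit n3 b1 k0.
have kc : 27%:R * k ^+ 3 * (b ^+ 2 - 1) != 0.
  by rewrite !mulf_neq0 ?expf_neq0 ?subr_eq0 // (natrM _ 3 9) (natrM _ 3 3) !mulf_neq0.
have sing x : x != 0 -> singular_at S x ->
    exists u0 u1 c, [/\ (u0 != 0) || (u1 != 0), c != 0 & x = c *: (twc u0 u1 *m M4 b k)].
  move=> x0 /singular_along sx; pose y := x *m invmx (M4 b k).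
  have yn0 : y != 0 by rewrite mul_unit_neq0 ?unitmx_inv.
  set q1 := y 0 o0 * y 0 o2 - y 0 o1 ^+ 2; set q2 := y 0 o0 * y 0 o3 - y 0 o1 * y 0 o2.
  set q3 := y 0 o1 * y 0 o3 - y 0 o2 ^+ 2.
  pose P1 := b * q2 + (b ^+ 2 - 1) * q3; pose P2 := 2%:R * q2 + b * q1 + b * q3.
  pose P3 := b * q2 + (b ^+ 2 - 1) * q1.
  have d z0 z1 z2 z3 :
      P1 * (z0 * y 0 o2 + y 0 o0 * z2 - 2%:R * y 0 o1 * z1)
      + P2 * (z0 * y 0 o3 + y 0 o0 * z3 - z1 * y 0 o2 - y 0 o1 * z2)
      + P3 * (z1 * y 0 o3 + y 0 o1 * z3 - 2%:R * y 0 o2 * z2) = 0.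
    have := sx (pt4 z0 z1 z2 z3 *m M4 b k).
    rewrite -{1}(mulmxKV uM x) -/y along_M4 !pt4E.
    set e := _ * _ => /dvdpP[q eq]; apply: (mulfI kc); rewrite mulr0.
    have : e`_1 = 0 by rewrite eq coefMXn.
    have eqf (y0 y1 y2 y3 : K) : (y0%:P + z0 *: 'X) * (y2%:P + z2 *: 'X) - (y1%:P + z1 *: 'X) ^+ 2
      = (y0 * y2 - y1 ^+ 2)%:P + (z0 * y2 + y0 * z2 - 2%:R * y1 * z1)%:P * 'X
         + (z0 * z2 - z1 ^+ 2)%:P * 'X^2 by rewrite -!mul_polyC; ring.
    have eqg (y0 y1 y2 y3 : K) : (y0%:P + z0 *: 'X) * (y3%:P + z3 *: 'X) - (y1%:P + z1 *: 'X) * (y2%:P + z2 *: 'X)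
      = (y0 * y3 - y1 * y2)%:P + (z0 * y3 + y0 * z3 - z1 * y2 - y1 * z2)%:P * 'X
         + (z0 * z3 - z1 * z2)%:P * 'X^2 by rewrite -!mul_polyC; ring.
    have eqh (y0 y1 y2 y3 : K) : (y1%:P + z1 *: 'X) * (y3%:P + z3 *: 'X) - (y2%:P + z2 *: 'X) ^+ 2
      = (y1 * y3 - y2 ^+ 2)%:P + (z1 * y3 + y1 * z3 - 2%:R * y2 * z2)%:P * 'X
         + (z1 * z3 - z2 ^+ 2)%:P * 'X^2 by rewrite -!mul_polyC; ring.
    rewrite /e eqf // eqg // eqh // -/q1 -/q2 -/q3.
    move: (z0 * y 0 o2 + _ - _) (_ - z1 ^+ 2) (z0 * y 0 o3 + _ - _ - _) (_ - z1 * z2)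
      (z1 * y 0 o3 + _ - _) (_ - z2 ^+ 2) => a1 a2 a3 a4 a5 a6.
    set Z := (27%:R * _ * _)%:P * _.
    have -> : Z = (27%:R * k ^+ 3 * (b ^+ 2 - 1) * (q2 ^+ 2 + b * q1 * q2 + b * q2 * q3 + (b ^+ 2 - 1) * q1 * q3))%:P
      + (27%:R * k ^+ 3 * (b ^+ 2 - 1) * (P1 * a1 + P2 * a3 + P3 * a5))%:P * 'X +
      ((27%:R * k ^+ 3 * (b ^+ 2 - 1))%:P * (
        ((a3%:P + a4%:P * 'X) ^+ 2 + 2%:R * q2%:P * a4%:P)
        + b%:P * ((a1%:P + a2%:P * 'X) * (a3%:P + a4%:P * 'X) + q1%:P * a4%:P + q2%:P * a2%:P)
        + b%:P * ((a5%:P + a6%:P * 'X) * (a3%:P + a4%:P * 'X) + q3%:P * a4%:P + q2%:P * a6%:P)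
        + (b ^+ 2 - 1)%:P * ((a1%:P + a2%:P * 'X) * (a5%:P + a6%:P * 'X) + q1%:P * a6%:P + q3%:P * a2%:P)))
       * 'X^2.
      by rewrite /Z /P1 /P2 /P3; ring.
    by rewrite coefD coefMXn /= addr0 coefD coefC coefCM coefX /= add0r mulr1.
  have [||||[p1 p2 p3]|[h1 h2 h3]] := @minors_submersion P1 P2 P3 y yn0.
  - by rewrite -[RHS](d 1 0 0 0); ring.
  - by rewrite -[RHS](d 0 1 0 0); ring.
  - by rewrite -[RHS](d 0 0 1 0); ring.
  - by rewrite -[RHS](d 0 0 0 1); ring.
  - have q31 : (b ^+ 2 - 1) * (q3 - q1) = 0.
      by rewrite -[RHS](subrr 0) -{1}p1 -p3 /P1 /P3; ring.
    have /eqP q13 : q3 == q1.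
      by move/eqP: q31; rewrite mulf_eq0 !subr_eq0 (negbTE b1).
    have q2E : q2 = - (b * q1).
      by apply: (mulfI n2); rewrite -[LHS]subr0 -p2 /P2 q13; ring.
    have q10 : q1 = 0 by rewrite -[RHS]oppr0 -p3 /P3 q2E; ring.
    have q20 : q2 = 0 by rewrite q2E q10 mulr0 oppr0.
    have q30 : q3 = 0 by rewrite q13.
    have [||| u0 [u1 [c [u c0 ey]]]] := @twisted_minors y yn0.
    + exact: subr0_eq q10.
    + exact: subr0_eq q20.
    + exact: subr0_eq q30.
    by exists u0, u1, c; rewrite scalemxAl -ey mulmxKV.
  have [u0 [u1 [c [u c0 ey]]]] := twisted_minors yn0 h1 h2 h3.
  by exists u0, u1, c; rewrite scalemxAl -ey mulmxKV.
split.
  exists (M4 b k) => // x x0; split.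
    move=> /(sing x x0)[u0 [u1 [c [u c0 ex]]]]; exists (pt2 u0 u1).
      by apply: contraTneq u => /rowP e; have := e 0; have := e 1; rewrite !mxE /= => -> ->; rewrite eqxx.
    rewrite veroneseE !pt2E; apply/eq_rV => //; last by exists c.
    by apply: contraNneq x0 => e; rewrite ex e scaler0.
  move=> [u u0]; rewrite veroneseE => e.
  have /sub_rVP[c ex] : (x <= twc (u 0%R 0%R) (u 0%R 1%R) *m M4 b k)%MS by case/andP: e.
  rewrite ex; have [s0 ds] := @twc_singular K b k n3 b1 (u 0 0) (u 0 1) k0.
  have c0 : c != 0 by apply: contraNneq x0 => c0; rewrite ex c0 scale0r.
  have h : mult_ge S (twc (u 0 0) (u 0 1) *m M4 b k) 2.
    exact: (proj1 (singular_along _ _) (twc_singular n3 b1 _ _ k0)).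
  have h2 := proj2 (mult_ge_scale _ _ (Smp_homog b k) c0) h.
  exact: (proj2 (singular_along _ _) h2).
move=> x x0 sx; split; first exact/singular_along.
have [u0 [u1 [c [u c0 ->]]]] := sing x x0 sx.
move/(proj1 (mult_ge_scale _ 3 (Smp_homog b k) c0)) => h.
(* In the directions of the two end coordinate points the second order terms are
   u0 ^ 3 A(u) and u1 ^ 3 B(u), and A and B have no common zero. *)
have d z0 z1 z2 z3 := h (pt4 z0 z1 z2 z3 *m M4 b k).
have d0 a q z0 z1 z2 z3 : along S (twc u0 u1 *m M4 b k) (pt4 z0 z1 z2 z3 *m M4 b k) =
    (27%:R * k ^+ 3 * (b ^+ 2 - 1))%:P * ('X^2 * (a%:P + 'X * q)) -> a = 0.
  move=> e; have := d z0 z1 z2 z3; rewrite e mul_polyC dvdpZr //; exact: (dvdp_X3 a q).1.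
have f1 : u0 ^+ 3 * cA b u0 u1 = 0.
  by apply: (d0 _ 0 0 0 0 1); rewrite along_M4 /twc /cA !pt4E -!mul_polyC; ring.
have f2 : u1 ^+ 3 * cB b u0 u1 = 0.
  by apply: (d0 _ 0 1 0 0 0); rewrite along_M4 /twc /cB !pt4E -!mul_polyC; ring.
have [||e0 e1] := @cAB_coprime _ b b1 u0 u1.
- by move/eqP: f1; rewrite mulf_eq0 expf_eq0 /= => /orP[/eqP->|/eqP//]; rewrite /cA expr0n mul0r.
- by move/eqP: f2; rewrite mulf_eq0 expf_eq0 /= => /orP[/eqP->|/eqP//]; rewrite /cB expr0n mul0r.
by move: u; rewrite e0 e1 eqxx.
Qed.
End SingularLocus.

(** * The ruling of the scroll *)

Section ClosedSets.
Variables (K : closedFieldType) (n : nat).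
Implicit Types (x p : 'rV[K]_n) (Z W : 'rV[K]_n -> Prop).

Lemma join2E (p q : 'rV[K]_n) i : (join2 p q 0 i = p 0 i) * (join2 p q 1 i = q 0 i).
Proof.
split; [rewrite -(col_mxEu p q 0 i) | rewrite -(col_mxEd p q 0 i)];
  by congr (col_mx p q _ i); apply: val_inj.
Qed.

Lemma zclosed_union A B : zclosed A -> zclosed B -> zclosed (fun x => A x \/ B x).
Proof.
move=> cA cB x x0 hx; apply: NNPP => nAB.
have sep Z : zclosed Z -> ~ Z x -> exists d (G : {mpoly K[n]}),
    [/\ G \is d.-homog, psub Z (zeros G) & ev G x != 0].
  move=> cZ nZ; apply: NNPP => nG; apply/nZ/(cZ x x0) => d G hG hZ.
  by apply/eqP; apply: contra_notT nG => Gx; exists d, G.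
have [d [G [hG hA Gx]]] := sep A cA (fun h => nAB (or_introl h)).
have [e [H [hH hB Hx]]] := sep B cB (fun h => nAB (or_intror h)).
have : ev (G * H) x = 0.
  apply: (hx _ _ (dhomogM hG hH)) => y y0; rewrite /zeros evM => -[/hA|/hB] ->;
  by rewrite ?mul0r ?mulr0.
by apply/eqP; rewrite evM mulf_neq0.
Qed.

Lemma zclosed_point p : p != 0 -> zclosed (fun x => (x == p)%MS).
Proof.
move=> p0 x x0 hx.
have e i j : p 0 i * x 0 j = p 0 j * x 0 i.
  have evE (y : 'rV[K]_n) : ev ((p 0 i)%:MP * 'X_j - (p 0 j)%:MP * 'X_i) y =
    p 0 i * y 0 j - p 0 j * y 0 i by rewrite evB !evM !evC !evXU.
  apply/eqP; rewrite -subr_eq0 -evE; apply/eqP/(hx 1%N).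
    by apply: homog_ev => c y; rewrite !evE !mxE; ring.
  by move=> y y0 /(eq_rV y0 p0)[c _ ->]; rewrite /zeros evE !mxE; ring.
have /rV0Pn[i pi] := p0.
have ex : x = (x 0 i / p 0 i) *: p.
  by apply/rowP => j; rewrite mxE; apply: (mulfI pi); rewrite e; field.
apply/(eq_rV x0 p0); exists (x 0 i / p 0 i) => //.
by apply: contraNneq x0 => c0; rewrite ex c0 scale0r.
Qed.

Lemma zclosed_points (ps : seq 'rV[K]_n) : all (fun p => p != 0) ps ->
  zclosed (fun x => has (fun p => (x == p)%MS) ps).
Proof.
elim: ps => [_ x _ /(_ 0 1 (dhomog1 _ _)) h|p ps IH] /=.
  by have /eqP := h (fun y _ f => False_ind _ (not_false_is_true f)); rewrite /ev meval1 oner_eq0.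
case/andP=> p0 /IH cps x x0 hx.
have /(_ x x0) := zclosed_union (zclosed_point p0) cps.
case=> [d G hG h|->|->]; rewrite ?orbT //; apply: (hx d) => // y y0 /orP; exact: h.
Qed.

(** A finite set is a union of closed points, so irreducibility leaves only one of them. *)
Lemma irreducible_finite W (ps : seq 'rV[K]_n) : zclosed W -> zirreducible W ->
  all (fun p => p != 0) ps -> psub W (fun x => has (fun p => (x == p)%MS) ps) -> is_point W.
Proof.
move=> cW irrW; elim: ps => [_|p ps IH] /=; first by case: irrW => -[x x0 Wx] _ /(_ x x0 Wx).
case/andP=> p0 ps0 hW.
have [|||hp|] := (irrW.2 (fun x => (x == p)%MS) (fun x => has (fun p => (x == p)%MS) ps)).
- exact: zclosed_point.
- exact: zclosed_points.
- by move=> x x0 /(hW x x0)/orP.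
- exists p => // x x0; split=> [/(hp x x0)//|xp]; have [y y0 Wy] := irrW.1.
  apply: (cW x x0) => d G hG /(_ y y0 Wy) Gy.
  have [c _ ->] := (eq_rV x0 p0).1 xp; rewrite (ev_homog _ _ hG).
  have [e e0 ey] := (eq_rV y0 p0).1 (hp y y0 Wy).
  move: Gy; rewrite /zeros ey (ev_homog _ _ hG) => /eqP.
  by rewrite mulf_eq0 expf_eq0 (negbTE e0) andbF => /eqP ->; rewrite mulr0.
by move/IH; apply.
Qed.

End ClosedSets.

Section PluckerCoordinates.
Variable K : closedFieldType.
Implicit Types (m : 'M[K]_(2, 4)).

Lemma plucker_neq0 m : is_line m -> plucker m != 0.
Proof.
move=> lm; apply: contraPneq lm => /(congr1 vec_mx); rewrite linear0 mxvecK => e.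
have eij i j : m 0 i * m 1 j = m 0 j * m 1 i.
  by apply/subr0_eq; move/matrixP: e => /(_ i j); rewrite !mxE.
rewrite [m]row_mx2 => lm; have ind := (is_line_join2 _ _).2 lm.
have r0 i : m 0 i = 0.
  have [] := ind (m 1 i) (- m 0 i); last by move=> _ /eqP; rewrite oppr_eq0 => /eqP.
  by apply/rowP => j; rewrite !mxE mulNr eij; ring.
have [] := ind 1 0; last by move/eqP; rewrite oner_eq0.
by apply/rowP => j; rewrite !mxE r0; ring.
Qed.

Lemma plucker_eqmx m m' : is_line m -> is_line m' -> (m == m')%MS ->
  exists2 c, c != 0 & plucker m = c *: plucker m'.
Proof.
move=> lm lm' /andP[/submxP[N e] _].
have sum2 (f : 'I_2 -> K) : \sum_i f i = f 0 + f 1.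
  by rewrite !big_ord_recl big_ord0 addr0; congr (_ + f _); apply: val_inj.
have eq : plucker m = (N 0 0 * N 1 1 - N 0 1 * N 1 0) *: plucker m'.
  rewrite /plucker -linearZ; congr mxvec; apply/matrixP => i j.
  by rewrite e ![in LHS]mxE ![in RHS]mxE !sum2; ring.
exists (N 0 0 * N 1 1 - N 0 1 * N 1 0) => //.
by apply: contraNneq (plucker_neq0 lm) => c0; rewrite eq c0 scale0r.
Qed.

Lemma plucker_scale c p q : plucker (join2 (c *: p) q : 'M[K]_(2, 4)) = c *: plucker (join2 p q).
Proof.
rewrite /plucker -linearZ; congr mxvec; apply/matrixP => i j.
by rewrite [LHS]mxE [RHS]mxE [in RHS]mxE !join2E !mxE; ring.
Qed.

End PluckerCoordinates.

(** The Pluecker coordinates of the generator of the scroll through the point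
    (u0 : u1) of its directrix. *)
Definition plT (R : comNzRingType) (b k u0 u1 : R) : 'M[R]_4 :=
  let p i := nth 0 [:: u0; u1; 0; 0] i in
  let q i := nth 0 [:: k * u0 * gq b u0 u1; 0; cB b u0 u1; - cA b u0 u1] i in
  \matrix_(i, j) (p i * q j - p j * q i).

Lemma map_plT (R R' : comNzRingType) (f : {rmorphism R -> R'}) (b k u0 u1 : R) :
  map_mx f (plT b k u0 u1) = plT (f b) (f k) (f u0) (f u1).
Proof.
apply/matrixP => i j; rewrite !mxE rmorphB !rmorphM.
have h (s : seq R) (l : 'I_4) : size s = 4%N -> f (nth 0 s l) = nth 0 (map f s) l.
  by move=> sz; rewrite (nth_map 0) // sz.
have e : f (k * u0 * gq b u0 u1) = f k * f u0 * gq (f b) (f u0) (f u1).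
  by rewrite -rmorph_gq -!rmorphM.
by rewrite !h //= !rmorph0 rmorphN e rmorph_cA rmorph_cB.
Qed.

Section Ruling.
Variables (K : closedFieldType) (b k : K).
Hypotheses (n2 : (2%:R : K) != 0) (n3 : (3%:R : K) != 0).
Hypotheses (b0 : b != 0) (b1 : b ^+ 2 != 1) (b9 : b ^+ 2 != 9%:R).

Local Notation A := (cA b).
Local Notation B := (cB b).
Local Notation g := (gq b).
Local Notation S := (Smp b k).
Local Notation T := (Tl b k).

Definition generator (m : 'M[K]_(2, 4)) :=
  exists u0 u1, [/\ (u0 != 0) || (u1 != 0) & (m == T u0 u1)%MS].

Let Y y := exists2 m, is_line m /\ generator m & y = plucker m.

Lemma plucker_Tl u0 u1 : plucker (T u0 u1) = mxvec (plT b k u0 u1).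
Proof. by congr mxvec; apply/matrixP => i j; rewrite [LHS]mxE [RHS]mxE !join2E !mxE. Qed.

Lemma generatorsP y : y != 0 ->
  Y y <-> exists u0 u1 c, [/\ (u0 != 0) || (u1 != 0), c != 0 & y = c *: mxvec (plT b k u0 u1)].
Proof.
move=> y0; split=> [[m [lm [u0 [u1 [u mT]]]] ->]|[u0 [u1 [c [u c0 ->]]]]].
  have [c c0 e] := plucker_eqmx lm (Tl_line k b1 u) mT.
  by exists u0, u1, c; rewrite -plucker_Tl.
have lc : is_line (join2 (c *: pt4 u0 u1 0 0) (pt4 (k * u0 * g u0 u1) 0 (B u0 u1) (- A u0 u1))).
  apply/is_line_join2 => a e; rewrite scalerA => /((is_line_join2 _ _).2 (Tl_line k b1 u))[].
  by move=> /eqP; rewrite mulf_eq0 (negbTE c0) orbF => /eqP.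
have := submx_refl (T u0 u1); rewrite {1}/Tl join2_sub => /andP[pT qT].
eexists; first split; [exact: lc | exists u0, u1; split=> // |].
  by apply: line_eq_join2 => //; [exact: Tl_line | exact: scalemx_sub].
by rewrite plucker_scale -plucker_Tl.
Qed.

Lemma plT_neq0 u0 u1 : (u0 != 0) || (u1 != 0) -> mxvec (plT b k u0 u1) != 0.
Proof. by move=> u; rewrite -plucker_Tl; apply: plucker_neq0; apply: Tl_line. Qed.

(** Explicit equations: antisymmetry, p23 = 0, the Pluecker relation, the condition that
    (p_i2, p_i3) is proportional to (B u, - A u) with u read off in column 2 or in column 3, and
    the value of p01.  If columns 2 and 3 both vanish, then so does p01, by the last quadratic
    equation. *)
Lemma generators_closed : zclosed Y.
Proof.
move=> x x0 hx; apply/generatorsP => //.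
pose p i j : K := x 0 (mxvec_index i j).
have pE (u0 u1 : K) i j : mxvec (plT b k u0 u1) 0 (mxvec_index i j) = plT b k u0 u1 i j.
  by rewrite mxvecE.
pose X i j : {mpoly K[4 * 4]} := 'X_(mxvec_index i j).
have form d G : (forall c y, ev G (c *: y) = c ^+ d * ev G y) ->
    (forall u0 u1, ev G (mxvec (plT b k u0 u1)) = 0) -> ev G x = 0.
  move=> hG h; apply: (hx d); first exact: homog_ev.
  by move=> y y0 /(generatorsP y0)[u0 [u1 [c [_ _ ->]]]]; rewrite /zeros hG h mulr0.
have anti i j : p i j + p j i = 0.
  have E y : ev (X i j + X j i) y = y 0 (mxvec_index i j) + y 0 (mxvec_index j i).
    by rewrite evD !evXU.
  rewrite /p -(E x); apply: (form 1%N) => [c y|u0 u1]; rewrite !E; first by rewrite !mxE; ring.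
  by rewrite !pE !mxE; ring.
have p23 : p o2 o3 = 0.
  have E y : ev (X o2 o3) y = y 0 (mxvec_index o2 o3) by rewrite evXU.
  rewrite /p -(E x); apply: (form 1%N) => [c y|u0 u1]; rewrite !E; first by rewrite !mxE; ring.
  by rewrite pE mxE /=; ring.
have rk : p o0 o2 * p o1 o3 = p o0 o3 * p o1 o2.
  apply: subr0_eq.
  have E y : ev (X o0 o2 * X o1 o3 - X o0 o3 * X o1 o2) y = y 0 (mxvec_index o0 o2) *
     y 0 (mxvec_index o1 o3) - y 0 (mxvec_index o0 o3) * y 0 (mxvec_index o1 o2).
    by rewrite evB !evM !evXU.
  rewrite /p -(E x); apply: (form 2%N) => [c y|u0 u1]; rewrite !E; first by rewrite !mxE; ring.
  by rewrite !pE !mxE /=; ring.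
have hA y (Z1 Z2 : {mpoly K[4 * 4]}) : ev (cA b%:MP Z1 Z2) y = A (ev Z1 y) (ev Z2 y).
  by rewrite /ev (rmorph_cA (meval _)) /= mevalC.
have hB y (Z1 Z2 : {mpoly K[4 * 4]}) : ev (cB b%:MP Z1 Z2) y = B (ev Z1 y) (ev Z2 y).
  by rewrite /ev (rmorph_cB (meval _)) /= mevalC.
have hg y (Z1 Z2 : {mpoly K[4 * 4]}) : ev (gq b%:MP Z1 Z2) y = g (ev Z1 y) (ev Z2 y).
  by rewrite /ev (rmorph_gq (meval _)) /= mevalC.
have inc (i j : 'I_4) : (i < 2)%N -> (1 < j)%N -> p i o2 * A (p o0 j) (p o1 j) + p i o3 * B (p o0 j) (p o1 j) = 0.
  have E y : ev (X i o2 * cA b%:MP (X o0 j) (X o1 j) + X i o3 * cB b%:MP (X o0 j) (X o1 j)) y =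
      y 0 (mxvec_index i o2) * A (y 0 (mxvec_index o0 j)) (y 0 (mxvec_index o1 j))
    + y 0 (mxvec_index i o3) * B (y 0 (mxvec_index o0 j)) (y 0 (mxvec_index o1 j)).
    by rewrite evD (evM _ (X i o2)) (evM _ (X i o3)) hA hB !evXU.
  move=> hi hj; rewrite /p -(E x); apply: (form 4%N) => [c y|u0 u1]; rewrite !E.
    by rewrite !mxE /cA /cB; ring.
  rewrite !pE !mxE /=; move: i j hi hj {E}; apply: ord4P; apply: ord4P => // _ _; rewrite /= /cA /cB; ring.
have p01A : p o0 o1 * A (p o0 o3) (p o1 o3) = k * (p o0 o3 * p o1 o3 * g (p o0 o3) (p o1 o3)).
  apply: subr0_eq.
  have E y : ev (X o0 o1 * cA b%:MP (X o0 o3) (X o1 o3)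
      - k%:MP * (X o0 o3 * X o1 o3 * gq b%:MP (X o0 o3) (X o1 o3))) y =
      y 0 (mxvec_index o0 o1) * A (y 0 (mxvec_index o0 o3)) (y 0 (mxvec_index o1 o3))
    - k * (y 0 (mxvec_index o0 o3) * y 0 (mxvec_index o1 o3) *
      g (y 0 (mxvec_index o0 o3)) (y 0 (mxvec_index o1 o3))).
    by rewrite evB (evM _ (X o0 o1)) hA (evM _ k%:MP) evC (evM _ (X o0 o3 * X o1 o3)) hg evM !evXU.
  rewrite /p -(E x); apply: (form 4%N) => [c y|u0 u1]; rewrite !E.
    by rewrite !mxE /cA /gq; ring.
  by rewrite !pE !mxE /= /cA /cB /gq; ring.
have p01B : p o0 o1 * B (p o0 o2) (p o1 o2) = - (k * (p o0 o2 * p o1 o2 * g (p o0 o2) (p o1 o2))).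
  apply/eqP; rewrite -addr_eq0; apply/eqP.
  have E y : ev (X o0 o1 * cB b%:MP (X o0 o2) (X o1 o2)
      + k%:MP * (X o0 o2 * X o1 o2 * gq b%:MP (X o0 o2) (X o1 o2))) y =
      y 0 (mxvec_index o0 o1) * B (y 0 (mxvec_index o0 o2)) (y 0 (mxvec_index o1 o2))
    + k * (y 0 (mxvec_index o0 o2) * y 0 (mxvec_index o1 o2) *
      g (y 0 (mxvec_index o0 o2)) (y 0 (mxvec_index o1 o2))).
    by rewrite evD (evM _ (X o0 o1)) hB (evM _ k%:MP) evC (evM _ (X o0 o2 * X o1 o2)) hg evM !evXU.
  rewrite /p -(E x); apply: (form 4%N) => [c y|u0 u1]; rewrite !E.
    by rewrite !mxE /cB /gq; ring.
  by rewrite !pE !mxE /= /cA /cB /gq; ring.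
have p01sq : p o0 o1 ^+ 2 + k ^+ 2 * (b * p o0 o2 * p o0 o3 *+ 3 - b ^+ 2 * p o0 o2 ^+ 2
    + (9%:R - b ^+ 2) * p o0 o2 * p o1 o3 + b * p o1 o2 * p o1 o3 *+ 3 - b ^+ 2 * p o1 o3 ^+ 2) = 0.
  have E y : ev (X o0 o1 ^+ 2 + (k ^+ 2)%:MP * ((b *+ 3)%:MP * (X o0 o2 * X o0 o3)
      + (- b ^+ 2)%:MP * (X o0 o2 * X o0 o2) + (9%:R - b ^+ 2)%:MP * (X o0 o2 * X o1 o3)
      + (b *+ 3)%:MP * (X o1 o2 * X o1 o3) + (- b ^+ 2)%:MP * (X o1 o3 * X o1 o3))) y =
     y 0 (mxvec_index o0 o1) ^+ 2 + k ^+ 2 * (b * y 0 (mxvec_index o0 o2) * y 0 (mxvec_index o0 o3) *+ 3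
     - b ^+ 2 * y 0 (mxvec_index o0 o2) ^+ 2
     + (9%:R - b ^+ 2) * y 0 (mxvec_index o0 o2) * y 0 (mxvec_index o1 o3)
     + b * y 0 (mxvec_index o1 o2) * y 0 (mxvec_index o1 o3) *+ 3 - b ^+ 2 * y 0 (mxvec_index o1 o3) ^+ 2).
    rewrite evD evX !evM !evD !evM !evC !evXU; ring.
  rewrite /p -(E x); apply: (form 2%N) => [c y|u0 u1]; rewrite !E.
    by rewrite !mxE; ring.
  by rewrite !pE !mxE /= /cA /cB /gq; ring.
have pd i : p i i = 0.
  by apply: (mulfI n2); rewrite mulr0 -[RHS](anti i i); ring.
have fin c u0 u1 : (u0 != 0) || (u1 != 0) ->
    p o0 o1 = c * plT b k u0 u1 o0 o1 -> p o0 o2 = c * plT b k u0 u1 o0 o2 ->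
    p o0 o3 = c * plT b k u0 u1 o0 o3 -> p o1 o2 = c * plT b k u0 u1 o1 o2 ->
    p o1 o3 = c * plT b k u0 u1 o1 o3 -> exists u0 u1 c,
      [/\ (u0 != 0) || (u1 != 0), c != 0 & x = c *: mxvec (plT b k u0 u1)].
  move=> u e01 e02 e03 e12 e13.
  have an i j : p i j = - p j i by apply/eqP; rewrite -addr_eq0 anti.
  have ex : x = c *: mxvec (plT b k u0 u1).
    apply/rowP => l; case/mxvec_indexP: l => i j; rewrite [RHS]mxE pE -/(p i j).
    have plan i' j' : plT b k u0 u1 i' j' = - plT b k u0 u1 j' i' by rewrite !mxE; ring.
    have pld i' : plT b k u0 u1 i' i' = 0 by rewrite !mxE; ring.
    have pl23 : plT b k u0 u1 o2 o3 = 0 by rewrite !mxE /=; ring.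
    move: i j; apply: ord4P; apply: ord4P; rewrite ?pd ?pld ?mulr0 //.
    - by rewrite an plan mulrN e01.
    - by rewrite an plan mulrN e02.
    - by rewrite an plan mulrN e12.
    - by rewrite p23 pl23 mulr0.
    - by rewrite an plan mulrN e03.
    - by rewrite an plan mulrN e13.
    by rewrite an plan mulrN p23 pl23 mulr0.
  exists u0, u1, c; split=> //; by apply: contraNneq x0 => c0; rewrite ex c0 scale0r.
have [u|] := boolP ((p o0 o2 != 0) || (p o1 o2 != 0)).
  have [m [e03 e13]] := prop2 u (esym (etrans rk (mulrC _ _))).
  have eqAB : A (p o0 o2) (p o1 o2) = - (m * B (p o0 o2) (p o1 o2)).
    have h (i : 'I_4) : (i < 2)%N -> p i o3 = m * p i o2 ->
        p i o2 * (A (p o0 o2) (p o1 o2) + m * B (p o0 o2) (p o1 o2)) = 0.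
      by move=> hi e; rewrite -[RHS](inc i o2) // e; ring.
    apply/eqP; rewrite -addr_eq0; case/orP: u => un.
      by have /eqP := h o0 isT e03; rewrite mulf_eq0 (negbTE un).
    by have /eqP := h o1 isT e13; rewrite mulf_eq0 (negbTE un).
  have Bn : B (p o0 o2) (p o1 o2) != 0.
    apply: contraTneq u => B0; have [] := cAB_coprime b1 _ B0; first by rewrite eqAB B0 mulr0 oppr0.
    by move=> -> ->; rewrite eqxx.
  apply: (fin (B (p o0 o2) (p o1 o2))^-1 _ _ u); rewrite !mxE /=.
  - apply: (mulfI Bn); rewrite mulVKf // mulrC p01B; ring.
  - by apply: (mulfI Bn); rewrite mulVKf //; ring.
  - by apply: (mulfI Bn); rewrite mulVKf // eqAB e03; ring.
  - by apply: (mulfI Bn); rewrite mulVKf //; ring.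
  - by apply: (mulfI Bn); rewrite mulVKf // eqAB e13; ring.
rewrite negb_or !negbK => /andP[/eqP e02 /eqP e12].
have [u|] := boolP ((p o0 o3 != 0) || (p o1 o3 != 0)).
  have B0 : B (p o0 o3) (p o1 o3) = 0.
    apply/eqP; case/orP: u => un; [have := inc o0 o3 isT isT | have := inc o1 o3 isT isT];
      by rewrite ?e02 ?e12 mul0r add0r => /eqP; rewrite mulf_eq0 (negbTE un).
  have An : A (p o0 o3) (p o1 o3) != 0 by have := cAB_neq0 b1 u; rewrite B0 eqxx orbF.
  apply: (fin (- (A (p o0 o3) (p o1 o3))^-1) _ _ u); rewrite !mxE /= ?B0 ?e02 ?e12.
  - by apply: (mulfI An); rewrite mulNr mulrN mulVKf // mulrC p01A; ring.
  - ring.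
  - by apply: (mulfI An); rewrite mulNr mulrN mulVKf //; ring.
  - ring.
  - by apply: (mulfI An); rewrite mulNr mulrN mulVKf //; ring.
rewrite negb_or !negbK => /andP[/eqP e03 /eqP e13].
have e01 : p o0 o1 = 0.
  by apply/eqP; rewrite -sqrf_eq0; apply/eqP; rewrite -[RHS]p01sq e02 e03 e12 e13; ring.
case/eqP: x0; apply/rowP => l; case/mxvec_indexP: l => i j; rewrite [RHS]mxE -/(p i j).
have an i' j' : p i' j' = - p j' i' by apply/eqP; rewrite -addr_eq0 anti.
by move: i j; apply: ord4P; apply: ord4P; rewrite ?pd // an ?(e01, e02, e03, e12, e13, p23) ?oppr0 // an
  ?(e01, e02, e03, e12, e13, p23) !oppr0.
Qed.

Lemma plT_scale c u0 u1 : plT b k (c * u0) (c * u1) = c ^+ 4 *: plT b k u0 u1.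
Proof.
apply/matrixP => i j; rewrite !mxE; move: i j.
by apply: ord4P; apply: ord4P; rewrite /= /cA /cB /gq; ring.
Qed.

Lemma generators_irreducible : zirreducible Y.
Proof.
pose P (l : 'I_(4 * 4)) : {mpoly K[3]} :=
  'X_r2 * mxvec (plT b%:MP k%:MP 'X_r0 'X_r1) 0 l.
have PE u0 u1 c : \row_l ev (P l) (pt3 u0 u1 c) = c *: mxvec (plT b k u0 u1).
  apply/rowP => l; rewrite [LHS]mxE [RHS]mxE evM evXU pt3E; congr (_ * _).
  case/mxvec_indexP: l => i j; rewrite !mxvecE.
  have := congr1 (fun M : 'M[K]_4 => M i j) (map_plT (meval (pt3 u0 u1 c 0)) b%:MP k%:MP 'X_r0 'X_r1).
  by rewrite mxE /= !mevalC !mevalXU !pt3E.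
apply: zirreducible_path.
  have u : ((1 : K) != 0) || ((0 : K) != 0) by rewrite oner_eq0.
  exists (mxvec (plT b k 1 0)); first exact: plT_neq0.
  by apply/generatorsP; [exact: plT_neq0 | exists 1, 0, 1; rewrite scale1r oner_eq0].
move=> x y x0 y0 /(generatorsP x0)[u0 [u1 [c [_ _ ->]]]] /(generatorsP y0)[v0 [v1 [d [_ _ ->]]]].
rewrite -!PE; apply: path_param => z; rewrite [z]row3E PE.
set w := (X in X *: _); have [w0|w0] := eqVneq w 0; first by left; rewrite w0 scale0r.
have [u|] := boolP ((z 0 r0 != 0) || (z 0 r1 != 0)).
  right; apply/generatorsP; last by exists (z 0 r0), (z 0 r1), w.
  by rewrite scaler_eq0 negb_or w0 plT_neq0.
rewrite negb_or !negbK => /andP[/eqP-> /eqP->]; left.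
have -> : plT b k 0 0 = 0.
  by rewrite -[X in plT _ _ X _](mul0r 0) -[X in plT _ _ _ X](mul0r 0) plT_scale expr0n scale0r.
by rewrite linear0 scaler0.
Qed.

(** A form that does not vanish on all generators restricts to a nonzero polynomial in u, with
    finitely many zeros; so a smaller irreducible closed set is a point. *)
Lemma generators_curve : irreducible_curve Y.
Proof.
split; [exact: generators_closed | exact: generators_irreducible | |].
  case=> p p0 hp.
  have u : ((1 : K) != 0) || ((0 : K) != 0) by rewrite oner_eq0.
  have v : ((0 : K) != 0) || ((1 : K) != 0) by rewrite oner_eq0 orbT.
  have h u0 u1 : (u0 != 0) || (u1 != 0) -> (mxvec (plT b k u0 u1) == p)%MS.
    move=> uu; apply/hp; first exact: plT_neq0.
    by apply/generatorsP; [exact: plT_neq0 | exists u0, u1, 1; rewrite scale1r oner_eq0].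
  have [c c0 e] : exists2 c, c != 0 & mxvec (plT b k 1 0) = c *: mxvec (plT b k 0 1).
    apply/eq_rV; [exact: plT_neq0 | exact: plT_neq0 |].
    have /eqmxP hu := h _ _ u; have /eqmxP hv := h _ _ v.
    by apply/eqmxP; apply: eqmx_trans hu (eqmx_sym hv).
  move/(congr1 (fun x : 'rV[K]_(4 * 4) => x 0 (mxvec_index o1 o2))): e.
  rewrite [RHS]mxE !mxvecE !mxE /= /cA /cB => /eqP.
  rewrite !(mulr0, mul0r, expr0n, expr1n, mulr1, mul1r, subr0, addr0) /=.
  by rewrite eq_sym (negbTE c0).
move=> W cW iW WY; have [YW|nYW] := classic (psub Y W); [by left | right].
have [y [y0 Yy Wy]] : exists y, [/\ y != 0, Y y & ~ W y].
  by apply: NNPP => h; apply: nYW => y y0 Yy; apply: NNPP => Wy; apply: h; exists y.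
have [d [G [hG hW Gy]]] : exists d (G : {mpoly K[4 * 4]}),
    [/\ G \is d.-homog, psub W (zeros G) & ev G y != 0].
  apply: NNPP => h; apply: Wy; apply: (cW y y0) => d G hG hW.
  by apply/eqP/negPn/negP => Gy; apply: h; exists d, G.
have [u0 [u1 [c [u c0 ey]]]] := (generatorsP y0).1 Yy.
have Gu : ev G (mxvec (plT b k u0 u1)) != 0.
  by apply: contraNneq Gy => e; rewrite ey (ev_homog _ _ hG) e mulr0.
have [v0 [v1 v]] : exists v0 v1, u0 * v1 - u1 * v0 != 0.
  case/orP: u => un; [exists 0, 1 | exists 1, 0]; rewrite ?mulr0 ?mulr1 ?subr0 //.
  by rewrite sub0r oppr_eq0.
pose q := peval (fun l => mxvec (plT b%:P k%:P (u0%:P + v0 *: 'X) (u1%:P + v1 *: 'X)) 0 l) G.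
have qE t : q.[t] = ev G (mxvec (plT b k (u0 + t * v0) (u1 + t * v1))).
  rewrite /q horner_peval; congr ev; apply/rowP => l; rewrite [LHS]mxE.
  case/mxvec_indexP: l => i j; rewrite !mxvecE.
  have := congr1 (fun M : 'M[K]_4 => M i j) (map_plT (horner_eval t) b%:P k%:P
     (u0%:P + v0 *: 'X) (u1%:P + v1 *: 'X)).
  by rewrite mxE /= /horner_eval !hornerD !hornerC !hornerZ hornerX ![t * _]mulrC.
have q0 : q != 0.
  by apply: contraNneq Gu => e; have := qE 0; rewrite e horner0 !mul0r !addr0 => <-.
have [rs hrs] := closed_field_poly_normal q.
have vv : (v0 != 0) || (v1 != 0).
  rewrite -negb_and; apply: contraNN v => /andP[/eqP-> /eqP->]; by rewrite !mulr0 subr0.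
have ut t : (u0 + t * v0 != 0) || (u1 + t * v1 != 0).
  rewrite -negb_and; apply: contraNN v => /andP[/eqP e0 /eqP e1].
  have -> : u0 * v1 - u1 * v0 = (u0 + t * v0) * v1 - (u1 + t * v1) * v0 by ring.
  by rewrite e0 e1 !mul0r subr0.
apply: (@irreducible_finite _ _ W (mxvec (plT b k v0 v1) ::
   [seq mxvec (plT b k (u0 + t * v0) (u1 + t * v1)) | t <- rs])) => //.
  by rewrite /= plT_neq0 //=; apply/allP => _ /mapP[t _ ->]; apply: plT_neq0.
move=> x x0 Wx; have [z0 [z1 [e [z en ex]]]] := (generatorsP x0).1 (WY x x0 Wx).
have Gz : ev G (mxvec (plT b k z0 z1)) = 0.
  have := hW x x0 Wx; rewrite /zeros ex (ev_homog _ _ hG) => /eqP.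
  by rewrite mulf_eq0 expf_eq0 (negbTE en) andbF => /eqP.
(* the coordinates of z in the basis u, v *)
pose f := (u0 * v1 - u1 * v0)^-1.
have fE : f * (u0 * v1 - u1 * v0) = 1 by rewrite mulVf.
pose a := (z0 * v1 - z1 * v0) * f; pose h := (u0 * z1 - u1 * z0) * f.
have z0E : z0 = a * u0 + h * v0 by rewrite -[LHS]mulr1 -fE /a /h; ring.
have z1E : z1 = a * u1 + h * v1 by rewrite -[LHS]mulr1 -fE /a /h; ring.
apply/orP; have [a0|a0] := eqVneq a 0; [left | right].
  apply/eq_rV => //; first exact: plT_neq0.
  have h0 : h != 0.
    by apply: contraTneq z => h0; rewrite z0E z1E a0 h0 !mul0r addr0 eqxx.
  exists (e * h ^+ 4); first by rewrite mulf_neq0 ?expf_neq0.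
  by rewrite ex z0E z1E a0 !mul0r !add0r plT_scale linearZ scalerA.
have za : plT b k z0 z1 = a ^+ 4 *: plT b k (u0 + h / a * v0) (u1 + h / a * v1).
  by rewrite -plT_scale z0E z1E; congr plT; field.
apply/hasP; exists (mxvec (plT b k (u0 + h / a * v0) (u1 + h / a * v1))).
  apply: map_f; rewrite -root_prod_XsubC.
  have : root q (h / a).
    rewrite /root qE; move/eqP: Gz; rewrite za linearZ (ev_homog _ _ hG) mulf_eq0.
    by rewrite !expf_eq0 (negbTE a0) !andbF.
  by rewrite hrs rootZ // lead_coef_eq0.
apply/eq_rV => //; first exact: plT_neq0.
exists (e * a ^+ 4); first by rewrite mulf_neq0 ?expf_neq0.
by rewrite ex za linearZ scalerA.
Qed.
End Ruling.

(** * Lines on the scroll *)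

Section LinesOnScroll.
Variables (K : closedFieldType) (b k : K).
Hypotheses (n2 : (2%:R : K) != 0) (n3 : (3%:R : K) != 0).
Hypotheses (b0 : b != 0) (b1 : b ^+ 2 != 1) (b9 : b ^+ 2 != 9%:R).

Local Notation A := (cA b).
Local Notation B := (cB b).
Local Notation g := (gq b).
Local Notation S := (Smp b k).
Local Notation T := (Tl b k).

Lemma lincombE n (x y : 'rV[K]_n) a c i : (a *: x + c *: y) 0 i = a * x 0 i + c * y 0 i.
Proof. by rewrite !mxE. Qed.

Lemma affine0 (p q : K) : (forall a, p * a + q = 0) -> p = 0 /\ q = 0.
Proof.
move=> h; have q0 : q = 0 by rewrite -(h 0) mulr0 add0r.
by split=> //; rewrite -(h 1) q0 addr0 mulr1.
Qed.

(** A line meeting ell lies in a plane through ell, where the quartic splits into ell and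
    three generators. *)
Lemma line_meeting_directrix m : is_line m -> line_in m S -> lines_meet m (E01 K) ->
  (m == E01 K)%MS \/ generator b k m.
Proof.
move=> lm mS [p [p0 pm /sub_E01[p2 p3]]].
have [r [rm lpr epr]] := line_through lm p0 pm.
have hp := row4E p; rewrite p2 p3 in hp.
have [st|] := boolP ((r 0 o2 != 0) || (r 0 o3 != 0)); last first.
  rewrite negb_or !negbK => /andP[/eqP r2 /eqP r3]; left.
  apply/eqmxP; apply: eqmx_trans (eqmx_sym (eqmxP epr)) _; apply/eqmxP.
  apply: line_eq_join2 => //; first exact: E01_line.
    by apply/sub_E01.
  by apply/sub_E01.
right; set s := r 0 o2 in st; set t := r 0 o3 in st.
have [u [v [z [un vn zn fac [nu1 [nu2 [nu3 [f1 f2 f3 hprod]]]]]]]] := fibre_lines k b1 st.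
have via (u' : K * K) nu : (u'.1 != 0) || (u'.2 != 0) -> s = nu * B u'.1 u'.2 -> t = - (nu * A u'.1 u'.2) ->
    (forall a, (u'.1 * p 0 o1 - u'.2 * p 0 o0) * a
      + (u'.1 * r 0 o1 - u'.2 * r 0 o0 + k * nu * (u'.1 * u'.2 * g u'.1 u'.2)) = 0) -> generator b k m.
  move=> un' es et /affine0[e1 e2]; exists u'.1, u'.2; split=> //.
  have [] := @prop2 K u'.1 u'.2 (p 0 o0) (p 0 o1) un'; first by apply/esym/subr0_eq.
  move=> m1 [ep0 ep1].
  have [] := @prop2 K u'.1 u'.2 (r 0 o0 - nu * (k * u'.1 * g u'.1 u'.2)) (r 0 o1) un'.
    by apply/esym/subr0_eq; rewrite -[RHS]e2; ring.
  move=> m2 [er0 er1].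
  apply/eqmxP; apply: eqmx_trans (eqmx_sym (eqmxP epr)) _; apply/eqmxP.
  apply: line_eq_join2 => //; first exact: Tl_line.
    by apply/sub_Tl; exists m1, 0; rewrite hp ep0 ep1 !mul0r !addr0 oppr0.
  apply/sub_Tl; exists m2, nu; rewrite [LHS]row4E -/s -/t -er0 er1 -es -et; congr pt4.
  by rewrite subrK.
have hz a : (u.1 * (a * p 0 o1 + r 0 o1) - u.2 * (a * p 0 o0 + r 0 o0) + k * nu1 * (u.1 * u.2 * g u.1 u.2) * 1) *
   (v.1 * (a * p 0 o1 + r 0 o1) - v.2 * (a * p 0 o0 + r 0 o0) + k * nu2 * (v.1 * v.2 * g v.1 v.2) * 1) *
   (z.1 * (a * p 0 o1 + r 0 o1) - z.2 * (a * p 0 o0 + r 0 o0) + k * nu3 * (z.1 * z.2 * g z.1 z.2) * 1) = 0.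
  rewrite -hprod; have := mS (a *: p + r); rewrite ev_Smp !mxE p2 p3 !mulr0 !add0r -/s -/t.
  rewrite -[s in Sf _ _ _ _ s]mulr1 -[t in Sf _ _ _ _ _ t]mulr1 Sf_plane !mul1r => -> //.
  by apply: addmx_sub => //; apply: scalemx_sub.
pose L (w : K * K) nu : {poly K} := (w.1 * p 0 o1 - w.2 * p 0 o0)%:P * 'X
   + (w.1 * r 0 o1 - w.2 * r 0 o0 + k * nu * (w.1 * w.2 * g w.1 w.2))%:P.
have LE w nu a : (L w nu).[a] = (w.1 * p 0 o1 - w.2 * p 0 o0) * a
      + (w.1 * r 0 o1 - w.2 * r 0 o0 + k * nu * (w.1 * w.2 * g w.1 w.2)).
  by rewrite hornerD hornerM !hornerC hornerX.
have /eqP : L u nu1 * L v nu2 * L z nu3 = 0.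
  by apply: poly_ext0 => a; rewrite !hornerM !LE -[RHS](hz a); congr (_ * _ * _); ring.
rewrite !mulf_eq0 => /orP[/orP[]|] /eqP e.
- by case: f1 => es et _; apply: (via u nu1) => // a; rewrite -LE e horner0.
- by case: f2 => es et _; apply: (via v nu2) => // a; rewrite -LE e horner0.
by case: f3 => es et _; apply: (via z nu3) => // a; rewrite -LE e horner0.
Qed.

(** A line disjoint from ell meets each plane through ell in one point, lying on one of
    its three generators.  So the quartic form expressing that the line meets the
    generator through u has a zero in every such plane, hence vanishes. *)
Lemma line_avoiding_directrix m : is_line m -> line_in m S -> ~ lines_meet m (E01 K) ->
  k = 0 /\ (m == axis K)%MS.
Proof.
move=> lm mS nm; pose x := row 0 m; pose y := row 1 m.
have xm : (x <= m)%MS := row_sub 0 m; have ym : (y <= m)%MS := row_sub 1 m.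
have ind := (is_line_join2 x y).2 (etrans (congr1 mxrank (esym (row_mx2 m))) lm).
have off a c : a * x 0 o2 + c * y 0 o2 = 0 -> a * x 0 o3 + c * y 0 o3 = 0 -> a = 0 /\ c = 0.
  rewrite -!lincombE => e2 e3; have [/ind//|n0] := eqVneq (a *: x + c *: y) 0.
  case: nm; exists (a *: x + c *: y); split=> //; last exact/sub_E01.
  by rewrite addmx_sub // scalemx_sub.
pose D := x 0 o2 * y 0 o3 - x 0 o3 * y 0 o2.
have D0 : D != 0.
  apply/eqP => D0.
  have [||] := off (y 0 o2) (- x 0 o2).
  - ring.
  - by rewrite -[RHS]oppr0 -D0 /D; ring.
  move=> y2 /eqP; rewrite oppr_eq0 => /eqP x2.
  have [||] := off (y 0 o3) (- x 0 o3).
  - by rewrite x2 y2; ring.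
  - ring.
  move=> y3 /eqP; rewrite oppr_eq0 => /eqP x3.
  have [||/eqP] := off 1 0; rewrite ?oner_eq0 //.
    by rewrite x2 y2; ring.
  by rewrite x3 y3; ring.
pose a2 := (y 0 o3 * x 0 o0 - x 0 o3 * y 0 o0) / D; pose b2 := (y 0 o3 * x 0 o1 - x 0 o3 * y 0 o1) / D.
pose a3 := (x 0 o2 * y 0 o0 - y 0 o2 * x 0 o0) / D; pose b3 := (x 0 o2 * y 0 o1 - y 0 o2 * x 0 o1) / D.
have hm s t : (pt4 (a2 * s + a3 * t) (b2 * s + b3 * t) s t <= m)%MS.
  have -> : pt4 (a2 * s + a3 * t) (b2 * s + b3 * t) s t =
     ((y 0 o3 * s - y 0 o2 * t) / D) *: x + ((x 0 o2 * t - x 0 o3 * s) / D) *: y.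
    rewrite [RHS]row4E !lincombE /a2 /b2 /a3 /b3; congr pt4; last 2 first.
    - by apply: (mulIf D0); rewrite mulrDl mulrAC divfK // mulrAC divfK // /D; ring.
    - by apply: (mulIf D0); rewrite mulrDl mulrAC divfK // mulrAC divfK // /D; ring.
    - by rewrite ![_ / D * _]mulrAC -!mulrDl; congr (_ / D); ring.
    by rewrite ![_ / D * _]mulrAC -!mulrDl; congr (_ / D); ring.
  by rewrite addmx_sub // scalemx_sub.
pose f0 := b3; pose f1 := - a3 + b * b3 - b * k *+ 2.
pose f2 := - (b * a3) - b * b2 - k * (b ^+ 2 + 3%:R).
pose f3 := b * a2 - b2 - b * k *+ 2; pose f4 := a2.
have psiE u0 u1 nu : let s := nu * B u0 u1 in let t := - (nu * A u0 u1) in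
    u0 * (b2 * s + b3 * t) - u1 * (a2 * s + a3 * t) + k * nu * (u0 * u1 * g u0 u1) =
    - nu * quartic f0 f1 f2 f3 f4 u0 u1.
  by rewrite /quartic /f0 /f1 /f2 /f3 /f4 /cA /cB /gq; ring.
have zero t : exists u0 u1 nu, [/\ (u0 != 0) || (u1 != 0), 1 = nu * B u0 u1, t = - (nu * A u0 u1) &
     quartic f0 f1 f2 f3 f4 u0 u1 = 0].
  have st : ((1 : K) != 0) || (t != 0) by rewrite oner_eq0.
  have [u [v [z [un vn zn fac [nu1 [nu2 [nu3 [h1 h2 h3 hprod]]]]]]]] := fibre_lines k b1 st.
  have := mS _ (hm 1 t); rewrite ev_Smp4.
  have := Sf_plane b k (a2 * 1 + a3 * t) (b2 * 1 + b3 * t) 1 t 1.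
  rewrite (mulr1 t) (mulr1 1) mul1r => ->; rewrite hprod => /eqP.
  have via (w : K * K) nu : (w.1 != 0) || (w.2 != 0) -> 1 = nu * B w.1 w.2 -> t = - (nu * A w.1 w.2) ->
     w.1 * (b2 * 1 + b3 * t) - w.2 * (a2 * 1 + a3 * t) + k * nu * (w.1 * w.2 * g w.1 w.2) * 1 = 0 ->
     exists u0 u1 nu, [/\ (u0 != 0) || (u1 != 0), 1 = nu * B u0 u1, t = - (nu * A u0 u1) &
       quartic f0 f1 f2 f3 f4 u0 u1 = 0].
    move=> wn e1 et h; have /eqP : - nu * quartic f0 f1 f2 f3 f4 w.1 w.2 = 0.
      by rewrite -psiE /= -e1 -et -[RHS]h; ring.
    rewrite mulf_eq0 oppr_eq0 => /orP[/eqP nu0|/eqP ?]; last by exists w.1, w.2, nu.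
    by move: e1; rewrite nu0 mul0r => /eqP; rewrite oner_eq0.
  rewrite !mulf_eq0 => /orP[/orP[]|] /eqP e.
  - by case: h1 => e1 et _; apply: (via u nu1).
  - by case: h2 => e1 et _; apply: (via v nu2).
  by case: h3 => e1 et _; apply: (via z nu3).
have [p [q pq]] := quartic_split f0 f1 f2 f3 f4.
have [i pqi] : exists i, (p i == 0) && (q i == 0).
  apply: NNPP => npq.
  have npqi i : (p i != 0) || (q i != 0).
    by rewrite -negb_and; apply/negP => h; apply: npq; exists i.
  pose R : {poly K} := \prod_i ((B (q i) (- p i))%:P * 'X + (A (q i) (- p i))%:P).
  have /closed_nonrootP[t /negP] : R != 0.
    apply/prodf_neq0 => i _; apply/eqP => e.
    have := cAB_neq0 b1 (u0 := q i) (u1 := - p i); rewrite oppr_eq0 orbC npqi => /(_ isT).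
    have := congr1 (fun r : {poly K} => r`_0) e; have := congr1 (fun r : {poly K} => r`_1) e.
    by rewrite !(coefD, coefMX, coefC) /= addr0 add0r => -> ->; rewrite eqxx.
  apply; have [u0 [u1 [nu [un e1 et]]]] := zero t.
  have [-> _] := pq u0 u1 => /eqP; rewrite prodf_seq_eq0 => /hasP[i _ /= /eqP e].
  rewrite /root horner_prod; apply/prodf_eq0; exists i => //.
  have [||c [c1 c2]] := @prop2 K (q i) (- p i) u0 u1.
  - by rewrite oppr_eq0 orbC.
  - by apply/eqP; rewrite -subr_eq0 -oppr_eq0; apply/eqP; rewrite -[RHS]e; ring.
  have e1' : 1 = nu * c ^+ 3 * B (q i) (- p i) by rewrite {1}e1 c1 c2 /cB; ring.
  have et' : t = - (nu * c ^+ 3 * A (q i) (- p i)) by rewrite et c1 c2 /cA; ring.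
  rewrite hornerD hornerM !hornerC hornerX et'; apply/eqP.
  by rewrite -[RHS](mul0r (A (q i) (- p i))) -(subrr 1) [in X in 1 - X]e1'; ring.
have q0 s t : quartic f0 f1 f2 f3 f4 s t = 0.
  have [-> _] := pq s t; case/andP: pqi => /eqP pi /eqP qi.
  by rewrite (bigD1 i) //= pi qi !mul0r addr0 mul0r.
have P0 : f0%:P + f1%:P * 'X + f2%:P * 'X^2 + f3%:P * 'X^3 + f4%:P * 'X^4 = 0 :> {poly K}.
  apply: poly_ext0 => t; rewrite !(hornerD, hornerM, hornerC, hornerXn, hornerX).
  by rewrite -[RHS](q0 1 t) /quartic; ring.
have co j : (f0%:P + f1%:P * 'X + f2%:P * 'X^2 + f3%:P * 'X^3 + f4%:P * 'X^4 : {poly K})`_j = 0.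
  by rewrite P0 coef0.
have := co 0%N; have := co 1%N; have := co 2%N; have := co 3%N; have := co 4%N.
rewrite !(coefD, coefCM, coefC, coefX, coefXn) /= !(mulr0, mulr1, addr0, add0r).
rewrite /f0 /f1 /f2 /f3 /f4 => e4 e3 e2 e1 e0.
rewrite e0 e4 !mulr0 !addr0 !sub0r in e1 e3.
have a3E : a3 = - (b * k *+ 2) by rewrite -[LHS]opprK -[X in - X](subrK (b * k *+ 2)) e1 add0r.
have b2E : b2 = - (b * k *+ 2) by rewrite -[LHS]opprK -[X in - X](subrK (b * k *+ 2)) e3 add0r.
have k0 : k = 0.
  apply/eqP; move: e2; rewrite a3E b2E.
  have -> : - (b * - (b * k *+ 2)) - b * - (b * k *+ 2) - k * (b ^+ 2 + 3%:R)
     = 3%:R * (b ^+ 2 - 1) * k by ring.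
  by move/eqP; rewrite !mulf_eq0 subr_eq0 (negbTE n3) (negbTE b1).
split=> //; apply/eqmxP/eqmx_sym/eqmxP; apply: line_eq_join2 => //; first exact: axis_line.
  by have := hm 1 0; rewrite e4 b2E k0 !mulr0 mul0rn oppr0 mul0r !addr0.
by have := hm 0 1; rewrite e0 a3E k0 !mulr0 mul0rn oppr0 mul0r !addr0.
Qed.

(** Apart from the generators the scroll contains only the directrix and, for k = 0, the triple
    line. *)
Lemma scroll_ruling : ruling S (generator b k).
Proof.
split; first exact: generators_curve.
have gen m : is_line m -> generator b k m -> line_in m S.
  move=> lm [u0 [u1 [_ /eqmxP e]]] x; rewrite e; exact: Tl_in_S.
exists (if k == 0 then [:: E01 K; axis K] else [:: E01 K]); first by case: ifP.
move=> m lm; split=> [mS|].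
  have [meet|nm] := classic (lines_meet m (E01 K)).
    have [e|] := line_meeting_directrix lm mS meet; last by left.
    by right; case: ifP => _ /=; rewrite e.
  have [k0 e] := line_avoiding_directrix lm mS nm.
  by right; rewrite k0 eqxx /= e orbT.
case=> [|h]; first exact: gen.
have [/eqmxP e|[k0 /eqmxP e]] : (m == E01 K)%MS \/ k = 0 /\ (m == axis K)%MS.
- move: h; case: eqP => k0 /=; rewrite orbF; last by left.
  by case/orP; [left | right].
- by move=> x; rewrite e; apply: directrix_in_S.
by move=> x; rewrite e => /sub_axis[e0 e1]; case: (axis_singular b (x 0 o2) (x 0 o3) k0) => h2 _; rewrite [x]row4E e0 e1.
Qed.

Lemma scroll_directrix : directrix S (E01 K).
Proof.
split; [exact: E01_line | exact: directrix_in_S |].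
exists (generator b k); first exact: scroll_ruling.
move=> m lm [u0 [u1 [u /eqmxP e]]]; exists (pt4 u0 u1 0 0); split.
- by rewrite pt4_eq0 !eqxx !andbT -negb_and in u *.
- by apply/sub_E01; rewrite !pt4E.
by rewrite e; have := submx_refl (T u0 u1); rewrite {1}/Tl join2_sub => /andP[].
Qed.
End LinesOnScroll.

(** * The scroll as a component of the surface of tangent lines *)

Section TangentSurface.
Variables (K : closedFieldType) (b k c0 c1 c2 c3 c4 : K).
Hypotheses (n2 : (2%:R : K) != 0) (n3 : (3%:R : K) != 0).
Hypotheses (b0 : b != 0) (b1 : b ^+ 2 != 1) (b9 : b ^+ 2 != 9%:R).

Local Notation A := (cA b).
Local Notation B := (cB b).
Local Notation g := (gq b).
Local Notation S := (Smp b k).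
Local Notation T := (Tl b k).
Local Notation F := (Fmp b k c0 c1 c2 c3 c4).
Local Notation G := (Gst b k c0 c1 c2 c3 c4).

(** Along ell the equation reduces to x2 A + x3 B up to terms of higher order. *)
Lemma gradient_directrix (u0 u1 : K) (v : 'rV[K]_4) :
  v *m (gradient F (pt4 u0 u1 0 0))^T = (v 0 o2 * A u0 u1 + v 0 o3 * B u0 u1)%:M.
Proof.
rewrite [LHS]mx11_scalar; congr (_%:M); rewrite mxE.
transitivity ((along F (pt4 u0 u1 0 0) v)`_1).
  by rewrite along_coef1; apply: eq_bigr => i _; rewrite !mxE.
rewrite along_Fmp along_Smp along_Qmp !pt4E !add0r.
set x := u0%:P + _; set y := u1%:P + _.
have -> : quartic c0%:P c1%:P c2%:P c3%:P c4%:P (v 0 o2 *: 'X) (v 0 o3 *: 'X) =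
    (quartic c0%:P c1%:P c2%:P c3%:P c4%:P (v 0 o2)%:P (v 0 o3)%:P * 'X^2) * 'X^2.
  by rewrite /quartic -!mul_polyC; ring.
rewrite -!mul_polyC Sf_plane coefD coefMXn /= addr0 coefXM /=.
set r := hess _ _ _ _ _ _; set r' := disc _ _ _ _.
have -> : cubic (v 0 o2)%:P (b%:P * (v 0 o2)%:P) (b%:P * (v 0 o3)%:P) (v 0 o3)%:P x y + k%:P * 'X * r
  + k%:P ^+ 3 * 'X ^+ 3 * r' = cubic (v 0 o2)%:P (b%:P * (v 0 o2)%:P) (b%:P * (v 0 o3)%:P) (v 0 o3)%:P x y
  + 'X * (k%:P * r + k%:P ^+ 3 * 'X ^+ 2 * r') by ring.
rewrite coefD coefXM /= addr0 -horner_coef0 -/(horner_eval 0 _) rmorph_cubic !rmorphM /= /horner_eval !hornerC.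
by rewrite /x /y !hornerD !hornerC !hornerZ !hornerX !mulr0 !addr0 /cubic /cA /cB; ring.
Qed.

Lemma along_Gst_directrix (s t x y x' y' w' : K) : exists q,
  along (G s t) (pt3 x y 0) (pt3 x' y' w') = (s * A x y + t * B x y)%:P
   + ((s * x ^+ 2 *+ 3 + b * s * x * y *+ 2 + b * t * y ^+ 2) * x'
    + (b * s * x ^+ 2 + b * t * x * y *+ 2 + t * y ^+ 2 *+ 3) * y'
    + k * w' * hess s (b * s) (b * t) t x y)%:P * 'X + q * 'X^2.
Proof.
pose X := x%:P + x' *: 'X; pose Y := y%:P + y' *: 'X.
pose h := hess s%:P (b * s)%:P (b * t)%:P t%:P.
have [q1 e1] : exists q, cubic s%:P (b * s)%:P (b * t)%:P t%:P X Y = (s * A x y + t * B x y)%:P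
   + ((s * x ^+ 2 *+ 3 + b * s * x * y *+ 2 + b * t * y ^+ 2) * x'
    + (b * s * x ^+ 2 + b * t * x * y *+ 2 + t * y ^+ 2 *+ 3) * y')%:P * 'X + q * 'X^2.
  exists (s%:P * (3%:R * x%:P * x'%:P ^+ 2 + x'%:P ^+ 3 * 'X) + (b * s)%:P * (2%:R * x%:P * x'%:P * y'%:P
    + x'%:P ^+ 2 * y%:P + x'%:P ^+ 2 * y'%:P * 'X) + (b * t)%:P * (2%:R * y%:P * y'%:P * x'%:P
    + y'%:P ^+ 2 * x%:P + y'%:P ^+ 2 * x'%:P * 'X) + t%:P * (3%:R * y%:P * y'%:P ^+ 2 + y'%:P ^+ 3 * 'X)).
  by rewrite /X /Y /cubic /cA /cB -!mul_polyC; ring.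
have [q2 e2] : exists q, h X Y = (hess s (b * s) (b * t) t x y)%:P + q * 'X.
  exists ((s * (b * t) *+ 3 - (b * s) ^+ 2)%:P * (2%:R * x%:P * x'%:P + x'%:P ^+ 2 * 'X)
    + (s * t *+ 9 - b * s * (b * t))%:P * (x%:P * y'%:P + x'%:P * y%:P + x'%:P * y'%:P * 'X)
    + (b * s * t *+ 3 - (b * t) ^+ 2)%:P * (2%:R * y%:P * y'%:P + y'%:P ^+ 2 * 'X)).
  by rewrite /h /X /Y /hess -!mul_polyC; ring.
exists (q1 + k%:P * w'%:P * q2 + (k ^+ 3 * disc s (b * s) (b * t) t
  + quartic c0 c1 c2 c3 c4 s t)%:P * w'%:P ^+ 3 * 'X).
rewrite along_Gst -/X -/Y -/h e1 e2 -!mul_polyC; ring.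
Qed.

Lemma tangent_generator u0 u1 : (u0 != 0) || (u1 != 0) ->
  tangent_line_family F (E01 K) (T u0 u1).
Proof.
move=> u; split; first exact: Tl_line.
have st : (B u0 u1 != 0) || (- A u0 u1 != 0) by rewrite oppr_eq0 orbC cAB_neq0.
exists (pt4 u0 u1 0 0), (Hst (B u0 u1) (- A u0 u1)), (G (B u0 u1) (- A u0 u1)),
  (pt3 u0 u1 0), (join2 (pt3 u0 u1 0) (pt3 (k * u0 * g u0 u1) 0 1)); split.
- by rewrite pt4_eq0 !eqxx !andbT -negb_and in u *; split=> //; apply/sub_E01; rewrite !pt4E.
- split; first by have [] := Hst_plane st.
  rewrite /Hst mul_join3 !gradient_directrix !pt4E !mul0r !addr0.
  have -> : B u0 u1 * A u0 u1 + - A u0 u1 * B u0 u1 = 0 by ring.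
  by apply/eqP; rewrite -submx0 join3_sub !submx0 raddf0 eqxx.
- exact: residual_Hst.
- by rewrite mul_join2 !mul_Hst !mulr0 !mulr1.
split; first by have := submx_refl (join2 (pt3 u0 u1 0) (pt3 (k * u0 * g u0 u1) 0 1)); rewrite {1}join2_sub => /andP[].
move=> v /sub_join2[a [c ->]]; rewrite !pt3Z pt3D.
have [q ->] := along_Gst_directrix (B u0 u1) (- A u0 u1) u0 u1 (a * u0 + c * (k * u0 * g u0 u1))
  (a * u1 + c * 0) (a * 0 + c * 1).
have := cubic_dx_scroll b 1 u0 u1; have := cubic_dy_scroll b 1 u0 u1.
have := hess_scroll b u0 u1; rewrite /= !mul1r => -> -> ->.
set e := (X in X%:P * 'X); have -> : e = 0.
  by rewrite /e; ring.
have -> : B u0 u1 * A u0 u1 + - A u0 u1 * B u0 u1 = 0 by ring.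
by rewrite !polyC0 mul0r !add0r dvdp_mull.
Qed.

Definition Dmp : {mpoly K[4]} := disc 'X_o2 (b%:MP * 'X_o2) (b%:MP * 'X_o3) 'X_o3.

Lemma ev_Dmp x : ev Dmp x = disc (x 0 o2) (b * x 0 o2) (b * x 0 o3) (x 0 o3).
Proof.
rewrite /ev /Dmp (rmorph_disc (meval _)) /= !(rmorphM (meval _)) /= !mevalC.
by rewrite -!/(ev _ _) !evXU.
Qed.

(** For an unramified point u of ell the fibre through u is smooth there, with tangent
    line T u; over a ramified point every line of the plane through u is tangent, and
    these planes are the zeros of the discriminant. *)
Lemma tangent_surface_sub x : S8 F (E01 K) x -> zeros S x \/ zeros Dmp x.
Proof.
case=> m [lm [P [H [R [p [m' [[P0 PE] [pH tH] res [pP mH] [pm' dv]]]]]]]] xm.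
have [u0 [u1 eP]] : exists u0 u1, P = pt4 u0 u1 0 0.
  by have [P2 P3] := (sub_E01 P).1 PE; exists (P 0 o0), (P 0 o1); rewrite [LHS]row4E P2 P3.
have u : (u0 != 0) || (u1 != 0).
  by move: P0; rewrite eP pt4_eq0 !eqxx !andbT negb_and.
have gr (v : 'rV[K]_4) : (v *m (gradient F P)^T == 0) = (v 0 o2 * A u0 u1 + v 0 o3 * B u0 u1 == 0).
  rewrite eP gradient_directrix; apply/eqP/eqP => [/matrixP/(_ 0 0)|->].
    by rewrite !mxE eqxx mulr1n.
  by apply/matrixP => i j; rewrite !mxE mul0rn.
have EH : pencil_plane (E01 K) H.
  split=> //; have HK : (H <= kermx (gradient F P)^T)%MS by apply/sub_kermxP.
  have rK : \rank (kermx (gradient F P)^T) = 3%N.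
    have g0 : (gradient F P)^T != 0.
      apply: contraTneq (cAB_neq0 b1 u) => e.
      have := gr (pt4 0 0 1 0); have := gr (pt4 0 0 0 1).
      by rewrite !e !mulmx0 eqxx !pt4E !mul0r !mul1r add0r addr0 => <- <-.
    by rewrite mxrank_ker mxrank_tr rank_rV -trmx_eq0 g0.
  have eqK : (H == kermx (gradient F P)^T)%MS.
    by rewrite HK /= -(geq_leqif (mxrank_leqif_sup HK)) pH rK.
  rewrite (eqmxP eqK); apply/sub_kermxP; apply/row_matrixP => i; rewrite row_mul row0.
  apply/eqP; rewrite gr; have /sub_E01[-> ->] := row_sub i (E01 K).
  by rewrite !mul0r addr0.
have [s [t [N [c [st uN cn0 eH eR]]]]] := residualP EH res.
have tan : s * A u0 u1 + t * B u0 u1 = 0.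
  apply/eqP; have := gr (pt4 0 0 s t); rewrite !pt4E => <-.
  have -> : pt4 0 0 s t = pt3 0 0 1 *m invmx N *m H.
    by rewrite eH mulmxA mulmxKV // mul_Hst !mulr1.
  by rewrite -mulmxA tH mulmx0.
have [nu [es et]] := root_nu b1 u tan.
have nu0 : nu != 0.
  by apply: contraTneq st => n0; rewrite es et n0 !mul0r oppr0 eqxx.
have /submxP[y ey] : (x <= m'  *m H)%MS by rewrite mH.
pose v := y *m m'; pose w := v *m N.
have ex : x = pt4 (w 0 r0) (w 0 r1) (s * w 0 r2) (t * w 0 r2).
  by rewrite -mul_Hst -row3E ey /w /v eH !mulmxA.
have epN : p *m N = pt3 u0 u1 0.
  move: pP; rewrite eH mulmxA; set q := p *m N; rewrite [q]row3E mul_Hst eP.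
  case/pt4_inj => -> -> e2 e3; congr pt3; apply/eqP.
  by case/orP: st => h; [move/eqP: e2 | move/eqP: e3]; rewrite mulf_eq0 (negbTE h).
have : 'X^2 %| along (G s t) (pt3 u0 u1 0) w.
  have := dv v (submxMl _ _); rewrite eR.
  have -> : along (c *: lsub N (G s t)) p v = c *: along (G s t) (p *m N) (v *m N).
    apply: poly_ext => r; rewrite hornerZ !horner_along evZ ev_lsub mulmxDl.
    by rewrite -scalemxAl.
  by rewrite dvdpZr // epN.
rewrite [w]row3E; have [q ->] := along_Gst_directrix s t u0 u1 (w 0 r0) (w 0 r1) (w 0 r2).
rewrite tan polyC0 add0r => /dvdpP[q'].
move/(congr1 (fun r : {poly K} => r`_1)); rewrite coefD !coefMXn coefCM coefX /= addr0 mulr1.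
have := cubic_dx_scroll b nu u0 u1; have := cubic_dy_scroll b nu u0 u1.
have := hess_scroll b u0 u1; rewrite /= -es -et => hs -> ->.
have -> : hess s (b * s) (b * t) t u0 u1 = - nu ^+ 2 * (u0 * u1 * g u0 u1) ^+ 2.
  by rewrite mulNr -mulrN -hs es et /hess; ring.
move=> e; have /eqP : nu * (u0 * u1 * g u0 u1) * (u1 * (w 0 r0 - nu * w 0 r2 * (k * u0 * g u0 u1))
    - u0 * w 0 r1) = 0 by rewrite -[RHS]e; ring.
rewrite mulf_eq0 mulf_eq0 (negbTE nu0) /= => /orP[/eqP J0|/eqP/subr0_eq e']; [right | left].
  rewrite /zeros ev_Dmp ex !pt4E es et.
  have -> : disc (nu * B u0 u1 * w 0 r2) (b * (nu * B u0 u1 * w 0 r2)) (b * (- (nu * A u0 u1) * w 0 r2))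
     (- (nu * A u0 u1) * w 0 r2) = (nu * w 0 r2) ^+ 4 *
     disc (B u0 u1) (b * B u0 u1) (b * - A u0 u1) (- A u0 u1) by rewrite /disc; ring.
  by have := disc_scroll b u0 u1; rewrite /= J0 expr0n mul0r => ->; rewrite mulr0.
have [m1 [ew0 ew1]] := prop2 u e'.
apply/(zeros_Smp k b1); exists u0, u1; split=> //; apply/sub_Tl; exists m1, (nu * w 0 r2).
by rewrite ex -ew0 -ew1 es et; congr pt4; ring.
Qed.

Lemma zclosed_zeros n (f : {mpoly K[n]}) d : f \is d.-homog -> zclosed (zeros f).
Proof. by move=> hf x _ /(_ d f hf); apply. Qed.

(** The tangent lines sweep out the scroll and lie on the union of the scroll with the planes
    of discriminant zero; an irreducible set containing the scroll is not in these planes. *)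
Lemma scroll_component : irreducible_component (S8 F (E01 K)) (zeros S).
Proof.
split.
- exact: zclosed_zeros (Smp_homog b k).
- apply: zirreducible_path => [|x y _ _ Sx Sy].
    exists (pt4 1 0 0 0); first by rewrite pt4_eq0 oner_eq0.
    by apply: directrix_in_S; apply/sub_E01; rewrite !pt4E.
  have [f [h ? ?]] := scroll_path b1 Sx Sy; exists f; split=> // t; right; exact: h.
- move=> x _ /(zeros_Smp k b1)[u0 [u1 [u xT]]]; exists (T u0 u1) => //.
  exact: tangent_generator.
move=> W cW iW SW WS8.
have hD : Dmp \is 4.-homog.
  by apply: homog_ev => c x; rewrite !ev_Dmp !mxE /disc; ring.
have [] := iW.2 (zeros S) (zeros Dmp) (zclosed_zeros (Smp_homog b k)) (zclosed_zeros hD).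
- by move=> x x0 /(WS8 x x0); apply: tangent_surface_sub.
- by [].
(* the directrix point (1 : -1) has its generator in the plane s = t *)
move=> WD; have b1' : b - 1 != 0.
  by apply: contraNneq b1 => /subr0_eq ->; rewrite expr1n.
have xS : zeros S (pt4 (k * 1 * g 1 (-1)) 0 (B 1 (-1)) (- A 1 (-1))).
  by apply: (Tl_in_S (u0 := 1) (u1 := -1)); have := submx_refl (T 1 (-1)); rewrite {1}/Tl join2_sub => /andP[].
have Bn : B 1 (-1) = b - 1 by rewrite /cB; ring.
have An : - A 1 (-1) = b - 1 by rewrite /cA; ring.
rewrite Bn An in xS.
have x0 : pt4 (k * 1 * g 1 (-1)) 0 (b - 1) (b - 1) != 0 by rewrite pt4_eq0 (negbTE b1') !andbF.
have /eqP := WD _ x0 (SW _ x0 xS); rewrite ev_Dmp !pt4E.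
have -> : disc (b - 1) (b * (b - 1)) (b * (b - 1)) (b - 1) = (b - 1) ^+ 4 * disc 1 (b * 1) (b * 1) 1.
  by rewrite /disc; ring.
rewrite mulf_eq0 expf_eq0 (negbTE b1') andbF /= => /eqP d0.
by have := disc11 b1 b9; rewrite d0 eqxx.
Qed.
End TangentSurface.

(** * Segre decompositions of the normal form *)

Section NormalFormConclusion.
Variables (K : closedFieldType) (b k c0 c1 c2 c3 c4 : K).
Hypotheses (n2 : (2%:R : K) != 0) (n3 : (3%:R : K) != 0).
Hypotheses (b0 : b != 0) (b1 : b ^+ 2 != 1) (b9 : b ^+ 2 != 9%:R).

Local Notation A := (cA b).
Local Notation B := (cB b).
Local Notation g := (gq b).
Local Notation S := (Smp b k).
Local Notation T := (Tl b k).
Local Notation F := (Fmp b k c0 c1 c2 c3 c4).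

Lemma plane_through_E01 (L : {mpoly K[4]}) : plane_through (E01 K) L ->
  exists p q, ((p != 0) || (q != 0)) /\ forall x, ev L x = p * x 0 o2 + q * x 0 o3.
Proof.
case=> [[L0 hL] Lell].
have lin x : ev L x = x 0 o0 * ev L^`M(o0) 0 + (x 0 o1 * ev L^`M(o1) 0
   + (x 0 o2 * ev L^`M(o2) 0 + x 0 o3 * ev L^`M(o3) 0)) by rewrite linear_ev // big_ord4.
have d0 : ev L^`M(o0) 0 = 0.
  have := Lell (pt4 1 0 0 0); rewrite lin !pt4E !mul0r !addr0 mul1r => -> //.
  by apply/sub_E01; rewrite !pt4E.
have d1 : ev L^`M(o1) 0 = 0.
  have := Lell (pt4 0 1 0 0); rewrite lin !pt4E !mul0r !addr0 add0r mul1r => -> //.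
  by apply/sub_E01; rewrite !pt4E.
have LE x : ev L x = ev L^`M(o2) 0 * x 0 o2 + ev L^`M(o3) 0 * x 0 o3.
  by rewrite lin d0 d1 !mulr0 !add0r ![x 0 _ * _]mulrC.
exists (ev L^`M(o2) 0), (ev L^`M(o3) 0); split=> //.
apply: contraNT L0; rewrite negb_or !negbK => /andP[/eqP p0 /eqP q0].
by apply/eqP/mpoly_ext0 => x; rewrite LE p0 q0 !mul0r addr0.
Qed.

Lemma proportional_planes (L L' : {mpoly K[4]}) p q p' q' : (p != 0) || (q != 0) ->
  (p' != 0) || (q' != 0) -> (forall x, ev L x = p * x 0 o2 + q * x 0 o3) ->
  (forall x, ev L' x = p' * x 0 o2 + q' * x 0 o3) ->
  proportional L L' <-> p * q' - q * p' = 0.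
Proof.
move=> pq pq' LE LE'; split=> [[c c0' eL]|e].
  have e2 : c * p' = p by have := LE (pt4 0 0 1 0); rewrite eL evZ LE' !pt4E !mulr1 !mulr0 !addr0.
  have e3 : c * q' = q by have := LE (pt4 0 0 0 1); rewrite eL evZ LE' !pt4E !mulr1 !mulr0 !add0r.
  by rewrite -e2 -e3; ring.
have [|m [ep eq]] := @prop2 K p' q' p q pq'.
  by apply/subr0_eq; rewrite -[RHS]e; ring.
exists m; first by apply: contraTneq pq => m0; rewrite ep eq m0 !mul0r eqxx.
by apply: mpoly_ext => x; rewrite evZ LE LE' ep eq; ring.
Qed.

Lemma affine_product (e1 f1 e2 f2 e3 f3 d : K) : d != 0 ->
  (forall a, (e1 + a * f1) * (e2 + a * f2) * (e3 + a * f3) = d) -> [/\ f1 = 0, f2 = 0 & f3 = 0].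
Proof.
move=> d0 h; split; apply/eqP; apply: contraNT d0 => fn.
- by rewrite -(h (- e1 / f1)) divfK // subrr !mul0r.
- by rewrite -(h (- e2 / f2)) (divfK fn) subrr mulr0 mul0r.
by rewrite -(h (- e3 / f3)) (divfK fn) subrr mulr0.
Qed.

(** Adding to the scroll a nonzero form dm in x2 and x3 destroys its lines.  Take a plane
    through ell where neither dm nor the discriminant vanishes, and a point of it on the new
    surface, off ell.  On a line through this point and a point of ell, dm is constant, so
    the product of the equations of the three generators would be a nonzero constant; hence
    all three would be parallel to the line, but they do not meet ell in one point. *)
Lemma no_ruled_deformation (dm S' : {mpoly K[4]}) (a : K) : a != 0 -> S' = a *: S + dm ->
  (forall x y : 'rV[K]_4, x 0 o2 = y 0 o2 -> x 0 o3 = y 0 o3 -> ev dm x = ev dm y) ->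
  (forall x, x != 0 -> zeros S' x -> exists m, [/\ is_line m, line_in m S', (x <= m)%MS & lines_meet m (E01 K)]) ->
  dm = 0.
Proof.
move=> a0 eS dmE ruled; apply: NNPP => dm0.
have aq (e : K) : a * (e / a) = e by rewrite mulrC divfK.
have [z dz] : exists z, ev dm z != 0.
  by apply: NNPP => h; apply/dm0/mpoly_ext0 => x; apply/eqP/negPn/negP => ?; apply: h; exists x.
pose y := pt4 0 0 1 1 : 'rV[K]_4.
have Dy : ev (Dmp b) y != 0 by rewrite ev_Dmp !pt4E disc11.
have /closed_nonrootP[r] : along dm z (y - z) * along (Dmp b) z (y - z) != 0.
  rewrite mulf_neq0 //.
    by apply: contraNneq dz => e; have := horner_along dm z (y - z) 0; rewrite e horner0 scale0r addr0 => <-.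
  apply: contraNneq Dy => e; have := horner_along (Dmp b) z (y - z) 1; rewrite e horner0 scale1r.
  by rewrite addrC subrK => <-.
rewrite rootM negb_or /root !horner_along; set x1 := z + _ => /andP[dx Dx].
pose s := x1 0 o2; pose t := x1 0 o3.
have D0 : disc s (b * s) (b * t) t != 0 by rewrite ev_Dmp in Dx.
have st : (s != 0) || (t != 0).
  apply: contraNT D0; rewrite negb_or !negbK => /andP[/eqP-> /eqP->].
  by rewrite /disc !(mulr0, mul0r, expr0n, mul0rn, subr0, addr0) /=.
have dst x0' x1' : ev dm (pt4 x0' x1' s t) = ev dm x1 by apply: dmE; rewrite pt4E.
(* a point of the plane on S', off ell *)
have [x [xS' x2 x3]] : exists x : 'rV[K]_4, [/\ zeros S' x, x 0 o2 = s & x 0 o3 = t].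
  have [v0 [v1 Cv]] : exists v0 v1, s * A v0 v1 + t * B v0 v1 != 0.
    case/orP: st => h; [exists 1, 0 | exists 0, 1]; rewrite /cA /cB.
      by rewrite (_ : _ + _ = s) //; ring.
    by rewrite (_ : _ + _ = t) //; ring.
  have [P1 [P2 eP]] := along_directrix b k 0 0 s t v0 v1.
  have : size (along S (pt4 0 0 s t) (pt4 v0 v1 0 0) + (ev dm x1 / a)%:P) = 4%N.
    rewrite eP -!addrA size_polyDl size_Cmul ?size_polyXn //.
    apply: leq_ltn_trans (size_polyD _ _) _; rewrite gtn_max; apply/andP; split.
      by apply: leq_ltn_trans (size_polyMleq _ _) _; rewrite size_polyXn size_polyC; case: (_ == _).
    apply: leq_ltn_trans (size_polyD _ _) _; rewrite gtn_max; apply/andP; split.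
      by apply: leq_ltn_trans (size_polyMleq _ _) _; rewrite size_polyX size_polyC; case: (_ == _).
    by rewrite -polyCD size_polyC; case: (_ == _).
  move=> sz; have /closed_rootP[r' /eqP] : size (along S (pt4 0 0 s t) (pt4 v0 v1 0 0) + (ev dm x1 / a)%:P) != 1%N.
    by rewrite sz.
  rewrite hornerD hornerC horner_along pt4Z pt4D !mulr0 !add0r !addr0 => er.
  exists (pt4 (r' * v0) (r' * v1) s t); rewrite !pt4E; split=> //.
  rewrite /zeros eS evD evZ dst -[RHS](mulr0 a) -er mulrDr; congr (_ + _).
  by rewrite aq.
have xE := row4E x; rewrite x2 x3 in xE.
have xn : x != 0 by rewrite xE pt4_eq0 -!negb_and in st *; apply: contra st => /and4P[_ _ -> ->].
have [m [lm mS xm [p [p0 pm /sub_E01[p2 p3]]]]] := ruled x xn xS'.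
have [u0 [u1 [v0 [v1 [z0 [z1 [D2 _ prod]]]]]]] := fibre_product k b1 st.
have pE := row4E p; rewrite p2 p3 in pE.
have dn : - (ev dm x1 / a) != 0 by rewrite oppr_eq0 mulf_neq0 ?invr_eq0.
have h r' : (u0 * x 0 o1 - u1 * x 0 o0 + k * ((z0 * u1 - z1 * u0) * (u0 * v1 - u1 * v0)) * 1 + r' * (u0 * p 0 o1 - u1 * p 0 o0)) *
  (v0 * x 0 o1 - v1 * x 0 o0 + k * ((u0 * v1 - u1 * v0) * (v0 * z1 - v1 * z0)) * 1 + r' * (v0 * p 0 o1 - v1 * p 0 o0)) *
  (z0 * x 0 o1 - z1 * x 0 o0 + k * ((v0 * z1 - v1 * z0) * (z0 * u1 - z1 * u0)) * 1 + r' * (z0 * p 0 o1 - z1 * p 0 o0))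
   = - (ev dm x1 / a).
  have : ev S' (x + r' *: p) = 0 by apply: mS; rewrite addmx_sub // scalemx_sub.
  rewrite eS evD evZ {1 2}xE {1 2}pE !pt4Z pt4D !mulr0 !addr0 dst ev_Smp4.
  have := Sf_plane b k (x 0 o0 + r' * p 0 o0) (x 0 o1 + r' * p 0 o1) s t 1.
  rewrite !mulr1 mul1r => ->; move/eqP; rewrite addr_eq0 => /eqP e.
  have := prod (x 0 o0 + r' * p 0 o0) (x 0 o1 + r' * p 0 o1) 1; rewrite !mulr1 => e'.
  apply: (mulfI a0); rewrite mulrN aq -e e'; congr (_ * _).
  ring.
have [f1 f2 _] := affine_product dn h.
have a3 : u0 * v1 - u1 * v0 != 0.
  by apply: contraNneq D0 => e; rewrite D2 e mulr0 expr0n.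
have [e0 e1] := bracket0 a3 f1 f2.
by move: p0; rewrite pE e0 e1 pt4_0 eqxx.
Qed.
End NormalFormConclusion.

(** * The theorem for the normal form *)

(** The conclusions of the theorem as a property of the pair, so that it can be moved
    along a change of coordinates. *)
Definition segre_description (K : closedFieldType) (F : {mpoly K[4]}) (ell : 'M[K]_(2, 4)) :=
  exists (S4 : {mpoly K[4]}) (lambda : K) (L : 'I_4 -> {mpoly K[4]}),
    ((lambda != 0 /\ proportional F (lambda *: S4 + \prod_j L j)) /\
     (forall j, plane_through ell (L j)) /\
     (forall i j, i != j -> ~ proportional (L i) (L j)) /\
     (forall j, meets_in_four_lines F (L j)) /\
     ruled_quartic S4 /\
     irreducible_component (S8 F ell) (zeros S4) /\
     directrix S4 ell /\
     (forall x : 'rV[K]_4, x != 0 -> (x <= ell)%MS -> ~ singular_at S4 x) /\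
     (sing_line_of_triple_points S4 \/
      sing_twisted_cubic_of_double_points S4)) /\
    (segre_decomposition F ell (lambda *: S4) L /\
     forall (S : {mpoly K[4]}) (Lhat : 'I_4 -> {mpoly K[4]}),
       segre_decomposition F ell S Lhat ->
       proportional S S4 /\
       (forall i, exists j, proportional (Lhat i) (L j)) /\
       (forall j, exists i, proportional (Lhat i) (L j))) /\
    (has_singular_fibers F ell (nseq 4 I_3 ++ nseq 4 I_1 ++ nseq 4 II) <->
     twisted_cubic (singular_at S4)) /\
    (has_singular_fibers F ell (nseq 4 IV ++ nseq 4 II) <->
     sing_line_of_triple_points S4).

Section NormalForm.
Variables (K : closedFieldType) (b k c0 c1 c2 c3 c4 : K).
Hypotheses (n2 : (2%:R : K) != 0) (n3 : (3%:R : K) != 0).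
Hypotheses (b0 : b != 0) (b1 : b ^+ 2 != 1) (b9 : b ^+ 2 != 9%:R).

Local Notation S := (Smp b k).
Local Notation Q := (quartic c0 c1 c2 c3 c4).
Local Notation F := (Fmp b k c0 c1 c2 c3 c4).
Hypothesis smF : smooth_form F.

Lemma sing_line_not_twisted (G : {mpoly K[4]}) :
  sing_line_of_triple_points G -> ~ twisted_cubic (singular_at G).
Proof. by case=> [[m lm hm] _]; apply: (twisted_cubic_not_line lm hm). Qed.

(** The parts are proved in the preceding sections; what is left is uniqueness.  In another
    decomposition S differs from a multiple of the scroll by a form in x2 and x3, which is zero
    by no_ruled_deformation.  Then the two products of four planes agree up to a scalar. *)
Lemma segre_description_normal : segre_description F (E01 K).
Proof.
have [p [q [QE pq0 pq]]] := quartic_sqfree_split (smooth_c_sqfree n2 n3 b1 smF).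
pose L i : {mpoly K[4]} := (p i)%:MP * 'X_o2 + (q i)%:MP * 'X_o3.
have LE i x : ev (L i) x = p i * x 0 o2 + q i * x 0 o3 by rewrite evD !evM !evC !evXU.
have prodL : Qmp c0 c1 c2 c3 c4 = \prod_i L i.
  by apply: mpoly_ext => x; rewrite ev_Qmp QE ev_prod; apply: eq_bigr => i _; rewrite LE.
have planeL i : plane_through (E01 K) (L i).
  split; last by move=> x /sub_E01[x2 x3]; rewrite LE x2 x3 !mulr0 addr0.
  split; last by apply: homog_ev => c x; rewrite !LE !mxE; ring.
  apply: contraTneq (pq0 i) => e; have e0 x : ev (L i) x = 0 by rewrite e /ev meval0.
  have e2 : p i = 0 by have := LE i (pt4 0 0 1 0); rewrite e0 !pt4E !mulr1 !mulr0 addr0.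
  have e3 : q i = 0 by have := LE i (pt4 0 0 0 1); rewrite e0 !pt4E !mulr1 !mulr0 add0r.
  by rewrite e2 e3 eqxx.
have S0 : S != 0.
  apply/eqP => e; have := scroll_irreducible k n2 n3 b1 b9.
  by rewrite e => -[]; rewrite msize0.
have dec : segre_decomposition F (E01 K) (1 *: S) L.
  rewrite scale1r; split=> //.
  - by split=> //; apply: Smp_homog.
  - move=> x x0 /(zeros_Smp k b1)[u0 [u1 [u xT]]]; exists (Tl b k u0 u1); split=> //.
    + exact: Tl_line.
    + exact: Tl_in_S.
    exists (pt4 u0 u1 0 0); split; last by apply/sub_E01; rewrite !pt4E.
      by rewrite pt4_eq0 !eqxx !andbT -negb_and in u *.
    by have := submx_refl (Tl b k u0 u1); rewrite {1}/Tl join2_sub => /andP[].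
  by exists 1; rewrite ?oner_eq0 // scale1r -prodL.
have triple : k = 0 -> sing_line_of_triple_points S by apply: scroll_triple_line.
have twist : k != 0 -> sing_twisted_cubic_of_double_points S by apply: scroll_twisted_cubic.
have f8 : k = 0 -> has_singular_fibers F (E01 K) (nseq 4 IV ++ nseq 4 II) by apply: fibres_triple.
have f12 : k != 0 -> has_singular_fibers F (E01 K) (nseq 4 I_3 ++ nseq 4 I_1 ++ nseq 4 II).
  by apply: fibres_twisted.
exists S, 1, L; split; [|split; [|split]].
- split; first by rewrite oner_eq0; split=> //; case: dec.
  split=> //; split.
    move=> i j ij /(proportional_planes (pq0 i) (pq0 j) (LE i) (LE j)) e.
    by have /eqP := pq i j ij; apply; rewrite -[RHS]e; ring.
  split.
    move=> j; have st : (q j != 0) || (- p j != 0) by rewrite oppr_eq0 orbC.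
    have Q0 : Q (q j) (- p j) = 0.
      by rewrite QE (bigD1 j) //= (_ : _ + _ = 0) ?mul0r //; ring.
    have D0 : disc (q j) (b * q j) (b * - p j) (- p j) != 0.
      by apply/eqP => D0; apply: (smooth_disc_c b0 b1 b9 smF st D0).
    have [M [lM dM hM]] := plane_section k b1 st D0.
    exists M; split=> // x x0; rewrite -hM (sub_Hst x st) /zeros LE.
    have e : (p j * x 0 o2 + q j * x 0 o3 = 0) <-> (- p j * x 0 o2 = q j * x 0 o3).
      by split=> [/eqP|e]; rewrite ?addr_eq0 ?mulNr -?e ?mulNr ?addrN // => /eqP ->; rewrite opprK.
    split=> -[h1 h2]; split; try exact/e.
      by move: h1; rewrite /Fmp evD prodL ev_prod (bigD1 j) //= LE h2 mul0r addr0.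
    by rewrite /Fmp evD h1 prodL ev_prod (bigD1 j) //= LE (proj2 e h2) mul0r addr0.
  split; first exact: scroll_ruled.
  split; first exact: scroll_component.
  split; first exact: scroll_directrix.
  split; first by move=> x; apply: S_smooth_directrix.
  by have [k0|k0] := eqVneq k 0; [left; apply: triple | right; apply: twist].
- split=> // S' L' [[S'0 hS'] ruled planeL' [c cn0 eF]].
  have L'E i := plane_through_E01 (planeL' i).
  pose dm := c^-1 *: Qmp c0 c1 c2 c3 c4 - \prod_i L' i.
  have eS' : S' = c^-1 *: S + dm.
    rewrite /dm addrA -scalerDr -/(Fmp b k c0 c1 c2 c3 c4) eF scalerA mulVf // scale1r.
    by rewrite addrK.
  have dm0 : dm = 0.
    apply: (no_ruled_deformation b1 b9 _ eS'); [by rewrite invr_eq0 | | exact: ruled].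
    move=> x y e2 e3; rewrite /dm !evB !evZ !ev_Qmp !ev_prod e2 e3; congr (_ - _).
    by apply: eq_bigr => i _; have [p' [q' [_ h]]] := L'E i; rewrite !h e2 e3.
  have prodE x : c * \prod_i ev (L' i) x = \prod_i ev (L i) x.
    rewrite -!ev_prod -prodL -[X in _ = ev X _]scale1r -(mulfV cn0) -scalerA evZ; congr (_ * ev _ x).
    by apply/esym/subr0_eq.
  split; first by exists c^-1; rewrite ?invr_eq0 // eS' dm0 addr0.
  split=> i.
    have [p' [q' [pq' h]]] := L'E i.
    have : \prod_j ev (L j) (pt4 0 0 q' (- p')) = 0.
      by rewrite -prodE (bigD1 i) //= h !pt4E (_ : _ + _ = 0) ?mul0r ?mulr0 //; ring.
    move/eqP; rewrite prodf_seq_eq0 => /hasP[j _ /= /eqP e]; exists j.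
    apply/(proportional_planes pq' (pq0 j) h (LE j)).
    by move: e; rewrite LE !pt4E => e; apply: oppr_inj; rewrite oppr0 -[RHS]e; ring.
  have : \prod_j ev (L' j) (pt4 0 0 (q i) (- p i)) = 0.
    apply: (mulfI cn0); rewrite prodE mulr0 (bigD1 i) //= LE !pt4E (_ : _ + _ = 0) ?mul0r //; ring.
  move/eqP; rewrite prodf_seq_eq0 => /hasP[j _ /= /eqP e]; exists j.
  have [p' [q' [pq' h]]] := L'E j.
  apply/(proportional_planes pq' (pq0 i) h (LE i)).
  by move: e; rewrite h !pt4E => e; rewrite -[RHS]e; ring.
- have [k0|k0] := eqVneq k 0.
    split=> [h|/(sing_line_not_twisted (triple k0))//].
    by have := singular_fibers_leq h (f8 k0).
  by split=> _; [case: (twist k0) | apply: f12].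
have [k0|k0] := eqVneq k 0; first by split=> _; [apply: triple | apply: f8].
split=> [h|h]; first by have := singular_fibers_leq (f12 k0) h.
by case: (sing_line_not_twisted h); case: (twist k0).
Qed.
End NormalForm.

Lemma segre_description_transport (K : closedFieldType) (M : 'M[K]_4) (ell ell' : 'M[K]_(2, 4))
  (F : {mpoly K[4]}) : M \in unitmx -> (ell' *m M :=: ell)%MS ->
  segre_description F ell -> segre_description (lsub M F) ell'.
Proof.
move=> uM hl [S [la [L [[[la0 hF] [hL [hLL [h4 [hR [hC [hD [hS hsing]]]]]]]] [[hdec huniq] [h3 h4']]]]]].
have uV : invmx M \in unitmx by rewrite unitmx_inv.
have hlV : (ell *m invmx M :=: ell')%MS.
  by apply/eqmxP; rewrite -(eqmx_mul _ _ uM) mulmxKV //; apply/eqmxP/eqmx_sym.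
have lK G : lsub (invmx M) (lsub M G) = G by rewrite lsub_comp mulVmx // lsub1.
have lVK G : lsub M (lsub (invmx M) G) = G by rewrite lsub_comp mulmxV // lsub1.
have fib s : has_singular_fibers (lsub M F) ell' s <-> has_singular_fibers F ell s.
  split=> h; last exact: (singular_fibers_transport uM hl h).
  by have := singular_fibers_transport uV hlV h; rewrite lK.
exists (lsub M S), la, (fun i => lsub M (L i)); split; [|split; [|split]].
- split.
    split=> //; have := proj2 (proportional_lsub uM _ _) hF.
    by rewrite lsubD lsubZ lsub_prod.
  split; first by move=> j; apply: (plane_through_transport uM hl).
  split; first by move=> i j ij /(proportional_lsub uM); apply: hLL.
  split; first by move=> j; apply: four_lines_transport.
  split; first exact: ruled_quartic_transport.
  split.
    apply: (irreducible_component_transport uM _ _ hC) => y _; first exact: S8_transport.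
    by rewrite /zeros ev_lsub.
  split; first exact: (directrix_transport uM hl).
  split.
    move=> x x0 xl /(singular_lsub _ _ uM); apply: hS; first by rewrite mul_unit_neq0.
    by rewrite -(eqmxP (introT eqmxP hl)) submx_mul.
  by case: hsing => h; [left; exact: (proj1 (sing_line_transport uM _) h) | right; exact: sing_twisted_transport].
- split.
    by have := segre_transport uM hl hdec; rewrite lsubZ.
  move=> S' L' /(segre_transport uV hlV); rewrite lK => /huniq[p1 [p2 p3]].
  split; first by apply/(proportional_lsub uV); rewrite lK.
  by split=> i; [case: (p2 i) | case: (p3 i)] => j p; exists j; apply/(proportional_lsub uV); rewrite lK.
- by rewrite fib h3 (twisted_cubic_transport uM).
by rewrite fib h4' (sing_line_transport uM).
Qed.

(** * Coefficients of a quartic through a line *)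

Section QuarticCoefficients.
Variable K : closedFieldType.

Lemma mderiv_homog n (G : {mpoly K[n]}) d i : G \is d.+1.-homog -> G^`M(i) \is d.-homog.
Proof.
move=> /dhomogP hG; apply/dhomogP => m; rewrite mcoeff_msupp mcoeff_mderiv => nz.
have : (m + U_(i))%MM \in msupp G.
  by rewrite mcoeff_msupp; apply: contra nz => /eqP ->; rewrite mul0rn.
by move/hG => /=; rewrite mdegD mdeg1 addn1 => -[].
Qed.

Lemma euler n (G : {mpoly K[n]}) d (x : 'rV[K]_n) : G \is d.+1.-homog ->
  \sum_i x 0 i * ev G^`M(i) x = d.+1%:R * ev G x.
Proof.
move=> hG; rewrite -along_coef1.
have -> : along G x x = ('X + 1) ^+ d.+1 * (ev G x)%:P.
  apply: poly_ext => t; rewrite horner_along hornerM hornerC horner_exp hornerD hornerX.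
  rewrite -[1]/(1%:P) hornerC -(ev_homog _ _ hG); congr ev.
  by rewrite scalerDl scale1r addrC.
rewrite coefMC; congr (_ * _); rewrite -[LHS]mulr1n -coef_deriv deriv_exp derivD derivX.
rewrite -[1 in X in X * _]/(1%:P) derivC addr0 mul1r coefMn -horner_coef0 horner_exp.
by rewrite hornerD hornerX -[1 in LHS]/(1%:P) hornerC add0r expr1n.
Qed.

(** By induction through the Euler relation, which divides by the degree. *)
Lemma form_split (G : {mpoly K[4]}) d : (forall e, (e <= d)%N -> (e.+1%:R : K) != 0) ->
  G \is d.+1.-homog -> exists (e : nat -> K) (P R : {mpoly K[4]}),
  [/\ forall x, ev G x = \sum_(i < d.+2) e i * x 0 o0 ^+ (d.+1 - i) * x 0 o1 ^+ i
                         + x 0 o2 * ev P x + x 0 o3 * ev R x,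
     P \is d.-homog & R \is d.-homog].
Proof.
elim: d G => [|d IH] G hd hG.
  have hC c : (c%:MP : {mpoly K[4]}) \is 0.-homog.
    by apply: homog_ev => a x; rewrite !evC expr0 mul1r.
  exists (fun i => if i is 0 then ev G^`M(o0) 0 else ev G^`M(o1) 0), (ev G^`M(o2) 0)%:MP,
    (ev G^`M(o3) 0)%:MP; split=> // x.
  rewrite linear_ev // big_ord4 /= !big_ord_recl big_ord0 /= !evC; ring.
have nz := hd d.+1 (leqnn _); pose D i := d.+2%:R^-1 *: G^`M(i).
have hD i : D i \is d.+1.-homog by apply: dhomogZ; apply: mderiv_homog.
have hd' e : (e <= d)%N -> (e.+1%:R : K) != 0 by move=> ed; apply: hd; apply: leqW.
have [e0 [P0 [R0 [E0 hP0 hR0]]]] := IH (D o0) hd' (hD o0).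
have [e1 [P1 [R1 [E1 hP1 hR1]]]] := IH (D o1) hd' (hD o1).
pose c i := (if (i <= d.+1)%N then e0 i else 0) + (if i is j.+1 then e1 j else 0).
have hX i P : P \is d.-homog -> ('X_i * P : {mpoly K[4]}) \is d.+1.-homog.
  by move=> hP; rewrite -(add1n d); apply: dhomogM => //; case: (linear_X K i).
exists c, ('X_o0 * P0 + 'X_o1 * P1 + D o2), ('X_o0 * R0 + 'X_o1 * R1 + D o3); split; first last.
- by apply: rpredD; [apply: rpredD; apply: hX | apply: hD].
- by apply: rpredD; [apply: rpredD; apply: hX | apply: hD].
move=> x; have s i : ev G^`M(i) x = d.+2%:R * ev (D i) x by rewrite evZ mulVKf.
have -> : ev G x = d.+2%:R^-1 * (\sum_i x 0 i * ev G^`M(i) x) by rewrite (euler _ hG) mulKf.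
rewrite big_ord4 /= !s !(mulrCA _ d.+2%:R) -!mulrDr mulKf // E0 E1.
have -> : \sum_(i < d.+3) c i * x 0 o0 ^+ (d.+2 - i) * x 0 o1 ^+ i =
    x 0 o0 * (\sum_(i < d.+2) e0 i * x 0 o0 ^+ (d.+1 - i) * x 0 o1 ^+ i) +
    x 0 o1 * (\sum_(i < d.+2) e1 i * x 0 o0 ^+ (d.+1 - i) * x 0 o1 ^+ i).
  transitivity (\sum_(i < d.+3) ((if (i <= d.+1)%N then e0 i else 0) * x 0 o0 ^+ (d.+2 - i) * x 0 o1 ^+ i) +
     \sum_(i < d.+3) (match nat_of_ord i with 0 => 0 | j.+1 => e1 j end * x 0 o0 ^+ (d.+2 - i) * x 0 o1 ^+ i)).
    by rewrite -big_split; apply: eq_bigr => i _; rewrite /= -!mulrDl.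
  congr (_ + _).
    rewrite big_ord_recr /= ltnn !mul0r addr0 mulr_sumr; apply: eq_bigr => i _.
    have hi : (i <= d.+1)%N by rewrite -ltnS ltn_ord.
    by rewrite hi subSn // exprS; ring.
  rewrite big_ord_recl /= !mul0r add0r mulr_sumr; apply: eq_bigr => i _.
  by rewrite subSS exprS; ring.
by rewrite !evD !evM !evXU; ring.
Qed.

End QuarticCoefficients.

Section LineQuartic.
Variable R : comNzRingType.
Implicit Types (a b p r w f : nat -> R) (l : nat -> nat -> R).

Definition bin3 a (u0 u1 : R) := cubic (a 0%N) (a 1%N) (a 2%N) (a 3%N) u0 u1.
Definition bin2 p (u0 u1 : R) := p 0%N * u0 ^+ 2 + p 1%N * (u0 * u1) + p 2%N * u1 ^+ 2.
Definition bin1 l (i : nat) (u0 u1 : R) := l i 0%N * u0 + l i 1%N * u1.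
Definition lin_part l (u0 u1 s t : R) := bin1 l 0 u0 u1 * s ^+ 3 + bin1 l 1 u0 u1 * (s ^+ 2 * t)
  + bin1 l 2 u0 u1 * (s * t ^+ 2) + bin1 l 3 u0 u1 * t ^+ 3.
Definition quad_part p r w (u0 u1 s t : R) :=
  s ^+ 2 * bin2 p u0 u1 + s * t * bin2 r u0 u1 + t ^+ 2 * bin2 w u0 u1.
Definition line_quartic a b p r w l f (u0 u1 s t : R) :=
  s * bin3 a u0 u1 + t * bin3 b u0 u1 + quad_part p r w u0 u1 s t + lin_part l u0 u1 s t
  + quartic (f 0%N) (f 1%N) (f 2%N) (f 3%N) (f 4%N) s t.
End LineQuartic.

Section LineQuarticExists.
Variable K : closedFieldType.
Hypotheses (n2 : (2%:R : K) != 0) (n3 : (3%:R : K) != 0).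

Lemma line_quarticP (F : {mpoly K[4]}) : F \is 4.-homog -> line_in (E01 K) F ->
  exists a b p r w l f, forall x,
    ev F x = line_quartic a b p r w l f (x 0 o0) (x 0 o1) (x 0 o2) (x 0 o3).
Proof.
move=> hF F0.
have nz d : (d <= 3)%N -> forall e, (e <= d)%N -> (e.+1%:R : K) != 0.
  move=> d3 e ed; have : (e <= 3)%N by apply: leq_trans d3.
  by case: e {ed} => [|[|[|[|//]]]] _; rewrite ?oner_eq0 // (natrM _ 2 2) mulf_neq0.
have [e [P [Q [FE hP hQ]]]] := form_split (nz 3 isT) hF.
have [a [P2 [P3 [PE hP2 hP3]]]] := form_split (nz 2 isT) hP.
have [b [Q2 [Q3 [QE hQ2 hQ3]]]] := form_split (nz 2 isT) hQ.
have [p [P22 [P23 [P2E hP22 hP23]]]] := form_split (nz 1 isT) hP2.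
have [r [P32 [P33 [P3E hP32 hP33]]]] := form_split (nz 1 isT) hP3.
have [r' [Q22 [Q23 [Q2E hQ22 hQ23]]]] := form_split (nz 1 isT) hQ2.
have [w [Q32 [Q33 [Q3E hQ32 hQ33]]]] := form_split (nz 1 isT) hQ3.
have [m0 [x0 [y0 [E0 hx0 hy0]]]] := form_split (nz 0 isT) hP22.
have [m1 [x1 [y1 [E1 hx1 hy1]]]] := form_split (nz 0 isT) hP23.
have [m2 [x2 [y2 [E2 hx2 hy2]]]] := form_split (nz 0 isT) hP32.
have [m3 [x3 [y3 [E3 hx3 hy3]]]] := form_split (nz 0 isT) hP33.
have [m4 [x4 [y4 [E4 hx4 hy4]]]] := form_split (nz 0 isT) hQ22.
have [m5 [x5 [y5 [E5 hx5 hy5]]]] := form_split (nz 0 isT) hQ23.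
have [m6 [x6 [y6 [E6 hx6 hy6]]]] := form_split (nz 0 isT) hQ32.
have [m7 [x7 [y7 [E7 hx7 hy7]]]] := form_split (nz 0 isT) hQ33.
have cst (G : {mpoly K[4]}) x : G \is 0.-homog -> ev G x = ev G 0.
  by move=> hG; have := ev_homog 0 x hG; rewrite scale0r expr0 mul1r => ->.
exists a, b, p, (fun i => r i + r' i), w,
  (fun i j => nth 0 [:: m0 j; m1 j + m2 j + m4 j; m3 j + m5 j + m6 j; m7 j] i),
  (fun i => nth 0 [:: ev x0 0; ev y0 0 + ev x1 0 + ev x2 0 + ev x4 0;
     ev y1 0 + ev y2 0 + ev y4 0 + ev x3 0 + ev x5 0 + ev x6 0;
     ev y3 0 + ev y5 0 + ev y6 0 + ev x7 0; ev y7 0] i) => x.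
have e0 : \sum_(i < 5) e i * x 0 o0 ^+ (4 - i) * x 0 o1 ^+ i = 0.
  have := F0 (pt4 (x 0 o0) (x 0 o1) 0 0); rewrite FE !pt4E !mul0r !addr0 => -> //.
  by apply/sub_E01; rewrite !pt4E.
rewrite FE e0 PE QE P2E P3E Q2E Q3E E0 E1 E2 E3 E4 E5 E6 E7.
rewrite !(cst x0, cst y0, cst x1, cst y1, cst x2, cst y2, cst x3, cst y3) //.
rewrite !(cst x4, cst y4, cst x5, cst y5, cst x6, cst y6, cst x7, cst y7) //.
rewrite !big_ord_recl !big_ord0 /= /line_quartic /quad_part /lin_part /quartic /bin1 /bin2 /bin3 /cubic /=.
rewrite /bump /=; ring.
Qed.
End LineQuarticExists.

(** * The Hessian of the pencil *)

(** The determinant of a symmetric matrix of size three. *)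
Definition sdet (R : comNzRingType) (h00 h01 h02 h11 h12 h22 : R) :=
  h00 * (h11 * h22 - h12 ^+ 2) - h01 * (h01 * h22 - h12 * h02) + h02 * (h01 * h12 - h11 * h02).

Section Flexes.
Variable K : closedFieldType.
Hypothesis n2 : (2%:R : K) != 0.

(** A nondegenerate ternary quadratic form has no isotropic plane: if (t, v) is a basis
    of such a plane, completing it by a unit vector gives a matrix of the form whose
    determinant is zero, and is also its determinant times the square of a minor. *)
Lemma isotropic_sdet (h00 h01 h02 h11 h12 h22 t0 t1 t2 v0 v1 v2 : K) :
  let B x0 x1 x2 y0 y1 y2 := x0 * (h00 * y0 + h01 * y1 + h02 * y2)
     + x1 * (h01 * y0 + h11 * y1 + h12 * y2) + x2 * (h02 * y0 + h12 * y1 + h22 * y2) in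
  B t0 t1 t2 t0 t1 t2 = 0 -> B v0 v1 v2 v0 v1 v2 = 0 ->
  B (t0 + v0) (t1 + v1) (t2 + v2) (t0 + v0) (t1 + v1) (t2 + v2) = 0 ->
  [|| t1 * v2 - t2 * v1 != 0, t2 * v0 - t0 * v2 != 0 | t0 * v1 - t1 * v0 != 0] ->
  sdet h00 h01 h02 h11 h12 h22 = 0.
Proof.
move=> B tt vv tv; have {tv} tv : B t0 t1 t2 v0 v1 v2 = 0.
  have e : B (t0 + v0) (t1 + v1) (t2 + v2) (t0 + v0) (t1 + v1) (t2 + v2) =
    B t0 t1 t2 t0 t1 t2 + 2%:R * B t0 t1 t2 v0 v1 v2 + B v0 v1 v2 v0 v1 v2 by rewrite /B; ring.
  by apply: (mulfI n2); rewrite mulr0 -[RHS]tv e tt vv add0r addr0.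
have id n e k1 k2 : n ^+ 2 * sdet h00 h01 h02 h11 h12 h22 =
    B t0 t1 t2 t0 t1 t2 * (B v0 v1 v2 v0 v1 v2 * e - k2 ^+ 2)
    - B t0 t1 t2 v0 v1 v2 * (B t0 t1 t2 v0 v1 v2 * e - k1 * k2)
    + k1 * (B t0 t1 t2 v0 v1 v2 * k2 - B v0 v1 v2 v0 v1 v2 * k1) -> n != 0 ->
    sdet h00 h01 h02 h11 h12 h22 = 0.
  rewrite tt tv vv !mul0r !subr0 !mulr0 addr0 => /eqP.
  by rewrite mulf_eq0 expf_eq0 => /orP[/andP[_ /eqP->]|/eqP//]; rewrite eqxx.
case/or3P => n0.
- apply: (id _ h00 (h00 * t0 + h01 * t1 + h02 * t2) (h00 * v0 + h01 * v1 + h02 * v2) _ n0).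
  by rewrite /B /sdet; ring.
- apply: (id _ h11 (h01 * t0 + h11 * t1 + h12 * t2) (h01 * v0 + h11 * v1 + h12 * v2) _ n0).
  by rewrite /B /sdet; ring.
apply: (id _ h22 (h02 * t0 + h12 * t1 + h22 * t2) (h02 * v0 + h12 * v1 + h22 * v2) _ n0).
by rewrite /B /sdet; ring.
Qed.

Lemma join2_minors (p q : 'rV[K]_3) : is_line (join2 p q) ->
  [|| p 0 r1 * q 0 r2 - p 0 r2 * q 0 r1 != 0, p 0 r2 * q 0 r0 - p 0 r0 * q 0 r2 != 0
    | p 0 r0 * q 0 r1 - p 0 r1 * q 0 r0 != 0].
Proof.
move=> /(is_line_join2 _ _).2 ind; apply/negPn; rewrite !negb_or !negbK.
apply/negP => /and3P[/eqP e0 /eqP e1 /eqP e2].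
have e (i j : 'I_3) : p 0 i * q 0 j = p 0 j * q 0 i.
  move: i j; apply: ord3P; apply: ord3P => //;
  by first [exact: subr0_eq e0 | exact: subr0_eq e1 | exact: subr0_eq e2
    | exact: esym (subr0_eq e0) | exact: esym (subr0_eq e1) | exact: esym (subr0_eq e2)].
have z (i : 'I_3) : p 0 i = 0.
  have [] := ind (q 0 i) (- p 0 i); last by move=> _ /eqP; rewrite oppr_eq0 => /eqP.
  by apply/rowP => j; rewrite !mxE mulNr e mulrC subrr.
have [] := ind 1 0; last by move/eqP; rewrite oner_eq0.
by rewrite scale1r scale0r addr0 [p]row3E !z pt3_0.
Qed.

Definition plane_cubic (R : comNzRingType) (c q r : nat -> R) (g x0 x1 w : R) :=
  bin3 c x0 x1 + w * bin2 q x0 x1 + w ^+ 2 * (r 0%N * x0 + r 1%N * x1) + g * w ^+ 3.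

Lemma flex_sdet (c q r : nat -> K) g (G : {mpoly K[3]}) p :
  (forall x, ev G x = plane_cubic c q r g (x 0 r0) (x 0 r1) (x 0 r2)) ->
  inflection_point G p -> let x0 := p 0 r0 in let x1 := p 0 r1 in let w := p 0 r2 in
  sdet (6%:R * c 0%N * x0 + 2%:R * c 1%N * x1 + 2%:R * w * q 0%N)
       (2%:R * c 1%N * x0 + 2%:R * c 2%N * x1 + w * q 1%N)
       (2%:R * q 0%N * x0 + q 1%N * x1 + 2%:R * w * r 0%N)
       (2%:R * c 2%N * x0 + 6%:R * c 3%N * x1 + 2%:R * w * q 2%N)
       (q 1%N * x0 + 2%:R * q 2%N * x1 + 2%:R * w * r 1%N)
       (2%:R * (r 0%N * x0 + r 1%N * x1) + 6%:R * g * w) = 0.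
Proof.
move=> GE [p0 [m lm [pm hm]]] x0 x1 w.
have [v [vm lv _]] := line_through lm p0 pm.
have sec (y : 'rV[K]_3) : (y <= m)%MS -> let v0 := y 0 r0 in let v1 := y 0 r1 in let v2 := y 0 r2 in
   c 0%N * (3%:R * x0 * v0 ^+ 2) + c 1%N * (x1 * v0 ^+ 2 + 2%:R * x0 * v0 * v1)
   + c 2%N * (x0 * v1 ^+ 2 + 2%:R * x1 * v0 * v1) + c 3%N * (3%:R * x1 * v1 ^+ 2)
   + w * bin2 q v0 v1 + v2 * (q 0%N * (2%:R * x0 * v0) + q 1%N * (x0 * v1 + x1 * v0) + q 2%N * (2%:R * x1 * v1))
   + (r 0%N * x0 + r 1%N * x1) * v2 ^+ 2 + 2%:R * w * v2 * (r 0%N * v0 + r 1%N * v1)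
   + 3%:R * g * w * v2 ^+ 2 = 0.
  move=> ym v0 v1 v2; set e := (LHS).
  have [e0 [e1 eq]] : exists e0 e1, along G p y =
      e0%:P + e1%:P * 'X + e%:P * 'X^2 + (plane_cubic c q r g v0 v1 v2)%:P * 'X^3.
    exists (plane_cubic c q r g x0 x1 w), (c 0%N * (3%:R * x0 ^+ 2 * v0) + c 1%N * (2%:R * x0 * x1 * v0 + x0 ^+ 2 * v1)
      + c 2%N * (2%:R * x1 * x0 * v1 + x1 ^+ 2 * v0) + c 3%N * (3%:R * x1 ^+ 2 * v1)
      + v2 * bin2 q x0 x1 + w * (q 0%N * (2%:R * x0 * v0) + q 1%N * (x0 * v1 + x1 * v0) + q 2%N * (2%:R * x1 * v1))
      + w ^+ 2 * (r 0%N * v0 + r 1%N * v1) + 2%:R * w * v2 * (r 0%N * x0 + r 1%N * x1) + 3%:R * g * w ^+ 2 * v2).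
    apply: poly_ext => z; rewrite horner_along GE !mxE -/x0 -/x1 -/w -/v0 -/v1 -/v2.
    rewrite !(hornerD, hornerM, hornerC, hornerX, hornerXn) /e /plane_cubic /bin3 /bin2 /cubic; ring.
  have := hm y ym; rewrite eq => /dvdpP[z]; move/(congr1 (fun f : {poly K} => f`_2)).
  by rewrite coefMXn !(coefD, coefCM, coefC, coefX, coefXn) /= !(mulr0, mulr1, addr0, add0r).
have pv : ((p + v)%R <= m)%MS by rewrite addmx_sub.
apply: (isotropic_sdet (t0 := x0) (t1 := x1) (t2 := w) (v0 := v 0 r0) (v1 := v 0 r1) (v2 := v 0 r2)).
- by rewrite -[RHS](mulr0 2%:R) -(sec p pm) -/x0 -/x1 -/w /bin2; ring.
- by rewrite -[RHS](mulr0 2%:R) -(sec v vm) /bin2; ring.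
- by have := sec _ pv; rewrite !mxE -/x0 -/x1 -/w => h; rewrite -[RHS](mulr0 2%:R) -h /bin2; ring.
exact: join2_minors.
Qed.
End Flexes.

(** * The form cutting out the inflection points *)

Section PolarForm.
Variable R : comNzRingType.
Variables (a b p r w : nat -> R) (l : nat -> nat -> R) (f : nat -> R).

(** The equation of the quartic is x2 * coefA + x3 * coefB, so that the plane of the
    pencil through a point of the quartic is the one with parameters (coefB, - coefA). *)
Definition coefA (x0 x1 x2 x3 : R) := bin3 a x0 x1 + x2 * bin2 p x0 x1 + x3 * bin2 r x0 x1
  + x2 ^+ 2 * bin1 l 0 x0 x1 + x2 * x3 * bin1 l 1 x0 x1 + x3 ^+ 2 * bin1 l 2 x0 x1
  + f 0%N * x2 ^+ 3 + f 1%N * x2 ^+ 2 * x3 + f 2%N * x2 * x3 ^+ 2 + f 3%N * x3 ^+ 3.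
Definition coefB (x0 x1 x2 x3 : R) :=
  bin3 b x0 x1 + x3 * bin2 w x0 x1 + x3 ^+ 2 * bin1 l 3 x0 x1 + f 4%N * x3 ^+ 3.

(** Hessian of the plane cubic of parameters (s, t) at the point x of its plane; in each
    entry one factor (s, t) is replaced by (x2, x3). *)
Definition polar_hess (s t x0 x1 x2 x3 : R) := sdet
  (s * (6%:R * a 0%N * x0 + 2%:R * a 1%N * x1 + 2%:R * (p 0%N * x2 + r 0%N * x3))
    + t * (6%:R * b 0%N * x0 + 2%:R * b 1%N * x1 + 2%:R * w 0%N * x3))
  (s * (2%:R * a 1%N * x0 + 2%:R * a 2%N * x1 + p 1%N * x2 + r 1%N * x3)
    + t * (2%:R * b 1%N * x0 + 2%:R * b 2%N * x1 + w 1%N * x3))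
  (2%:R * (s ^+ 2 * p 0%N + s * t * r 0%N + t ^+ 2 * w 0%N) * x0
    + (s ^+ 2 * p 1%N + s * t * r 1%N + t ^+ 2 * w 1%N) * x1
    + 2%:R * (s ^+ 2 * x2 * l 0%N 0%N + s ^+ 2 * x3 * l 1%N 0%N + s * t * x3 * l 2%N 0%N + t ^+ 2 * x3 * l 3%N 0%N))
  (s * (2%:R * a 2%N * x0 + 6%:R * a 3%N * x1 + 2%:R * (p 2%N * x2 + r 2%N * x3))
    + t * (2%:R * b 2%N * x0 + 6%:R * b 3%N * x1 + 2%:R * w 2%N * x3))
  ((s ^+ 2 * p 1%N + s * t * r 1%N + t ^+ 2 * w 1%N) * x0
    + 2%:R * (s ^+ 2 * p 2%N + s * t * r 2%N + t ^+ 2 * w 2%N) * x1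
    + 2%:R * (s ^+ 2 * x2 * l 0%N 1%N + s ^+ 2 * x3 * l 1%N 1%N + s * t * x3 * l 2%N 1%N + t ^+ 2 * x3 * l 3%N 1%N))
  (2%:R * lin_part l x0 x1 s t + 6%:R * (f 0%N * s ^+ 3 * x2 + f 1%N * s ^+ 3 * x3
    + f 2%N * s ^+ 2 * t * x3 + f 3%N * s * t ^+ 2 * x3 + f 4%N * t ^+ 3 * x3)).

Definition flex_form (x0 x1 x2 x3 : R) :=
  polar_hess (coefB x0 x1 x2 x3) (- coefA x0 x1 x2 x3) x0 x1 x2 x3.

Lemma sdet_scale (c h00 h01 h02 h11 h12 h22 : R) :
  sdet (c * h00) (c * h01) (c ^+ 2 * h02) (c * h11) (c ^+ 2 * h12) (c ^+ 3 * h22) =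
  c ^+ 5 * sdet h00 h01 h02 h11 h12 h22.
Proof. by rewrite /sdet; ring. Qed.

Lemma polar_hess_scale c s t x0 x1 x2 x3 :
  polar_hess (c * s) (c * t) x0 x1 x2 x3 = c ^+ 5 * polar_hess s t x0 x1 x2 x3.
Proof.
by rewrite /polar_hess -sdet_scale; congr sdet; rewrite /lin_part; ring.
Qed.

Lemma polar_hess_homog c s t x0 x1 x2 x3 :
  polar_hess s t (c * x0) (c * x1) (c * x2) (c * x3) = c ^+ 3 * polar_hess s t x0 x1 x2 x3.
Proof.
have e h00 h01 h02 h11 h12 h22 : c ^+ 3 * sdet h00 h01 h02 h11 h12 h22 =
  sdet (c * h00) (c * h01) (c * h02) (c * h11) (c * h12) (c * h22) by rewrite /sdet; ring.
by rewrite e /polar_hess; congr sdet; rewrite /lin_part /bin1; ring.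
Qed.

Lemma coefA_homog c x0 x1 x2 x3 :
  coefA (c * x0) (c * x1) (c * x2) (c * x3) = c ^+ 3 * coefA x0 x1 x2 x3.
Proof. by rewrite /coefA /bin3 /bin2 /bin1 /cubic; ring. Qed.

Lemma coefB_homog c x0 x1 x2 x3 :
  coefB (c * x0) (c * x1) (c * x2) (c * x3) = c ^+ 3 * coefB x0 x1 x2 x3.
Proof. by rewrite /coefB /bin3 /bin2 /bin1 /cubic; ring. Qed.

Lemma flex_form_homog c x0 x1 x2 x3 :
  flex_form (c * x0) (c * x1) (c * x2) (c * x3) = c ^+ 18 * flex_form x0 x1 x2 x3.
Proof.
rewrite /flex_form coefA_homog coefB_homog -mulrN polar_hess_homog polar_hess_scale.
by move: (polar_hess _ _ _ _ _ _) => h; ring.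
Qed.
End PolarForm.

Section PolarMorphism.
Variables (R R' : comNzRingType) (h : {rmorphism R -> R'}).
Variables (a b p r w : nat -> R) (l : nat -> nat -> R) (f : nat -> R).

Lemma rmorph_sdet h00 h01 h02 h11 h12 h22 : h (sdet h00 h01 h02 h11 h12 h22) =
  sdet (h h00) (h h01) (h h02) (h h11) (h h12) (h h22).
Proof. rewrite /sdet !(rmorphD, rmorphB, rmorphM, rmorphXn). ring. Qed.

Lemma rmorph_coefA x0 x1 x2 x3 : h (coefA a p r l f x0 x1 x2 x3) =
  coefA (h \o a) (h \o p) (h \o r) (fun i j => h (l i j)) (h \o f) (h x0) (h x1) (h x2) (h x3).
Proof.
rewrite /coefA /bin3 /bin2 /bin1 /cubic !(rmorphD, rmorphM, rmorphXn) /=; ring.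
Qed.

Lemma rmorph_coefB x0 x1 x2 x3 : h (coefB b w l f x0 x1 x2 x3) =
  coefB (h \o b) (h \o w) (fun i j => h (l i j)) (h \o f) (h x0) (h x1) (h x2) (h x3).
Proof.
rewrite /coefB /bin3 /bin2 /bin1 /cubic !(rmorphD, rmorphM, rmorphXn) /=; ring.
Qed.

Lemma rmorph_polar_hess s t x0 x1 x2 x3 : h (polar_hess a b p r w l f s t x0 x1 x2 x3) =
  polar_hess (h \o a) (h \o b) (h \o p) (h \o r) (h \o w) (fun i j => h (l i j)) (h \o f)
    (h s) (h t) (h x0) (h x1) (h x2) (h x3).
Proof.
rewrite /polar_hess rmorph_sdet.
congr sdet; rewrite /lin_part /bin1 !(rmorphD, rmorphM, rmorphXn, rmorph_nat) /=; ring.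
Qed.

Lemma rmorph_flex_form x0 x1 x2 x3 : h (flex_form a b p r w l f x0 x1 x2 x3) =
  flex_form (h \o a) (h \o b) (h \o p) (h \o r) (h \o w) (fun i j => h (l i j)) (h \o f)
    (h x0) (h x1) (h x2) (h x3).
Proof. by rewrite /flex_form rmorph_polar_hess rmorphN rmorph_coefA rmorph_coefB. Qed.
End PolarMorphism.

(** * Lines of the second kind *)

Section SecondKind.
Variable K : closedFieldType.
Hypothesis n2 : (2%:R : K) != 0.
Variables (a b p r w : nat -> K) (l : nat -> nat -> K) (f : nat -> K) (F : {mpoly K[4]}).
Hypothesis FE : forall x, ev F x = line_quartic a b p r w l f (x 0 o0) (x 0 o1) (x 0 o2) (x 0 o3).

Definition fibre_cubic (s t : K) : {mpoly K[3]} :=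
  plane_cubic (fun i => (s * a i + t * b i)%:MP)
    (fun i => (s ^+ 2 * p i + s * t * r i + t ^+ 2 * w i)%:MP)
    (fun i => (s ^+ 3 * l 0%N i + s ^+ 2 * t * l 1%N i + s * t ^+ 2 * l 2%N i + t ^+ 3 * l 3%N i)%:MP)
    (quartic (f 0%N) (f 1%N) (f 2%N) (f 3%N) (f 4%N) s t)%:MP 'X_r0 'X_r1 'X_r2.

Lemma ev_fibre_cubic s t x : ev (fibre_cubic s t) x =
  plane_cubic (fun i => s * a i + t * b i) (fun i => s ^+ 2 * p i + s * t * r i + t ^+ 2 * w i)
    (fun i => s ^+ 3 * l 0%N i + s ^+ 2 * t * l 1%N i + s * t ^+ 2 * l 2%N i + t ^+ 3 * l 3%N i)
    (quartic (f 0%N) (f 1%N) (f 2%N) (f 3%N) (f 4%N) s t) (x 0 r0) (x 0 r1) (x 0 r2).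
Proof.
rewrite /ev /fibre_cubic /plane_cubic /bin3 /bin2 /cubic.
rewrite !(rmorphD (meval _), rmorphM (meval _), rmorphXn (meval _)) /= !mevalC !mevalXU.
by ring.
Qed.

Lemma restrict_fibre_cubic s t : restrict F (Hst s t) = 'X_r2 * fibre_cubic s t.
Proof.
apply: mpoly_ext => x; rewrite evM evXU ev_fibre_cubic ev_restrict [x in LHS]row3E mul_Hst FE !pt4E.
rewrite /line_quartic /quad_part /lin_part /plane_cubic /quartic /bin3 /bin2 /bin1 /cubic; ring.
Qed.

Lemma inflection_lsub c (N : 'M[K]_3) (G : {mpoly K[3]}) x : c != 0 -> N \in unitmx ->
  inflection_point (c *: lsub N G) x -> inflection_point G (x *m N).
Proof.
move=> c0 uN [x0 [m lm [xm hm]]]; split; first by rewrite mul_unit_neq0.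
exists (m *m N); first by rewrite /is_line rank_mul.
split=> [|v vm]; first by rewrite submx_mul.
have vN : (v *m invmx N <= m)%MS by rewrite -(submx_mul _ _ uN) mulmxKV.
have := hm _ vN; have -> : along (c *: lsub N G) x (v *m invmx N) = c *: along G (x *m N) v.
  by apply: poly_ext => z; rewrite hornerZ !horner_along evZ ev_lsub mulmxDl -scalemxAl mulmxKV.
by rewrite dvdpZr.
Qed.

(** At an inflection point of the fibre of parameters (s, t) the pair (coefB, - coefA) is
    a multiple of (s, t). *)
Lemma flex_form_zero s t x : (s != 0) || (t != 0) -> inflection_point (fibre_cubic s t) x ->
  flex_form a b p r w l f (x 0 r0) (x 0 r1) (s * x 0 r2) (t * x 0 r2) = 0.
Proof.
move=> st fx; have := flex_sdet n2 (ev_fibre_cubic s t) fx; rewrite /=.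
set y0 := x 0 r0; set y1 := x 0 r1; set y2 := x 0 r2 => h.
have hs : polar_hess a b p r w l f s t y0 y1 (s * y2) (t * y2) = 0.
  rewrite -[RHS]h /polar_hess; congr sdet; rewrite /lin_part /bin1 /quartic; ring.
have Gx : ev (fibre_cubic s t) x = 0.
  case: fx => x0 [m lm [xm hm]]; have /dvdpP[z] := hm 0 (sub0mx _ _).
  move/(congr1 (fun q : {poly K} => q.[0])); rewrite horner_along scale0r addr0 => ->.
  by rewrite hornerM hornerXn expr0n mulr0.
have e : s * coefA a p r l f y0 y1 (s * y2) (t * y2) + t * coefB b w l f y0 y1 (s * y2) (t * y2) = 0.
  rewrite -[RHS]Gx ev_fibre_cubic -/y0 -/y1 -/y2 /plane_cubic /coefA /coefB.
  by rewrite /quartic /bin3 /bin2 /bin1 /cubic; ring.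
have [|mu [eB eA]] := @prop2 K s t (coefB b w l f y0 y1 (s * y2) (t * y2))
   (- coefA a p r l f y0 y1 (s * y2) (t * y2)) st.
  by apply: subr0_eq; rewrite -[RHS]e; ring.
by rewrite /flex_form eB eA polar_hess_scale hs mulr0.
Qed.

(** flex_form vanishes at all inflection points of the fibres, on ell or not, hence on the
    closure of this set. *)
Lemma second_kind_flex_form : second_kind F (E01 K) ->
  forall u0 u1, flex_form a b p r w l f u0 u1 0 0 = 0.
Proof.
move=> sk u0 u1.
pose C (g : nat -> K) := fun i => (g i)%:MP : {mpoly K[4]}.
pose G : {mpoly K[4]} := flex_form (C a) (C b) (C p) (C r) (C w) (fun i j => (l i j)%:MP) (C f)
  'X_o0 'X_o1 'X_o2 'X_o3.
have GE x : ev G x = flex_form a b p r w l f (x 0 o0) (x 0 o1) (x 0 o2) (x 0 o3).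
  rewrite /ev /G (rmorph_flex_form (meval _)) /= !mevalXU.
  rewrite /flex_form /polar_hess /coefA /coefB /lin_part /bin1 /bin2 /bin3 /C /= !mevalC.
  by [].
have hG : G \is 18.-homog.
  apply: homog_ev => c x; have xE i : (c *: x) 0 i = c * x 0 i by rewrite mxE.
  by rewrite !GE !xE flex_form_homog.
have [e|n0] := eqVneq (pt4 u0 u1 0 0) 0.
  by have := ev0_homog hG; rewrite -e GE !pt4E.
have := sk (pt4 u0 u1 0 0) n0; rewrite /= (sub_E01 _) !pt4E => /(_ (conj erefl erefl)).
move/(_ 18 G hG); rewrite GE !pt4E; apply.
move=> y y0 [H [Gy [t [pH res _ fl ey]]]].
have [s' [t' [N [c [st uN c0 eH eG]]]]] := residual_unique restrict_fibre_cubic pH res.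
rewrite eG in fl; have fl' := inflection_lsub c0 uN fl.
rewrite /zeros GE ey eH mulmxA; set z := t *m N in fl' *.
by rewrite [z in z *m _]row3E mul_Hst !pt4E; apply: flex_form_zero.
Qed.
End SecondKind.

(** * The normal form of a line of the second kind *)

Section FlexNormalForm.
Variables (K : closedFieldType) (b k q1 q5 z2 z3 : K) (l : nat -> nat -> K) (f : nat -> K).
Hypotheses (n2 : (2%:R : K) != 0) (n3 : (3%:R : K) != 0).
Hypotheses (b0 : b != 0) (b1 : b ^+ 2 != 1) (b9 : b ^+ 2 != 9%:R).

Local Notation A := (cA b).
Local Notation B := (cB b).
Local Notation g := (gq b).

Definition nf_a i : K := nth 0 [:: 1; b; 0; 0] i.
Definition nf_b i : K := nth 0 [:: 0; 0; b; 1] i.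
Definition nf_p i : K := nth 0 [:: - (k * b ^+ 2); 0; q1] i.
Definition nf_r i : K := nth 0 [:: 3%:R * b * k; (9%:R - b ^+ 2) * k + z2; 3%:R * b * k + z3] i.
Definition nf_w i : K := nth 0 [:: q5; 0; - (k * b ^+ 2)] i.

Hypothesis flex : forall u0 u1, flex_form nf_a nf_b nf_p nf_r nf_w l f u0 u1 0 0 = 0.

Lemma polar_zero u0 u1 : polar_hess nf_a nf_b nf_p nf_r nf_w l f (B u0 u1) (- A u0 u1) u0 u1 0 0 = 0.
Proof.
rewrite -[RHS](flex u0 u1) /flex_form; congr polar_hess.
  by rewrite /coefB /bin3 /cubic /nf_b /= /cB; ring.
by rewrite /coefA /bin3 /cubic /nf_a /= /cA; ring.
Qed.

Lemma flex_q5 : q5 = 0.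
Proof.
have := polar_zero 1 0; rewrite /polar_hess /sdet /cA /cB /nf_a /nf_b /nf_p /nf_r /nf_w /=.
move=> h; have /eqP : (2%:R * 2%:R * 2%:R * b) * q5 ^+ 2 = 0 by rewrite -[RHS]h; ring.
by rewrite !mulf_eq0 (negbTE n2) (negbTE b0) /= orbb => /eqP.
Qed.

Lemma flex_q1 : q1 = 0.
Proof.
have := polar_zero 0 1; rewrite /polar_hess /sdet /cA /cB /nf_a /nf_b /nf_p /nf_r /nf_w /=.
move=> h; have /eqP : (2%:R * 2%:R * 2%:R * b) * q1 ^+ 2 = 0.
  by rewrite -[RHS]oppr0 -[in RHS]h; ring.
by rewrite !mulf_eq0 (negbTE n2) (negbTE b0) /= orbb => /eqP.
Qed.

(** At a ramification point u the cubic of its fibre has the double root u, so its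
    Hessian has rank one and the inflection condition becomes the vanishing of the
    quadratic part at u. *)
Lemma ramified_flex (x : K) : g 1 x = 0 -> z2 + z3 * x = 0.
Proof.
move=> gx; have := polar_zero 1 x; rewrite /polar_hess !mulr0 !addr0.
set h00 := (X in sdet X _ _ _ _ _); set h01 := (X in sdet _ X _ _ _ _).
set h02 := (X in sdet _ _ X _ _ _); set h11 := (X in sdet _ _ _ X _ _).
set h12 := (X in sdet _ _ _ _ X _); set h22 := (X in sdet _ _ _ _ _ X) => e.
have e01 : h01 = - (h11 * x).
  apply/eqP; rewrite -addr_eq0; apply/eqP.
  have -> : h01 + h11 * x = - (2%:R * x * g 1 x).
    by rewrite /h01 /h11 /nf_a /nf_b /nf_p /nf_r /nf_w /cA /cB /gq /=; ring.
  by rewrite gx mulr0 oppr0.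
have e00 : h00 = h11 * x ^+ 2.
  apply/eqP; rewrite -subr_eq0; apply/eqP.
  have -> : h00 - h11 * x ^+ 2 = (h00 + h01 * x) - x * (h01 + h11 * x) by ring.
  have -> : h00 + h01 * x = 2%:R * x ^+ 2 * g 1 x.
    by rewrite /h00 /h01 /nf_a /nf_b /nf_p /nf_r /nf_w /cA /cB /gq /=; ring.
  by rewrite gx e01 addNr !mulr0 subr0.
have gne y : y = x -> g 1 y != 0 -> False by move=> ->; rewrite gx eqxx.
have x0 : x != 0.
  by apply/eqP => x0; apply: (gne 0) => //; rewrite /gq (_ : _ + _ = 2%:R * b) ?mulf_neq0 //; ring.
have b21 : b ^+ 2 - 1 != 0 by rewrite subr_eq0.
have h11n : h11 != 0.
  have -> : h11 = - (2%:R * (1 + b * x) * (b + 3%:R * x)).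
    by rewrite /h11 /nf_a /nf_b /nf_p /nf_r /nf_w /cA /cB /=; ring.
  rewrite oppr_eq0 !mulf_neq0 //.
    apply: contraNneq (mulf_neq0 b0 b21) => bx.
    have -> : b * (b ^+ 2 - 1) = b ^+ 2 * g 1 x - (1 + b * x) * (2%:R * b ^+ 2 * x + b + b ^+ 3).
      by rewrite /gq; ring.
    by rewrite gx bx !(mulr0, mul0r) subrr.
  have b29 : b ^+ 2 - 9%:R != 0 by rewrite subr_eq0.
  apply: contraNneq (mulf_neq0 b0 b29) => bx.
  have -> : b * (b ^+ 2 - 9%:R) = (b + 3%:R * x) * (6%:R * b * x + 9%:R + b ^+ 2) - 9%:R * g 1 x.
    by rewrite /gq; ring.
  by rewrite gx bx !(mulr0, mul0r) subrr.
have /eqP : h11 * (h02 + x * h12) ^+ 2 = 0.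
  rewrite -[RHS]oppr0 -[in RHS]e /sdet e00 e01; ring.
rewrite mulf_eq0 (negbTE h11n) expf_eq0 /= => /eqP Q0.
have xb : x + b != 0.
  apply: contraNneq (mulf_neq0 b0 b21) => xb.
  have -> : b * (b ^+ 2 - 1) = g 1 x - (x + b) * (2%:R * b * x + 3%:R - b ^+ 2) by rewrite /gq; ring.
  by rewrite gx xb mul0r subrr.
have bx : 1 + b * x != 0.
  apply: contraNneq h11n => bx.
  have -> : h11 = - (2%:R * (1 + b * x) * (b + 3%:R * x)).
    by rewrite /h11 /nf_a /nf_b /nf_p /nf_r /nf_w /cA /cB /=; ring.
  by rewrite bx mulr0 mul0r oppr0.
have /eqP : 2%:R * x ^+ 3 * (x + b) * (1 + b * x) * (z2 + z3 * x) = 0.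
  have -> : 2%:R * x ^+ 3 * (x + b) * (1 + b * x) * (z2 + z3 * x) =
     - (h02 + x * h12) - 2%:R * k * x ^+ 2 * g 1 x ^+ 2.
    by rewrite /h02 /h12 /nf_a /nf_b /nf_p /nf_r /nf_w /cA /cB /gq flex_q1 flex_q5 /=; ring.
  by rewrite Q0 gx expr0n /= !mulr0 !oppr0 addr0.
have nz : 2%:R * x ^+ 3 * (x + b) * (1 + b * x) != 0.
  by rewrite mulf_neq0 // mulf_neq0 // mulf_neq0 // expf_neq0.
by rewrite mulf_eq0 (negbTE nz) => /eqP.
Qed.

Lemma flex_z : z2 = 0 /\ z3 = 0.
Proof.
pose P : {poly K} := (2%:R * b)%:P * 'X^2 + ((b ^+ 2 + 3%:R)%:P * 'X + (2%:R * b)%:P).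
have sP : size P != 1%N.
  rewrite size_polyDl size_Cmul ?size_polyXn ?mulf_neq0 //.
  apply: leq_ltn_trans (size_polyD _ _) _; rewrite gtn_max; apply/andP; split.
    by apply: leq_ltn_trans (size_polyMleq _ _) _; rewrite size_polyX size_polyC; case: (_ == _).
  by rewrite size_polyC; case: (_ == _).
have /closed_rootP[x /eqP] := sP.
rewrite !(hornerD, hornerM, hornerC, hornerX, hornerXn) => rx.
have gx : g 1 x = 0 by rewrite -[RHS]rx /gq; ring.
have x0 : x != 0.
  apply/eqP => x0; have /eqP : 2%:R * b = 0 by rewrite -[RHS]rx x0; ring.
  by rewrite mulf_eq0 (negbTE n2) (negbTE b0).
(* the form g is palindromic *)
have gV : g 1 x^-1 = 0.
  apply: (mulfI (expf_neq0 2 x0)); rewrite mulr0 -[RHS]gx /gq.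
  by rewrite !mulrDr; field.
have e1 := ramified_flex gx; have e2 := ramified_flex gV.
have xx : x ^+ 2 != 1.
  have b21 : b ^+ 2 - 1 != 0 by rewrite subr_eq0.
  have b29 : b ^+ 2 - 9%:R != 0 by rewrite subr_eq0.
  apply: contraNneq (mulf_neq0 b21 b29) => x2; apply/eqP.
  have e3 : (b ^+ 2 + 3%:R) * x = - (4%:R * b).
    apply/eqP; rewrite -addr_eq0; apply/eqP; rewrite -[RHS]gx /gq -[in RHS]mulr_natr.
    have -> : b * x ^+ 2 *+ 2 = b *+ 2 by rewrite x2 mulr1.
    ring.
  have -> : (b ^+ 2 - 1) * (b ^+ 2 - 9%:R) = ((b ^+ 2 + 3%:R) * x) ^+ 2 - 16%:R * b ^+ 2
    - (b ^+ 2 + 3%:R) ^+ 2 * (x ^+ 2 - 1) by ring.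
  by rewrite e3 x2; ring.
have z30 : z3 = 0.
  have /eqP : z3 * (x ^+ 2 - 1) = 0.
    have e3 : x * (z2 + z3 * x^-1) = 0 by rewrite e2 mulr0.
    have {}e3 : z2 * x + z3 = 0 by rewrite -[RHS]e3 mulrDr mulrCA divff // mulr1 mulrC.
    by rewrite -[RHS](subrr 0) -{1}(mulr0 x) -{1}e1 -e3; ring.
  by rewrite mulf_eq0 subr_eq0 (negbTE xx) orbF => /eqP.
by split=> //; rewrite -[RHS]e1 z30 mul0r addr0.
Qed.

(** With the quadratic part known, the inflection condition says that lin_part vanishes at
    (B u, - A u) for unramified u.  This is a form of degree ten in u; solving from both
    ends, its coefficients determine those of l. *)
Lemma flex_lin i j : (i < 4)%N -> (j < 2)%N -> l i j = 0.
Proof.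
have J0 x : (x * g x 1) ^+ 2 * lin_part l x 1 (B x 1) (- A x 1) = 0.
  have [z20 z30] := flex_z; have := polar_zero x 1.
  have id s t : polar_hess nf_a nf_b nf_p nf_r nf_w l f s t x 1 0 0 =
    8%:R * lin_part l x 1 s t * hess s (b * s) (b * t) t x 1
    + 18%:R * k ^+ 2 * disc s (b * s) (b * t) t * (s * A x 1 + t * B x 1).
    rewrite /polar_hess !mulr0 !addr0; move: (lin_part l x 1 s t) => L.
    rewrite /sdet /nf_a /nf_b /nf_p /nf_r /nf_w /= flex_q1 flex_q5 z20 z30 /hess /disc /cA /cB; ring.
  rewrite id; have := hess_scroll b x 1; rewrite /= => -> e.
  apply: (mulfI (_ : - 8%:R != 0)); first by rewrite oppr_eq0 (natrM _ 2 4) (natrM _ 2 2) !mulf_neq0.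
  by rewrite mulr0 -[RHS]e; ring.
pose e3 : K := 1 + b ^+ 2 *+ 2; pose e4 : K := b *+ 2 + b ^+ 3.
pose R : {poly K} := (l 0%N 1%N)%:P + (l 0%N 0%N + 3%:R * b * l 0%N 1%N)%:P * 'X
  + (3%:R * b * l 0%N 0%N + 3%:R * b ^+ 2 * l 0%N 1%N - b * l 1%N 1%N)%:P * 'X^2
  + (3%:R * b ^+ 2 * l 0%N 0%N + b ^+ 3 * l 0%N 1%N - b * l 1%N 0%N - e3 * l 1%N 1%N)%:P * 'X^3
  + (b ^+ 3 * l 0%N 0%N - e3 * l 1%N 0%N - e4 * l 1%N 1%N + b ^+ 2 * l 2%N 1%N)%:P * 'X^4
  + (- e4 * l 1%N 0%N - b ^+ 2 * l 1%N 1%N + b ^+ 2 * l 2%N 0%N + e4 * l 2%N 1%N)%:P * 'X^5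
  + (- b ^+ 2 * l 1%N 0%N + e4 * l 2%N 0%N + e3 * l 2%N 1%N - b ^+ 3 * l 3%N 1%N)%:P * 'X^6
  + (e3 * l 2%N 0%N + b * l 2%N 1%N - b ^+ 3 * l 3%N 0%N - 3%:R * b ^+ 2 * l 3%N 1%N)%:P * 'X^7
  + (b * l 2%N 0%N - 3%:R * b ^+ 2 * l 3%N 0%N - 3%:R * b * l 3%N 1%N)%:P * 'X^8
  + (- (3%:R * b * l 3%N 0%N) - l 3%N 1%N)%:P * 'X^9 + (- l 3%N 0%N)%:P * 'X^10.
pose J : {poly K} := 'X * ((2%:R * b)%:P * 'X^2 + (b ^+ 2 + 3%:R)%:P * 'X + (2%:R * b)%:P).
have Jn : J != 0.
  rewrite mulf_neq0 ?polyX_eq0 //; apply/eqP => /(congr1 (fun p : {poly K} => p`_0)).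
  rewrite !(coefD, coefCM, coefX, coefXn, coefC) /= !mulr0 !add0r => /eqP.
  by rewrite mulf_eq0 (negbTE n2) (negbTE b0).
have R0 : R = 0.
  apply: (mulfI (expf_neq0 2 Jn)); rewrite mulr0; apply: poly_ext0 => x.
  rewrite hornerM horner_exp /J /R !(hornerD, hornerM, hornerC, hornerX, hornerXn) -[RHS](J0 x).
  rewrite /lin_part /bin1 /gq /cA /cB /e3 /e4; ring.
have co d : R`_d = 0 by rewrite R0 coef0.
have := co 0%N; have := co 1%N; have := co 2%N; have := co 3%N.
have := co 7%N; have := co 8%N; have := co 9%N; have := co 10%N.
rewrite /R !(coefD, coefCM, coefX, coefXn, coefC) /= !(mulr0, mulr1, addr0, add0r).
move=> c10 c9 c8 c7 c3 c2 c1 c0.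
have l30 : l 3%N 0%N = 0 by rewrite -[RHS]oppr0 -c10 opprK.
have l31 : l 3%N 1%N = 0 by rewrite -[RHS]oppr0 -c9 l30; ring.
have l20 : l 2%N 0%N = 0 by apply: (mulfI b0); rewrite mulr0 -[RHS]c8 l30 l31; ring.
have l21 : l 2%N 1%N = 0 by apply: (mulfI b0); rewrite mulr0 -[RHS]c7 l30 l31 l20; ring.
have l00 : l 0%N 0%N = 0 by rewrite -[RHS]c1 c0; ring.
have l11 : l 1%N 1%N = 0 by apply: (mulfI b0); rewrite mulr0 -[RHS]oppr0 -c2 c0 l00; ring.
have l10 : l 1%N 0%N = 0 by apply: (mulfI b0); rewrite mulr0 -[RHS]oppr0 -c3 c0 l00 l11; ring.
by case: i => [|[|[|[|//]]]] _; case: j => [|[|//]] _.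
Qed.

Lemma line_quartic_normal : exists c0 c1 c2 c3 c4, forall x : 'rV[K]_4,
  line_quartic nf_a nf_b nf_p nf_r nf_w l f (x 0 o0) (x 0 o1) (x 0 o2) (x 0 o3) =
  ev (Fmp b k c0 c1 c2 c3 c4) x.
Proof.
exists (f 0%N), (f 1%N + 4%:R * k ^+ 3 * b ^+ 3), (f 2%N - k ^+ 3 * (b ^+ 4 + 18%:R * b ^+ 2 - 27%:R)),
  (f 3%N + 4%:R * k ^+ 3 * b ^+ 3), (f 4%N) => x; rewrite ev_Fmp.
have [z20 z30] := flex_z; rewrite /line_quartic /lin_part /bin1 !flex_lin //.
rewrite /quad_part /bin3 /bin2 /nf_a /nf_b /nf_p /nf_r /nf_w /= flex_q1 flex_q5 z20 z30.
rewrite /Sf /cubic /hess /disc /quartic; ring.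
Qed.
End FlexNormalForm.

(** * Adapted coordinates *)

Section LineGradient.
Variable K : closedFieldType.
Variables (a b p r w : nat -> K) (l : nat -> nat -> K) (f : nat -> K) (F : {mpoly K[4]}).
Hypothesis FE : forall x, ev F x = line_quartic a b p r w l f (x 0 o0) (x 0 o1) (x 0 o2) (x 0 o3).

Lemma gradient_line u0 u1 i :
  ev F^`M(i) (pt4 u0 u1 0 0) = pt4 0 0 (bin3 a u0 u1) (bin3 b u0 u1) 0 i.
Proof.
have h (v : 'rV[K]_4) : \sum_i v 0 i * ev F^`M(i) (pt4 u0 u1 0 0) = v 0 o2 * bin3 a u0 u1 + v 0 o3 * bin3 b u0 u1.
  rewrite -along_coef1; pose U := u0%:P + v 0 o0 *: 'X : {poly K}; pose V := u1%:P + v 0 o1 *: 'X : {poly K}.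
  pose q := quad_part (polyC \o p) (polyC \o r) (polyC \o w) U V (v 0 o2)%:P (v 0 o3)%:P
    + 'X * lin_part (fun i j => (l i j)%:P) U V (v 0 o2)%:P (v 0 o3)%:P
    + 'X^2 * (quartic (f 0%N) (f 1%N) (f 2%N) (f 3%N) (f 4%N) (v 0 o2) (v 0 o3))%:P.
  have -> : along F (pt4 u0 u1 0 0) v = 'X * ((v 0 o2)%:P * bin3 (polyC \o a) U V
     + (v 0 o3)%:P * bin3 (polyC \o b) U V) + 'X^2 * q.
    apply: poly_ext => t; rewrite horner_along FE.
    have hE (i' : 'I_4) : (pt4 u0 u1 0 0 + t *: v) 0 i' = pt4 u0 u1 0 0 0 i' + t * v 0 i' by rewrite !mxE.
    rewrite !hE !pt4E /q /bin3 /quad_part /lin_part /bin2 /bin1 /cubic /U /V.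
    rewrite !(hornerD, hornerM, hornerC, hornerZ, hornerX, hornerXn, horner_exp) /=.
    by rewrite ?hornerC /line_quartic /quad_part /lin_part /bin3 /bin2 /bin1 /cubic /quartic; ring.
  rewrite coefD coefXM coefXnM /= addr0 -horner_coef0 /bin3 /cubic /U /V.
  rewrite !(hornerD, hornerM, hornerC, hornerZ, hornerX, hornerXn, horner_exp) /=.
  by rewrite ?hornerC; ring.
have := h (delta_mx 0 i); rewrite (bigD1 i) //= big1 => [|j ji]; last by rewrite mxE eqxx (negbTE ji) mul0r.
rewrite !mxE !eqxx mul1r addr0 => ->.
by move: i; apply: ord4P; rewrite ?mxE /=; ring.
Qed.

Definition ram_poly u0 u1 v0 v1 : {poly K} :=
  let U := u0%:P + v0 *: 'X in let V := u1%:P + v1 *: 'X in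
  (bin3 a u0 u1)%:P * bin3 (polyC \o b) U V - (bin3 b u0 u1)%:P * bin3 (polyC \o a) U V.

(** Along ell the gradient is (0, 0, bin3 a, bin3 b), so only one of the minors matters. *)
Lemma ramificationE u0 u1 k : ramification_ge F (E01 K) (pt4 u0 u1 0 0) k <->
  forall v0 v1, 'X^k %| ram_poly u0 u1 v0 v1.
Proof.
have al j v0 v1 : along F^`M(j) (pt4 u0 u1 0 0) (pt4 v0 v1 0 0) =
    nth 0 [:: 0; 0; bin3 (polyC \o a) (u0%:P + v0 *: 'X) (u1%:P + v1 *: 'X);
      bin3 (polyC \o b) (u0%:P + v0 *: 'X) (u1%:P + v1 *: 'X)] j.
  apply: poly_ext => t; rewrite horner_along pt4Z pt4D !mulr0 !addr0 gradient_line.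
  move: j; apply: ord4P; rewrite ?pt4E /= ?horner0 //.
    by rewrite /bin3 /cubic !(hornerD, hornerM, hornerC, hornerZ, hornerX, horner_exp) /= ?hornerC;  ring.
  by rewrite /bin3 /cubic !(hornerD, hornerM, hornerC, hornerZ, hornerX, horner_exp) /= ?hornerC; ring.
have gr i : gradient F (pt4 u0 u1 0 0) 0 i = pt4 0 0 (bin3 a u0 u1) (bin3 b u0 u1) 0 i.
  by rewrite mxE gradient_line.
split=> h.
  move=> v0 v1; have vE : (pt4 v0 v1 0 0 <= E01 K)%MS by apply/sub_E01; rewrite !pt4E.
  by have := h _ vE o2 o3; rewrite !al !gr !pt4E /= -[X in X - _]mul_polyC -[X in _ - X]mul_polyC.
move=> v /sub_E01[v2 v3] i j; rewrite [v]row4E v2 v3 !al !gr.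
have dv := h (v 0 o0) (v 0 o1); rewrite /ram_poly [X in X - _]mul_polyC [X in _ - X]mul_polyC in dv.
move: i j; apply: ord4P; apply: ord4P; rewrite !pt4E /= ?scale0r ?scaler0 ?subrr ?dvdp0 //.
by rewrite -opprB dvdpNr.
Qed.
End LineGradient.

Section LinearCoefficients.
Variables (K : closedFieldType) (M : 'M[K]_4).
Variables (a b p r w : nat -> K) (l : nat -> nat -> K) (f : nat -> K).
Variables (a' b' p' r' w' : nat -> K) (l' : nat -> nat -> K) (f' : nat -> K) (F : {mpoly K[4]}).
Hypothesis FE : forall x, ev F x = line_quartic a b p r w l f (x 0 o0) (x 0 o1) (x 0 o2) (x 0 o3).
Hypothesis FE' : forall x, ev (lsub M F) x =
  line_quartic a' b' p' r' w' l' f' (x 0 o0) (x 0 o1) (x 0 o2) (x 0 o3).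

Lemma lsub_bin3 u0 u1 v0 v1 : pt4 u0 u1 0 0 *m M = pt4 v0 v1 0 0 ->
  bin3 a' u0 u1 = M o2 o2 * bin3 a v0 v1 + M o2 o3 * bin3 b v0 v1 /\
  bin3 b' u0 u1 = M o3 o2 * bin3 a v0 v1 + M o3 o3 * bin3 b v0 v1.
Proof.
move=> e; have g (i : 'I_4) : pt4 0 0 (bin3 a' u0 u1) (bin3 b' u0 u1) 0 i =
    M i o2 * bin3 a v0 v1 + M i o3 * bin3 b v0 v1.
  have /rowP/(_ i) := gradient_lsub M F (pt4 u0 u1 0 0).
  rewrite e ![LHS]mxE (gradient_line FE') => ->; rewrite mxE big_ord4 /= ![gradient _ _ _ _]mxE.
  by rewrite !(gradient_line FE) !pt4E ![M^T _ _]mxE; ring.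
by split; [have := g o2 | have := g o3]; rewrite pt4E.
Qed.
End LinearCoefficients.

Section AdaptedCoordinates.
Variable K : closedFieldType.
Hypotheses (n2 : (2%:R : K) != 0) (n3 : (3%:R : K) != 0).

Definition mx4 (s : seq (seq K)) : 'M[K]_4 := \matrix_(i, j) nth 0 (nth [::] s i) j.

Lemma mul_mx4 s (y0 y1 y2 y3 : K) : pt4 y0 y1 y2 y3 *m mx4 s =
  \row_j (y0 * nth 0 (nth [::] s 0) j + y1 * nth 0 (nth [::] s 1) j
    + y2 * nth 0 (nth [::] s 2) j + y3 * nth 0 (nth [::] s 3) j).
Proof. by apply/rowP => j; rewrite [LHS]mxE big_ord4 /= !pt4E !mxE /= !addrA. Qed.

Lemma unit_mulI (M : 'M[K]_4) : (forall y : 'rV[K]_4, y *m M = 0 -> y = 0) -> M \in unitmx.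
Proof. by move=> h; rewrite -row_free_unit; apply: (inj_row_free h). Qed.

(** Add a basis of a complement of the line. *)
Lemma complete_basis (p q : 'rV[K]_4) : is_line (join2 p q) -> exists M : 'M[K]_4,
  [/\ M \in unitmx, pt4 1 0 0 0 *m M = p & pt4 0 1 0 0 *m M = q].
Proof.
move=> lpq; set m := join2 p q in lpq.
have rC : \rank (m^C)%MS = 2%N by rewrite mxrank_compl lpq.
pose C := castmx (rC, erefl) (row_base (m^C)%MS).
have full : row_full (col_mx m C : 'M[K]_(2 + 2, 4)).
  rewrite -sub1mx -addsmxE; have := addsmx_compl_full m; rewrite -sub1mx => h.
  apply: submx_trans h _; rewrite addsmx_sub addsmxSl /=.
  apply: submx_trans (addsmxSr _ _); by rewrite /C eqmx_cast eq_row_base.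
exists (col_mx m C : 'M[K]_4); split.
- by rewrite -row_full_unit.
- have -> : pt4 1 0 0 0 = delta_mx 0 o0 :> 'rV[K]_4.
    by apply/rowP; apply: ord4P; rewrite pt4E mxE.
  rewrite -rowE; apply/rowP => j; rewrite mxE -(join2E p q j).1 -/m -(col_mxEu m C 0 j).
  by congr (col_mx m C _ j); apply: val_inj.
have -> : pt4 0 1 0 0 = delta_mx 0 o1 :> 'rV[K]_4.
  by apply/rowP; apply: ord4P; rewrite pt4E mxE.
rewrite -rowE; apply/rowP => j; rewrite mxE -(join2E p q j).2 -/m -(col_mxEu m C 1 j).
by congr (col_mx m C _ j); apply: val_inj.
Qed.

Section Ramification.
Variables (a b p r w : nat -> K) (l : nat -> nat -> K) (f : nat -> K) (F : {mpoly K[4]}).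
Hypothesis FE : forall x, ev F x = line_quartic a b p r w l f (x 0 o0) (x 0 o1) (x 0 o2) (x 0 o3).

(** Two ramification points of index two never lie in the same fibre of the projection
    of ell, which has degree three.  So the fibres through them can be taken as the
    coordinate planes, and it remains to scale. *)
Lemma ramified_coordinates :
  ramification_ge F (E01 K) (pt4 1 0 0 0) 2 -> ~ ramification_ge F (E01 K) (pt4 1 0 0 0) 3 ->
  ramification_ge F (E01 K) (pt4 0 1 0 0) 2 -> ~ ramification_ge F (E01 K) (pt4 0 1 0 0) 3 ->
  exists (M : 'M[K]_4) (c be : K), [/\ M \in unitmx, c != 0, be != 0,
    forall u0 u1, pt4 u0 u1 0 0 *m M = pt4 u0 (be * u1) 0 0 &
    forall u0 u1,
      M o2 o2 * bin3 a u0 (be * u1) + M o2 o3 * bin3 b u0 (be * u1) = cA c u0 u1 /\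
      M o3 o2 * bin3 a u0 (be * u1) + M o3 o3 * bin3 b u0 (be * u1) = cB c u0 u1].
Proof.
pose D i := a 0%N * b i - b 0%N * a i; pose E i := a 3%N * b i - b 3%N * a i.
have D0 : D 0%N = 0 by rewrite /D; ring.
have E3 : E 3%N = 0 by rewrite /E; ring.
have ram0 v0 v1 : ram_poly a b 1 0 v0 v1 = bin3 (polyC \o D) (1%:P + v0 *: 'X) (0%:P + v1 *: 'X).
  by rewrite /ram_poly /bin3 /cubic /D /= -!mul_polyC; ring.
have ram1 v0 v1 : ram_poly a b 0 1 v0 v1 = bin3 (polyC \o E) (0%:P + v0 *: 'X) (1%:P + v1 *: 'X).
  by rewrite /ram_poly /bin3 /cubic /E /= -!mul_polyC; ring.
move=> /(ramificationE FE) r0 n0 /(ramificationE FE) r1 n1.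
have D1 : D 1%N = 0.
  have := r0 0 1; rewrite ram0 => /dvdpP[q]; move/(congr1 (fun s : {poly K} => s`_1)).
  rewrite coefMXn /=; have -> : bin3 (polyC \o D) (1%:P + 0 *: 'X) (0%:P + 1 *: 'X) =
    (D 0%N)%:P + (D 1%N)%:P * 'X + (D 2%N)%:P * 'X^2 + (D 3%N)%:P * 'X^3.
    by rewrite /bin3 /cubic /= -!mul_polyC; ring.
  by rewrite !(coefD, coefCM, coefC, coefX, coefXn) /= !(mulr0, mulr1, addr0, add0r).
have E2 : E 2%N = 0.
  have := r1 1 0; rewrite ram1 => /dvdpP[q]; move/(congr1 (fun s : {poly K} => s`_1)).
  rewrite coefMXn /=; have -> : bin3 (polyC \o E) (0%:P + 1 *: 'X) (1%:P + 0 *: 'X) =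
    (E 3%N)%:P + (E 2%N)%:P * 'X + (E 1%N)%:P * 'X^2 + (E 0%N)%:P * 'X^3.
    by rewrite /bin3 /cubic /= -!mul_polyC; ring.
  by rewrite !(coefD, coefCM, coefC, coefX, coefXn) /= !(mulr0, mulr1, addr0, add0r).
have D2 : D 2%N != 0.
  apply/eqP => D2; apply: n0; apply/(ramificationE FE) => v0 v1; rewrite ram0.
  rewrite /bin3 /cubic /= D0 D1 D2 !mul0r !add0r -mul_polyC exprMn.
  by rewrite mulrA dvdp_mull.
have E1 : E 1%N != 0.
  apply/eqP => E1; apply: n1; apply/(ramificationE FE) => v0 v1; rewrite ram1.
  rewrite /bin3 /cubic /= E1 E2 E3 !mul0r !addr0 add0r -mul_polyC exprMn.
  by rewrite mulrA dvdp_mull.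
pose dl := a 0%N * b 3%N - b 0%N * a 3%N.
have dl0 : dl != 0.
  apply/eqP => dl0.
  have e1 : D 2%N * a 3%N = 0.
    have -> : D 2%N * a 3%N = a 2%N * dl + a 0%N * E 2%N by rewrite /D /E /dl; ring.
    by rewrite dl0 E2 !mulr0 addr0.
  have e2 : D 2%N * b 3%N = 0.
    have -> : D 2%N * b 3%N = b 2%N * dl + b 0%N * E 2%N by rewrite /D /E /dl; ring.
    by rewrite dl0 E2 !mulr0 addr0.
  move/eqP: e1; move/eqP: e2; rewrite !mulf_eq0 (negbTE D2) /= => /eqP b30 /eqP a30.
  by move: E1; rewrite /E a30 b30 !mul0r subr0 eqxx.
have [be bE] : exists be, be ^+ 2 = - D 2%N / E 1%N.
  have [z] := @solve_monicpoly K 2 (fun i => if i is 0 then - D 2%N / E 1%N else 0) isT.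
  by rewrite !big_ord_recl big_ord0 /= expr0 mulr1 mul0r !addr0; exists z.
have be0 : be != 0.
  have : - D 2%N / E 1%N != 0 by rewrite mulf_neq0 ?oppr_eq0 ?invr_eq0.
  by rewrite -bE expf_eq0.
pose ga := dl^-1; pose de := (dl * be ^+ 3)^-1; pose c := D 2%N / (dl * be).
pose M := mx4 [:: [:: 1; 0; 0; 0]; [:: 0; be; 0; 0]; [:: 0; 0; ga * b 3%N; - (ga * a 3%N)];
   [:: 0; 0; - (de * b 0%N); de * a 0%N]].
have ga0 : ga * dl = 1 by rewrite mulVf.
have de0 : de * (dl * be ^+ 3) = 1 by rewrite mulVf // mulf_neq0 ?expf_neq0.
have c0 : c != 0 by rewrite mulf_neq0 // invr_eq0 mulf_neq0.
exists M, c, be; split=> //.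
- apply: unit_mulI => y; rewrite [y]row4E mul_mx4 => /rowP h.
  have := h o0; have := h o1; have := h o2; have := h o3; rewrite !mxE /=.
  move: (y 0 o0) (y 0 o1) (y 0 o2) (y 0 o3) => y0 y1 y2 y3.
  rewrite !(mulr0, mulr1, addr0, add0r) => h3 h2 h1 h0.
  have y1E : y1 = 0 by move/eqP: h1; rewrite mulf_eq0 (negbTE be0) orbF => /eqP.
  have y2E : y2 = 0.
    rewrite -[LHS]mulr1 -ga0.
    have -> : y2 * (ga * dl) = a 0%N * (y2 * (ga * b 3%N) + y3 * (- (de * b 0%N)))
      + b 0%N * (y2 * - (ga * a 3%N) + y3 * (de * a 0%N)) by rewrite /dl; ring.
    by rewrite h2 h3 !mulr0 addr0.
  have y3E : y3 = 0.
    rewrite -[LHS]mulr1 -de0.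
    have -> : y3 * (de * (dl * be ^+ 3)) = be ^+ 3 * (a 3%N * (y2 * (ga * b 3%N) + y3 * (- (de * b 0%N)))
      + b 3%N * (y2 * - (ga * a 3%N) + y3 * (de * a 0%N))) by rewrite /dl; ring.
    by rewrite h2 h3 !mulr0 addr0 mulr0.
  by rewrite h0 y1E y2E y3E pt4_0.
- move=> u0 u1; rewrite mul_mx4; apply/rowP; apply: ord4P; rewrite mxE pt4E /=; ring.
move=> u0 u1; rewrite !mxE /=.
have cE1 : - ga * E 1%N * be = c.
  rewrite /c /ga invfM; have -> : E 1%N = - D 2%N / be ^+ 2 by rewrite bE invf_div mulrC divfK // oppr_eq0.
  by move: (D 2%N) => d; field; rewrite dl0 be0.
have cE2 : de * D 2%N * be ^+ 2 = c.
  by rewrite /c /de; move: (D 2%N) => d; field; rewrite dl0 be0.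
split.
  have -> : ga * b 3%N * bin3 a u0 (be * u1) + - (ga * a 3%N) * bin3 b u0 (be * u1) =
     ga * dl * u0 ^+ 3 + (- ga * E 1%N * be) * u0 ^+ 2 * u1 - ga * E 2%N * be ^+ 2 * u0 * u1 ^+ 2.
    by rewrite /bin3 /cubic /E /dl; ring.
  by rewrite ga0 cE1 E2 /cA; ring.
have -> : - (de * b 0%N) * bin3 a u0 (be * u1) + de * a 0%N * bin3 b u0 (be * u1) =
     de * D 1%N * be * u0 ^+ 2 * u1 + (de * D 2%N * be ^+ 2) * u0 * u1 ^+ 2 + de * (dl * be ^+ 3) * u1 ^+ 3.
  by rewrite /bin3 /cubic /D /dl; ring.
by rewrite de0 cE2 D1 /cB; ring.
Qed.
End Ramification.
End AdaptedCoordinates.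

(** * Reduction to the normal form *)

Section Reduction.
Variable K : closedFieldType.
Hypotheses (n2 : (2%:R : K) != 0) (n3 : (3%:R : K) != 0).

Section Discriminant.
Variables (c : K) (a b p r w : nat -> K) (l : nat -> nat -> K) (f : nat -> K) (F : {mpoly K[4]}).
Hypothesis FE : forall x, ev F x = line_quartic a b p r w l f (x 0 o0) (x 0 o1) (x 0 o2) (x 0 o3).
Hypotheses (aE : forall u0 u1, bin3 a u0 u1 = cA c u0 u1) (bE : forall u0 u1, bin3 b u0 u1 = cB c u0 u1).

(** Otherwise the two cubics of the pencil share the zero (1 : - c), where F is singular. *)
Lemma smooth_directrix_coprime : smooth_form F -> c ^+ 2 != 1.
Proof.
move=> sm; apply/eqP => c2; apply: (sm (pt4 1 (- c) 0 0)); first by rewrite pt4_eq0 oner_eq0.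
have A0 : cA c 1 (- c) = 0 by rewrite /cA -[RHS](subrr 1) -[in X in 1 - X]c2; ring.
have B0 : cB c 1 (- c) = 0 by rewrite /cB; ring.
split=> [|i]; last first.
  by rewrite (gradient_line FE) aE bE A0 B0 pt4_0 mxE.
rewrite FE !pt4E /line_quartic /quad_part /lin_part /quartic; ring.
Qed.

(** For c ^+ 2 = 9 the fibre through (3 : - c) is a triple point, the cube of c u0 + 3 u1. *)
Lemma ramification_distinct : (forall P, P != 0 -> (P <= E01 K)%MS -> ~ ramification_ge F (E01 K) P 3) ->
  c ^+ 2 != 9%:R.
Proof.
move=> nr; apply/eqP => c2; apply: (nr (pt4 3%:R (- c) 0 0)).
- by rewrite pt4_eq0 (negbTE n3).
- by apply/sub_E01; rewrite !pt4E.
apply/(ramificationE FE) => v0 v1.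
have pA (U V : {poly K}) : bin3 (polyC \o a) U V = cA c%:P U V.
  apply: poly_ext => t; have := aE U.[t] V.[t].
  rewrite -!/(horner_eval t _) (rmorph_cA (horner_eval t)) /= => e.
  rewrite /bin3 (rmorph_cubic (horner_eval t)) /= /horner_eval !hornerC.
  exact: e.
have pB (U V : {poly K}) : bin3 (polyC \o b) U V = cB c%:P U V.
  apply: poly_ext => t; have := bE U.[t] V.[t].
  rewrite -!/(horner_eval t _) (rmorph_cB (horner_eval t)) /= => e.
  rewrite /bin3 (rmorph_cubic (horner_eval t)) /= /horner_eval !hornerC.
  exact: e.
rewrite /ram_poly pA pB aE bE.
have -> : cA c 3%:R (- c) = - 54%:R.
  have -> : cA c 3%:R (- c) = 27%:R - 9%:R * c ^+ 2 by rewrite /cA; ring.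
  by rewrite c2; ring.
have -> : cB c 3%:R (- c) = 18%:R * c.
  have -> : cB c 3%:R (- c) = 2%:R * c ^+ 2 * c by rewrite /cB; ring.
  by rewrite c2; ring.
set U := 3%:R%:P + _; set V := _ + v1 *: 'X.
have hc : c%:P ^+ 2 = 9%:R :> {poly K} by rewrite -rmorphXn c2 rmorph_nat.
have hUV : c%:P * U + 3%:R * V = (c * v0 + 3%:R * v1)%:P * 'X by rewrite /U /V -!mul_polyC; ring.
have -> : (- 54%:R)%:P * cB c%:P U V - (18%:R * c)%:P * cA c%:P U V =
   - 2%:R * (c%:P * U + 3%:R * V) ^+ 3 + (c%:P ^+ 2 - 9%:R) * (2%:R * c%:P * U ^+ 3).
  rewrite /cA /cB; ring.
by rewrite hUV hc subrr mul0r addr0 exprMn mulrA dvdp_mull.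
Qed.
End Discriminant.

Section Shift.
Variables (c : K) (a b p r w : nat -> K) (l : nat -> nat -> K) (f : nat -> K) (F : {mpoly K[4]}).
Hypothesis FE : forall x, ev F x = line_quartic a b p r w l f (x 0 o0) (x 0 o1) (x 0 o2) (x 0 o3).
Hypotheses (aE : forall u0 u1, bin3 a u0 u1 = cA c u0 u1) (bE : forall u0 u1, bin3 b u0 u1 = cB c u0 u1).

Lemma along_line_coef2 u0 u1 v0 v1 s t : (along F (pt4 u0 u1 0 0) (pt4 v0 v1 s t))`_2 =
  s * ((3%:R * u0 ^+ 2 + 2%:R * c * u0 * u1) * v0 + c * u0 ^+ 2 * v1)
  + t * (c * u1 ^+ 2 * v0 + (3%:R * u1 ^+ 2 + 2%:R * c * u0 * u1) * v1) + quad_part p r w u0 u1 s t.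
Proof.
set e := (RHS); pose e1 := s * cA c u0 u1 + t * cB c u0 u1.
pose bp (q : nat -> K) := 2%:R * q 0%N * u0 * v0 + q 1%N * (u0 * v1 + u1 * v0) + 2%:R * q 2%N * u1 * v1.
pose e3 := s * ((3%:R * u0 + c * u1) * v0 ^+ 2 + 2%:R * c * u0 * v0 * v1)
  + t * ((3%:R * u1 + c * u0) * v1 ^+ 2 + 2%:R * c * u1 * v0 * v1)
  + s ^+ 2 * bp p + s * t * bp r + t ^+ 2 * bp w + lin_part l u0 u1 s t.
pose e4 := s * cA c v0 v1 + t * cB c v0 v1 + quad_part p r w v0 v1 s t + lin_part l v0 v1 s t
  + quartic (f 0%N) (f 1%N) (f 2%N) (f 3%N) (f 4%N) s t.
have -> : along F (pt4 u0 u1 0 0) (pt4 v0 v1 s t) =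
    e1%:P * 'X + e%:P * 'X^2 + e3%:P * 'X^3 + e4%:P * 'X^4.
  apply: poly_ext => z; rewrite horner_along FE pt4Z pt4D !pt4E !add0r /line_quartic aE bE.
  rewrite !(hornerD, hornerM, hornerC, hornerX, hornerXn) /e /e1 /e3 /e4 /bp.
  by rewrite /quad_part /lin_part /bin2 /bin1 /quartic /cA /cB; ring.
by rewrite !(coefD, coefCM, coefX, coefXn) /= !(mulr0, mulr1, addr0, add0r).
Qed.

(** The parameters of a translation along ell that makes the quadratic part as close as
    possible to a multiple k of the Hessian of the pencil of binary cubics. *)
Lemma shift_parameters : c != 0 -> exists a2 a3 b2 b3 k,
  [/\ p 0%N = - (k * c ^+ 2) - 3%:R * a2 - c * b2, p 1%N = - (2%:R * c * a2),
      r 0%N = 3%:R * c * k - 3%:R * a3 - c * b3, w 1%N = - (2%:R * c * b3) &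
      w 2%N = - (k * c ^+ 2) - c * a3 - 3%:R * b3].
Proof.
move=> c0; pose a2 := - p 1%N / (2%:R * c); pose b3 := - w 1%N / (2%:R * c).
pose k := (c * (r 0%N + c * b3) / 3%:R - w 2%N - 3%:R * b3) / (2%:R * c ^+ 2).
pose a3 := c * k - (r 0%N + c * b3) / 3%:R; pose b2 := (- (k * c ^+ 2) - p 0%N - 3%:R * a2) / c.
exists a2, a3, b2, b3, k; split.
- by rewrite /b2; field.
- by rewrite /a2; field; rewrite n2 c0.
- by rewrite /a3; field.
- by rewrite /b3; field; rewrite n2 c0.
by rewrite /a3 /k; field; rewrite n2 n3 c0.
Qed.
End Shift.

Lemma mul_invmx_eqmx (M : 'M[K]_4) (ell ell' : 'M[K]_(2, 4)) : M \in unitmx ->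
  (ell' *m M :=: ell)%MS -> (ell *m invmx M :=: ell')%MS.
Proof.
move=> uM hl; apply/eqmxP; rewrite -(eqmx_mul _ _ uM) mulmxKV //.
by apply/eqmxP; apply: eqmx_sym.
Qed.

Lemma segre_description_pullback (M : 'M[K]_4) (ell ell' : 'M[K]_(2, 4)) (F : {mpoly K[4]}) :
  M \in unitmx -> (ell' *m M :=: ell)%MS ->
  segre_description (lsub M F) ell' -> segre_description F ell.
Proof.
move=> uM hl h; have uV : invmx M \in unitmx by rewrite unitmx_inv.
have := segre_description_transport uV (mul_invmx_eqmx uM hl) h.
by rewrite lsub_comp mulVmx // lsub1.
Qed.

Lemma E01_mul (M : 'M[K]_4) : M \in unitmx ->
  (forall u0 u1, exists v0 v1, pt4 u0 u1 0 0 *m M = pt4 v0 v1 0 0) -> (E01 K *m M :=: E01 K)%MS.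
Proof.
move=> uM h; apply: eqmx_sym; apply/eqmxP; rewrite /E01 mul_join2 -/(E01 K).
have inE u0 u1 : (pt4 u0 u1 0 0 *m M <= E01 K)%MS.
  by have [v0 [v1 ->]] := h u0 u1; apply/sub_E01; rewrite !pt4E.
have lM : is_line (E01 K *m M) by rewrite /is_line rank_mul // E01_line.
rewrite /E01 mul_join2 -/(E01 K) in lM.
by rewrite andbC; apply: line_eq_join2 => //; exact: E01_line.
Qed.

(** The last step: with the linear part of the equation in normal form, a translation
    along ell and the inflection condition give the full normal form. *)
Lemma segre_description_adapted (c : K) a b p r w l f (F : {mpoly K[4]}) :
  (forall x, ev F x = line_quartic a b p r w l f (x 0 o0) (x 0 o1) (x 0 o2) (x 0 o3)) ->
  (forall u0 u1, bin3 a u0 u1 = cA c u0 u1) -> (forall u0 u1, bin3 b u0 u1 = cB c u0 u1) ->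
  c != 0 -> c ^+ 2 != 1 -> c ^+ 2 != 9%:R ->
  smooth_quartic F -> line_in (E01 K) F -> second_kind F (E01 K) -> segre_description F (E01 K).
Proof.
move=> FE aE bE c0 c1 c9 smF lF sk.
have [a2 [a3 [b2 [b3 [k [p0 p1 r0 w1 w2]]]]]] := shift_parameters p r w c0.
pose M := mx4 [:: [:: 1; 0; 0; 0]; [:: 0; 1; 0; 0]; [:: a2; b2; 1; 0]; [:: a3; b3; 0; 1 : K]].
have mM (y0 y1 y2 y3 : K) : pt4 y0 y1 y2 y3 *m M =
    pt4 (y0 + a2 * y2 + a3 * y3) (y1 + b2 * y2 + b3 * y3) y2 y3.
  by rewrite mul_mx4; apply/rowP; apply: ord4P; rewrite mxE pt4E /=; ring.
have uM : M \in unitmx.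
  apply: unit_mulI => y; rewrite {1}[y]row4E mM -pt4_0 => /pt4_inj[e0 e1 e2 e3].
  rewrite [y]row4E e2 e3; congr pt4; [rewrite -[RHS]e0 | rewrite -[RHS]e1]; rewrite e2 e3; ring.
have mE u0 u1 : pt4 u0 u1 0 0 *m M = pt4 u0 u1 0 0 by rewrite mM; congr pt4; ring.
have hl : (E01 K *m M :=: E01 K)%MS by apply: E01_mul => // u0 u1; exists u0, u1.
apply: (segre_description_pullback uM hl).
have smF' := smooth_quartic_transport uM smF.
have lF' : line_in (E01 K) (lsub M F) by exact: (proj1 (line_in_ell_transport uM hl _)).
have sk' := second_kind_transport uM hl sk.
have [a' [b' [p' [r' [w' [l' [f' FE']]]]]]] := line_quarticP n2 n3 smF'.1 lF'.
have aE' u0 u1 : bin3 a' u0 u1 = bin3 (nf_a c) u0 u1.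
  have [-> _] := lsub_bin3 FE FE' (mE u0 u1).
  by rewrite aE bE !mxE /= /bin3 /cubic /nf_a /cA /=; ring.
have bE' u0 u1 : bin3 b' u0 u1 = bin3 (nf_b c) u0 u1.
  have [_ ->] := lsub_bin3 FE FE' (mE u0 u1).
  by rewrite aE bE !mxE /= /bin3 /cubic /nf_b /cB /=; ring.
have aE'' u0 u1 : bin3 a' u0 u1 = cA c u0 u1 by rewrite aE' /bin3 /cubic /nf_a /cA /=; ring.
have bE'' u0 u1 : bin3 b' u0 u1 = cB c u0 u1 by rewrite bE' /bin3 /cubic /nf_b /cB /=; ring.
pose z2 := r 1%N + 2%:R * c * a3 + 2%:R * c * b2 - (9%:R - c ^+ 2) * k.
pose z3 := r 2%N + c * a2 + 3%:R * b2 - 3%:R * c * k.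
have qE u0 u1 s t : quad_part p' r' w' u0 u1 s t =
    quad_part (nf_p c k (p 2%N)) (nf_r c k z2 z3) (nf_w c k (w 0%N)) u0 u1 s t.
  have -> : quad_part p' r' w' u0 u1 s t = (along (lsub M F) (pt4 u0 u1 0 0) (pt4 0 0 s t))`_2.
    by rewrite (along_line_coef2 FE' aE'' bE''); ring.
  rewrite along_lsub mE mM (along_line_coef2 FE aE bE).
  by rewrite /quad_part /bin2 /nf_p /nf_r /nf_w /= p0 p1 r0 w1 w2 /z2 /z3; ring.
have FE3 x : ev (lsub M F) x = line_quartic (nf_a c) (nf_b c) (nf_p c k (p 2%N)) (nf_r c k z2 z3)
    (nf_w c k (w 0%N)) l' f' (x 0 o0) (x 0 o1) (x 0 o2) (x 0 o3).
  by rewrite FE' /line_quartic aE' bE' qE.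
have flex := second_kind_flex_form n2 FE3 sk'.
have [c0' [c1' [c2' [c3' [c4' nf]]]]] := line_quartic_normal n2 c0 c1 c9 flex.
have eF : lsub M F = Fmp c k c0' c1' c2' c3' c4'.
  by apply: mpoly_ext => x; rewrite FE3 nf.
by rewrite eF; apply: segre_description_normal => //; rewrite -eF; case: smF'.
Qed.

(** Take two of the ramification points as coordinate points of ell and apply
    ramified_coordinates. *)
Theorem segre_description_second_kind (F : {mpoly K[4]}) (ell : 'M[K]_(2, 4)) :
  smooth_quartic F -> is_line ell -> line_in ell F -> second_kind F ell ->
  ramification_1111 F ell -> segre_description F ell.
Proof.
move=> smF lell lF sk ram; have [R [R0 Rd Rram]] := ram.
have line01 : is_line (join2 (R o0) (R o1)).
  apply/is_line_join2 => s t e; have [p0 _] := R0 o0; have [q0 _] := R0 o1.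
  have /negP nd := Rd o0 o1 isT.
  have t0 : t = 0.
    apply/eqP/negPn/negP => tn; apply: nd; apply/(eq_rV p0 q0).
    have sn : s != 0.
      apply: contraNneq q0 => s0; move/eqP: e; rewrite s0 scale0r add0r scaler_eq0.
      by rewrite (negbTE tn).
    exists (- t / s); first by rewrite mulf_neq0 ?oppr_eq0 ?invr_eq0.
    apply: (scalerI sn); rewrite scalerA mulrC divfK // scaleNr.
    by apply/eqP; rewrite -addr_eq0 e.
  move/eqP: e; rewrite t0 scale0r addr0 scaler_eq0 (negbTE p0) orbF => /eqP ->.
  by [].
have [M1 [uM1 e0 e1]] := complete_basis line01.
have hl1 : (E01 K *m M1 :=: ell)%MS.
  rewrite /E01 mul_join2 e0 e1; apply/eqmxP; apply: line_eq_join2 => //.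
    by case: (R0 o0).
  by case: (R0 o1).
apply: (segre_description_pullback uM1 hl1).
have sm1 := smooth_quartic_transport uM1 smF.
have lF1 : line_in (E01 K) (lsub M1 F) by exact: (proj1 (line_in_ell_transport uM1 hl1 _)).
have sk1 := second_kind_transport uM1 hl1 sk.
have ram1 := ramification_transport uM1 hl1 ram.
have [a [b [p [r [w [l [f FE]]]]]]] := line_quarticP n2 n3 sm1.1 lF1.
have two i e : e *m M1 = R i -> ramification_ge (lsub M1 F) (E01 K) e 2.
  move=> he; apply: (ramification_ge_lsub uM1 hl1); rewrite he.
  have [Ri Rell] := R0 i; apply/(Rram _ Ri Rell).1; exists i.
  by rewrite submx_refl.
have nothree (G : {mpoly K[4]}) ell0 : ramification_1111 G ell0 -> forall P, P != 0 -> (P <= ell0)%MS ->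
    ~ ramification_ge G ell0 P 3.
  by move=> [R' [_ _ h]] P P0 Pl; case: (h P P0 Pl).
have nz0 : pt4 1 0 0 0 != 0 :> 'rV[K]_4 by rewrite pt4_eq0 oner_eq0.
have nz1 : pt4 0 1 0 0 != 0 :> 'rV[K]_4 by rewrite pt4_eq0 oner_eq0 andbF.
have in0 : (pt4 1 0 0 0 <= E01 K)%MS by apply/sub_E01; rewrite !pt4E.
have in1 : (pt4 0 1 0 0 <= E01 K)%MS by apply/sub_E01; rewrite !pt4E.
have [||||M2 [c [be [uM2 c0 be0 mM2 AB]]]] := ramified_coordinates FE.
- exact: two e0.
- exact: (nothree _ _ ram1 _ nz0 in0).
- exact: two e1.
- exact: (nothree _ _ ram1 _ nz1 in1).
have hl2 : (E01 K *m M2 :=: E01 K)%MS by apply: E01_mul => // u0 u1; exists u0, (be * u1).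
apply: (segre_description_pullback uM2 hl2).
have sm2 := smooth_quartic_transport uM2 sm1.
have lF2 : line_in (E01 K) (lsub M2 (lsub M1 F)) by exact: (proj1 (line_in_ell_transport uM2 hl2 _)).
have sk2 := second_kind_transport uM2 hl2 sk1.
have ram2 := ramification_transport uM2 hl2 ram1.
have [a' [b' [p' [r' [w' [l' [f' FE']]]]]]] := line_quarticP n2 n3 sm2.1 lF2.
have aE u0 u1 : bin3 a' u0 u1 = cA c u0 u1.
  by have [-> _] := lsub_bin3 FE FE' (mM2 u0 u1); case: (AB u0 u1).
have bE u0 u1 : bin3 b' u0 u1 = cB c u0 u1.
  by have [_ ->] := lsub_bin3 FE FE' (mM2 u0 u1); case: (AB u0 u1).
apply: (segre_description_adapted FE' aE bE) => //.
  by apply: (smooth_directrix_coprime FE' aE bE); case: sm2.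
exact: (ramification_distinct FE' aE bE (nothree _ _ ram2)).
Qed.
End Reduction.

Theorem proposition5p2 (K : closedFieldType)
  (char2 : 2%N \notin [pchar K]) (char3 : 3%N \notin [pchar K])
  (F : {mpoly K[4]}) (ell : 'M[K]_(2, 4))
  (F_smooth : smooth_quartic F)
  (ell_line : is_line ell) (ell_in_X : line_in ell F)
  (ell_second_kind : second_kind F ell)
  (ell_ramification : ramification_1111 F ell) :
  exists (S4 : {mpoly K[4]}) (lambda : K) (L : 'I_4 -> {mpoly K[4]}),
    (* (a) *)
    ((lambda != 0 /\ proportional F (lambda *: S4 + \prod_j L j)) /\
     (forall j, plane_through ell (L j)) /\
     (forall i j, i != j -> ~ proportional (L i) (L j)) /\
     (forall j, meets_in_four_lines F (L j)) /\
     ruled_quartic S4 /\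
     irreducible_component (S8 F ell) (zeros S4) /\
     directrix S4 ell /\
     (forall x : 'rV[K]_4, x != 0 -> (x <= ell)%MS -> ~ singular_at S4 x) /\
     (sing_line_of_triple_points S4 \/
      sing_twisted_cubic_of_double_points S4)) /\
    (* (b) *)
    (segre_decomposition F ell (lambda *: S4) L /\
     forall (S : {mpoly K[4]}) (Lhat : 'I_4 -> {mpoly K[4]}),
       segre_decomposition F ell S Lhat ->
       proportional S S4 /\
       (forall i, exists j, proportional (Lhat i) (L j)) /\
       (forall j, exists i, proportional (Lhat i) (L j))) /\
    (* (c) *)
    (has_singular_fibers F ell (nseq 4 I_3 ++ nseq 4 I_1 ++ nseq 4 II) <->
     twisted_cubic (singular_at S4)) /\
    (* (d) *)
    (has_singular_fibers F ell (nseq 4 IV ++ nseq 4 II) <->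
     sing_line_of_triple_points S4).
Proof.
have n2 : (2%:R : K) != 0 by apply: contraNneq char2 => e; rewrite inE /= e eqxx.
have n3 : (3%:R : K) != 0 by apply: contraNneq char3 => e; rewrite inE /= e eqxx.
exact: (segre_description_second_kind n2 n3).
Qed.
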